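(* Let $N\ge 1$ be an integer, $\alpha\in(0,N)$, and let $p,q$ satisfy $\frac{N+\alpha}{N}<p,\,q<2_*^\alpha$ and $p\neq q$. Let $\tau_1,\dots,\tau_N>0$. Let $A\in C(\mathbb R^N,\mathbb R^+)$ satisfy $A(x)\ge A_0>0$ for all $x\in\mathbb R^N$ (for some constant $A_0$) and be $\tau_i$-periodic in $x_i$ for each $1\le i\le N$. Let $B\in C(\mathbb R^N,\mathbb R^+)$ be $\tau_i$-periodic in $x_i$ for each $1\le i\le N$, with $B(x)\ge B>0$ for all $x\in\mathbb R^N$ (for some constant also denoted $B$). Then there exists a positive ground state solution $(u,v)\in H$ (that is, a ground state solution with $u>0$ and $v>0$) of the system $$\begin{cases}-\Delta u+A(x)u=\frac{2p}{p+q}\bigl(I_\alpha\ast|v|^q\bigr)|u|^{p-2}u,\\ -\Delta v+B(x)v=\frac{2q}{p+q}\bigl(I_\alpha\ast|u|^p\bigr)|v|^{q-2}v,\\ u(x)\to0\ \text{ and }\ v(x)\to 0\ \text{ as } |x|\to\infty\end{cases}$$ in $\mathbb R^N$, such that $\mathcal I(u,v)=c_0$.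
   Context: Functions are real valued on $\mathbb R^N$. $2_*^\alpha:=\frac{N+\alpha}{N-2}$ if $N\ge3$ and $2_*^\alpha:=\infty$ if $N=1,2$. The Riesz potential $I_\alpha:\mathbb R^N\setminus\{0\}\to\mathbb R$ is $I_\alpha(x)=\frac{A_\alpha}{|x|^{N-\alpha}}$ with $A_\alpha=\frac{\Gamma(\frac{N-\alpha}{2})}{2^\alpha\pi^{N/2}\Gamma(\frac{\alpha}{2})}$, and $\ast$ is convolution on $\mathbb R^N$. $H:=H^1(\mathbb R^N)\times H^1(\mathbb R^N)$. The action functional on $H$ is $$\mathcal I(u,v)=\frac12\int_{\mathbb R^N}\bigl(|\nabla u|^2+A(x)|u|^2+|\nabla v|^2+B(x)|v|^2\bigr)-\frac{2}{p+q}\int_{\mathbb R^N}(I_\alpha\ast|u|^p)|v|^q ,$$ which is well defined and continuously differentiable; solutions in $H$ of the differential equations of the system are understood in the weak sense, i.e. as critical points of $\mathcal I$. Put $\mathcal P(u,v):=\langle\mathcal I'(u,v),(u,v)\rangle$, $\mathcal N_0:=\{(u,v)\in H\setminus\{(0,0)\}\mid \mathcal P(u,v)=0\}$ and $c_0:=\inf_{(u,v)\in\mathcal N_0}\mathcal I(u,v)$. A nontrivial solution $(u,v)\in H$ of the system is called a ground state solution if $\mathcal I(u,v)=c_0$. *)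

(* Defs.v *)
From HB Require Import structures.
From mathcomp Require Import all_boot all_order all_algebra.
From mathcomp Require Import all_classical all_reals all_analysis.

Set Implicit Arguments.
Unset Strict Implicit.
Unset Printing Implicit Defensive.

Import Order.TTheory GRing.Theory Num.Theory.
Import numFieldNormedType.Exports.

Local Open Scope classical_set_scope.
Local Open Scope ring_scope.

Definition measure_rV_display : measure_display.
Proof. exact: default_measure_display. Qed.

Section measurable_rV.
Context (R : realType) (n : nat).

Definition rV_coord (i : 'I_n) (x : 'rV[R]_n) : measurableTypeR R := x ord0 i.

Let rV_set0 : g_sigma_preimage rV_coord set0.
Proof. exact: sigma_algebra0. Qed.

Let rV_setC A : g_sigma_preimage rV_coord A -> g_sigma_preimage rV_coord (~` A).
Proof. exact: sigma_algebraC. Qed.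

Let rV_bigcup (F : _^nat) : (forall i, g_sigma_preimage rV_coord (F i)) ->
  g_sigma_preimage rV_coord (\bigcup_i (F i)).
Proof. exact: sigma_algebra_bigcup. Qed.

(* The sigma-algebra generated by the coordinates, i.e. the Borel one. *)
HB.instance Definition _ := @isMeasurable.Build measure_rV_display
  'rV[R]_n (g_sigma_preimage rV_coord) rV_set0 rV_setC rV_bigcup.

End measurable_rV.


Lemma measurable_rV_coord (R : realType) n (i : 'I_n) :
  measurable_fun [set: 'rV[R]_n] (rV_coord i).
Proof.
move=> _ Y mY; rewrite setTI; apply: sub_sigma_algebra => /=.
rewrite -bigcup_seq/=; exists i => /=; first by rewrite mem_index_enum.
by exists Y => //; rewrite setTI.
Qed.

Lemma measurable_fun_rV d (T : measurableType d) (R : realType) n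
    (f : T -> 'rV[R]_n) :
  (forall i, measurable_fun [set: T] (rV_coord i \o f)) ->
  measurable_fun [set: T] f.
Proof.
move=> mf; suff : g_sigma_preimage (fun i => rV_coord i \o f) `<=` measurable.
  rewrite g_sigma_preimage_comp => prefS _ A mA.
  by apply: prefS; exists A.
apply: smallest_sub; first exact: sigma_algebra_measurable.
case: n => [|n] in f mf *; first by rewrite big_ord0.
rewrite -bigcup_mkord_ord; apply: bigcup_sub => i Ii.
by move=> A [B mB <-]; exact: mf.
Qed.

Definition rV_cons (R : realType) n (x : measurableTypeR R * 'rV[R]_n) :
  'rV[R]_n.+1 :=
  \row_i (if unlift ord0 i is Some j then x.2 ord0 j else x.1).

Lemma measurable_rV_cons (R : realType) n :
  measurable_fun [set: measurableTypeR R * 'rV[R]_n] (@rV_cons R n).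
Proof.
apply: measurable_fun_rV => i.
have [j ->|->] := unliftP ord0 i; last first.
  rewrite (_ : _ \o _ = fst); last first.
    by apply/funext => x /=; rewrite /rV_coord mxE unlift_none.
  exact: measurable_fst.
rewrite (_ : _ \o _ = rV_coord j \o snd); last first.
  by apply/funext => x /=; rewrite /rV_coord mxE liftK.
apply: measurableT_comp; first exact: measurable_rV_coord.
exact: measurable_snd.
Qed.

Section lebesgue_rV_step.
Local Open Scope ereal_scope.
Context (R : realType) (n : nat).
Variable m : {sigma_finite_measure set 'rV[R]_n -> \bar R}.

Definition lebesgue_rV_step (A : set 'rV[R]_n.+1) : \bar R :=
  pushforward (lebesgue_measure \x m) (@rV_cons R n) A.

Let mcons (A : set 'rV[R]_n.+1) : measurable A ->
  measurable (@rV_cons R n @^-1` A).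
Proof.
move=> mA; rewrite -[X in measurable X]setTI; exact: measurable_rV_cons.
Qed.

Let step0 : lebesgue_rV_step set0 = 0.
Proof. by rewrite /lebesgue_rV_step /pushforward preimage_set0 measure0. Qed.

Let step_ge0 A : 0 <= lebesgue_rV_step A.
Proof. by rewrite /lebesgue_rV_step /pushforward measure_ge0. Qed.

Let step_sigma_additive : semi_sigma_additive lebesgue_rV_step.
Proof.
move=> F mF tF mUF; rewrite /lebesgue_rV_step /pushforward preimage_bigcup.
apply: measure_semi_sigma_additive.
- by move=> k; exact: mcons.
- apply/trivIsetP => /= i j _ _ ij; rewrite -preimage_setI.
  by move/trivIsetP : tF => /(_ _ _ _ _ ij) ->//; rewrite preimage_set0.
- by rewrite -preimage_bigcup; exact: mcons.
Qed.

HB.instance Definition _ := isMeasure.Build _ _ _ lebesgue_rV_step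
  step0 step_ge0 step_sigma_additive.

Definition rV_uncons (x : 'rV[R]_n.+1) : measurableTypeR R * 'rV[R]_n :=
  (x ord0 ord0, \row_j x ord0 (lift ord0 j)).

Let rV_consK : cancel (@rV_cons R n) rV_uncons.
Proof.
move=> [a x]; rewrite /rV_uncons mxE unlift_none; congr pair.
by apply/rowP => j; rewrite !mxE liftK.
Qed.

Let measurable_rV_uncons : measurable_fun [set: 'rV[R]_n.+1] rV_uncons.
Proof.
apply: measurable_fun_pair; first exact: (@measurable_rV_coord R n.+1 ord0).
apply: measurable_fun_rV => j.
rewrite (_ : _ \o _ = @rV_coord R n.+1 (lift ord0 j)); last first.
  by apply/funext => x /=; rewrite /rV_coord mxE.
exact: measurable_rV_coord.
Qed.

Let step_sigma_finite : sigma_finite [set: 'rV[R]_n.+1] lebesgue_rV_step.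
Proof.
have [F TF Foo] := sigma_finiteT (@lebesgue_measure R).
have [G TG Goo] := sigma_finiteT m.
have /sigma_finiteP[{TF Foo}F [TF ndF Foo]] : sigma_finite setT
  (@lebesgue_measure R) by exists F.
have /sigma_finiteP[{TG Goo}G [TG ndG Goo]] : sigma_finite setT m by exists G.
exists (fun k => rV_uncons @^-1` (F k `*` G k)).
  rewrite -preimage_bigcup -[LHS](preimage_setT rV_uncons); congr (_ @^-1` _).
  rewrite -setXTT TF TG predeqE => -[x y]; split.
    move=> [/= [i _ Fix] [k _ Gky]]; exists (maxn i k) => //; split.
    - by move: x Fix; exact/subsetPset/ndF/leq_maxl.
    - by move: y Gky; exact/subsetPset/ndG/leq_maxr.
  by move=> [i _ []/= ? ?]; split; exists i.
move=> k; have [mF Fk] := Foo k; have [mG Gk] := Goo k; split.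
  rewrite -[X in measurable X]setTI; apply: measurable_rV_uncons => //.
  exact: measurableX.
rewrite /lebesgue_rV_step /pushforward -comp_preimage.
rewrite (_ : _ \o _ = id); last by apply/funext => x /=; rewrite rV_consK.
by rewrite preimage_id product_measure1E// lte_mul_pinfty// ge0_fin_numE.
Qed.

HB.instance Definition _ := Measure_isSigmaFinite.Build _ _ _
  lebesgue_rV_step step_sigma_finite.

End lebesgue_rV_step.

(* A point mass when [n = 0], and otherwise the image of the product measure
   under the identification of [R * R^n] with [R^n.+1]. *)
Fixpoint lebesgue_rV (R : realType) (n : nat) :
    {sigma_finite_measure set 'rV[R]_n -> \bar R} :=
  match n with
  | 0 => (\d_(0%R : 'rV[R]_0) : {measure set 'rV[R]_0 -> \bar R})
  | k.+1 => lebesgue_rV_step (lebesgue_rV R k)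
  end.

Lemma lebesgue_rV_box (R : realType) n (F : 'I_n -> set (measurableTypeR R)) :
  (forall i, measurable (F i)) ->
  lebesgue_rV R n [set x | forall i, F i (x ord0 i)] =
  (\prod_(i < n) lebesgue_measure (F i))%E.
Proof.
elim: n F => [|n IHn] F mF.
  by rewrite big_ord0 /= diracE mem_set// => -[].
rewrite big_ord_recl /= /lebesgue_rV_step /pushforward.
rewrite (_ : _ @^-1` _ = F ord0 `*`
    [set x : 'rV[R]_n | forall i, F (lift ord0 i) (x ord0 i)]); last first.
  apply/seteqP; split=> -[a x] /=.
    move=> Fax; split=> [|i]; first by have := Fax ord0; rewrite mxE unlift_none.
    by have := Fax (lift ord0 i); rewrite mxE liftK.
  move=> [Fa Fx] i; rewrite mxE.
  by have [j ->|->] := unliftP ord0 i; [exact: Fx|].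
rewrite product_measure1E//; last first.
  rewrite (_ : mkset _ = \bigcap_(i in [set: 'I_n])
      (rV_coord i @^-1` F (lift ord0 i))); last first.
    by apply/seteqP; split=> x /= Fx i; [move=> _|]; exact: Fx.
  apply: fin_bigcap_measurable => // i _.
  by rewrite -[X in measurable X]setTI; exact: measurable_rV_coord.
by congr (_ * _)%E; apply: IHn.
Qed.

Section sobolev.
Context (R : realType) (N : nat).
Local Notation mu := (lebesgue_rV R N).
Implicit Types (u f g : 'rV[R]_N -> R) (x : 'rV[R]_N).

(* The norm `|x| provided by the library on row vectors is the sup norm. *)
Definition enorm x : R := Num.sqrt (\sum_(i < N) x ord0 i ^+ 2).

Definition partial (i : 'I_N) f : 'rV[R]_N -> R :=
  fun x => 'D_(delta_mx ord0 i) f x.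

Fixpoint Cn (k : nat) f : Prop :=
  match k with
  | 0 => continuous f
  | k'.+1 => continuous f /\ forall i,
      (forall x, derivable f x (delta_mx ord0 i)) /\ Cn k' (partial i f)
  end.

Definition test_function f : Prop :=
  (forall k, Cn k f) /\ compact (closure [set x | f x != 0]).

Definition is_weak_partial (i : 'I_N) u g : Prop :=
  g \in Lfun mu 2%:E /\
  forall phi, test_function phi ->
    \int[mu]_x (u x * partial i phi x) = - \int[mu]_x (g x * phi x).

(* Elements of [H^1] are functions rather than classes modulo a.e. equality. *)
Definition H1 : set ('rV[R]_N -> R) :=
  [set u | u \in Lfun mu 2%:E /\ forall i, exists g, is_weak_partial i u g].

Definition weak_partial (i : 'I_N) u : 'rV[R]_N -> R :=
  xget (cst 0) [set g | is_weak_partial i u g].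

Definition grad_sq u x : R := \sum_(i < N) weak_partial i u x ^+ 2.

Definition H1pair : set (('rV[R]_N -> R) * ('rV[R]_N -> R)) :=
  [set w | H1 w.1 /\ H1 w.2].

Definition normH (w : ('rV[R]_N -> R) * ('rV[R]_N -> R)) : R :=
  Num.sqrt (\int[mu]_x (grad_sq w.1 x + w.1 x ^+ 2)
            + \int[mu]_x (grad_sq w.2 x + w.2 x ^+ 2)).

Definition nontrivial (w : ('rV[R]_N -> R) * ('rV[R]_N -> R)) : Prop :=
  ~ ({ae mu, forall x, w.1 x = 0} /\ {ae mu, forall x, w.2 x = 0}).

(* [L] is the Frechet derivative at [w] of the functional [J] on [H1pair]; only the
   values of [J] and [L] on [H1pair] matter. *)
Definition is_frechet_derivative
    (J : ('rV[R]_N -> R) * ('rV[R]_N -> R) -> R)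
    (w : ('rV[R]_N -> R) * ('rV[R]_N -> R))
    (L : ('rV[R]_N -> R) * ('rV[R]_N -> R) -> R) : Prop :=
  [/\ forall (a : R) h k, H1pair h -> H1pair k -> L (a *: h + k) = a * L h + L k,
      exists C : R, forall h, H1pair h -> `|L h| <= C * normH h
    & forall eps : R, 0 < eps -> exists2 delta : R, 0 < delta &
        forall h, H1pair h -> normH h < delta ->
          `|J (w + h) - J w - L h| <= eps * normH h].

Definition frechet_derivative J w : ('rV[R]_N -> R) * ('rV[R]_N -> R) -> R :=
  xget (cst 0) [set L | is_frechet_derivative J w L].

Definition critical_point J w : Prop :=
  H1pair w /\ is_frechet_derivative J w (cst 0).

Definition vanishes_at_infinity u : Prop :=
  forall eps : R, 0 < eps -> exists M : R, forall x, M < enorm x -> `|u x| < eps.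

End sobolev.

Section choquard.
Context (R : realType) (N : nat).
Local Notation mu := (lebesgue_rV R N).

Definition Gamma (s : R) : R :=
  \int[lebesgue_measure]_(t in `]0, +oo[) (t `^ (s - 1) * expR (- t)).

Definition crit_exp (alpha : R) : \bar R :=
  if (3 <= N)%N then ((N%:R + alpha) / (N%:R - 2))%:E else +oo%E.

Definition riesz_const (alpha : R) : R :=
  Gamma ((N%:R - alpha) / 2) /
  (2 `^ alpha * pi `^ (N%:R / 2) * Gamma (alpha / 2)).

(* The value at the origin, where the potential is undefined, is irrelevant. *)
Definition riesz (alpha : R) (x : 'rV[R]_N) : R :=
  riesz_const alpha / enorm x `^ (N%:R - alpha).

Definition convolution (f g : 'rV[R]_N -> R) (x : 'rV[R]_N) : R :=
  \int[mu]_y (f (x - y) * g y).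

Context (alpha p q : R) (A B : 'rV[R]_N -> R).
Implicit Types w : ('rV[R]_N -> R) * ('rV[R]_N -> R).

Definition action w : R :=
  let u := w.1 in let v := w.2 in
  2^-1 * \int[mu]_x (grad_sq u x + A x * `|u x| ^+ 2
                     + grad_sq v x + B x * `|v x| ^+ 2)
  - 2 / (p + q) *
    \int[mu]_x (convolution (riesz alpha) (fun y => `|u y| `^ p) x * `|v x| `^ q).

Definition pairing w : R := frechet_derivative action w w.

Definition nehari : set (('rV[R]_N -> R) * ('rV[R]_N -> R)) :=
  [set w | [/\ H1pair w, nontrivial w & pairing w = 0]].

Definition ground_level : \bar R := ereal_inf [set (action w)%:E | w in nehari].

(* The two equations tested against [phi] and [psi] in [H1]. When [p < 2] the
   factor [`|u x| `^ (p - 2)] is 0 at the zeros of [u]. *)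
Definition weak_form w : Prop :=
  let u := w.1 in let v := w.2 in
  (forall phi, H1 phi ->
    \int[mu]_x (\sum_(i < N) weak_partial i u x * weak_partial i phi x
                + A x * u x * phi x) =
    2 * p / (p + q) *
    \int[mu]_x (convolution (riesz alpha) (fun y => `|v y| `^ q) x *
                `|u x| `^ (p - 2) * u x * phi x)) /\
  (forall psi, H1 psi ->
    \int[mu]_x (\sum_(i < N) weak_partial i v x * weak_partial i psi x
                + B x * v x * psi x) =
    2 * q / (p + q) *
    \int[mu]_x (convolution (riesz alpha) (fun y => `|u y| `^ p) x *
                `|v x| `^ (q - 2) * v x * psi x)).

(* Solutions are by definition the critical points of [action]; [weak_form]
   spells out the system that is its Euler-Lagrange equation. *)
Definition solution w : Prop :=
  [/\ critical_point action w, weak_form w,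
      vanishes_at_infinity w.1 & vanishes_at_infinity w.2].

Definition ground_state w : Prop :=
  [/\ solution w, nontrivial w & (action w)%:E = ground_level].

End choquard.

(* Main.v *)
(* Write D for the nonlocal term and Q for the quadratic part of the action.  By homogeneity the ground states are the
   rescaled maximisers of D on {Q <= 1}.  A maximising sequence, translated along the periods so as not to vanish, has a
   weak limit w; splitting D between w and the remainder gives S <= S t^g + S (1 - t)^g with t = Q(w), g = (p+q)/2 > 1,
   so t = 1 and w is a maximiser.  Subcriticality enters through averages over dyadic cells (Sobolev embedding, Rellich,
   nonvanishing), and Young's inequality for the two halves of the Riesz kernel replaces Hardy-Littlewood-Sobolev.
   A maximiser (|u|, |v|) is critical.  Testing its equation with the heat kernel h_s gives d/ds (h_s * u) = h_s * (A u - f),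
   hence c h_1 * u <= u (positivity) and u <= h_1 * u + C K * f with K an explicit majorant of h_s; a bootstrap
   on Lebesgue exponents then gives decay at infinity. *)
From HB Require Import structures.
Require Import Defs.
From mathcomp Require Import all_boot all_order all_algebra.
From mathcomp Require Import all_classical all_reals all_analysis.
From mathcomp Require Import measurable_realfun.
From mathcomp Require Import ring lra.
Import Order.TTheory GRing.Theory Num.Theory.
Import numFieldNormedType.Exports.
Set Implicit Arguments.
Unset Strict Implicit.
Unset Printing Implicit Defensive.
Local Open Scope classical_set_scope.
Local Open Scope ring_scope.

(** All strict inequalities on p and q meet at one number, r = (N + alpha)/(2N): it lies below p/2
    and q/2, while p(N-2) and q(N-2) lie below 2Nr. This leaves room for exponents x1 < r < x2; the
    half of the Riesz kernel that is singular at the origin is paired with L^(1/x1), the half that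
    decays slowly at infinity with L^(1/x2). Limits of bounded sequences are taken along one
    ultrafilter finer than the cofinite filter, so that all weak limits exist at once and no
    subsequence is extracted. Weak derivatives are reached through difference quotients, which give
    |u|, translations and integration by parts with neither mollifiers nor a chain rule. By
    homogeneity D <= S Q^g holds on the whole space, not only on the constraint set, so first-order
    optimality is read off without a multiplier rule. Elements of H^1 are functions, and positivity
    and decay are claimed at every point. The maximiser has them only almost everywhere; it is
    finally replaced by an almost everywhere equal function, confined between a multiple of h_1 * u
    and a decaying bound, and every functional is shown not to see the change. *)

Notation mf f := (measurable_fun setT f).

Lemma le_of_eq d (T : porderType d) (x y : T) : x = y -> (x <= y)%O.
Proof. by move=> ->. Qed.

(** * Integration and square-integrable functions *)

Section integrals.
Context d (T : measurableType d) (R : realType).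
Variable mu : {measure set T -> \bar R}.
Implicit Types f g h : T -> R.

Definition intg f : Prop := mu.-integrable setT (EFin \o f).
(** Kept apart from the real-valued integral: with extended values, comparison and Tonelli need no
    prior finiteness, whereas an infinite integral becomes 0 once it is made real. *)
Definition nnI f : \bar R := (\int[mu]_x (f x)%:E)%E.

Lemma intg_mf f : intg f -> mf f.
Proof. by move/measurable_int/measurable_EFinP. Qed.

Lemma nnI_ge0 f : (forall x, 0 <= f x) -> (0 <= nnI f)%E.
Proof. by move=> f0; apply: integral_ge0 => x _; rewrite lee_fin. Qed.

Lemma nnI_le f g : mf f -> mf g -> (forall x, 0 <= f x) ->
  (forall x, f x <= g x) -> (nnI f <= nnI g)%E.
Proof.
move=> mf_ mg f0 fg; apply: ge0_le_integral => //.
- by move=> x _; rewrite lee_fin.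
- exact/measurable_EFinP.
- exact/measurable_EFinP.
- by move=> x _; rewrite lee_fin.
Qed.

Lemma nnID f g : mf f -> mf g -> (forall x, 0 <= f x) -> (forall x, 0 <= g x) ->
  nnI (fun x => f x + g x) = (nnI f + nnI g)%E.
Proof.
move=> mf_ mg f0 g0; rewrite /nnI -ge0_integralD //.
- by move=> x _; rewrite lee_fin.
- exact/measurable_EFinP.
- by move=> x _; rewrite lee_fin.
- exact/measurable_EFinP.
Qed.

Lemma nnIZ (c : R) f : mf f -> 0 <= c -> (forall x, 0 <= f x) ->
  nnI (fun x => c * f x) = (c%:E * nnI f)%E.
Proof.
move=> mf_ c0 f0; rewrite /nnI -ge0_integralZl_EFin //.
- by move=> x _; rewrite lee_fin.
- exact/measurable_EFinP.
Qed.

Lemma intgP f : mf f -> (nnI (fun x => `|f x|)%R < +oo)%E -> intg f.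
Proof.
move=> mf_ fi; apply/integrableP; split; first exact/measurable_EFinP.
exact: fi.
Qed.

Lemma intg_ge0P f : mf f -> (forall x, 0 <= f x) -> (nnI f < +oo)%E -> intg f.
Proof.
move=> mf_ f0 fi; apply: intgP => //.
by rewrite (_ : (fun x => _) = f)//; apply/funext => x; rewrite ger0_norm.
Qed.

Lemma intg_lty f : intg f -> (nnI (fun x => `|f x|)%R < +oo)%E.
Proof. by move=> /integrableP[]. Qed.

Lemma intg_le f g : mf f -> (forall x, `|f x| <= g x) -> intg g -> intg f.
Proof.
move=> mf_ fg ig; apply: (le_integrable measurableT _ _ ig).
  exact/measurable_EFinP.
by move=> x _; rewrite lee_fin; apply: le_trans (fg x) (ler_norm _).
Qed.

Lemma intg0 : intg (fun=> 0).
Proof. exact: integrable0. Qed.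

Lemma intgD f g : intg f -> intg g -> intg (fun x => f x + g x).
Proof. by move=> fi gi; exact: (integrableD measurableT fi gi). Qed.

Lemma intgB f g : intg f -> intg g -> intg (fun x => f x - g x).
Proof. by move=> fi gi; exact: (integrableB measurableT fi gi). Qed.

Lemma intgZ (c : R) f : intg f -> intg (fun x => c * f x).
Proof. by move=> fi; exact: (integrableZl measurableT c fi). Qed.

Lemma intgZr (c : R) f : intg f -> intg (fun x => f x * c).
Proof. by move=> /(intgZ c); congr intg; apply/funext => x; rewrite mulrC. Qed.

Lemma intg_abs f : intg f -> intg (fun x => `|f x|).
Proof.
move=> fi; apply: (intg_le _ _ (_ : intg (fun x => `|f x|))); last first.
- apply: intgP; first by apply: measurableT_comp => //; exact: intg_mf.
  by under [X in nnI X]eq_fun do rewrite normr_id; exact: intg_lty.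
- by move=> x; rewrite normr_id.
- by apply: measurableT_comp => //; exact: intg_mf.
Qed.

Lemma intg_sum (I : eqType) (s : seq I) (F : I -> T -> R) :
  (forall i, i \in s -> intg (F i)) -> intg (fun x => \sum_(i <- s) F i x).
Proof.
elim: s => [|i s IH] Fi; first by under eq_fun do rewrite big_nil; exact: intg0.
under eq_fun do rewrite big_cons; apply: intgD; first by apply: Fi; rewrite mem_head.
by apply: IH => j js; apply: Fi; rewrite inE js orbT.
Qed.

Lemma nnI_Int f : intg f -> (forall x, 0 <= f x) -> nnI f = (\int[mu]_x f x)%:E.
Proof.
move=> fi f0; rewrite /Rintegral fineK//.
exact: integrable_fin_num.
Qed.

Lemma IntD f g : intg f -> intg g ->
  \int[mu]_x (f x + g x) = \int[mu]_x f x + \int[mu]_x g x.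
Proof. by move=> fi gi; rewrite RintegralD. Qed.

Lemma IntB f g : intg f -> intg g ->
  \int[mu]_x (f x - g x) = \int[mu]_x f x - \int[mu]_x g x.
Proof. by move=> fi gi; rewrite RintegralB. Qed.

Lemma IntZ (c : R) f : intg f -> \int[mu]_x (c * f x) = c * \int[mu]_x f x.
Proof. by move=> fi; rewrite RintegralZl. Qed.

Lemma Int0 : \int[mu]_x 0 = 0 :> R.
Proof. by rewrite /Rintegral integral0. Qed.

Lemma Int_ge0 f : (forall x, 0 <= f x) -> 0 <= \int[mu]_x f x.
Proof. by move=> f0; apply: Rintegral_ge0. Qed.

Lemma Int_le f g : intg f -> intg g -> (forall x, f x <= g x) ->
  \int[mu]_x f x <= \int[mu]_x g x.
Proof. by move=> fi gi fg; apply: le_Rintegral. Qed.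

Lemma Int_abs f : intg f -> `|\int[mu]_x f x| <= \int[mu]_x `|f x|.
Proof. by move=> fi; apply: le_normr_Rintegral. Qed.

Lemma Int_sum (I : eqType) (s : seq I) (F : I -> T -> R) :
  (forall i, i \in s -> intg (F i)) ->
  \int[mu]_x (\sum_(i <- s) F i x) = \sum_(i <- s) \int[mu]_x F i x.
Proof.
elim: s => [|i s IH] Fi.
  by rewrite big_nil; under eq_Rintegral do rewrite big_nil; exact: Int0.
rewrite big_cons -IH; last by move=> j js; apply: Fi; rewrite inE js orbT.
rewrite -IntD.
- by apply: eq_Rintegral => x _; rewrite big_cons.
- by apply: Fi; rewrite mem_head.
- by apply: intg_sum => j js; apply: Fi; rewrite inE js orbT.
Qed.

Lemma Int_ae f g : mf f -> mf g -> {ae mu, forall x, f x = g x} ->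
  \int[mu]_x f x = \int[mu]_x g x.
Proof.
move=> mf_ mg fg; congr fine; apply: ae_eq_integral => //.
- exact/measurable_EFinP.
- exact/measurable_EFinP.
- by apply: filterS fg => x /= + _ => ->.
Qed.

Lemma nnI_ae f g : mf f -> mf g -> {ae mu, forall x, f x = g x} -> nnI f = nnI g.
Proof.
move=> mf_ mg fg; apply: ae_eq_integral => //.
- exact/measurable_EFinP.
- exact/measurable_EFinP.
- by apply: filterS fg => x /= + _ => ->.
Qed.

Lemma intg_ae f g : mf g -> {ae mu, forall x, f x = g x} -> intg f -> intg g.
Proof.
move=> mg fg fi; apply: intgP => //.
rewrite -(nnI_ae (f := fun x => `|f x|)); first exact: intg_lty.
- by apply: measurableT_comp => //; exact: intg_mf.
- exact: measurableT_comp.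
- by apply: filterS fg => x /= ->.
Qed.

Lemma nnI_eq0 f : mf f -> (forall x, 0 <= f x) -> nnI f = 0%E ->
  {ae mu, forall x, f x = 0}.
Proof.
move=> mf_ f0 If; have /ae_eq_integral_abs : measurable_fun setT (EFin \o f).
  exact/measurable_EFinP.
move=> /(_ mu measurableT)[+ _]; have -> : (\int[mu]_x `|(EFin \o f) x| = nnI f)%E.
  by apply: eq_integral => x _ /=; rewrite ger0_norm.
by move=> /(_ If); apply: filterS => x /= /(_ I) [].
Qed.

Lemma Int_eq0 f : intg f -> (forall x, 0 <= f x) -> \int[mu]_x f x = 0 ->
  {ae mu, forall x, f x = 0}.
Proof.
move=> fi f0 If; apply: nnI_eq0 => //; first exact: intg_mf.
by rewrite nnI_Int // If.
Qed.

Lemma Int_ae0 f : {ae mu, forall x, f x = 0} -> mf f -> \int[mu]_x f x = 0.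
Proof. by move=> f0 mf_; rewrite (Int_ae _ _ f0) ?Int0. Qed.

(** Replacing [g] by the maximum of [f] and [g] changes it on a null set only and makes the
    inequality hold everywhere. *)
Lemma Int_le_ae f g : intg f -> intg g -> {ae mu, forall x, f x <= g x} ->
  \int[mu]_x f x <= \int[mu]_x g x.
Proof.
move=> fi gi fg.
have mM : mf (fun x => Num.max (f x) (g x)).
  by apply: measurable_maxr; exact: intg_mf.
have -> : \int[mu]_x g x = \int[mu]_x Num.max (f x) (g x).
  apply: Int_ae => //; first exact: intg_mf.
  by apply: filterS fg => x /= /max_idPr.
apply: Int_le => // [|x]; last by rewrite le_max lexx.
apply: intg_le (intgD (intg_abs fi) (intg_abs gi)) => // x.
by rewrite /Num.max; case: ifP => _; rewrite ?lerDl ?lerDr.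
Qed.

Lemma dct (u : nat -> T -> R) f g : (forall n, mf (u n)) -> mf f -> intg g ->
  (forall n x, `|u n x| <= g x) ->
  {ae mu, forall x, (u ^~ x) @ \oo --> f x} ->
  (\int[mu]_x u n x) @[n --> \oo] --> \int[mu]_x f x.
Proof.
move=> mu_ mf_ gi ug uf.
have [|||||fi _ cv] := @dominated_convergence _ T R mu setT measurableT
   (fun n x => (u n x)%:E) (fun x => (f x)%:E) (fun x => (g x)%:E).
- by move=> n; apply/measurable_EFinP.
- exact/measurable_EFinP.
- by apply: filterS uf => x /= uf _; apply: cvg_EFin => //; exact: nearW.
- exact: gi.
- by apply: filterE => x n _ /=; rewrite lee_fin.
by apply/fine_cvg; rewrite fineK // integrable_fin_num.
Qed.

Lemma fatou_le (u : nat -> T -> R) f (c : R) : (forall n, mf (u n)) ->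
  (forall n x, 0 <= u n x) -> (forall x, (u ^~ x) @ \oo --> f x) ->
  (\forall n \near \oo, (nnI (u n) <= c%:E)%E) -> (nnI f <= c%:E)%E.
Proof.
move=> mu_ u0 uf uc.
have := @fatou _ T R mu setT measurableT (fun n x => (u n x)%:E).
have -> : (\int[mu]_x limn_einf (fun n => (u n x)%:E) = nnI f)%E.
  apply: eq_integral => x _.
  have cv : (u n x)%:E @[n --> \oo] --> (f x)%:E.
    by apply: cvg_EFin; [exact: nearW|exact: uf].
  by have [-> _] := cvg_limn_einf_sup cv.
move=> F; apply: le_trans (F _ _) _.
- by move=> n; exact/measurable_EFinP.
- by move=> n x _; rewrite lee_fin.
have [N _ Nc] := uc.
rewrite limn_einf_lim; apply: lime_le; first exact: is_cvg_einfs.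
near=> n; apply: le_trans (Nc (maxn n N) (leq_maxr _ _)).
by apply: ereal_inf_lbound; exists (maxn n N) => //=; exact: leq_maxl.
Unshelve. all: by end_near.
Qed.

End integrals.

Section L2_space.
Context d (T : measurableType d) (R : realType).
Variable mu : {measure set T -> \bar R}.
Implicit Types f g h : T -> R.

Definition L2 f : Prop := mf f /\ intg mu (fun x => f x ^+ 2).
Definition ip f g : R := \int[mu]_x (f x * g x).
Definition nn f : R := ip f f.

Lemma L2_mf f : L2 f -> mf f. Proof. by case. Qed.

Lemma L2_intgM f g : L2 f -> L2 g -> intg mu (fun x => f x * g x).
Proof.
move=> [mf_ f2] [mg g2]; apply: intg_le (intgD f2 g2).
  exact: measurable_funM.
move=> x; rewrite normrM -(real_normK (num_real (f x))) -(real_normK (num_real (g x))).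
have := sqr_ge0 (`|f x| - `|g x|); have := mulr_ge0 (normr_ge0 (f x)) (normr_ge0 (g x)).
nra.
Qed.

Lemma L2_mono f g : mf f -> (forall x, `|f x| <= `|g x|) -> L2 g -> L2 f.
Proof.
move=> mf_ fg [_ g2]; split=> //; apply: intg_le g2; first exact: measurable_funX.
by move=> x; rewrite normrX -(real_normK (num_real (g x))) lerXn2r ?nnegrE.
Qed.

Lemma L2_0 : L2 (fun=> 0).
Proof. by split=> //; under eq_fun do rewrite expr0n; exact: intg0. Qed.

Lemma L2Z c f : L2 f -> L2 (fun x => c * f x).
Proof.
move=> [mf_ f2]; split; first exact: measurable_funM.
by under eq_fun do rewrite exprMn; exact: intgZ.
Qed.

Lemma L2D f g : L2 f -> L2 g -> L2 (fun x => f x + g x).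
Proof.
move=> lf lg; split; first by apply: measurable_funD; [case: lf|case: lg].
under eq_fun do rewrite sqrrD.
apply: intgD; last by case: lg.
apply: intgD; first by case: lf.
under eq_fun do rewrite -mulr_natl.
by apply: intgZ; exact: L2_intgM.
Qed.

Lemma L2N f : L2 f -> L2 (fun x => - f x).
Proof. by move=> /(L2Z (-1)); congr L2; apply/funext => x; rewrite mulN1r. Qed.

Lemma L2B f g : L2 f -> L2 g -> L2 (fun x => f x - g x).
Proof. by move=> lf lg; apply: L2D lf (L2N lg). Qed.

Lemma L2_abs f : L2 f -> L2 (fun x => `|f x|).
Proof.
move=> lf; apply: (L2_mono _ _ lf); last by move=> x; rewrite normr_id.
by apply: measurableT_comp => //; case: lf.
Qed.

Lemma L2_sum (I : eqType) (s : seq I) (F : I -> T -> R) :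
  (forall i, i \in s -> L2 (F i)) -> L2 (fun x => \sum_(i <- s) F i x).
Proof.
elim: s => [|i s IH] Fi; first by under eq_fun do rewrite big_nil; exact: L2_0.
under eq_fun do rewrite big_cons; apply: L2D; first by apply: Fi; rewrite mem_head.
by apply: IH => j js; apply: Fi; rewrite inE js orbT.
Qed.

Lemma L2_ae f g : mf g -> {ae mu, forall x, f x = g x} -> L2 f -> L2 g.
Proof.
move=> mg fg [mf_ f2]; split=> //; apply: intg_ae f2; first exact: measurable_funX.
by apply: filterS fg => x /= ->.
Qed.

Lemma ipC f g : ip f g = ip g f.
Proof. by apply: eq_Rintegral => x _; rewrite mulrC. Qed.

Lemma ipDl f g h : L2 f -> L2 g -> L2 h ->
  ip (fun x => f x + g x) h = ip f h + ip g h.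
Proof.
move=> lf lg lh; rewrite /ip -IntD; try exact: L2_intgM.
by apply: eq_Rintegral => x _; rewrite mulrDl.
Qed.

Lemma ipZl c f h : L2 f -> L2 h -> ip (fun x => c * f x) h = c * ip f h.
Proof.
move=> lf lh; rewrite /ip -IntZ; try exact: L2_intgM.
by apply: eq_Rintegral => x _; rewrite mulrA.
Qed.

Lemma ipBl f g h : L2 f -> L2 g -> L2 h ->
  ip (fun x => f x - g x) h = ip f h - ip g h.
Proof.
move=> lf lg lh; rewrite /ip -IntB; try exact: L2_intgM.
by apply: eq_Rintegral => x _; rewrite mulrBl.
Qed.

Lemma ipDr f g h : L2 f -> L2 g -> L2 h ->
  ip h (fun x => f x + g x) = ip h f + ip h g.
Proof. by move=> *; rewrite ipC ipDl // !(ipC h). Qed.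

Lemma ipBr f g h : L2 f -> L2 g -> L2 h ->
  ip h (fun x => f x - g x) = ip h f - ip h g.
Proof. by move=> *; rewrite ipC ipBl // !(ipC h). Qed.

Lemma ipZr c f h : L2 f -> L2 h -> ip h (fun x => c * f x) = c * ip h f.
Proof. by move=> *; rewrite ipC ipZl // (ipC h). Qed.

Lemma nnE f : nn f = \int[mu]_x (f x ^+ 2). 
Proof. by apply: eq_Rintegral => x _; rewrite expr2. Qed.

Lemma nn_ge0 f : 0 <= nn f.
Proof. by rewrite nnE; apply: Int_ge0 => x; exact: sqr_ge0. Qed.

Lemma nnZ c f : L2 f -> nn (fun x => c * f x) = c ^+ 2 * nn f.
Proof. by move=> lf; rewrite /nn ipZl ?ipZr //; [rewrite mulrA expr2|exact: L2Z]. Qed.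

Lemma nn_add f g : L2 f -> L2 g ->
  nn (fun x => f x + g x) = nn f + 2 * ip f g + nn g.
Proof.
move=> lf lg; rewrite /nn ipDl ?ipDr //; last exact: L2D.
by rewrite (ipC g f) /nn; ring.
Qed.

Lemma nn_sub f g : L2 f -> L2 g ->
  nn (fun x => f x - g x) = nn f - 2 * ip f g + nn g.
Proof.
move=> lf lg; rewrite /nn ipBl ?ipBr //; last exact: L2B.
by rewrite (ipC g f) /nn; ring.
Qed.

Lemma nn_mono f g : mf f -> (forall x, `|f x| <= `|g x|) -> L2 g -> nn f <= nn g.
Proof.
move=> mf_ fg lg; have lf := L2_mono mf_ fg lg; rewrite !nnE; apply: Int_le.
- by case: lf.
- by case: lg.
by move=> x; rewrite -(real_normK (num_real (g x))) -(real_normK (num_real (f x))) lerXn2r ?nnegrE.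
Qed.

Lemma ip_CS f g : L2 f -> L2 g -> ip f g ^+ 2 <= nn f * nn g.
Proof.
move=> lf lg.
have P t : 0 <= nn f + 2 * (t * ip f g) + t ^+ 2 * nn g.
  rewrite -(nnZ _ lg) -(ipZr _ lg lf) -nn_add //; [exact: nn_ge0|exact: L2Z].
have [g0|g0] := eqVneq (nn g) 0.
  (* With [nn g = 0] the polynomial is affine in t; this t would make it equal to - nn f - 2 unless
     the slope vanishes. *)
  have := P (- (nn f + 1) / (ip f g)); have [->|fg0] := eqVneq (ip f g) 0.
    by rewrite expr0n /= mulr_ge0 ?nn_ge0.
  by rewrite g0 mulr0 addr0 -mulrA mulVf // mulr1 => ?; have := nn_ge0 f; lra.
have gp : 0 < nn g by rewrite lt_def g0 nn_ge0.
(* The minimiser of the quadratic polynomial. *)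
have := P (- ip f g / nn g); rewrite -(pmulr_lge0 _ gp).
have -> : (nn f + 2 * (- ip f g / nn g * ip f g) + (- ip f g / nn g) ^+ 2 * nn g) * nn g
   = nn f * nn g - ip f g ^+ 2.
  by field.
by rewrite subr_ge0.
Qed.

Lemma ip_le_sqrt f g : L2 f -> L2 g -> `|ip f g| <= Num.sqrt (nn f) * Num.sqrt (nn g).
Proof.
move=> lf lg; rewrite -sqrtrM ?nn_ge0 // -sqrtr_sqr ler_sqrt ?ip_CS //.
by rewrite mulr_ge0 ?nn_ge0.
Qed.

Lemma sqrt_nn_add f g : L2 f -> L2 g ->
  Num.sqrt (nn (fun x => f x + g x)) <= Num.sqrt (nn f) + Num.sqrt (nn g).
Proof.
move=> lf lg; rewrite -(@ler_pXn2r _ 2) ?nnegrE ?addr_ge0 ?sqrtr_ge0 //.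
rewrite sqr_sqrtr ?nn_ge0 // sqrrD !sqr_sqrtr ?nn_ge0 // nn_add //.
have := ip_le_sqrt lf lg; have := ler_norm (ip f g); lra.
Qed.

Lemma sqrt_nn_sub f g : L2 f -> L2 g ->
  Num.sqrt (nn (fun x => f x - g x)) <= Num.sqrt (nn f) + Num.sqrt (nn g).
Proof.
move=> lf lg; apply: le_trans (sqrt_nn_add lf (L2N lg)) _.
by rewrite (_ : nn (fun x => - g x) = nn g) // !nnE; apply: eq_Rintegral => x _; rewrite sqrrN.
Qed.

Lemma nn_eq0 f : L2 f -> nn f = 0 -> {ae mu, forall x, f x = 0}.
Proof.
move=> [mf_ f2]; rewrite nnE => /(Int_eq0 f2) => /(_ (fun x => sqr_ge0 _)).
by apply: filterS => x /eqP; rewrite sqrf_eq0 => /eqP.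
Qed.

Lemma nn_ae f g : mf f -> mf g -> {ae mu, forall x, f x = g x} -> nn f = nn g.
Proof.
move=> mf_ mg fg; rewrite !nnE; apply: Int_ae; try exact: measurable_funX.
by apply: filterS fg => x /= ->.
Qed.

Lemma ip_ae f g h : mf f -> mf g -> mf h -> {ae mu, forall x, f x = g x} ->
  ip f h = ip g h.
Proof.
move=> mf_ mg mh fg; apply: Int_ae; try exact: measurable_funM.
by apply: filterS fg => x /= ->.
Qed.

Lemma nn_ae0 f : mf f -> {ae mu, forall x, f x = 0} -> nn f = 0.
Proof.
move=> mf_ f0; rewrite (nn_ae (g := fun=> 0)) // nnE.
by under eq_Rintegral do rewrite expr0n; exact: Int0.
Qed.

(* A subsequence with summable steps converges almost everywhere, off the set where the
   series of weighted squared steps diverges; the limit is then identified by Fatou. *)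
Lemma L2_complete (u : nat -> T -> R) : (forall n, L2 (u n)) ->
  (forall e : R, 0 < e -> exists n0, forall n m, (n0 <= n)%N -> (n0 <= m)%N ->
     nn (fun x => u n x - u m x) <= e) ->
  exists2 v, L2 v & (nn (fun x => v x - u n x)) @[n --> \oo] --> 0.
Proof.
move=> lu cu.
have /choice [N NP] : forall k : nat, exists n0, forall n m, (n0 <= n)%N -> (n0 <= m)%N ->
     nn (fun x => u n x - u m x) <= (4^-1)^+k.
  by move=> k; apply: cu; rewrite exprn_gt0.
(* A nondecreasing choice of indices that dominates both [N k] and k. *)
pose M k := (\sum_(j < k.+1) N j + k)%N.
have NM k : (N k <= M k)%N by rewrite /M big_ord_recr /= -addnA addnCA leq_addr.
have kM k : (k <= M k)%N by exact: leq_addl.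
have MS k : (M k <= M k.+1)%N by rewrite /M (big_ord_recr k.+1) /= addnS ltnW // ltnS leq_add2r leq_addr.
have MM k : (N k <= M k.+1)%N by exact: leq_trans (NM k) (MS k).
pose dl k x := u (M k.+1) x - u (M k) x.
have ldl k : L2 (dl k) by exact: L2B.
have ndl k : nn (dl k) <= (4^-1)^+k by exact: NP.
(* The squared steps have integral at most 4^-k, so the weight 2^k leaves a convergent series;
   conversely W x finite forces the k-th step at x to be at most a constant times 2^(-k/2). *)
pose W x : \bar R := (\sum_(k <oo) (2^+k * dl k x ^+ 2)%:E)%E.
have mW : measurable_fun setT W.
  apply: ge0_emeasurable_sum.
    by move=> k x _ _; rewrite lee_fin mulr_ge0 ?sqr_ge0 ?exprn_ge0.
  move=> k _; apply/measurable_EFinP; apply: measurable_funM => //.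
  by apply: measurable_funX; case: (ldl k).
have W0 x : (0 <= W x)%E.
  by apply: nneseries_ge0 => k _ _; rewrite lee_fin mulr_ge0 ?sqr_ge0 ?exprn_ge0.
have IW : (\int[mu]_x W x < +oo)%E.
  rewrite /W integral_nneseries //; last 2 first.
  - move=> k; apply/measurable_EFinP; apply: measurable_funM => //.
    by apply: measurable_funX; case: (ldl k).
  - by move=> k x _; rewrite lee_fin mulr_ge0 ?sqr_ge0 ?exprn_ge0.
  apply: (@le_lt_trans _ _ (\sum_(k <oo) ((2^-1)^+k : R)%:E)%E).
    apply: lee_nneseries.
      by move=> k _ _; apply: integral_ge0 => x _; rewrite lee_fin mulr_ge0 ?sqr_ge0 ?exprn_ge0.
    move=> k _; have i2 : intg mu (fun x => 2^+k * dl k x ^+ 2).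
      by apply: intgZ; case: (ldl k).
    rewrite -/(nnI mu (fun x => 2^+k * dl k x ^+ 2)) nnI_Int //; last first.
      by move=> x; rewrite mulr_ge0 ?sqr_ge0 ?exprn_ge0.
    rewrite lee_fin IntZ; last by case: (ldl k).
    rewrite -nnE (le_trans (ler_wpM2l _ (ndl k))) ?exprn_ge0 //.
    by rewrite -exprMn (_ : 2 * 4^-1 = 2^-1) //; lra.
  have h : (fun n => \sum_(0 <= k < n) ((2^-1)^+k : R)%:E)%E @ \oo --> (2 : R)%:E.
    have := @cvg_geometric_series R 1 (2^-1).
    rewrite ger0_norm ?invr_ge0 // => /(_ _)/wrap[|]; first by lra.
    rewrite (_ : 1 - 2^-1 = 2^-1 :> R) ?invrK ?mul1r; last by lra.
    move=> g; rewrite (_ : (fun n => _) = EFin \o series (geometric 1 2^-1)).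
      by apply: cvg_EFin; [exact: nearW|exact: g].
    by apply/funext => n /=; rewrite sumEFin /series /=; congr EFin; apply: eq_bigr => i _; rewrite mul1r.
  by rewrite (cvg_lim _ h) // ltry.
have aeW : {ae mu, forall x, (W x < +oo)%E}.
  have iW : mu.-integrable setT W.
    apply/integrableP; split => //; apply: le_lt_trans IW.
    under eq_integral => x _ do rewrite gee0_abs ?W0 //.
    exact: lexx.
  apply: filterS (integrable_ae measurableT iW) => x /(_ I).
  by rewrite ge0_fin_numE.
pose G := [set x | (W x < +oo)%E].
have mG : measurable G.
  by rewrite -[G]setTI; apply: emeasurable_fun_infty_o.
(* Multiplying by the indicator of G makes the sequence converge at every point, which gives a
   measurable limit defined everywhere. *)
pose v_ k x := \1_G x * u (M k) x.
have lG f : L2 f -> L2 (fun x => \1_G x * f x).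
  move=> lf; apply: (L2_mono _ _ lf).
    by apply: measurable_funM; [exact: measurable_indic|case: lf].
  move=> x; rewrite normrM indicE; case: (_ \in _); rewrite ?normr1 ?normr0 ?mul1r //.
  by rewrite mul0r.
have cv x : cvgn (v_ ^~ x).
  have [xG|xG] := boolP (x \in G); last first.
    rewrite /v_ indicE (negbTE xG); under eq_fun do rewrite mul0r.
    exact: is_cvg_cst.
  rewrite /v_ indicE xG; under eq_fun do rewrite mul1r.
  have Wf : (W x < +oo)%E by move: xG; rewrite inE.
  have dle k : `|dl k x| <= Num.sqrt (fine (W x)) * (Num.sqrt 2^-1) ^+ k.
    have : 2 ^+ k * dl k x ^+ 2 <= fine (W x).
      rewrite -lee_fin fineK ?ge0_fin_numE // /W (nneseriesD1 (n := k)) //; last first.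
        by move=> i _; rewrite lee_fin mulr_ge0 ?sqr_ge0 ?exprn_ge0.
      rewrite leeDl //; apply: nneseries_ge0 => i _ _.
      by rewrite lee_fin mulr_ge0 ?sqr_ge0 ?exprn_ge0.
    move=> h; rewrite -(@ler_pXn2r _ 2) ?nnegrE ?mulr_ge0 ?exprn_ge0 ?sqrtr_ge0 //.
    rewrite exprMn -exprM mulnC exprM !sqr_sqrtr ?fine_ge0 ?invr_ge0 // real_normK ?num_real //.
    by rewrite exprVn ler_pdivlMr ?exprn_gt0 // mulrC.
  have cs : cvgn (series (fun k => dl k x)).
    apply: normed_cvg; apply: series_le_cvg dle _ => //.
    apply: is_cvg_geometric_series; rewrite ger0_norm ?sqrtr_ge0 //.
    by rewrite -[X in _ < X]sqrtr1 ltr_sqrt //; lra.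
  suff -> : (fun n => u (M n) x) = (fun n => u (M 0%N) x + series (fun k => dl k x) n).
    by apply: is_cvgD => //; exact: is_cvg_cst.
  apply/funext => n; elim: n => [|n IH]; first by rewrite /series /= big_geq ?addr0.
  by move: IH; rewrite /series /= big_nat_recr //= addrA => <-; rewrite /dl; ring.
pose v x := lim (v_ ^~ x @ \oo).
have cvv x : v_ ^~ x @ \oo --> v x by exact: cv.
have lv_ k : L2 (v_ k) by apply: lG.
have mv : mf v by apply: (measurable_fun_cvg (h := v_)) => // m; case: (lv_ m).
have mI : mf (\1_G : T -> R) by exact: measurable_indic.
have Iae f : {ae mu, forall x, \1_G x * f x = f x}.
  by apply: filterS aeW => x Wx; rewrite indicE mem_set // mul1r.
have key e n0 : (forall n m, (n0 <= n)%N -> (n0 <= m)%N ->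
     nn (fun x => u n x - u m x) <= e) -> forall n, (n0 <= n)%N ->
     L2 (fun x => v x - u n x) /\ nn (fun x => v x - u n x) <= e.
  move=> H n nn0.
  have ll k : L2 (fun x => v_ k x - \1_G x * u n x) by apply: L2B => //; exact: lG.
  have F : (nnI mu (fun x => (v x - \1_G x * u n x) ^+ 2)%R <= e%:E)%E.
    apply: (fatou_le (u := fun k x => (v_ k x - \1_G x * u n x) ^+ 2)).
    - by move=> k; apply: measurable_funX; case: (ll k).
    - by move=> k x; exact: sqr_ge0.
    - move=> x; have c : (v_ k x - \1_G x * u n x) @[k --> \oo] --> v x - \1_G x * u n x.
        by apply: cvgB; [exact: cvv|exact: cvg_cst].
      exact: (cvgM c c).
    - exists n0 => // k /= kn0; rewrite nnI_Int; [|by case: (ll k)|by move=> x; exact: sqr_ge0].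
      rewrite lee_fin -nnE (nn_ae (g := fun x => u (M k) x - u n x)).
      + by apply: H => //; exact: leq_trans (kM k).
      + by case: (ll k).
      + by apply: measurable_funB; [case: (lu (M k))|case: (lu n)].
      + by apply: filterS aeW => x Wx; rewrite /v_ indicE mem_set // !mul1r.
  have mvu : mf (fun x => v x - \1_G x * u n x).
    by apply: measurable_funB => //; case: (lG _ (lu n)).
  have lvu : L2 (fun x => v x - \1_G x * u n x).
    split => //; apply: intg_ge0P; first exact: measurable_funX.
      by move=> x; exact: sqr_ge0.
    by apply: le_lt_trans F _; rewrite ltry.
  have mvu' : mf (fun x => v x - u n x) by apply: measurable_funB => //; case: (lu n).
  have ae : {ae mu, forall x, v x - \1_G x * u n x = v x - u n x}.
    by apply: filterS (Iae (u n)) => x ->.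
  split; first exact: L2_ae lvu.
  rewrite -(nn_ae mvu mvu' ae) nnE -lee_fin -nnI_Int //; first by case: lvu.
  by move=> x; exact: sqr_ge0.
exists v.
  have [n0 H] := cu 1 ltr01; have [l _] := key _ _ H n0 (leqnn _).
  have -> : v = (fun x => (v x - u n0 x) + u n0 x) by apply/funext => x; rewrite subrK.
  exact: L2D.
apply/cvgrPdist_le => e e0; have [n0 H] := cu e e0.
exists n0 => // n /= nn0; rewrite sub0r normrN ger0_norm ?nn_ge0 //.
by have [] := key _ _ H n nn0.
Qed.

End L2_space.

(** * Projection and Riesz representation *)

Section riesz_representation.
Context d (T : measurableType d) (R : realType).
Variable mu : {measure set T -> \bar R}.
Implicit Types f g h : T -> R.
Local Notation L2 := (L2 mu).
Local Notation ip := (ip mu).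
Local Notation nn := (nn mu).

(* The Riesz representation and the projection theorem at once: [h] minimises
   [nn f - 2 * l f] over the closure of [V]. *)
Lemma riesz_subspace (V : set (T -> R)) (l : (T -> R) -> R) (C : R) :
  (forall f, V f -> L2 f) -> V (fun=> 0) ->
  (forall a f g, V f -> V g -> V (fun x => a * f x + g x)) ->
  (forall a f g, V f -> V g -> l (fun x => a * f x + g x) = a * l f + l g) ->
  (forall f, V f -> `|l f| <= C * Num.sqrt (nn f)) ->
  exists h, [/\ L2 h, forall f, V f -> ip h f = l f &
    forall e, 0 < e -> exists2 f, V f & nn (fun x => h x - f x) <= e].
Proof.
move=> VL V0 Vlin llin lC.
pose E f := nn f - 2 * l f.
have Elow f : V f -> - C ^+ 2 <= E f.
  move=> Vf; have := lC _ Vf; rewrite /E; set s := Num.sqrt (nn f).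
  have -> : nn f = s ^+ 2 by rewrite sqr_sqrtr // nn_ge0.
  by have := ler_norm (l f); have := sqr_ge0 (s - C); nra.
pose m := inf [set E f | f in V].
have hi : has_inf [set E f | f in V].
  split; first by exists (E (fun=> 0)), (fun=> 0).
  by exists (- C ^+ 2) => _ [f Vf <-]; exact: Elow.
have mE f : V f -> m <= E f by move=> Vf; apply: ge_inf; [case: hi|exists f].
have mlin a f g : V f -> V g ->
    E (fun x => a * f x + g x) = a ^+ 2 * nn f + 2 * a * (ip f g - l f) + E g.
  move=> Vf Vg; have lf := VL _ Vf; have lg := VL _ Vg.
  rewrite /E llin // nn_add //; last exact: L2Z.
  by rewrite nnZ // ipZl //; ring.
have Vsub f g : V f -> V g -> V (fun x => f x - g x).
  move=> Vf Vg; rewrite (_ : (fun x => _) = (fun x => -1 * g x + f x)); first exact: Vlin.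
  by apply/funext => x; rewrite mulN1r addrC.
(* The parallelogram identity, with m as a lower bound of E at the midpoint: minimising sequences
   are Cauchy. *)
have par f g : V f -> V g -> nn (fun x => f x - g x) <= 2 * (E f - m) + 2 * (E g - m).
  move=> Vf Vg; have lf := VL _ Vf; have lg := VL _ Vg.
  have := mE _ (Vlin (2^-1) _ _ (Vsub _ _ Vf Vg) Vg).
  rewrite mlin //; last exact: Vsub.
  have := llin (-1) _ _ Vg Vf.
  rewrite (_ : (fun x => -1 * g x + f x) = (fun x => f x - g x)); last first.
    by apply/funext => x; rewrite mulN1r addrC.
  move=> ->; rewrite ipBl // nn_sub // /E -/(nn g).
  lra.
have /choice [fs fsP] : forall n : nat, exists f, V f /\ E f <= m + n.+1%:R^-1.
  move=> n; have n0 : 0 < (n.+1%:R^-1 : R) by rewrite invr_gt0.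
  by have [_ [f Vf <-] /ltW Ef] := inf_adherent n0 hi; exists f.
have fV n : V (fs n) by case: (fsP n).
have fE n : E (fs n) - m <= n.+1%:R^-1 by rewrite lerBlDl; case: (fsP n).
have small (e : R) : 0 < e -> exists n0, forall n, (n0 <= n)%N -> n.+1%:R^-1 <= e.
  move=> e0; exists (Num.truncn e^-1) => n hn.
  rewrite -[e]invrK lef_pV2 ?posrE ?invr_gt0 //.
  apply: ltW; apply: lt_le_trans (truncnS_gt _) _.
  by rewrite ler_nat.
have [h lh ch] : exists2 h, L2 h & (nn (fun x => h x - fs n x)) @[n --> \oo] --> 0.
  apply: L2_complete; first by move=> n; exact: VL.
  move=> e e0; have [|n0 H] := small (e / 4); first by rewrite divr_gt0.
  exists n0 => n k hn hk; apply: le_trans (par _ _ (fV n) (fV k)) _.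
  have := le_trans (fE n) (H _ hn); have := le_trans (fE k) (H _ hk).
  by move: (E (fs n)) (E (fs k)) => x y; lra.
have near_ (e : R) : 0 < e -> exists n, nn (fun x => h x - fs n x) <= e /\ E (fs n) - m <= e.
  move=> e0; have [n0 H] := small _ e0.
  have /cvgrPdist_le /(_ _ e0) [n1 _ H1] := ch.
  exists (maxn n0 n1); split.
    have := H1 (maxn n0 n1) (leq_maxr _ _).
    by rewrite /= sub0r normrN ger0_norm ?nn_ge0.
  exact: le_trans (fE _) (H _ (leq_maxl _ _)).
exists h; split => // [f Vf|e e0]; last first.
  by have [n [H _]] := near_ _ e0; exists (fs n).
have lf := VL _ Vf.
(* Perturbing a near-minimiser by t f cannot lower E below m; the discriminant of this quadratic in
   t bounds the defect in the Euler equation. *)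
have key n : (ip (fs n) f - l f) ^+ 2 <= nn f * (E (fs n) - m).
  set X := ip (fs n) f - l f.
  have P t : 0 <= t ^+ 2 * nn f + 2 * t * X + (E (fs n) - m).
    have := mE _ (Vlin t _ _ Vf (fV n)).
    by rewrite mlin // (ipC _ f) -/X; lra.
  have [f0|f0] := eqVneq (nn f) 0.
    have [->|X0] := eqVneq X 0; first by rewrite f0 expr0n /= mul0r.
    have := P (- (E (fs n) - m + 1) / (2 * X)).
    have -> : 2 * (- (E (fs n) - m + 1) / (2 * X)) * X = - (E (fs n) - m + 1) by field.
    rewrite f0 mulr0 add0r.
    by move=> ?; exfalso; lra.
  have fp : 0 < nn f by rewrite lt_def f0 nn_ge0.
  have := P (- X / nn f); rewrite -(pmulr_lge0 _ fp).
  have -> : ((- X / nn f) ^+ 2 * nn f + 2 * (- X / nn f) * X + (E (fs n) - m)) * nn f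
     = nn f * (E (fs n) - m) - X ^+ 2 by field.
  by rewrite subr_ge0.
apply/eqP; rewrite -subr_eq0 -sqrf_eq0 eq_le sqr_ge0 andbT.
apply/ler_addgt0Pr => e e0; rewrite add0r.
have e1 : 0 < e / (4 * (nn f + 1)).
  by rewrite divr_gt0 // mulr_gt0 // ltr_wpDl ?nn_ge0.
have [n [h1 h2]] := near_ _ e1.
have k1 := key n.
have k2 : (ip h f - ip (fs n) f) ^+ 2 <= nn f * (e / (4 * (nn f + 1))).
  rewrite -ipBl //; last exact: VL.
  apply: le_trans (ip_CS _ _) _ => //; first by apply: L2B => //; exact: VL.
  by rewrite mulrC; apply: ler_wpM2l => //; exact: nn_ge0.
have k3 : nn f * (E (fs n) - m) <= nn f * (e / (4 * (nn f + 1))).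
  by apply: ler_wpM2l => //; exact: nn_ge0.
have k4 : nn f * (e / (4 * (nn f + 1))) <= e / 4.
  have fp : 0 < nn f + 1 by rewrite ltr_wpDl ?nn_ge0.
  rewrite mulrA ler_pdivrMr ?mulr_gt0 //.
  by rewrite mulrA divfK //; have := nn_ge0 mu f; nra.
move: k1 k2 k3 k4; set a := ip (fs n) f; set b := ip h f; set c := l f.
set z := nn f * (E (fs n) - m); set y := nn f * _.
move=> k1 k2 k3 k4; have := sqr_ge0 ((b - a) - (a - c)); nra.
Qed.

Lemma riesz_representation (l : (T -> R) -> R) (C : R) :
  (forall a f g, L2 f -> L2 g -> l (fun x => a * f x + g x) = a * l f + l g) ->
  (forall f, L2 f -> `|l f| <= C * Num.sqrt (nn f)) ->
  exists2 h, L2 h & forall f, L2 f -> ip h f = l f.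
Proof.
move=> llin lC.
have [|||h [lh hP _]] := @riesz_subspace L2 l C _ _ _ llin lC => //.
- exact: L2_0.
- by move=> a f g lf lg; apply: L2D => //; exact: L2Z.
by exists h.
Qed.

End riesz_representation.

(** * Ultrafilter limits and weak convergence *)

Lemma ultra_fmap (I J : Type) (F : set_system I) (FF : UltraFilter F) (a : I -> J) :
  UltraFilter (a @ F).
Proof.
split=> [|G GF aG]; first exact: fmap_proper_filter.
apply/seteqP; split => // B GB.
have [//|nB] := in_ultra_setVsetC (a @^-1` B) FF.
have : G (B `&` ~` B) by apply: filterI => //; exact: aG.
by rewrite setICr => /filter_not_empty.
Qed.

(** Compactness of a segment, with no passage to a subsequence: the same filter serves all bounded
    sequences at once. *)
Lemma ultra_cvg (R : realType) (I : Type) (F : set_system I) (FF : UltraFilter F)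
  (a : I -> R) (C : R) : (forall i, `|a i| <= C) -> exists l : R, a i @[i --> F] --> l.
Proof.
move=> aC.
have FC : (a @ F) [set` `[- C, C]].
  rewrite /fmap /=; apply: filterS (@filterT _ F _) => i _ /=.
  by rewrite in_itv /= -ler_norml.
have := @segment_compact R (- C) C; rewrite compact_ultra => /(_ (a @ F) (ultra_fmap FF a) FC).
by move=> [l [_ al]]; exists l.
Qed.

Lemma ultra_seq : exists F : set_system nat, UltraFilter F /\ \oo `<=` F.
Proof. exact: ultraFilterLemma. Qed.

Section weak_limit.
Context d (T : measurableType d) (R : realType).
Variable mu : {measure set T -> \bar R}.
Context (F : set_system nat) {FF : UltraFilter F}.
Local Notation L2 := (L2 mu).
Local Notation ip := (ip mu).
Local Notation nn := (nn mu).

Definition wcvg (u : nat -> T -> R) (w : T -> R) : Prop :=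
  forall f, L2 f -> ip (u n) f @[n --> F] --> ip w f.

(** The limits of all [ip (u n) f] exist along the same filter, and they depend on f linearly and
    boundedly; Riesz representation turns them into a function. *)
Lemma L2_weak_limit (u : nat -> T -> R) (C : R) :
  (forall n, L2 (u n)) -> (forall n, nn (u n) <= C) ->
  exists2 w, L2 w & wcvg u w.
Proof.
move=> lu uC.
have C0 : 0 <= C by apply: le_trans (uC 0%N); exact: nn_ge0.
have ub f n : L2 f -> `|ip (u n) f| <= Num.sqrt C * Num.sqrt (nn f).
  move=> lf; apply: le_trans (ip_le_sqrt _ _) _ => //.
  by rewrite ler_wpM2r ?sqrtr_ge0 ?ler_wsqrtr.
have lx f : exists l : R, L2 f -> ip (u n) f @[n --> F] --> l.
  have [lf|nlf] := pselect (L2 f); last by exists 0.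
  by have [l lP] := ultra_cvg FF (fun n => ub f n lf); exists l.
have /choice [l lP] := lx.
have [|f lf|w lw wP] := @riesz_representation _ T R mu l (Num.sqrt C).
- move=> a f g lf lg; apply: (@cvg_unique _ (@Rhausdorff R) (ip (u n) (fun x => a * f x + g x) @[n --> F])).
  + by apply: lP; apply: L2D => //; exact: L2Z.
  + rewrite (_ : (fun n => _) = (fun n => a * ip (u n) f + ip (u n) g)); last first.
      by apply/funext => n; rewrite ipDr ?ipZr //; exact: L2Z.
    by apply: cvgD; [apply: cvgMl_tmp|]; exact: lP.
- have c : `|ip (u n) f| @[n --> F] --> `|l f| by apply: cvg_norm; exact: lP.
  by apply: (cvgr_to_le c); apply: filterE => n; exact: ub.
exists w => // f lf; rewrite wP //; exact: lP.
Qed.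

(** Weak lower semicontinuity: test with the limit [w] itself and apply Cauchy-Schwarz. *)
Lemma wcvg_nn_le (u : nat -> T -> R) w (C : R) :
  (forall n, L2 (u n)) -> L2 w -> wcvg u w -> (forall n, nn (u n) <= C) -> nn w <= C.
Proof.
move=> lu lw uw uC.
have C0 : 0 <= C by apply: le_trans (uC 0%N); exact: nn_ge0.
have h : ip (u n) w ^+ 2 @[n --> F] --> nn w ^+ 2 by have c := uw _ lw; exact: (cvgM c c).
have [w0|w0] := eqVneq (nn w) 0; first by rewrite w0.
have wp : 0 < nn w by rewrite lt_def w0 nn_ge0.
suff : nn w ^+ 2 <= C * nn w by rewrite expr2 ler_pM2r.
apply: (cvgr_to_le h); apply: filterE => n; apply: le_trans (ip_CS _ _) _ => //.
by rewrite ler_pM2r.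
Qed.

Lemma wcvg_sub0 u w : (forall n, L2 (u n)) -> L2 w -> wcvg u w ->
  wcvg (fun n x => u n x - w x) (fun=> 0).
Proof.
move=> lu lw uw f lf.
have -> : ip (fun=> 0) f = ip w f - ip w f.
  by rewrite subrr /ip; under eq_Rintegral do rewrite mul0r; exact: Int0.
rewrite (_ : (fun n => _) = (fun n => ip (u n) f - ip w f)); last first.
  by apply/funext => n; rewrite ipBl.
by apply: cvgB; [exact: uw|exact: cvg_cst].
Qed.

End weak_limit.

(** * Lebesgue measure on row vectors *)

Section change_of_variables.
Context d (T : measurableType d) (R : realType).
Variable mu : {measure set T -> \bar R}.
Variables (phi : T -> T) (mphi : measurable_fun setT phi).
Hypothesis inv : forall f : T -> R, mf f -> (forall x, 0 <= f x) ->
  nnI mu (fun x => f (phi x)) = nnI mu f.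

Lemma mf_comp (f : T -> R) : mf f -> mf (fun x => f (phi x)).
Proof. by move=> mf_; exact: measurableT_comp. Qed.

Lemma intg_comp (f : T -> R) : intg mu f -> intg mu (fun x => f (phi x)).
Proof.
move=> fi; have mf_ := intg_mf fi; apply: intgP; first exact: mf_comp.
by rewrite (inv (f := fun x => `|f x|)); [exact: intg_lty|exact: measurableT_comp|].
Qed.

(** Invariance is assumed for nonnegative functions only; a signed f is the difference of |f| and
    |f| - f, both nonnegative. *)
Lemma Int_comp (f : T -> R) : intg mu f -> \int[mu]_x f (phi x) = \int[mu]_x f x.
Proof.
have P g : intg mu g -> (forall x, 0 <= g x) -> \int[mu]_x g (phi x) = \int[mu]_x g x.
  move=> gi g0; apply: EFin_inj; rewrite -!nnI_Int //; last exact: intg_comp.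
  by apply: inv => //; exact: intg_mf gi.
move=> fi; have ai := intg_abs fi; have bi := intgB ai fi.
have pi := intg_comp fi; have api := intg_comp ai.
have H1 : \int[mu]_x (`|f (phi x)| - f (phi x)) = \int[mu]_x (`|f x| - f x).
  by apply: P bi _ => x; rewrite subr_ge0 ler_norm.
have H2 : \int[mu]_x `|f (phi x)| = \int[mu]_x `|f x| by exact: P ai _.
by move: H1; rewrite !IntB // H2; lra.
Qed.

Lemma L2_comp f : L2 mu f -> L2 mu (fun x => f (phi x)).
Proof. by move=> [mf_ f2]; split; [exact: mf_comp|exact: (intg_comp f2)]. Qed.

Lemma ip_comp f g : L2 mu f -> L2 mu g ->
  ip mu (fun x => f (phi x)) (fun x => g (phi x)) = ip mu f g.
Proof. by move=> lf lg; apply: (Int_comp (f := fun x => f x * g x)); exact: L2_intgM. Qed.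

Lemma nn_comp f : L2 mu f -> nn mu (fun x => f (phi x)) = nn mu f.
Proof. by move=> lf; exact: ip_comp. Qed.

End change_of_variables.

Section rV_integrals.
Context (R : realType).
Local Notation leb := (@lebesgue_measure R).
Local Notation mu n := (lebesgue_rV R n).

Lemma nnI_cons n (f : 'rV[R]_n.+1 -> R) : mf f -> (forall x, 0 <= f x) ->
  nnI (mu n.+1) f = (\int[leb]_t nnI (mu n) (fun x => f (rV_cons (t, x))))%E.
Proof.
move=> mf_ f0; rewrite /nnI.
have m1 : measurable_fun setT (fun z => (f (@rV_cons R n z))%:E).
  by apply/measurable_EFinP; apply: measurableT_comp => //; exact: measurable_rV_cons.
transitivity (\int[leb \x mu n]_z (f (rV_cons z))%:E)%E.
  rewrite -[RHS](@ge0_integral_pushforward _ _ _ _ _ _ (@measurable_rV_cons R n) _ setT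
     (fun x => (f x)%:E)) //.
  - exact/measurable_EFinP.
  - by move=> x _; rewrite lee_fin.
by rewrite (fubini_tonelli1 _ m1) // => z; rewrite lee_fin.
Qed.

Lemma nnI_dim0 (f : 'rV[R]_0 -> R) : nnI (mu 0) f = (f 0)%:E.
Proof.
rewrite /nnI /= integral_dirac //= ?diracE ?in_setT ?mul1e //.
apply/measurable_EFinP; rewrite (_ : f = cst (f 0)) //.
by apply/funext => x; rewrite [x]thinmx0.
Qed.

Lemma mf_coord n (i : 'I_n) (g : R -> R) : mf g -> mf (fun x : 'rV[R]_n => g (x ord0 i)).
Proof.
by move=> mg; apply: (measurableT_comp mg); exact: measurable_rV_coord.
Qed.

Lemma measurable_coord n (i : 'I_n) : mf (fun x : 'rV[R]_n => x ord0 i).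
Proof. exact: (mf_coord i (@measurable_id _ _ setT)). Qed.

Lemma measurable_rV_add n (a : 'rV[R]_n) : mf (fun x : 'rV[R]_n => x + a).
Proof.
apply: measurable_fun_rV => i; rewrite (_ : _ \o _ = fun x : 'rV[R]_n => x ord0 i + a ord0 i).
  by apply: measurable_funD => //; exact: measurable_coord.
by apply/funext => x; rewrite /rV_coord /= mxE.
Qed.

Lemma measurable_rV_opp n : mf (fun x : 'rV[R]_n => - x).
Proof.
apply: measurable_fun_rV => i; rewrite (_ : _ \o _ = fun x : 'rV[R]_n => - x ord0 i).
  by apply: measurable_funN; exact: measurable_coord.
by apply/funext => x; rewrite /rV_coord /= mxE.
Qed.

Lemma measurable_rV_sub n : mf (fun z : 'rV[R]_n * 'rV[R]_n => z.1 - z.2).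
Proof.
apply: measurable_fun_rV => i.
rewrite (_ : _ \o _ = fun z : 'rV[R]_n * 'rV[R]_n => z.1 ord0 i - z.2 ord0 i).
  by apply: measurable_funB;
    [apply: (measurableT_comp (measurable_coord i) measurable_fst)
    |apply: (measurableT_comp (measurable_coord i) measurable_snd)].
by apply/funext => x; rewrite /rV_coord /= !mxE.
Qed.

(** The image of Lebesgue measure under the translation agrees with it on intervals, hence on all
    measurable sets. *)
Lemma ge0_integral_translate (b : R) (f : R -> \bar R) : measurable_fun setT f ->
  (forall x, 0 <= f x)%E -> (\int[leb]_x f (x + b)%R = \int[leb]_x f x)%E.
Proof.
move=> mf_ f0.
pose tb (x : measurableTypeR R) : measurableTypeR R := x + b.
have ma : measurable_fun setT tb by exact: measurable_funD.
pose tmix := isMeasurableFun.Build _ _ _ _ _ ma.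
pose t : {mfun measurableTypeR R >-> measurableTypeR R} := HB.pack tb tmix.
have E A : measurable A -> leb A = pushforward leb t A.
  apply: (lebesgue_measure_unique (mu := pushforward leb t)).
  move=> _ [[x y]] _ <-; transitivity (leb (tb @^-1` [set` `]x, y]])); last by [].
  rewrite (_ : tb @^-1` _ = [set` `]x - b, y - b]]); last first.
    by apply/seteqP; split=> z /=; rewrite /tb !in_itv /= ltrBlDr lerBrDr.
  rewrite !lebesgue_measure_itv /= !lte_fin ltrD2r -!EFinB; case: ifP => // _.
  by congr EFin; ring.
transitivity (\int[pushforward leb t]_x f x)%E; first by rewrite ge0_integral_pushforward.
by apply: eq_measure_integral => A mA _; symmetry; exact: E.
Qed.

Lemma ge0_integral_opp (f : R -> \bar R) : measurable_fun setT f ->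
  (forall x, 0 <= f x)%E -> (\int[leb]_x f (- x)%R = \int[leb]_x f x)%E.
Proof.
move=> mf_ f0.
transitivity (\int[pushforward leb (-%R : _ -> measurableTypeR R)]_x f x)%E.
  by rewrite ge0_integral_pushforward.
by apply: eq_measure_integral => A mA _; exact: lebesgue_measureN.
Qed.

Lemma mf_nnI_cons n (f : 'rV[R]_n.+1 -> R) : mf f -> (forall x, 0 <= f x) ->
  measurable_fun setT (fun t => nnI (mu n) (fun x => f (rV_cons (t, x)))).
Proof.
move=> mf_ f0; have m1 : measurable_fun setT (fun z => (f (@rV_cons R n z))%:E).
  by apply/measurable_EFinP; apply: measurableT_comp => //; exact: measurable_rV_cons.
by apply: (measurable_fun_fubini_tonelli_F _ m1) => z; rewrite lee_fin.
Qed.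

Lemma rV_consD n t (x : 'rV[R]_n) (a : 'rV[R]_n.+1) :
  rV_cons (t, x) + a = rV_cons (t + a ord0 ord0, x + \row_j a ord0 (lift ord0 j)).
Proof.
apply/rowP => i; rewrite !mxE; have [j ->|->] := unliftP ord0 i; last first.
  by [].
by rewrite /= !mxE.
Qed.

Lemma rV_consN n t (x : 'rV[R]_n) : - rV_cons (t, x) = rV_cons (- t, - x).
Proof. by apply/rowP => i; rewrite !mxE; case: unlift => [j|//]; rewrite /= mxE. Qed.

Lemma mf_rV_cons n (f : 'rV[R]_n.+1 -> R) t : mf f -> mf (fun x => f (rV_cons (t, x))).
Proof.
move=> mf_; have : mf (fun z => f (@rV_cons R n z)).
  by apply: (measurableT_comp mf_); exact: measurable_rV_cons.
by move=> m; exact: (measurableT_comp m (measurable_pair1 t)).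
Qed.

(** By induction on the dimension, following the recursive definition of the measure: the first
    coordinate is shifted on the line, the others by the induction hypothesis. *)
Lemma nnI_trn n (a : 'rV[R]_n) (f : 'rV[R]_n -> R) : mf f -> (forall x, 0 <= f x) ->
  nnI (mu n) (fun x => f (x + a)) = nnI (mu n) f.
Proof.
elim: n a f => [|n IH] a f mf_ f0; first by rewrite !nnI_dim0 [a]thinmx0 addr0.
rewrite [LHS]nnI_cons //; last first.
  by apply: (measurableT_comp mf_); exact: measurable_rV_add.
rewrite (nnI_cons mf_ f0).
transitivity (\int[leb]_t nnI (mu n) (fun x => f (rV_cons ((t + a ord0 ord0)%R, x))))%E; last first.
  apply: (ge0_integral_translate _ (f := fun t => nnI (mu n) (fun x => f (rV_cons (t, x))))).
    exact: mf_nnI_cons.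
  by move=> t; exact: nnI_ge0.
apply: eq_integral => t _.
under [in LHS]eq_fun do rewrite rV_consD.
by apply: (IH _ (fun x => f (rV_cons (t + a ord0 ord0, x)))) => //; exact: mf_rV_cons.
Qed.

Lemma nnI_opp n (f : 'rV[R]_n -> R) : mf f -> (forall x, 0 <= f x) ->
  nnI (mu n) (fun x => f (- x)) = nnI (mu n) f.
Proof.
elim: n f => [|n IH] f mf_ f0; first by rewrite !nnI_dim0 oppr0.
rewrite [LHS]nnI_cons //; last first.
  by apply: (measurableT_comp mf_); exact: measurable_rV_opp.
rewrite (nnI_cons mf_ f0).
transitivity (\int[leb]_t nnI (mu n) (fun x => f (rV_cons ((- t)%R, x))))%E; last first.
  apply: (ge0_integral_opp (f := fun t => nnI (mu n) (fun x => f (rV_cons (t, x))))).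
    exact: mf_nnI_cons.
  by move=> t; exact: nnI_ge0.
apply: eq_integral => t _.
under [in LHS]eq_fun do rewrite rV_consN.
by apply: (IH (fun x => f (rV_cons (- t, x)))) => //; exact: mf_rV_cons.
Qed.

Lemma nnI_prod n (g : 'I_n -> R -> R) : (forall i, mf (g i)) -> (forall i t, 0 <= g i t) ->
  nnI (mu n) (fun x => \prod_(i < n) g i (x ord0 i)) = (\prod_(i < n) nnI leb (g i))%E.
Proof.
elim: n g => [|n IH] g mg g0; first by rewrite nnI_dim0 !big_ord0.
have mP m (h : 'I_m -> R -> R) : (forall i, mf (h i)) ->
    mf (fun x : 'rV[R]_m => \prod_(i < m) h i (x ord0 i)).
  by move=> mh; apply: measurable_prod => i _; exact: mf_coord.
rewrite nnI_cons; [|exact: mP|by move=> x; exact: prodr_ge0].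
rewrite big_ord_recl -IH //.
set c := nnI (mu n) _.
under eq_integral => t _.
  have -> : nnI (mu n) (fun x => \prod_(i < n.+1) g i (rV_cons (t, x) ord0 i)) = ((g ord0 t)%:E * c)%E.
    rewrite -nnIZ //; last 2 first.
    - exact: (mP n (fun i => g (lift ord0 i)) (fun i => mg _)).
    - by move=> x; exact: prodr_ge0.
    congr nnI; apply/funext => x; rewrite big_ord_recl mxE unlift_none; congr (_ * _).
    by apply: eq_bigr => i _; rewrite mxE liftK.
  over.
rewrite ge0_integralZr //.
- by apply/measurable_EFinP; exact: mg.
- by move=> t _; rewrite lee_fin.
- by apply: nnI_ge0 => x; exact: prodr_ge0.
Qed.

End rV_integrals.

Section rV_norm.
Context (R : realType) (N : nat).
Implicit Types x y : 'rV[R]_N.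

Lemma rV_norm_le x (e : R) : 0 <= e -> (forall i, `|x ord0 i| <= e) -> `|x| <= e.
Proof.
move=> e0 xe; rewrite -[`|x|]/(mx_norm x) mx_normrE.
by apply: bigmax_le => // -[i j] _ /=; rewrite (ord1 i).
Qed.

Lemma coord_norm_le x i : `|x ord0 i| <= `|x|.
Proof. by rewrite -[`|x|]/(mx_norm x) mx_normrE; apply: (le_bigmax _ _ (ord0, i)). Qed.

Lemma delta_norm (i : 'I_N) : `|delta_mx ord0 i : 'rV[R]_N| <= 1.
Proof.
apply: rV_norm_le => // j; rewrite !mxE eqxx /=.
by case: (_ == _); rewrite ?normr1 ?normr0.
Qed.

Lemma coord_le_enorm x i : `|x ord0 i| <= enorm x.
Proof.
rewrite /enorm -sqrtr_sqr ler_wsqrtr // (bigD1 i) //= lerDl.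
by apply: sumr_ge0 => j _; exact: sqr_ge0.
Qed.

Lemma norm_le_enorm x : `|x| <= enorm x.
Proof. by apply: rV_norm_le; [exact: sqrtr_ge0|move=> i; exact: coord_le_enorm]. Qed.

Lemma enorm_le_norm x : enorm x <= N%:R * `|x|.
Proof.
have n0 : 0 <= N%:R * `|x| by rewrite mulr_ge0.
rewrite /enorm -[X in _ <= X]ger0_norm // -sqrtr_sqr ler_wsqrtr //.
have [N0|N0] := posnP N.
  by rewrite big1 ?sqr_ge0 // => i; have := ltn_ord i; rewrite {2}N0.
apply: (@le_trans _ _ (\sum_(i < N) `|x| ^+ 2)).
  by apply: ler_sum => i _; rewrite -real_normK ?num_real // lerXn2r ?nnegrE // coord_norm_le.
rewrite sumr_const card_ord -[X in X <= _]mulr_natl exprMn ler_wpM2r ?sqr_ge0 // expr2.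
by rewrite ler_peMl // ler1n.
Qed.

End rV_norm.

Lemma bigcup_count_measurable d (T : measurableType d) (U : countType) (F : U -> set T) :
  (forall c, measurable (F c)) -> measurable (\bigcup_c F c).
Proof.
move=> mF; rewrite (_ : \bigcup_c _ = \bigcup_(n : nat) (if unpickle n is Some c then F c else set0)).
  by apply: bigcupT_measurable => n; case: unpickle.
apply/seteqP; split => [x [c _ Fx]|x [n _]].
  by exists (pickle c) => //; rewrite pickleK.
by case: unpickle => // c Fx; exists c.
Qed.

(** * Dyadic cells *)

Section cells.
Context (R : realType) (N : nat).

(** Names the dyadic cube of side 2^-m that contains x, by the integer vector of its lower corner.
    These cubes carry the measurability of continuous functions and, later, all the embeddings. *)
Definition cell (m : nat) (x : 'rV[R]_N) : {ffun 'I_N -> int} :=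
  [ffun i => Num.floor (2 ^+ m * x ord0 i)].

Lemma measurable_floor_eq (k : int) : measurable [set t : R | Num.floor t == k].
Proof.
rewrite (_ : mkset _ = [set` `[k%:~R, (k + 1)%:~R[]); first exact: measurable_itv.
apply/seteqP; split => t /=.
  by move=> /eqP <-; rewrite in_itv /= floor_itv.
by rewrite in_itv /= => /floor_def ->.
Qed.

Lemma measurable_cell m c : measurable [set x : 'rV[R]_N | cell m x = c].
Proof.
rewrite (_ : mkset _ = \bigcap_(i in [set: 'I_N]) [set x : 'rV[R]_N | Num.floor (2 ^+ m * x ord0 i) == c i]).
  apply: fin_bigcap_measurable => // i _.
  have mg : mf (fun t : R => 2 ^+ m * t) by exact: measurable_funM.
  have := mf_coord i mg; move=> /(_ measurableT _ (measurable_floor_eq (c i))).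
  by rewrite setTI.
apply/seteqP; split => x /=; first by move=> <- i _; rewrite /= ffunE.
by move=> h; apply/ffunP => i; rewrite ffunE; apply/eqP/h.
Qed.

(** There are only countably many cells, so any function of the cell is measurable. *)
Lemma mf_cell d (T : measurableType d) m (h : {ffun 'I_N -> int} -> T) :
  measurable_fun setT (fun x => h (cell m x)).
Proof.
move=> _ Y mY; rewrite setTI.
rewrite (_ : _ @^-1` _ = \bigcup_c (if `[< Y (h c) >] then [set x : 'rV[R]_N | cell m x = c] else set0)).
  by apply: bigcup_count_measurable => c; case: ifP => // _; exact: measurable_cell.
apply/seteqP; split => [x Yx|x [c _]].
  by exists (cell m x) => //; rewrite asboolT.
by case: asboolP => // Yc /= ->.
Qed.

Lemma cell_dist m (x y : 'rV[R]_N) : cell m x = cell m y -> `|x - y| <= (2 ^+ m)^-1.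
Proof.
move=> /ffunP e; apply: rV_norm_le => [|i]; first by rewrite invr_ge0 exprn_ge0.
have p0 : 0 < 2 ^+ m :> R by rewrite exprn_gt0.
rewrite -[X in _ <= X]mul1r ler_pdivlMr // -[2 ^+ m]gtr0_norm // -normrM mulrC !mxE mulrBr.
have := e i; rewrite !ffunE => ei.
have /andP[a1 a2] := floor_itv (2 ^+ m * x ord0 i).
have /andP[b1 b2] := floor_itv (2 ^+ m * y ord0 i).
move: a1 a2 b1 b2; rewrite ei intrD !mulr1z; set k := _%:~R => *.
by rewrite ler_norml; apply/andP; split; lra.
Qed.

(** The sigma-algebra is generated by the coordinates, so continuity alone does not give
    measurability at once. Here f is the limit of its values at the lower corners of the cells, and
    each of these is a function of the cell. *)
Lemma mf_continuous (f : 'rV[R]_N -> R) : continuous f -> mf f.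
Proof.
move=> cf.
pose r m (x : 'rV[R]_N) : 'rV[R]_N := \row_i ((cell m x i)%:~R / 2 ^+ m).
apply: (measurable_fun_cvg (h := fun m x => f (r m x))).
  move=> m; exact: (mf_cell m (fun c => f (\row_i ((c i)%:~R / 2 ^+ m)))).
move=> x _; suff rx_ : r m x @[m --> \oo] --> (x : 'rV[R]_N) by exact: (cvg_comp _ _ rx_ (cf x)).
apply/cvgrPdist_le => e e0.
have p0 m : 0 < 2 ^+ m :> R by rewrite exprn_gt0.
have rx m : `|x - r m x| <= (2^-1) ^+ m.
  apply: rV_norm_le => [|i]; first by rewrite exprn_ge0 // invr_ge0.
  rewrite exprVn -[X in _ <= X]mul1r ler_pdivlMr // -[2 ^+ m]gtr0_norm // -normrM mulrC.
  rewrite !mxE mulrBr ffunE [2 ^+ m * (_ / _)]mulrC divfK ?gt_eqF //.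
  have /andP[] := floor_itv (2 ^+ m * x ord0 i).
  rewrite intrD mulr1z; set k := _%:~R => *.
  by rewrite ler_norml; apply/andP; split; lra.
have : (2^-1 : R) ^+ m @[m --> \oo] --> 0.
  by apply: cvg_expr; rewrite ger0_norm ?invr_ge0 // invf_lt1 // ltr1n.
move=> /cvgrPdist_le /(_ _ e0); apply: filterS => m.
by rewrite sub0r normrN ger0_norm ?exprn_ge0 ?invr_ge0 // => h; apply: le_trans (rx m) h.
Qed.

End cells.

(** * Test functions and weak derivatives *)

Section Cn_algebra.
Context (R : realType) (N : nat).
Implicit Types f g : 'rV[R]_N -> R.
Local Notation e i := (delta_mx ord0 i : 'rV[R]_N).

Lemma CnW k f : Cn k.+1 f -> Cn k f.
Proof.
elim: k f => [|k IH] f; first by case.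
by move=> [cf H]; split => // i; have [df c] := H i; split => //; exact: IH.
Qed.

Lemma Cn_cst k (c : R) : Cn k (fun _ : 'rV[R]_N => c).
Proof.
elim: k c => [|k IH] c; first exact: cst_continuous.
split; first exact: cst_continuous.
move=> i; split; first by move=> x; exact: derivable_cst.
rewrite (_ : partial i _ = fun=> 0) //.
by apply/funext => x; rewrite /partial derive_cst.
Qed.

Lemma CnD k f g : Cn k f -> Cn k g -> Cn k (fun x => f x + g x).
Proof.
elim: k f g => [|k IH] f g; first by move=> cf cg x; exact: (cvgD ((cf : continuous f) x) ((cg : continuous g) x)).
move=> [cf Hf] [cg Hg]; split; first by move=> x; exact: (cvgD (cf x) (cg x)).
move=> i; have [df Cf] := Hf i; have [dg Cg] := Hg i.
split; first by move=> x; exact: derivableD.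
rewrite (_ : partial i _ = fun x => partial i f x + partial i g x); first exact: IH.
by apply/funext => x; rewrite /partial deriveD.
Qed.

Lemma CnM k f g : Cn k f -> Cn k g -> Cn k (fun x => f x * g x).
Proof.
elim: k f g => [|k IH] f g; first by move=> cf cg x; exact: (cvgM ((cf : continuous f) x) ((cg : continuous g) x)).
move=> Sf Sg; have [cf Hf] := Sf; have [cg Hg] := Sg.
split; first by move=> x; exact: (cvgM (cf x) (cg x)).
move=> i; have [df Cf] := Hf i; have [dg Cg] := Hg i.
split; first by move=> x; exact: derivableM.
rewrite (_ : partial i _ = fun x => f x * partial i g x + g x * partial i f x).
  by apply: CnD; apply: IH => //; exact: CnW.
by apply/funext => x; rewrite /partial deriveM.
Qed.

Lemma Cn_prod k (I : Type) (s : seq I) (F : I -> 'rV[R]_N -> R) :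
  (forall i, Cn k (F i)) -> Cn k (fun x => \prod_(i <- s) F i x).
Proof.
move=> CF; elim: s => [|i s IH].
  by under eq_fun do rewrite big_nil; exact: Cn_cst.
by under eq_fun do rewrite big_cons; exact: CnM.
Qed.

Lemma is_derive_cvgP (V W : normedModType R) (f : V -> W) x v df :
  is_derive x v f df <-> (fun h : R => h^-1 *: (f (h *: v + x) - f x)) @ 0^' --> df.
Proof.
split=> [[Df <-]|c]; first exact: Df.
by split; [apply/cvg_ex; exists df|exact: cvg_lim].
Qed.

Lemma is_derive_val (V W : normedModType R) (f : V -> W) x v df :
  is_derive x v f df -> 'D_v f x = df.
Proof. by case. Qed.

Lemma is_derive_coord (g : R -> R) (c b dg : R) i j (x : 'rV[R]_N) :
  is_derive (c * x ord0 i + b) 1 g dg ->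
  is_derive x (e j) (fun x => g (c * x ord0 i + b)) (if i == j then c * dg else 0).
Proof.
move=> dg_.
have Q h : (h *: e j + x) ord0 i = (if i == j then h else 0) + x ord0 i.
  by rewrite !mxE eqxx /=; case: (_ == _); rewrite ?mulr1 ?mulr0.
have L : is_derive (0 : R) 1 (fun h : R => g (c * ((if i == j then h else 0) + x ord0 i) + b))
   (if i == j then c * dg else 0).
  case: ifP => _; last by exact: is_derive_cst.
  rewrite (_ : (fun h => _) = g \o (fun h : R => c * h + (c * x ord0 i + b))); last first.
    by apply/funext => h /=; congr g; ring.
  rewrite [c * dg]mulrC; apply: is_derive1_comp; first by rewrite mulr0 add0r.
  have H := @is_deriveD _ _ _ _ _ _ _ _ _ (@is_deriveZ _ _ _ _ c _ _ _ (is_derive_id (0 : R) (1 : R)))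
    (is_derive_cst (c * x ord0 i + b : R) (0 : R) (1 : R)).
  by apply: (is_derive_eq H); rewrite addr0 /GRing.scale /= mulr1.
apply/is_derive_cvgP; move/is_derive_cvgP : L; apply: cvg_trans; apply: near_eq_cvg.
by apply: nearW => h /=; rewrite Q !addr0 [h%:A]mulr1; case: ifP => _; rewrite ?add0r.
Qed.

End Cn_algebra.

(** * A smooth function vanishing on a half-line *)

Section bump.
Context (R : realType).
Implicit Types (P : {poly R}) (t : R).

(* Every derivative of [exp (-1/t)] is a polynomial in [1/t] times [exp (-1/t)]. *)
Definition bump P t : R := if 0 < t then P.[t^-1] * expR (- t^-1) else 0.

Lemma bump_neg P t : t <= 0 -> bump P t = 0.
Proof. by rewrite /bump leNgt => /negbTE ->. Qed.

Lemma poly_bound P : exists (C : R) (n : nat), 0 <= C /\ forall t, 1 <= t -> `|P.[t]| <= C * t ^+ n.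
Proof.
exists (\sum_(i < size P) `|P`_i|), (size P); split; first by apply: sumr_ge0.
move=> t t1; rewrite horner_coef mulr_suml; apply: le_trans (ler_norm_sum _ _ _) _.
apply: ler_sum => i _; rewrite normrM ler_wpM2l // ger0_norm; last by rewrite exprn_ge0 // (le_trans _ t1).
by rewrite ler_weXn2l // ltnW.
Qed.

(** The exponential beats every power of 1/t. The exponent 2 is what makes the difference quotient
    at 0 tend to 0. *)
Lemma bump_small P : exists C, 0 <= C /\ forall t, t <= 1 -> `|bump P t| <= C * t ^+ 2.
Proof.
have [C [n [C0 PC]]] := poly_bound P.
exists (C * (n.+3)`!%:R); split; first by rewrite mulr_ge0.
move=> t t1; have [t0|t0] := leP t 0.
  by rewrite bump_neg // normr0 mulr_ge0 ?sqr_ge0 // mulr_ge0.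
rewrite /bump t0 normrM [X in _ * X]ger0_norm ?expR_ge0 //.
have t1' : 1 <= t^-1 by rewrite -[X in X <= _]invr1 lef_pV2 ?posrE.
have tn0 : 0 < t^-1 by rewrite invr_gt0.
rewrite expRN ler_pdivrMr ?expR_gt0 //.
apply: le_trans (PC _ t1') _.
(* One term of the exponential series: degree n absorbs the polynomial and two more give the factor
   t^2; the remaining one is spare, since 1/t is at least 1. *)
have : t^-1 ^+ n.+3 / (n.+3)`!%:R <= expR t^-1.
  by apply: le_trans (expR_ge1Dxn n.+2 (ltW tn0)); rewrite lerDr.
have f0 : 0 < (n.+3)`!%:R :> R by rewrite ltr0n fact_gt0.
rewrite ler_pdivrMr // => h.
have -> : C * (n.+3)`!%:R * t ^+ 2 * expR t^-1 = C * (t ^+ 2 * (expR t^-1 * (n.+3)`!%:R)) by ring.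
rewrite ler_wpM2l //; apply: (@le_trans _ _ (t ^+ 2 * t^-1 ^+ n.+3)); last first.
  by rewrite ler_wpM2l ?sqr_ge0.
have -> : t^-1 ^+ n = t ^+ 2 * t^-1 ^+ n.+2.
  by rewrite -[n.+2]/(2 + n)%N exprD mulrA -exprMn mulfV ?gt_eqF // expr1n mul1r.
by rewrite ler_wpM2l ?sqr_ge0 // [X in _ <= X]exprS ler_peMl // exprn_ge0 // ltW.
Qed.

(** For t > 0, P(1/t) exp(-1/t) has derivative t^-2 (P - P')(1/t) exp(-1/t), again of the same form;
    hence smoothness follows by induction on the order. *)
Lemma is_derive_bump P t :
  is_derive t 1 (bump P) (bump ('X^2 * (P - P^`())) t).
Proof.
have [t0|t0|t0] := ltgtP t 0.
- rewrite [bump _ t]bump_neg ?ltW //.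
  apply: (near_eq_is_derive (f := cst (0 : R))) (is_derive_cst (0 : R) t (1 : R)).
  near=> z; rewrite /cst bump_neg //; apply: ltW; near: z; exact: lt_nbhsl.
- have D : is_derive t 1 (fun t => P.[t^-1] * expR (- t^-1)) (bump ('X^2 * (P - P^`())) t).
    have dV : is_derive t 1 (fun t : R => t^-1) (- t ^- 2).
      have H := @is_deriveV R (@id R) t 1 1 _ (is_derive_id t (1 : R)).
      by apply: (is_derive_eq (H _)); rewrite ?gt_eqF // /GRing.scale /= mulr1.
    have d1 : is_derive t 1 ((horner P) \o (fun t : R => t^-1)) (P^`().[t^-1] * (- t ^- 2)).
      exact: is_derive1_comp.
    have d2 : is_derive t 1 (expR \o (fun t : R => - t^-1)) (expR (- t^-1) * (t ^- 2)).
      apply: is_derive1_comp; rewrite -[t ^- 2]opprK.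
      exact: is_deriveN.
    apply: (is_derive_eq (is_deriveM d1 d2)).
    rewrite /bump t0 !hornerE !exprVn.
    change (P.[t^-1] * (expR (- t^-1) * t ^- 2) + expR (- t^-1) * (P^`().[t^-1] * - t ^- 2) =
      t ^- 2 * (P.[t^-1] - P^`().[t^-1]) * expR (- t^-1)).
    ring.
  apply: near_eq_is_derive D.
  by near=> z; rewrite /bump ifT //; near: z; exact: lt_nbhsr.
- rewrite t0 [bump _ 0]bump_neg //.
  have [C [C0 PC]] := bump_small P.
  apply/is_derive_cvgP.
  apply/cvgrPdist_le => eps eps0; near=> h.
  rewrite sub0r normrN [bump P 0]bump_neg // subr0 addr0 /GRing.scale /= mulr1.
  have h0 : h != 0 by near: h; exact: nbhs_dnbhs_neq.
  have h1 : `|h| < 1 by near: h; apply: dnbhs0_lt.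
  have h2 : `|h| < eps / (C + 1).
    by near: h; apply: dnbhs0_lt; rewrite divr_gt0 // ltr_wpDl.
  rewrite normrM normfV ler_pdivrMl ?normr_gt0 //.
  apply: le_trans (PC h _) _; first by apply: ltW; apply: le_lt_trans (ler_norm _) h1.
  rewrite -real_normK ?num_real // expr2 mulrCA ler_wpM2l //.
  rewrite ltr_pdivlMr in h2; last by rewrite ltr_wpDl.
  apply: le_trans (ltW h2); rewrite mulrDr mulr1 mulrC lerDl //.
Unshelve. all: by end_near.
Qed.

Lemma bump_continuous P : continuous (bump P).
Proof.
move=> t; apply: differentiable_continuous; apply/derivable1_diffP.
by have [] := is_derive_bump P t.
Qed.

Lemma Cn_bump N k P (c b : R) (i : 'I_N) : Cn k (fun x : 'rV[R]_N => bump P (c * x ord0 i + b)).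
Proof.
have cont Q : continuous (fun x : 'rV[R]_N => bump Q (c * x ord0 i + b)).
  move=> x; apply: (continuous_comp (f := fun x : 'rV[R]_N => c * x ord0 i + b)); last exact: bump_continuous.
  by apply: (@cvgD _ _ _ (nbhs x)); [apply: (@cvgMl_tmp _ _ (nbhs x)); exact: coord_continuous|exact: cvg_cst].
elim: k P => [|k IH] P; first exact: cont.
split; first exact: cont.
move=> j; have D (x : 'rV[R]_N) := is_derive_coord j (is_derive_bump P (c * x ord0 i + b)).
split; first by move=> x; have [] := D x.
rewrite (_ : partial j _ = fun x => (if i == j then c else 0) * bump ('X^2 * (P - P^`())) (c * x ord0 i + b)).
  by apply: CnM; [exact: Cn_cst|exact: IH].
apply/funext => x; rewrite /partial (is_derive_val (D x)).
by case: ifP; rewrite ?mul0r.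
Qed.

Lemma bump1_ge0 t : 0 <= bump 1 t.
Proof. by rewrite /bump; case: ifP => // _; rewrite hornerE mul1r expR_ge0. Qed.

Lemma bump1_le1 t : bump 1 t <= 1.
Proof.
rewrite /bump; case: ifP => // t0; rewrite hornerE mul1r -expR0 ler_expR oppr_le0 invr_ge0 ltW //.
Qed.

End bump.

Section test_functions.
Context (R : realType) (N : nat).
Local Notation mu := (lebesgue_rV R N).
Implicit Types f g phi : 'rV[R]_N -> R.
Local Notation e i := (delta_mx ord0 i : 'rV[R]_N).

(** Compact support reduced to a bound on the points where f does not vanish, which is easier to
    carry through sums, derivatives and translations. *)
Lemma test_functionP f :
  test_function f <-> (forall k, Cn k f) /\ exists M, forall x, f x != 0 -> `|x| <= M.
Proof.
split=> -[cf]; last first.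
  move=> [M fM]; split => //; apply: bounded_closed_compact; last exact: closed_closure.
  have H : closure [set x | f x != 0] `<=` [set x | `|x| <= M].
    have cl : closed [set x : 'rV[R]_N | `|x| <= M]; last first.
      by move/closure_id: cl => ->; apply: closureS => x; exact: fM.
    rewrite (_ : mkset _ = (fun x : 'rV[R]_N => `|x|) @^-1` [set t | t <= M]) //.
    by apply: closed_comp; [move=> x _; exact: norm_continuous|exact: closed_le].
  by exists M; split => [|y My x /H /=]; [exact: num_real|move=> /le_trans; apply; exact: ltW].
move=> /compact_bounded [M [_ HM]]; split => //.
exists (M + 1) => x fx; apply: HM; first by rewrite ltrDl.
exact: subset_closure.
Qed.

Lemma test_lin a f g : test_function f -> test_function g ->
  test_function (fun x => a * f x + g x).
Proof.
move=> /test_functionP [cf [M fM]] /test_functionP [cg [K gK]]; apply/test_functionP; split.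
  by move=> k; apply: CnD => //; apply: CnM => //; exact: Cn_cst.
exists (Num.max M K) => x; have [f0|f0] := eqVneq (f x) 0.
  by rewrite f0 mulr0 add0r => /gK h; rewrite le_max h orbT.
by move=> _; rewrite le_max fM.
Qed.

Lemma test0 : test_function (fun _ : 'rV[R]_N => 0 : R).
Proof.
apply/test_functionP; split; first by move=> k; exact: Cn_cst.
by exists 0 => x; rewrite eqxx.
Qed.

Lemma test_partial i f : test_function f -> test_function (partial i f).
Proof.
move=> tf; have /test_functionP [cf [M fM]] := tf; apply/test_functionP; split.
  by move=> k; have [_ /(_ i) []] := cf k.+1.
exists M => x; apply: contraNT; rewrite -ltNge => Mx.
rewrite /partial -(derive_cst (0 : R) x (e i)); apply/eqP; apply: near_eq_derive.
have : nbhs x [set y : 'rV[R]_N | M < `|y|].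
  apply: open_nbhs_nbhs; split => //.
  rewrite (_ : mkset _ = (fun x : 'rV[R]_N => `|x|) @^-1` [set t | M < t]) //.
  by apply: open_comp; [move=> y _; exact: norm_continuous|exact: open_gt].
apply: filterS => y /= My; apply/eqP; apply: contraTT My => /fM.
by rewrite -leNgt.
Qed.

Lemma test_is_derive i f x : test_function f -> is_derive x (e i) f (partial i f x).
Proof. by move=> [/(_ 1%N) [_ /(_ i) [df _]] _]; split => //; exact: df. Qed.

Lemma Cn_trn k a f : Cn k f -> Cn k (fun x => f (x + a)).
Proof.
have ct g : continuous g -> continuous (fun x : 'rV[R]_N => g (x + a)).
  move=> cg x; have c : (y + a) @[y --> x] --> x + a.
    by apply: (@cvgD _ _ _ (nbhs x)); [exact: cvg_id|exact: cvg_cst].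
  exact: (cvg_comp _ _ c (cg (x + a))).
elim: k f => [|k IH] f; first exact: ct.
move=> [cf H]; split; first exact: ct.
move=> i; have [df C] := H i.
have D x : is_derive x (e i) (fun x => f (x + a)) (partial i f (x + a)).
  have Df : is_derive (x + a) (e i) f (partial i f (x + a)) by split => //; exact: df.
  apply/is_derive_cvgP; move/is_derive_cvgP: Df; apply: cvg_trans; apply: near_eq_cvg.
  by apply: nearW => h /=; rewrite addrA.
split; first by move=> x; have [] := D x.
rewrite (_ : partial i _ = fun x => partial i f (x + a)); first exact: IH.
by apply/funext => x; exact: is_derive_val (D x).
Qed.

Lemma test_trn a f : test_function f -> test_function (fun x => f (x + a)).
Proof.
move=> /test_functionP [cf [M fM]]; apply/test_functionP; split.
  by move=> k; exact: Cn_trn.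
exists (M + `|a|) => x /fM h; rewrite -[x](addrK a); apply: le_trans (ler_normB _ _) _.
by rewrite lerD2r.
Qed.

Lemma partial_trn i a f x : test_function f ->
  partial i (fun x => f (x + a)) x = partial i f (x + a).
Proof.
move=> tf; have Df := test_is_derive i (x + a) tf.
apply: is_derive_val; apply/is_derive_cvgP; move/is_derive_cvgP: Df; apply: cvg_trans.
by apply: near_eq_cvg; apply: nearW => h /=; rewrite addrA.
Qed.

Definition box (M : R) : set 'rV[R]_N := [set x | `|x| <= M].

Lemma measurable_box M : measurable (box M).
Proof.
have m : mf (fun x : 'rV[R]_N => `|x|) by apply: mf_continuous; exact: norm_continuous.
rewrite -[box M]setTI.
have := m measurableT `]-oo, M]%classic (measurable_itv _).
by congr measurable; apply/seteqP; split => x /=; rewrite in_itv.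
Qed.

Lemma mu_cube_lty (a b : 'I_N -> R) :
  (mu [set x | forall i, [set` `[a i, b i]] (x ord0 i)] < +oo)%E.
Proof.
rewrite (lebesgue_rV_box (F := fun i => [set` `[a i, b i]])) //.
have -> : (\prod_(i < N) lebesgue_measure [set` `[a i, b i]] =
   (\prod_(i < N) (if a i < b i then b i - a i else 0))%:E)%E.
  rewrite -prodEFin; apply: eq_bigr => i _.
  by rewrite lebesgue_measure_itv /= lte_fin -EFinB; case: ifP.
exact: ltry.
Qed.

Lemma mu_box_lty M : (mu (box M) < +oo)%E.
Proof.
apply: le_lt_trans (mu_cube_lty (fun=> - M) (fun=> M)).
apply: le_measure; rewrite ?inE; first exact: measurable_box.
  rewrite [X in measurable X](_ : _ = \bigcap_(i in [set: 'I_N]) ((rV_coord i : 'rV[R]_N -> _) @^-1` [set` `[- M, M]])).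
    apply: fin_bigcap_measurable => // i _.
    by rewrite -[X in measurable X]setTI; exact: measurable_rV_coord.
  by apply/seteqP; split => x /= H i; [move=> _|]; exact: H.
by move=> x /= xM i; rewrite in_itv /= -ler_norml; apply: le_trans xM; exact: coord_norm_le.
Qed.

Lemma intg_box (M c : R) : intg mu (fun x => c * \1_(box M) x).
Proof.
apply: intgZ; apply: intg_ge0P.
- by apply/measurable_indicP; exact: measurable_box.
- by move=> x; rewrite indicE.
by rewrite /nnI integral_indic ?setIT ?mu_box_lty //; exact: measurable_box.
Qed.

Lemma mf_box M : mf (\1_(box M) : 'rV[R]_N -> R).
Proof. by apply/measurable_indicP; exact: measurable_box. Qed.

Lemma L2_box (M c : R) : L2 mu (fun x => c * \1_(box M) x).
Proof.
split; first by apply: measurable_funM => //; exact: mf_box.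
under eq_fun do rewrite exprMn.
rewrite (_ : (fun x => _) = fun x => c ^+ 2 * \1_(box M) x); first exact: intg_box.
by apply/funext => x; rewrite indicE; case: (_ \in _); rewrite ?expr1n ?expr0n.
Qed.

Lemma test_bound f : test_function f -> exists C M, [/\ 0 <= C, 0 <= M &
  forall x, `|f x| <= C * \1_(box M) x].
Proof.
move=> tf; have /test_functionP [cf [M fM]] := tf.
have cpt : compact (box (Num.max M 0)).
  apply: bounded_closed_compact.
    by exists (Num.max M 0); split => [|y My x /= h]; [exact: num_real|apply: le_trans h (ltW My)].
  rewrite (_ : box _ = (fun x : 'rV[R]_N => `|x|) @^-1` [set t | t <= Num.max M 0]) //.
  by apply: closed_comp; [move=> x _; exact: norm_continuous|exact: closed_le].
have bnd : bounded_set (f @` box (Num.max M 0)).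
  apply: compact_bounded; apply: continuous_compact => //.
  by apply: continuous_subspaceT; exact: (cf 0%N).
case: bnd => C [_ HC]; exists (Num.max (C + 1) 0), (Num.max M 0); split.
- by rewrite le_max lexx orbT.
- by rewrite le_max lexx orbT.
move=> x; have [f0|f0] := eqVneq (f x) 0.
  by rewrite f0 normr0 mulr_ge0 ?indicE // le_max lexx orbT.
have xb : box (Num.max M 0) x by rewrite /box /= le_max fM.
rewrite indicE mem_set // mulr1 le_max; apply/orP; left.
by apply: (HC (C + 1)); [rewrite ltrDl|exists x].
Qed.

Lemma test_L2 f : test_function f -> L2 mu f.
Proof.
move=> tf; have [C [M [C0 M0 fC]]] := test_bound tf.
apply: (L2_mono _ _ (L2_box M C)); first by apply: mf_continuous; case: tf => /(_ 0%N).
move=> x; rewrite [X in _ <= X]ger0_norm //.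
by rewrite mulr_ge0 // indicE.
Qed.

Definition oobox (a b : 'I_N -> R) : set 'rV[R]_N := [set x | forall i, a i < x ord0 i < b i].

Lemma measurable_oobox a b : measurable (oobox a b).
Proof.
rewrite (_ : oobox a b = \bigcap_(i in [set: 'I_N]) ((rV_coord i : 'rV[R]_N -> _) @^-1` [set` `]a i, b i[])).
  apply: fin_bigcap_measurable => // i _.
  by rewrite -[X in measurable X]setTI; exact: measurable_rV_coord.
apply/seteqP; split => x /= H i.
  by move=> _; rewrite /preimage /= in_itv; exact: H.
by have := H i I; rewrite /preimage /= in_itv.
Qed.

(** Since exp(-1/(nt)) tends to 1 for every t > 0, these test functions increase in steepness and
    converge pointwise to the indicator of the open box. *)
Definition bumpbox (a b : 'I_N -> R) (n : nat) (x : 'rV[R]_N) : R :=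
  \prod_(i < N) (bump 1 (n.+1%:R * x ord0 i + (- (n.+1%:R * a i))) *
                 bump 1 (- n.+1%:R * x ord0 i + n.+1%:R * b i)).

Lemma bumpbox_supp a b n x : bumpbox a b n x != 0 -> oobox a b x.
Proof.
move=> /prodf_neq0 h i; have := h i isT; rewrite mulf_eq0 negb_or => /andP[h1 h2].
have n0 : 0 < n.+1%:R :> R by [].
apply/andP; split; rewrite ltNge; apply/negP => hle.
  by move: h1; rewrite bump_neg ?eqxx // -mulrBr pmulr_rle0 // subr_le0.
by move: h2; rewrite bump_neg ?eqxx // mulNr addrC -mulrBr pmulr_rle0 // subr_le0.
Qed.

Lemma bumpbox_bound a b n x : `|bumpbox a b n x| <= 1.
Proof.
rewrite /bumpbox normr_prod; apply: (@le_trans _ _ (\prod_(i < N) (1 : R))); last first.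
  by rewrite prodr_const expr1n.
apply: ler_prod => i _; rewrite normr_ge0 /= ger0_norm ?mulr_ge0 ?bump1_ge0 //.
by rewrite mulr_ile1 ?bump1_ge0 ?bump1_le1.
Qed.

Lemma bumpbox_test a b n : test_function (bumpbox a b n).
Proof.
apply/test_functionP; split.
  by move=> k; apply: Cn_prod => i; apply: CnM; exact: Cn_bump.
exists (\sum_(i < N) (`|a i| + `|b i|)) => x /bumpbox_supp h.
apply: rV_norm_le => [|i]; first by apply: sumr_ge0 => i _; rewrite addr_ge0.
rewrite (bigD1 i) //= -[X in X <= _]addr0 lerD //; last first.
  by apply: sumr_ge0 => j _; rewrite addr_ge0.
have /andP[h1 h2] := h i; have := ler_norm (b i); have := ler_norm (- a i); rewrite normrN.
have := normr_ge0 (a i); have := normr_ge0 (b i).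
by move=> *; rewrite ler_norml; apply/andP; split; lra.
Qed.

Lemma bump1_cvg (t : R) : 0 < t -> bump 1 (n.+1%:R * t) @[n --> \oo] --> (1 : R).
Proof.
move=> t0.
have E n : bump 1 (n.+1%:R * t) = expR (- (t^-1 * n.+1%:R^-1)).
  by rewrite /bump mulr_gt0 // hornerE mul1r invfM mulrC.
under eq_fun do rewrite E.
have h : - (t^-1 * n.+1%:R^-1) @[n --> \oo] --> - (t^-1 * 0).
  by apply: cvgN; apply: cvgMl_tmp; exact: cvg_harmonic.
have := cvg_comp _ _ h (@continuous_expR R _).
by rewrite mulr0 oppr0 expR0.
Qed.

Lemma cvg_prod (I : Type) (s : seq I) (F : I -> nat -> R) (l : I -> R) :
  (forall i, F i n @[n --> \oo] --> l i) ->
  \prod_(i <- s) F i n @[n --> \oo] --> \prod_(i <- s) l i.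
Proof.
move=> Fl; elim: s => [|i s IH].
  by rewrite big_nil; under eq_fun do rewrite big_nil; exact: cvg_cst.
by rewrite big_cons; under eq_fun do rewrite big_cons; exact: cvgM.
Qed.

Lemma bumpbox_cvg a b x : bumpbox a b n x @[n --> \oo] --> (\1_(oobox a b) x : R).
Proof.
rewrite indicE; case: (boolP (x \in oobox a b)) => xb; last first.
  rewrite (_ : (fun n => _) = fun=> 0); first exact: cvg_cst.
  apply/funext => n; apply/eqP; apply: contraNT xb => /bumpbox_supp.
  by rewrite inE.
move: xb; rewrite inE => xb.
have -> : (true%:R : R) = \prod_(i < N) (1 * 1) by rewrite big1 // => i _; rewrite mulr1.
apply: cvg_prod => i; have /andP[ai bi] := xb i.
apply: cvgM.
  rewrite (_ : (fun n => _) = fun n => bump 1 (n.+1%:R * (x ord0 i - a i))).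
    by apply: bump1_cvg; rewrite subr_gt0.
  by apply/funext => n; congr bump; ring.
rewrite (_ : (fun n => _) = fun n => bump 1 (n.+1%:R * (b i - x ord0 i))).
  by apply: bump1_cvg; rewrite subr_gt0.
by apply/funext => n; congr bump; ring.
Qed.

Lemma oobox_sub_box a b : exists M, oobox a b `<=` box M.
Proof.
exists (\sum_(i < N) (`|a i| + `|b i|)) => x h.
apply: rV_norm_le => [|i]; first by apply: sumr_ge0 => i _; rewrite addr_ge0.
rewrite (bigD1 i) //= -[X in X <= _]addr0 lerD //; last first.
  by apply: sumr_ge0 => j _; rewrite addr_ge0.
have /andP[h1 h2] := h i; have := ler_norm (b i); have := ler_norm (- a i); rewrite normrN.
have := normr_ge0 (a i); have := normr_ge0 (b i).
by move=> *; rewrite ler_norml; apply/andP; split; lra.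
Qed.

Let G : set (set 'rV[R]_N) := [set A | exists a b, A = oobox a b].

Lemma ooboxI a b c d : oobox a b `&` oobox c d =
  oobox (fun i => Num.max (a i) (c i)) (fun i => Num.min (b i) (d i)).
Proof.
apply/seteqP; split => x.
  move=> [h1 h2] i; have /andP[a1 a2] := h1 i; have /andP[b1 b2] := h2 i.
  by rewrite gt_max lt_min a1 a2 b1 b2.
move=> h; split => i; have := h i; rewrite gt_max lt_min => /andP[/andP[? ?] /andP[? ?]];
  by apply/andP.
Qed.

(** Open boxes are stable under intersection, so together with this they allow an induction on
    measurable sets by Dynkin's theorem. *)
Lemma measurable_oobox_gen : @measurable _ 'rV[R]_N = <<s G >>.
Proof.
apply/seteqP; split; last first.
  apply: smallest_sub; first exact: sigma_algebra_measurable.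
  by move=> _ [a [b ->]]; exact: measurable_oobox.
have mc i : measurable_fun [set: g_sigma_algebraType G] (rV_coord i : g_sigma_algebraType G -> measurableTypeR R).
  apply: (@measurability _ _ (g_sigma_algebraType G) (measurableTypeR R) setT _ _ (RGenOInfty.measurableE R)) => _ [_ [c ->] <-].
  rewrite setTI.
  rewrite (_ : _ @^-1` _ = \bigcup_n oobox (fun j => if j == i then c else - n%:R) (fun=> n%:R)).
    apply: bigcupT_measurable => n; apply: sub_sigma_algebra.
    by do 2 eexists.
  apply/seteqP; split => x; rewrite /preimage /= in_itv /= andbT.
    move=> xc; exists (Num.truncn `|x|).+1 => // j.
    have hx := truncnS_gt `|x|; have hj := coord_norm_le x j.
    have : `|x ord0 j| < (Num.truncn `|x|).+1%:R by exact: le_lt_trans hx.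
    by rewrite ltr_norml => /andP[h1 h2]; rewrite h2 andbT; case: eqP => [->|_].
  by move=> [n _ /(_ i)]; rewrite eqxx => /andP[].
apply: smallest_sub; first exact: smallest_sigma_algebra.
rewrite -bigcup_seq; apply: bigcup_sub => i _ A [B mB <-].
exact: (mc i measurableT B mB).
Qed.

(** The fundamental lemma of the calculus of variations. Smooth bumps converge to indicators of
    boxes, so g has integral 0 over every box, then over every measurable part of a bounded box, in
    particular over the part where g is nonnegative and over its complement. *)
Lemma orth_test_ae0 g : L2 mu g -> (forall phi, test_function phi -> ip mu g phi = 0) ->
  {ae mu, forall x, g x = 0}.
Proof.
move=> lg H.
have mI A : measurable A -> mf (\1_A : 'rV[R]_N -> R) by move=> /measurable_indicP.
have ig M : intg mu (fun x => `|g x| * \1_(box M) x).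
  by have := L2_intgM (L2_abs lg) (L2_box M 1); under eq_fun do rewrite mul1r.
have bb a b : \int[mu]_x (g x * \1_(oobox a b) x) = 0.
  have [M sub] := oobox_sub_box a b.
  have c : \int[mu]_x (g x * bumpbox a b n x) @[n --> \oo] --> \int[mu]_x (g x * \1_(oobox a b) x).
    apply: (dct _ _ (ig M)).
    - move=> n; apply: measurable_funM; first by case: lg.
      by case: (test_L2 (bumpbox_test a b n)).
    - by apply: measurable_funM; [case: lg|apply: mI; exact: measurable_oobox].
    - move=> n x; rewrite normrM ler_wpM2l //.
      have [->|/bumpbox_supp h] := eqVneq (bumpbox a b n x) 0; first by rewrite normr0 indicE.
      by rewrite indicE mem_set ?bumpbox_bound //; exact: sub.
    - by apply: filterE => x; apply: cvgMl_tmp; exact: bumpbox_cvg.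
  rewrite -(cvg_lim (@Rhausdorff R) c) (_ : (fun n => _) = fun=> 0) ?lim_cst //.
  by apply/funext => n; exact: H (bumpbox_test a b n).
pose K (n : nat) := oobox (fun=> - n%:R) (fun=> n%:R).
have mK n : measurable (K n) by exact: measurable_oobox.
have subK n : K n `<=` box n%:R.
  move=> x h; apply: rV_norm_le => // i; rewrite ler_norml.
  by have /andP[h1 h2] := h i; rewrite !ltW.
(* Cut to a bounded box, where an L^2 function is integrable; the complement of a set in Dynkin's
   induction needs this. *)
pose gK n x := g x * \1_(K n) x.
have igK n : intg mu (gK n).
  apply: intg_le (ig n%:R); first by apply: measurable_funM; [case: lg|exact: mI].
  move=> x; rewrite normrM ler_wpM2l // ger0_norm ?indicE //.
  by case: (boolP (x \in K n)) => //; rewrite inE => /subK h; rewrite mem_set.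
have igA n A : measurable A -> intg mu (fun x => gK n x * \1_A x).
  move=> mA; apply: intg_le (intg_abs (igK n)).
    by apply: measurable_funM; [exact: intg_mf (igK n)|exact: mI].
  by move=> x; rewrite normrM ler_piMr // ger0_norm ?indicE //; case: (_ \in _).
have D n A : measurable A -> \int[mu]_x (gK n x * \1_A x) = 0.
  have iT : \int[mu]_x gK n x = 0 by exact: bb.
  rewrite measurable_oobox_gen.
  apply: (dynkin_induction (P := fun A => \int[mu]_x (gK n x * \1_A x) = 0)).
  - exact: measurable_oobox_gen.
  - by move=> _ _ [a [b ->]] [c [d ->]]; rewrite ooboxI; do 2 eexists.
  - by rewrite -[RHS]iT; apply: eq_Rintegral => x _; rewrite indicT mulr1.
  - move=> _ [a [b ->]]; rewrite -(bb (fun i => Num.max (- n%:R) (a i)) (fun i => Num.min n%:R (b i))).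
    apply: eq_Rintegral => x _; rewrite -ooboxI /gK -mulrA; congr (_ * _).
    by rewrite !indicE in_setI; case: (_ \in _); case: (_ \in _); rewrite ?mulr1 ?mulr0 ?mul0r.
  - move=> S mS S0; rewrite -[RHS](subrr 0) -{1}iT -S0 -IntB //; last exact: igA.
    apply: eq_Rintegral => x _; rewrite !indicE in_setC.
    by case: (_ \in _); rewrite ?mulr1 ?mulr0 ?subr0 ?subrr.
  - move=> F mFs tF F0.
    have mU k : measurable (\big[setU/set0]_(i < k) F i) by exact: bigsetU_measurable.
    have mUU : measurable (\bigcup_k F k) by exact: bigcupT_measurable.
    have c : \int[mu]_x (gK n x * \1_(\big[setU/set0]_(i < k) F i) x) @[k --> \oo] -->
      \int[mu]_x (gK n x * \1_(\bigcup_k F k) x).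
      apply: (dct _ _ (intg_abs (igK n))).
      + by move=> k; exact: intg_mf (igA n _ (mU k)).
      + exact: intg_mf (igA n _ mUU).
      + by move=> k x; rewrite normrM ler_piMr // ger0_norm ?indicE //; case: (_ \in _).
      apply: filterE => x; apply: cvgMl_tmp; apply: cvg_near_cst.
      have [xU|xU] := boolP (x \in \bigcup_k F k); last first.
        apply: nearW => k; rewrite !indicE (negbTE xU); case: (boolP (_ \in _)) => //.
        rewrite inE -bigcup_mkord => -[i /= _ Fx]; move: xU; rewrite notin_setE.
        by case; exists i.
      move: (xU); rewrite inE => -[i _ Fx]; exists i.+1 => // k /= ik.
      rewrite !indicE xU mem_set // -bigcup_mkord; by exists i.
    rewrite -(cvg_lim (@Rhausdorff R) c) (_ : (fun k => _) = fun=> 0) ?lim_cst //.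
    apply/funext => k; elim: k => [|k IH].
      under eq_Rintegral do rewrite big_ord0 indic0 mulr0; exact: Int0.
    rewrite -[RHS](addr0 0) -{1}IH -(F0 k) -IntD; [|exact: igA..].
    apply: eq_Rintegral => x _; rewrite -mulrDr; congr (_ * _).
    rewrite big_ord_recr /= !indicE in_setU; case: (boolP (x \in F k)) => xk; last first.
      by rewrite orbF addr0.
    rewrite orbT (_ : x \in _ = false) ?add0r //; apply/negbTE.
    rewrite notin_setE -bigcup_mkord => -[i /= ik Fi].
    move: tF => /(_ i k I I) h; have : F i `&` F k !=set0 by exists x; split => //; rewrite inE in xk.
    by move/h => eik; move: ik; rewrite eik ltnn.
have gpos n : {ae mu, forall x, x \in K n -> g x = 0}.
  have mg : mf (gK n) by exact: intg_mf (igK n).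
  (* On P and on its complement the integral of [gK n] vanishes; subtracting the two gives the
     integral of its absolute value. *)
  pose P := [set x | 0 <= gK n x].
  have mP : measurable P.
    rewrite -[P]setTI; have := mg measurableT `[0, +oo[%classic (measurable_itv _).
    by congr measurable; apply/seteqP; split => x /=; rewrite in_itv /= andbT.
  have ab : \int[mu]_x `|gK n x| = 0.
    have -> : \int[mu]_x `|gK n x| = \int[mu]_x (gK n x * \1_P x - gK n x * \1_(~` P) x).
      apply: eq_Rintegral => x _; rewrite !indicE in_setC.
      case: (boolP (x \in P)); rewrite /= ?mulr1 ?mulr0 ?subr0 ?sub0r ?inE => h.
        by rewrite ger0_norm.
      by rewrite ltr0_norm // ltNge; apply/negP => h'; move: h; rewrite notin_setE.
    by rewrite IntB ?D ?subrr //; [exact: measurableC|exact: igA|apply/igA/measurableC].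
  have := Int_eq0 (intg_abs (igK n)) (fun=> normr_ge0 _) ab.
  apply: filterS => x /eqP; rewrite normr_eq0 => /eqP + xK.
  by rewrite /gK indicE xK mulr1.
have := ae_foralln gpos; apply: filterS => x h; apply: (h (Num.truncn `|x|).+1).
rewrite inE => j; have hx := truncnS_gt `|x|; have hj := coord_norm_le x j.
have : `|x ord0 j| < (Num.truncn `|x|).+1%:R by exact: le_lt_trans hx.
by rewrite ltr_norml.
Qed.

(** Density without mollification: the projection of g on the closure of the test functions differs
    from g by a function orthogonal to all test functions, hence null. *)
Lemma L2_dense g (eps : R) : L2 mu g -> 0 < eps ->
  exists2 phi, test_function phi & nn mu (fun x => g x - phi x) <= eps.
Proof.
move=> lg eps0.
have [|||||h [lh hP hA]] := @riesz_subspace _ _ R mu (@test_function R N) (ip mu g) (Num.sqrt (nn mu g)).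
- exact: test_L2.
- exact: test0.
- exact: test_lin.
- by move=> a f k tf tk; rewrite ipDr ?ipZr //; try apply: L2Z; exact: test_L2.
- by move=> f tf; apply: ip_le_sqrt => //; exact: test_L2.
have hg : {ae mu, forall x, h x = g x}.
  have : {ae mu, forall x, h x - g x = 0}.
    apply: orth_test_ae0 => [|phi tp]; first exact: L2B.
    by rewrite ipBl ?hP ?subrr //; exact: test_L2.
  by apply: filterS => x /eqP; rewrite subr_eq0 => /eqP.
have [phi tp hp] := hA _ eps0; exists phi => //.
rewrite (nn_ae (g := fun x => h x - phi x)) //.
- by apply: measurable_funB; [case: lg|case: (test_L2 tp)].
- by apply: measurable_funB; [case: lh|case: (test_L2 tp)].
by apply: filterS hg => x ->.
Qed.

End test_functions.

Lemma sqrtr_le (R : rcfType) (x t : R) : 0 <= t -> x <= t ^+ 2 -> Num.sqrt x <= t.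
Proof. by move=> t0 xt; rewrite -[t]ger0_norm // -sqrtr_sqr ler_wsqrtr. Qed.

Section weak_derivatives.
Context (R : realType) (N : nat).
Local Notation mu := (lebesgue_rV R N).
Implicit Types u f g phi : 'rV[R]_N -> R.
Local Notation e i := (delta_mx ord0 i : 'rV[R]_N).
Local Notation L2 := (L2 mu).
Local Notation ip := (ip mu).
Local Notation nn := (nn mu).

Lemma Lfun_L2 f : f \in Lfun mu 2%:E <-> L2 f.
Proof.
split=> [lf|[mf_ f2]].
  split; last exact: Lfun2_integrable_sqr.
  by move: lf; rewrite inE => /andP[]; rewrite inE.
rewrite inE /=; apply/andP; split; rewrite inE//=.
rewrite /finite_norm unlock poweR_lty//.
apply: (le_lt_trans _ (intg_lty f2)); rewrite /nnI; apply: le_of_eq.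
apply: eq_integral => x _ /=; rewrite normrX -powR_mulrn //.
Qed.

Definition trn (a : 'rV[R]_N) f : 'rV[R]_N -> R := fun x => f (x + a).

Lemma trn_inv a f : mf f -> (forall x, 0 <= f x) -> nnI mu (trn a f) = nnI mu f.
Proof. exact: nnI_trn. Qed.

Lemma mf_trn a f : mf f -> mf (trn a f).
Proof. exact: (mf_comp (measurable_rV_add a)). Qed.

Lemma L2_trn a f : L2 f -> L2 (trn a f).
Proof. exact: (L2_comp (measurable_rV_add a) (trn_inv a)). Qed.

Lemma ip_trn a f g : L2 f -> L2 g -> ip (trn a f) (trn a g) = ip f g.
Proof. exact: (ip_comp (measurable_rV_add a) (trn_inv a)). Qed.

Lemma nn_trn a f : L2 f -> nn (trn a f) = nn f.
Proof. exact: (nn_comp (measurable_rV_add a) (trn_inv a)). Qed.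

Lemma ip_trn_l a f g : L2 f -> L2 g -> ip (trn a f) g = ip f (trn (- a) g).
Proof.
move=> lf lg; rewrite -(ip_trn a lf (L2_trn (- a) lg)); congr (ip _ _).
by apply/funext => x; rewrite /trn addrK.
Qed.

Definition dq i (h : R) f : 'rV[R]_N -> R := fun x => h^-1 * (f (x + h *: e i) - f x).

Lemma L2_dq i h f : L2 f -> L2 (dq i h f).
Proof. by move=> lf; apply: L2Z; apply: L2B => //; exact: L2_trn. Qed.

Lemma ip_dq i h u f : L2 u -> L2 f -> ip (dq i h u) f = - ip u (dq i (- h) f).
Proof.
move=> lu lf; have lt := L2_trn (h *: e i) lu; have lt' := L2_trn ((- h) *: e i) lf.
rewrite /dq ipZl //; last exact: L2B.
rewrite ipZr //; last exact: L2B.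
rewrite ipBl // ipBr // -/(trn (h *: e i) u) ip_trn_l // scaleNr -/(trn _ f).
by rewrite invrN mulNr opprK.
Qed.

(* A class of test functions containing the heat kernel, which has no compact support. *)
Definition diff_dom i phi dphi (M : 'rV[R]_N -> R) : Prop :=
  [/\ L2 phi, mf dphi, L2 M, forall x, is_derive x (e i) phi (dphi x) &
      forall x t, `|t| <= 1 -> `|dphi (x + t *: e i)| <= M x].

Lemma diff_dom_L2 i phi dphi M : diff_dom i phi dphi M -> L2 dphi.
Proof.
move=> [_ md lM _ H]; apply: (L2_mono md _ lM) => x.
have := H x 0; rewrite normr0 ler01 => /(_ isT); rewrite scale0r addr0 => h.
exact: le_trans h (ler_norm _).
Qed.

Lemma slice_derive i phi dphi x (t : R) : (forall x, is_derive x (e i) phi (dphi x)) ->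
  is_derive t 1 (fun t : R => phi (x + t *: e i)) (dphi (x + t *: e i)).
Proof.
move=> D; have := D (x + t *: e i) => /is_derive_cvgP H; apply/is_derive_cvgP.
apply: cvg_trans H; apply: near_eq_cvg; apply: nearW => h /=.
by rewrite [h%:A]mulr1 scalerDl addrCA.
Qed.

(** The mean value theorem along the line through x in direction i; steps of size at most 1 stay in
    the range where M dominates. *)
Lemma dq_le i phi dphi M h x : diff_dom i phi dphi M -> h != 0 -> `|h| <= 1 ->
  `|dq i h phi x| <= M x.
Proof.
move=> [_ _ _ D H] h0 h1.
have S t := slice_derive x t D.
have C : continuous (fun t : R => phi (x + t *: e i)).
  by move=> t; apply: differentiable_continuous; apply/derivable1_diffP; case: (S t).
have [c hc E] : exists2 c, `|c| <= `|h| & phi (x + h *: e i) - phi x = dphi (x + c *: e i) * h.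
  have [hp|hn] := leP 0 h.
    have [c ci E] := @MVT_segment R _ _ 0 h hp (fun t _ => S t) (continuous_subspaceT C).
    exists c; last by move: E; rewrite scale0r addr0 subr0.
    by move: ci; rewrite in_itv /= => /andP[c0 ch]; rewrite !ger0_norm.
  have [c ci E] := @MVT_segment R _ _ h 0 (ltW hn) (fun t _ => S t) (continuous_subspaceT C).
  exists c; last by move: E; rewrite scale0r addr0 sub0r mulrN => E; rewrite -[RHS]opprK -E opprB.
  by move: ci; rewrite in_itv /= => /andP[c0 ch]; rewrite !ler0_norm ?lerN2 // ltW.
rewrite /dq E mulrCA mulVf // mulr1; apply: H; exact: le_trans h1.
Qed.

Definition vanishing (hs : nat -> R) : Prop :=
  (forall n, hs n != 0 /\ `|hs n| <= 1) /\ hs n @[n --> \oo] --> 0.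

Lemma vanishingN hs : vanishing hs -> vanishing (fun n => - hs n).
Proof.
move=> [H c]; split => [n|]; first by rewrite oppr_eq0 normrN; exact: H.
by rewrite -oppr0; exact: cvgN.
Qed.

Lemma vanishing_harmonic (c : R) : c != 0 -> `|c| <= 1 -> vanishing (fun n => c / n.+1%:R).
Proof.
move=> c0 c1; split => [n|].
  rewrite mulf_neq0 ?invr_neq0 //; split => //; rewrite normrM normfV [X in _ / X]ger0_norm //.
  by rewrite ler_pdivrMr // mul1r (le_trans c1) // ler1n.
by rewrite -[X in _ --> X](mulr0 c); apply: cvgMl_tmp; exact: cvg_harmonic.
Qed.

Lemma dq_cvg_pt i phi dphi M hs x : diff_dom i phi dphi M -> vanishing hs ->
  dq i (hs n) phi x @[n --> \oo] --> dphi x.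
Proof.
move=> [_ _ _ D _] [H c]; have := D x => /is_derive_cvgP Dx.
have cc : hs n @[n --> \oo] --> (0 : R)^'.
  move=> P /= HP; have h : \forall n \near \oo, hs n != 0 -> P (hs n) := c _ HP.
  by apply: filterS h => n /=; apply; have [] := H n.
have := cvg_comp _ _ cc Dx; apply: cvg_trans; apply: near_eq_cvg; apply: nearW => n /=.
by rewrite /dq [x + _]addrC.
Qed.

Lemma dq_cvg_L2 i phi dphi M hs : diff_dom i phi dphi M -> vanishing hs ->
  nn (fun x => dq i (hs n) phi x - dphi x) @[n --> \oo] --> 0.
Proof.
move=> dd van; have ld := diff_dom_L2 dd; have [lp _ lM _ _] := dd.
rewrite -(_ : \int[mu]_x 0 = 0 :> R); last exact: Int0.
have E n : nn (fun x => dq i (hs n) phi x - dphi x) = \int[mu]_x (dq i (hs n) phi x - dphi x) ^+ 2.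
  by rewrite nnE.
under eq_fun do rewrite E.
apply: (dct (g := fun x => 4 * M x ^+ 2)).
- by move=> n; apply: measurable_funX; case: (L2B (L2_dq i (hs n) lp) ld).
- by [].
- by apply: intgZ; case: lM.
- move=> n x; have [h0 h1] := van.1 n.
  have a1 := dq_le x dd h0 h1.
  have a2 : `|dphi x| <= M x.
    by case: dd => _ _ _ _ /(_ x 0); rewrite normr0 scale0r addr0; apply.
  have a3 : `|dq i (hs n) phi x - dphi x| <= 2 * M x.
    by apply: le_trans (ler_normB _ _) _; lra.
  rewrite normrX (_ : 4 * M x ^+ 2 = (2 * M x) ^+ 2); last by ring.
  by rewrite lerXn2r ?nnegrE // (le_trans _ a3).
- apply: filterE => x.
  have c : dq i (hs n) phi x - dphi x @[n --> \oo] --> dphi x - dphi x.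
    by apply: cvgB; [exact: dq_cvg_pt dd van|exact: cvg_cst].
  by have := cvgM c c; rewrite subrr mulr0; exact.
Qed.

Lemma ip_dq_cvg i phi dphi M hs g : diff_dom i phi dphi M -> vanishing hs -> L2 g ->
  ip g (dq i (hs n) phi) @[n --> \oo] --> ip g dphi.
Proof.
move=> dd vh lg; have c := dq_cvg_L2 dd vh; have lp : L2 phi by case: dd.
have ld := diff_dom_L2 dd; apply/cvgrPdist_le => eps eps0.
have c2 : Num.sqrt (nn g) * Num.sqrt (nn (fun x => dq i (hs n) phi x - dphi x)) @[n --> \oo] --> Num.sqrt (nn g) * Num.sqrt 0.
  by apply: cvgMl_tmp; exact: (cvg_comp _ _ c (@sqrt_continuous R 0)).
rewrite sqrtr0 mulr0 in c2.
have /cvgrPdist_le /(_ _ eps0) := c2; apply: filterS => n; rewrite sub0r normrN => h.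
apply: le_trans (le_trans (ler_norm _) h).
have lq := L2_dq i (hs n) lp.
by rewrite distrC -ipBr //; exact: ip_le_sqrt lg (L2B lq ld).
Qed.

Lemma test_diff_dom i phi : test_function phi -> exists M, diff_dom i phi (partial i phi) M.
Proof.
move=> tp; have [C [K [C0 K0 H]]] := test_bound (test_partial i tp).
exists (fun x => C * \1_(box (K + 1)) x); split.
- exact: test_L2.
- by case: (test_L2 (test_partial i tp)).
- exact: L2_box.
- by move=> x; exact: test_is_derive.
move=> x t t1; apply: le_trans (H _) _; rewrite ler_wpM2l //.
rewrite !indicE; case: (boolP (_ \in box K)) => //; rewrite inE => h.
rewrite mem_set // /box /= -[x](addrK (t *: e i)).
apply: le_trans (ler_normB _ _) _; apply: lerD => //.
by rewrite normrZ mulr_ile1 ?delta_norm.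
Qed.

Definition weak i u g : Prop :=
  L2 g /\ forall phi, test_function phi -> ip u (partial i phi) = - ip g phi.

Lemma is_weak_partialP i u g : is_weak_partial i u g <-> weak i u g.
Proof. by rewrite /is_weak_partial; split=> -[/Lfun_L2 lg H]. Qed.

(** The L^2 norm by duality, tested only against smooth functions: f is approximated by a test
    function within t. *)
Lemma test_dual_bound f (C : R) : L2 f -> 0 <= C ->
  (forall phi, test_function phi -> `|ip f phi| <= C * Num.sqrt (nn phi)) ->
  nn f <= C ^+ 2.
Proof.
move=> lf C0 H; pose s := Num.sqrt (nn f).
have s0 : 0 <= s by exact: sqrtr_ge0.
have ss : nn f = s ^+ 2 by rewrite sqr_sqrtr ?nn_ge0.
have key (t : R) : 0 < t -> s ^+ 2 <= C * (s + t) + s * t.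
  move=> t0; have [phi tp hp] := L2_dense lf (exprn_gt0 2 t0).
  have lp := test_L2 tp; have lfp := L2B lf lp.
  have hp' : Num.sqrt (nn (fun x => f x - phi x)) <= t.
    by apply: sqrtr_le => //; exact: ltW.
  have E : s ^+ 2 = ip f phi + ip f (fun x => f x - phi x).
    by rewrite -ss ipBr // addrC subrK.
  rewrite E; apply: lerD.
    apply: le_trans (ler_norm _) _; apply: le_trans (H _ tp) _; rewrite ler_wpM2l //.
    have -> : phi = (fun x => f x - (f x - phi x)) by apply/funext => x; ring.
    by apply: le_trans (sqrt_nn_sub lf lfp) _; rewrite lerD2l.
  by apply: le_trans (ler_norm _) _; apply: le_trans (ip_le_sqrt lf lfp) _; rewrite ler_wpM2l.
rewrite ss lerXn2r ?nnegrE // leNgt; apply/negP => sC.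
have sp : 0 < s by exact: le_lt_trans sC.
(* This t makes C (s + t) + s t equal to C s + s (s - C)/2, which is strictly less than s^2 as long
   as s > C. *)
have := key (s * (s - C) / (2 * (C + s))).
have Cs : 0 < C + s by rewrite ltr_wpDl.
have -> : C * (s + s * (s - C) / (2 * (C + s))) + s * (s * (s - C) / (2 * (C + s))) =
  C * s + s * (s - C) / 2 by field; rewrite gt_eqF.
move=> /(_ _)/wrap[|]; first by rewrite divr_gt0 // mulr_gt0 // subr_gt0.
have : 0 < s * (s - C) by rewrite mulr_gt0 // subr_gt0.
lra.
Qed.

(** By duality it is enough to bound the pairing of u with a quotient of a test function. The
    quotient with step h is the mean of n+1 translates of the quotient with step h/(n+1); each
    translate is close in L^2 to a translated derivative, to which the definition of the weak
    derivative applies. The error vanishes as n grows. *)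
Lemma weak_dq_le i u g h : L2 u -> weak i u g -> h != 0 -> `|h| <= 1 ->
  nn (dq i h u) <= nn g.
Proof.
move=> lu [lg H] h0 h1.
rewrite -[nn g]sqr_sqrtr ?nn_ge0 //; apply: test_dual_bound; [exact: L2_dq|exact: sqrtr_ge0|].
move=> phi tp; rewrite ip_dq //; last exact: test_L2.
rewrite normrN; have hn0 : - h != 0 by rewrite oppr_eq0.
have hn1 : `|- h| <= 1 by rewrite normrN.
move: (- h) hn0 hn1 => {h0 h1}h h0 h1.
have [M dd] := test_diff_dom i tp; have lp := test_L2 tp; have lpp := test_L2 (test_partial i tp).
have van := vanishing_harmonic h0 h1.
have c := dq_cvg_L2 dd van.
set s := fun n : nat => h / n.+1%:R.
have B n : `|ip u (dq i h phi)| <= Num.sqrt (nn u) * Num.sqrt (nn (fun x => dq i (s n) phi x - partial i phi x)) + Num.sqrt (nn g) * Num.sqrt (nn phi).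
  set X := (X in _ <= X).
  have n0 : n.+1%:R != 0 :> R by [].
  have ld k : L2 (trn ((k%:R * s n) *: e i) (dq i (s n) phi)).
    by apply: L2_trn; exact: L2_dq.
  have bk k : `|ip u (trn ((k%:R * s n) *: e i) (dq i (s n) phi))| <= X.
    set a := _ *: _.
    have -> : ip u (trn a (dq i (s n) phi)) =
      ip u (trn a (fun x => dq i (s n) phi x - partial i phi x)) + ip u (trn a (partial i phi)).
      rewrite -ipDr //; [|by apply: L2_trn; apply: L2B => //; exact: L2_dq|exact: L2_trn].
      by congr (ip _ _); apply/funext => x; rewrite /trn subrK.
    have lq : L2 (fun x => dq i (s n) phi x - partial i phi x).
      by apply: L2B => //; exact: L2_dq.
    apply: le_trans (ler_normD _ _) _; apply: lerD.
      by apply: le_trans (ip_le_sqrt lu (L2_trn a lq)) _; rewrite nn_trn.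
    have -> : trn a (partial i phi) = partial i (trn a phi).
      by apply/funext => x; rewrite /trn partial_trn.
    rewrite H; last exact: test_trn.
    by rewrite normrN; apply: le_trans (ip_le_sqrt lg (L2_trn a lp)) _; rewrite nn_trn.
  (* The telescoping sum behind the mean of the translated quotients. *)
  have E : dq i h phi = fun x => n.+1%:R^-1 * \sum_(k <- iota 0 n.+1) trn ((k%:R * s n) *: e i) (dq i (s n) phi) x.
    apply/funext => x; rewrite /dq /trn.
    under eq_bigr => k _ do rewrite -addrA -scalerDl.
    rewrite -mulr_sumr.
    have -> : \sum_(k <- iota 0 n.+1) (phi (x + (k%:R * s n + s n) *: e i) - phi (x + (k%:R * s n) *: e i))
       = phi (x + h *: e i) - phi x.
      transitivity (\sum_(0 <= k < n.+1) (phi (x + (k.+1%:R * s n) *: e i) - phi (x + (k%:R * s n) *: e i))).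
        rewrite /index_iota subn0; apply: eq_bigr => k _.
        by congr (phi (x + _ *: _) - _); rewrite -natr1 mulrDl mul1r.
      rewrite (telescope_sumr (fun k => phi (x + (k%:R * s n) *: e i))) // mul0r scale0r addr0.
      by rewrite /s mulrCA mulfV // mulr1.
    by rewrite mulrA /s invfM invrK mulrCA mulVf // mulr1.
  rewrite E ipZr //; last by apply: L2_sum => k _; exact: ld.
  have -> : ip u (fun x => \sum_(k <- iota 0 n.+1) trn ((k%:R * s n) *: e i) (dq i (s n) phi) x)
    = \sum_(k <- iota 0 n.+1) ip u (trn ((k%:R * s n) *: e i) (dq i (s n) phi)).
    rewrite /ip -Int_sum; last by move=> k _; exact: L2_intgM.
    by apply: eq_Rintegral => x _; rewrite mulr_sumr.
  rewrite normrM normfV [`|n.+1%:R|]ger0_norm // ler_pdivrMl //.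
  apply: le_trans (ler_norm_sum _ _ _) _.
  apply: (@le_trans _ _ (\sum_(k <- iota 0 n.+1) X)); first by apply: ler_sum => k _; exact: bk.
  by rewrite big_const_seq count_predT size_iota iter_addr_0 mulr_natl.
have c2 : Num.sqrt (nn u) * Num.sqrt (nn (fun x => dq i (s n) phi x - partial i phi x)) + Num.sqrt (nn g) * Num.sqrt (nn phi) @[n --> \oo] --> Num.sqrt (nn u) * Num.sqrt 0 + Num.sqrt (nn g) * Num.sqrt (nn phi).
  apply: cvgD; last exact: cvg_cst.
  by apply: cvgMl_tmp; exact: (cvg_comp _ _ c (@sqrt_continuous R 0)).
rewrite -[X in _ <= X]add0r -{1}(mulr0 (Num.sqrt (nn u))) -{1}sqrtr0.
by apply: (cvgr_to_ge c2); apply: nearW => n; exact: B.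
Qed.

(** On test functions this is discrete integration by parts; the uniform bound [weak_dq_le] extends
    it to all of L^2 by density. *)
Lemma dq_weak_cvg i u g hs f : L2 u -> weak i u g -> vanishing hs -> L2 f ->
  ip (dq i (hs n) u) f @[n --> \oo] --> ip g f.
Proof.
move=> lu W van lf; have [lg H] := W.
have T phi : test_function phi -> ip (dq i (hs n) u) phi @[n --> \oo] --> ip g phi.
  move=> tp; have [M dd] := test_diff_dom i tp; have lp := test_L2 tp.
  rewrite -[ip g phi]opprK -H //.
  under eq_fun do rewrite ip_dq //.
  by apply: cvgN; exact: ip_dq_cvg dd (vanishingN van) lu.
apply/cvgrPdist_le => eps eps0.
pose s := Num.sqrt (nn g); have s0 : 0 <= s by exact: sqrtr_ge0.
pose t := eps / (4 * (s + 1)).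
have t0 : 0 < t by rewrite divr_gt0 // mulr_gt0 // ltr_wpDl.
have st : s * t <= eps / 4.
  rewrite /t mulrA ler_pdivrMr ?mulr_gt0 ?ltr_wpDl //.
  by have := eps0; nra.
have [phi tp hp] := L2_dense lf (exprn_gt0 2 t0).
have lp := test_L2 tp; have lfp := L2B lf lp.
have hp' : Num.sqrt (nn (fun x => f x - phi x)) <= t.
  by apply: sqrtr_le => //; exact: ltW.
have b v : L2 v -> nn v <= nn g -> `|ip v f - ip v phi| <= eps / 4.
  move=> lv vg; rewrite -ipBr //; apply: le_trans (ip_le_sqrt _ _) _ => //.
  by apply: le_trans st; apply: ler_pM; rewrite ?sqrtr_ge0 ?ler_wsqrtr.
have e2 : 0 < eps / 2 by rewrite divr_gt0.
have /cvgrPdist_le /(_ _ e2) := T _ tp; apply: filterS => n hn.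
have [h0 h1] := van.1 n.
have b1 := b _ (L2_dq i (hs n) lu) (weak_dq_le lu W h0 h1).
have b2 := b _ lg (lexx _).
move: b1 b2 hn; set x1 := ip _ f; set x2 := ip _ phi; set x3 := ip g f; set x4 := ip g phi.
by rewrite !ler_norml => /andP[? ?] /andP[? ?] /andP[? ?]; apply/andP; split; lra.
Qed.

(** The converse of [weak_dq_le]: a weak limit of bounded difference quotients is a weak
    derivative. *)
Lemma weak_of_bound i u hs (C : R) : L2 u -> vanishing hs ->
  (forall n, nn (dq i (hs n) u) <= C) -> exists2 g, weak i u g & nn g <= C.
Proof.
move=> lu van HC; have [F [FF sF]] := ultra_seq.
have [|w lw W] := @L2_weak_limit _ _ R mu F FF (fun n => dq i (hs n) u) C _ HC.
  by move=> n; exact: L2_dq.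
exists w; last by apply: (wcvg_nn_le (FF := FF) _ lw W HC) => n; exact: L2_dq.
split => // phi tp; have lp := test_L2 tp; have [M dd] := test_diff_dom i tp.
have c1 : ip u (dq i (- hs n) phi) @[n --> F] --> ip u (partial i phi).
  by move=> A /(ip_dq_cvg dd (vanishingN van) lu) => h; exact: sF.
have c2 : ip (dq i (hs n) u) phi @[n --> F] --> - ip u (partial i phi).
  by under eq_fun do rewrite ip_dq //; apply: cvgN.
have -> : ip w phi = - ip u (partial i phi) := cvg_unique (@Rhausdorff R) (W _ lp) c2.
by rewrite opprK.
Qed.

Lemma weak_unique i u g g' : weak i u g -> weak i u g' -> {ae mu, forall x, g x = g' x}.
Proof.
move=> [lg H] [lg' H'].
have : {ae mu, forall x, g x - g' x = 0}.
  apply: orth_test_ae0 => [|phi tp]; first exact: L2B.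
  have lp := test_L2 tp.
  by rewrite ipBl // -[ip g _]opprK -H // H' // opprK subrr.
by apply: filterS => x /eqP; rewrite subr_eq0 => /eqP.
Qed.

(** Summation by parts for difference quotients, passed to the limit on both sides; this admits
    functions without compact support, such as the heat kernel. *)
Lemma weak_ibp i u g phi dphi M : L2 u -> weak i u g -> diff_dom i phi dphi M ->
  ip g phi = - ip u dphi.
Proof.
move=> lu W dd; have lp : L2 phi by case: dd.
have ld := diff_dom_L2 dd.
have van : vanishing (fun n => 1 / n.+1%:R) by apply: vanishing_harmonic; rewrite ?oner_eq0 ?normr1.
have c1 := dq_weak_cvg lu W van lp.
have c2 : ip (dq i (1 / n.+1%:R) u) phi @[n --> \oo] --> - ip u dphi.
  under eq_fun do rewrite ip_dq //.
  by apply: cvgN; exact: ip_dq_cvg dd (vanishingN van) lu.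
exact: (cvg_unique (@Rhausdorff R) c1 c2).
Qed.

Lemma diff_dom_weak i phi dphi M : diff_dom i phi dphi M -> weak i phi dphi.
Proof.
move=> dk; split; first exact: diff_dom_L2 dk.
move=> psi ts; have [L dd] := test_diff_dom i ts; have ls := test_L2 ts.
have lp : L2 phi by case: dk.
have van : vanishing (fun n => 1 / n.+1%:R) by apply: vanishing_harmonic; rewrite ?oner_eq0 ?normr1.
have c1 := ip_dq_cvg dd van lp.
have c2 : - ip psi (dq i (- (1 / n.+1%:R)) phi) @[n --> \oo] --> - ip psi dphi.
  by apply: cvgN; exact: ip_dq_cvg dk (vanishingN van) ls.
rewrite (ipC mu dphi); apply: (cvg_unique (@Rhausdorff R) c1).
suff -> : (fun n => ip phi (dq i (1 / n.+1%:R) psi)) =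
  (fun n => - ip psi (dq i (- (1 / n.+1%:R)) phi)) by [].
by apply/funext => n; rewrite -ip_dq // ipC.
Qed.

Lemma test_weak i phi : test_function phi -> weak i phi (partial i phi).
Proof. by move=> /(test_diff_dom i) [M]; exact: diff_dom_weak. Qed.

End weak_derivatives.

Opaque nn.

(** * The space H^1, absolute values and translations *)

Section H1_space.
Context (R : realType) (N : nat).
Local Notation mu := (lebesgue_rV R N).
Implicit Types u v f g phi : 'rV[R]_N -> R.
Local Notation e i := (delta_mx ord0 i : 'rV[R]_N).
Local Notation L2 := (L2 mu).
Local Notation ip := (ip mu).
Local Notation nn := (nn mu).

Lemma H1P u : H1 u <-> L2 u /\ forall i, exists g, weak i u g.
Proof.
split=> -[lu H]; split.
- by apply/Lfun_L2.
- by move=> i; have [g /is_weak_partialP W] := H i; exists g.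
- by apply/Lfun_L2.
- by move=> i; have [g /is_weak_partialP W] := H i; exists g.
Qed.

Lemma H1_L2 u : H1 u -> L2 u.
Proof. by move=> /H1P[]. Qed.

Lemma weak_partialP i u : H1 u -> weak i u (weak_partial i u).
Proof.
move=> /H1P [lu /(_ i) [g W]]; apply/is_weak_partialP.
by apply: (@xgetPex _ (cst 0) [set g | is_weak_partial i u g]); exists g; apply/is_weak_partialP.
Qed.

Lemma weak_partial_L2 i u : H1 u -> L2 (weak_partial i u).
Proof. by move=> /(weak_partialP i) []. Qed.

Lemma weak_partial_ae i u g : H1 u -> weak i u g ->
  {ae mu, forall x, weak_partial i u x = g x}.
Proof. by move=> hu; apply: weak_unique; exact: weak_partialP. Qed.

Lemma weak_lin i a u v g k : L2 u -> L2 v -> weak i u g -> weak i v k ->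
  weak i (fun x => a * u x + v x) (fun x => a * g x + k x).
Proof.
move=> lu lv [lg H] [lk K]; split; first by apply: L2D => //; exact: L2Z.
move=> phi tp; have lp := test_L2 tp; have lpp := test_L2 (test_partial i tp).
by rewrite !ipDl ?ipZl ?H ?K //; try exact: L2Z; ring.
Qed.

Lemma H1_lin a u v : H1 u -> H1 v -> H1 (fun x => a * u x + v x).
Proof.
move=> hu hv; have lu := H1_L2 hu; have lv := H1_L2 hv; apply/H1P; split.
  by apply: L2D => //; exact: L2Z.
move=> i; exists (fun x => a * weak_partial i u x + weak_partial i v x).
by apply: weak_lin => //; exact: weak_partialP.
Qed.

Lemma weak_partial_lin i a u v : H1 u -> H1 v -> {ae mu, forall x,
  weak_partial i (fun x => a * u x + v x) x = a * weak_partial i u x + weak_partial i v x}.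
Proof.
move=> hu hv; apply: weak_partial_ae; first exact: H1_lin.
by apply: weak_lin; [exact: H1_L2|exact: H1_L2|exact: weak_partialP|exact: weak_partialP].
Qed.

Lemma H1_0 : H1 (fun _ : 'rV[R]_N => 0 : R).
Proof.
apply/H1P; split; first exact: L2_0.
move=> i; exists (fun=> 0); split; first exact: L2_0.
by move=> phi _; rewrite /ip; under eq_Rintegral do rewrite mul0r;
  under [in RHS]eq_Rintegral do rewrite mul0r; rewrite Int0 oppr0.
Qed.

Lemma H1D u v : H1 u -> H1 v -> H1 (fun x => u x + v x).
Proof. by move=> hu hv; have := H1_lin 1 hu hv; congr H1; apply/funext => x; rewrite mul1r. Qed.

Lemma H1Z a u : H1 u -> H1 (fun x => a * u x).
Proof. by move=> hu; have := H1_lin a hu H1_0; congr H1; apply/funext => x; rewrite addr0. Qed.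

Lemma H1B u v : H1 u -> H1 v -> H1 (fun x => u x - v x).
Proof.
move=> hu hv; have := H1_lin (-1) hv hu; congr H1; apply/funext => x.
by rewrite mulN1r addrC.
Qed.

Lemma H1_ae u v : mf v -> {ae mu, forall x, u x = v x} -> H1 u -> H1 v.
Proof.
move=> mv uv /H1P[lu H]; apply/H1P; split; first exact: L2_ae lu.
move=> i; have [g [lg W]] := H i; exists g; split => // phi tp; rewrite -W //.
apply: ip_ae => //; first by case: lu.
  by case: (test_L2 (test_partial i tp)).
by apply: filterS uv => x ->.
Qed.

Lemma weak_ae i u v g : mf u -> mf v -> {ae mu, forall x, u x = v x} -> weak i u g -> weak i v g.
Proof.
move=> mu_ mv uv [lg W]; split => // phi tp; rewrite -W //.
apply: ip_ae => //.
  by case: (test_L2 (test_partial i tp)).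
by apply: filterS uv => x ->.
Qed.

(** An equivalent H^1 norm; as a sum of L^2 norms it inherits homogeneity and the triangle
    inequality term by term. *)
Definition S1 u : R := Num.sqrt (nn u) + \sum_(i < N) Num.sqrt (nn (weak_partial i u)).

Lemma S1_ge0 u : 0 <= S1 u.
Proof. by rewrite addr_ge0 ?sqrtr_ge0 // sumr_ge0 // => i _; exact: sqrtr_ge0. Qed.

Lemma nn_le_S1 u : nn u <= S1 u ^+ 2.
Proof.
rewrite -[nn u]sqr_sqrtr ?nn_ge0 // lerXn2r ?nnegrE ?sqrtr_ge0 ?S1_ge0 //.
by rewrite lerDl sumr_ge0 // => i _; exact: sqrtr_ge0.
Qed.

Lemma S1_lin a u v : H1 u -> H1 v -> S1 (fun x => a * u x + v x) <= `|a| * S1 u + S1 v.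
Proof.
move=> hu hv; rewrite /S1 mulrDr addrACA; apply: lerD.
  apply: le_trans (sqrt_nn_add (L2Z a (H1_L2 hu)) (H1_L2 hv)) _.
  by rewrite (nnZ _ (H1_L2 hu)) sqrtrM ?sqr_ge0 // sqrtr_sqr lexx.
rewrite mulr_sumr -big_split /=; apply: ler_sum => i _.
have lu := weak_partial_L2 i hu; have lv := weak_partial_L2 i hv.
rewrite (nn_ae _ _ (weak_partial_lin i a hu hv)).
- apply: le_trans (sqrt_nn_add (L2Z a lu) lv) _.
  by rewrite (nnZ _ lu) sqrtrM ?sqr_ge0 // sqrtr_sqr lexx.
- by case: (weak_partial_L2 i (H1_lin a hu hv)).
- by case: (L2D (L2Z a lu) lv).
Qed.

Lemma weak_trn i a u g : L2 u -> weak i u g -> weak i (trn a u) (trn a g).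
Proof.
move=> lu [lg W]; split; first exact: L2_trn.
move=> phi tp; have lp := test_L2 tp; have lpp := test_L2 (test_partial i tp).
rewrite !ip_trn_l // -W; last exact: test_trn.
by congr ip; apply/funext => x; rewrite /trn partial_trn.
Qed.

Lemma H1_trn a u : H1 u -> H1 (trn a u).
Proof.
move=> hu; apply/H1P; split; first exact/L2_trn/H1_L2.
move=> i; exists (trn a (weak_partial i u)).
by apply: weak_trn; [exact: H1_L2|exact: weak_partialP].
Qed.

Lemma weak_partial_trn i a u : H1 u ->
  {ae mu, forall x, weak_partial i (trn a u) x = trn a (weak_partial i u) x}.
Proof.
move=> hu; apply: weak_partial_ae; first exact: H1_trn.
by apply: weak_trn; [exact: H1_L2|exact: weak_partialP].
Qed.

(** The difference quotients of |u| are dominated by those of u, so they have a weak limit with no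
    larger norm. No formula for the derivative of |u| is required. *)
Lemma weak_abs i u g : L2 u -> weak i u g -> exists2 k, weak i (fun x => `|u x|) k & nn k <= nn g.
Proof.
move=> lu W; have la := L2_abs lu.
have van : vanishing (fun n => 1 / n.+1%:R : R).
  by apply: vanishing_harmonic; rewrite ?oner_eq0 ?normr1.
apply: (weak_of_bound la van) => n; have [h0 h1] := van.1 n.
apply: le_trans (weak_dq_le lu W h0 h1); apply: nn_mono; last exact: L2_dq.
  by case: (L2_dq i (1 / n.+1%:R) la).
move=> x; rewrite /dq !normrM ler_wpM2l //.
by apply: ler_dist_dist.
Qed.

Lemma H1_abs u : H1 u -> H1 (fun x => `|u x|).
Proof.
move=> hu; apply/H1P; split; first exact/L2_abs/H1_L2.
by move=> i; have [k W _] := weak_abs (H1_L2 hu) (weak_partialP i hu); exists k.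
Qed.

Lemma nn_weak_partial_abs i u : H1 u ->
  nn (weak_partial i (fun x => `|u x|)) <= nn (weak_partial i u).
Proof.
move=> hu; have [k W kg] := weak_abs (H1_L2 hu) (weak_partialP i hu).
apply: le_trans kg; rewrite (nn_ae _ _ (weak_partial_ae (H1_abs hu) W)) //.
  by case: (weak_partial_L2 i (H1_abs hu)).
by case: W => [[]].
Qed.

Lemma rV_sum_delta (a : 'rV[R]_N) : a = \sum_(i < N) a ord0 i *: e i.
Proof. exact: row_sum_delta. Qed.

(** The translation is carried out one coordinate at a time; each move is a difference quotient of
    step at most 1, bounded by the weak derivative. *)
Lemma nn_trn_sub a u : H1 u -> `|a| <= 1 ->
  nn (fun x => u (x + a) - u x) <= (`|a| * S1 u) ^+ 2.
Proof.
move=> hu a1; have lu := H1_L2 hu.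
pose c i := Num.sqrt (nn (weak_partial i u)).
have c0 i : 0 <= c i by exact: sqrtr_ge0.
have step i : Num.sqrt (nn (fun x => u (x + a ord0 i *: e i) - u x)) <= `|a ord0 i| * c i.
  have [->|h0] := eqVneq (a ord0 i) 0.
    rewrite normr0 mul0r; under eq_fun do rewrite scale0r addr0 subrr.
    by rewrite nnE; under eq_Rintegral do rewrite expr0n; rewrite Int0 sqrtr0.
  have h1 : `|a ord0 i| <= 1 by apply: le_trans a1; exact: coord_norm_le.
  have := weak_dq_le lu (weak_partialP i hu) h0 h1.
  rewrite /dq nnZ; last by apply: L2B => //; exact: (L2_trn (a ord0 i *: e i) lu).
  set X := nn _; rewrite exprVn mulrC ler_pdivrMr; last by rewrite -real_normK ?num_real // exprn_gt0 // normr_gt0.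
  move=> h; apply: sqrtr_le; first by rewrite mulr_ge0.
  by rewrite exprMn real_normK ?num_real // sqr_sqrtr ?nn_ge0 // mulrC.
have main (s : seq 'I_N) : Num.sqrt (nn (fun x => u (x + \sum_(i <- s) a ord0 i *: e i) - u x)) <=
    \sum_(i <- s) `|a ord0 i| * c i.
  elim: s => [|i s IH].
    rewrite !big_nil; under eq_fun do rewrite addr0 subrr.
    by rewrite nnE; under eq_Rintegral do rewrite expr0n; rewrite Int0 sqrtr0.
  rewrite !big_cons; set b := \sum_(i <- s) _.
  have l1 : L2 (fun x => u (x + a ord0 i *: e i) - u x).
    by apply: L2B => //; exact: (L2_trn (a ord0 i *: e i) lu).
  have l2 : L2 (fun x => u (x + b) - u x) by apply: L2B => //; exact: (L2_trn b lu).
  have -> : (fun x => u (x + (a ord0 i *: e i + b)) - u x) =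
    (fun x => trn b (fun x => u (x + a ord0 i *: e i) - u x) x + (u (x + b) - u x)).
    by apply/funext => x; rewrite /trn addrA [x + _ *: _ + b]addrAC; ring.
  apply: le_trans (sqrt_nn_add (L2_trn b l1) l2) _.
  by rewrite nn_trn //; apply: lerD.
have := main (index_enum 'I_N); rewrite -rV_sum_delta => h.
have X0 : 0 <= \sum_i `|a ord0 i| * c i by rewrite sumr_ge0 // => i _; rewrite mulr_ge0.
rewrite -[X in X <= _]sqr_sqrtr ?nn_ge0 // lerXn2r ?nnegrE ?sqrtr_ge0 ?mulr_ge0 ?S1_ge0 //.
apply: le_trans h _; rewrite /S1 mulrDr -[X in X <= _]add0r; apply: lerD.
  by rewrite mulr_ge0 ?sqrtr_ge0.
rewrite mulr_sumr; apply: ler_sum => i _; rewrite ler_wpM2r //; exact: coord_norm_le.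
Qed.

End H1_space.

(** * Subcritical embedding by cell averages *)

Section cell_averages.
Context (R : realType) (N : nat).
Local Notation mu := (lebesgue_rV R N).
Implicit Types u v f g : 'rV[R]_N -> R.
Local Notation L2 := (L2 mu).
Local Notation ip := (ip mu).
Local Notation nn := (nn mu).

Lemma nnI_indic (D : set 'rV[R]_N) : measurable D -> nnI mu (\1_D) = mu D.
Proof. by move=> mD; rewrite /nnI integral_indic // setIT. Qed.

Lemma powR_expn (b s : R) n : 0 <= b -> (b ^+ n) `^ s = (b `^ s) ^+ n.
Proof.
move=> b0; elim: n => [|n IH]; first by rewrite !expr0 powR1.
by rewrite !exprS powRM ?exprn_ge0 // IH.
Qed.

Definition cellset m c : set 'rV[R]_N := [set x | cell m x = c].

Lemma cellsetE m c : cellset m c =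
  [set x | forall i, [set` `[(c i)%:~R / 2 ^+ m, (c i + 1)%:~R / 2 ^+ m[] (x ord0 i)].
Proof.
have p0 : 0 < 2 ^+ m :> R by rewrite exprn_gt0.
apply/seteqP; split => x /=.
  move=> <- i; rewrite ffunE in_itv /= ler_pdivrMr // ltr_pdivlMr // mulrC.
  exact: floor_itv.
move=> H; apply/ffunP => i; rewrite ffunE; apply: floor_def.
by have := H i; rewrite in_itv /= ler_pdivrMr // ltr_pdivlMr // mulrC.
Qed.

Lemma measurable_cellset m c : measurable (cellset m c).
Proof. exact: measurable_cell. Qed.

Lemma mu_cellset m c : mu (cellset m c) = ((2 ^+ (m * N))^-1)%:E.
Proof.
rewrite cellsetE (lebesgue_rV_box (F := fun i => [set` `[(c i)%:~R / 2 ^+ m, (c i + 1)%:~R / 2 ^+ m[])) //.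
have p0 : 0 < 2 ^+ m :> R by rewrite exprn_gt0.
transitivity (\prod_(i < N) ((2 ^+ m)^-1 : R)%:E)%E.
  apply: eq_bigr => i _; rewrite lebesgue_measure_itv /= lte_fin ltr_pM2r ?invr_gt0 // ltr_int ltrDl ltr01.
  by rewrite -EFinB -mulrBl intrD addrAC subrr add0r mulr1z mul1r.
by rewrite prodEFin prodr_const card_ord exprM exprVn.
Qed.

Lemma mu_box (r : R) : 0 <= r -> mu (box r) = ((2 * r) ^+ N)%:E.
Proof.
move=> r0; rewrite (_ : box r = [set x | forall i, [set` `[- r, r]] (x ord0 i)]).
  rewrite (lebesgue_rV_box (F := fun i => [set` `[- r, r]])) //.
  transitivity (\prod_(i < N) ((2 * r))%:E)%E.
    apply: eq_bigr => i _; rewrite lebesgue_measure_itv /= lte_fin.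
    case: ifP => [_|/negbT]; first by rewrite -EFinB; congr EFin; ring.
    rewrite -leNgt => rr; congr EFin; lra.
  by rewrite prodEFin prodr_const card_ord.
apply/seteqP; split => x /=.
  by move=> xr i; rewrite in_itv /= -ler_norml; apply: le_trans xr; exact: coord_norm_le.
by move=> H; apply: rV_norm_le => // i; have := H i; rewrite in_itv /= -ler_norml.
Qed.

Lemma L2_cellset m c : L2 (\1_(cellset m c)) /\ nn (\1_(cellset m c)) = (2 ^+ (m * N))^-1.
Proof.
have m1 : mf (\1_(cellset m c) : 'rV[R]_N -> R) by apply/measurable_indicP; exact: measurable_cellset.
have E : (fun x => (\1_(cellset m c) x : R) ^+ 2) = \1_(cellset m c).
  by apply/funext => x; rewrite indicE; case: (_ \in _); rewrite ?expr1n ?expr0n.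
have I1 : nnI mu (\1_(cellset m c)) = ((2 ^+ (m * N))^-1)%:E.
  by rewrite nnI_indic ?mu_cellset //; exact: measurable_cellset.
have i1 : intg mu (\1_(cellset m c)).
  apply: intg_ge0P; [exact: m1|by move=> x; rewrite indicE|by rewrite I1 ltry].
split; first by split => //; rewrite E.
by rewrite nnE E; apply: EFin_inj; rewrite -nnI_Int // => x; rewrite indicE.
Qed.

Definition avg m c u : R := 2 ^+ (m * N) * \int[mu]_x (\1_(cellset m c) x * u x).

Lemma avgE m c u : avg m c u = 2 ^+ (m * N) * ip (\1_(cellset m c)) u.
Proof. by []. Qed.

Lemma avg_sq m c u : L2 u -> avg m c u ^+ 2 <= 2 ^+ (m * N) * nn u.
Proof.
move=> lu; have [l1 n1] := L2_cellset m c; rewrite avgE exprMn.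
have p0 : 0 < 2 ^+ (m * N) :> R by rewrite exprn_gt0.
apply: le_trans (ler_wpM2l (sqr_ge0 _) (ip_CS l1 lu)) _.
by rewrite n1 expr2 -mulrA mulVKf // gt_eqF.
Qed.

Lemma avgB m c u v : L2 u -> L2 v -> avg m c (fun x => u x - v x) = avg m c u - avg m c v.
Proof. by move=> lu lv; have [l1 _] := L2_cellset m c; rewrite !avgE ipBr // mulrBr. Qed.

Lemma avg_cell_cst m c u (k : R) : (forall x, cell m x = c -> u x = k) -> avg m c u = k.
Proof.
move=> uk; rewrite /avg.
have [l1 n1] := L2_cellset m c.
have p0 : 0 < 2 ^+ (m * N) :> R by rewrite exprn_gt0.
have -> : \int[mu]_x (\1_(cellset m c) x * u x) = \int[mu]_x (k * (\1_(cellset m c) x) ^+ 2).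
  apply: eq_Rintegral => x _; rewrite indicE; case: (boolP (x \in _)).
    by rewrite inE => /uk ->; rewrite expr1n mul1r mulr1.
  by rewrite expr0n /= mul0r mulr0.
by rewrite IntZ; [rewrite -nnE n1 mulrCA mulfV ?mulr1 // gt_eqF|case: l1].
Qed.

(** The conditional expectation on the dyadic cells of level m. *)
Definition Pm m u : 'rV[R]_N -> R := fun x => avg m (cell m x) u.

Lemma mf_Pm m u : mf (Pm m u).
Proof. exact: (mf_cell m (fun c => avg m c u)). Qed.

Lemma measurable_rV_addp : mf (fun z : 'rV[R]_N * 'rV[R]_N => z.2 + z.1).
Proof.
apply: measurable_fun_rV => i.
rewrite (_ : _ \o _ = fun z : 'rV[R]_N * 'rV[R]_N => z.2 ord0 i + z.1 ord0 i).
  by apply: measurable_funD;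
    [apply: (measurableT_comp (measurable_coord i) measurable_snd)
    |apply: (measurableT_comp (measurable_coord i) measurable_fst)].
by apply/funext => x; rewrite /rV_coord /= !mxE.
Qed.

(** The deviation of u from its mean on a cell is controlled by differences u(x) - u(x+h) with |h|
    at most 2^-m, and Tonelli turns this into translation differences, each at most |h| times the
    H^1 norm. The factor 2^N is the volume of the box of radius 2^-m divided by that of a cell. *)
Lemma poincare m u : H1 u -> L2 (fun x => u x - Pm m u x) /\
  nn (fun x => u x - Pm m u x) <= 2 ^+ N * (4^-1) ^+ m * S1 u ^+ 2.
Proof.
move=> hu; have lu := H1_L2 hu; have mu_ := L2_mf lu.
have p0 : 0 < 2 ^+ (m * N) :> R by rewrite exprn_gt0.
pose r : R := (2 ^+ m)^-1.
have r0 : 0 <= r by rewrite invr_ge0 exprn_ge0.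
have r1 : r <= 1 by rewrite invf_le1 ?exprn_gt0 // exprn_ege1 // ler1n.
pose D (z : 'rV[R]_N * 'rV[R]_N) : R := \1_(box r) z.2 * (u z.1 - u (z.2 + z.1)) ^+ 2.
have D0 z : 0 <= D z by rewrite mulr_ge0 ?sqr_ge0 // indicE.
have mD : mf D.
  apply: measurable_funM.
    exact: (measurableT_comp (@mf_box R N r) measurable_snd).
  apply: measurable_funX; apply: measurable_funB.
    exact: (measurableT_comp mu_ measurable_fst).
  exact: (measurableT_comp mu_ measurable_rV_addp).
have mD1 x : mf (fun h => D (x, h)) by exact: (measurableT_comp mD (measurable_pair1 x)).
have mD2 h : mf (fun x => D (x, h)) by exact: (measurableT_comp mD (measurable_pair2 h)).
have mv : mf (fun x => u x - Pm m u x) by apply: measurable_funB => //; exact: mf_Pm.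
(* Cauchy-Schwarz on the cell of x, after which the cell is enlarged to the box of radius 2^-m
   around x. *)
have ptw x : (((u x - Pm m u x) ^+ 2)%:E <= (2 ^+ (m * N))%:E * nnI mu (fun h => D (x, h)))%E.
  set C := cellset m (cell m x).
  have [l1 n1] := L2_cellset m (cell m x); rewrite -/C in l1 n1.
  pose w y := \1_C y * (u x - u y).
  have lw : L2 w.
    have -> : w = fun y => u x * \1_C y - \1_C y * u y by apply/funext => y; rewrite /w; ring.
    apply: L2B; first exact: L2Z.
    apply: (L2_mono _ _ lu); first by apply: measurable_funM => //; case: l1.
    by move=> y; rewrite normrM ler_piMl // indicE; case: (_ \in _); rewrite ?normr1 ?normr0.
  have E1 : u x - Pm m u x = 2 ^+ (m * N) * ip (\1_C) w.
    have -> : ip (\1_C) w = ip (\1_C) (fun y => u x * \1_C y - u y).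
      apply: eq_Rintegral => y _; rewrite /w indicE; case: (_ \in _) => /=; ring.
    rewrite ipBr ?ipZr //; last exact: L2Z.
    have n1' : ip (\1_C) (\1_C) = (2 ^+ (m * N))^-1 by exact: n1.
    by rewrite mulrBr mulrCA n1' mulfV ?mulr1 ?gt_eqF.
  have E2 : (u x - Pm m u x) ^+ 2 <= 2 ^+ (m * N) * nn w.
    rewrite E1 exprMn; apply: le_trans (ler_wpM2l (sqr_ge0 _) (ip_CS l1 lw)) _.
    by rewrite n1 expr2 -mulrA mulVKf // gt_eqF.
  apply: (@le_trans _ _ (2 ^+ (m * N) * nn w)%:E); first by rewrite lee_fin.
  rewrite EFinM lee_pmul2l // ?lte_fin //.
  rewrite nnE -nnI_Int; [|by case: lw|by move=> y; exact: sqr_ge0].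
  have mw2 : mf (fun y => w y ^+ 2) by apply: measurable_funX; case: lw.
  rewrite -(nnI_trn x mw2); last by move=> y; exact: sqr_ge0.
  apply: nnI_le => //.
  - exact: (mf_comp (measurable_rV_add x) mw2).
  - by move=> y; exact: sqr_ge0.
  move=> y; rewrite /w /D /= exprMn ler_wpM2r ?sqr_ge0 // !indicE.
  case: (boolP (_ \in C)); rewrite ?expr0n //= inE => xy.
  rewrite mem_set ?expr1n // /box /=; have := cell_dist xy.
  by rewrite addrK.
have big : (nnI mu (fun x => (u x - Pm m u x) ^+ 2)%R <= (2 ^+ N * (4^-1) ^+ m * S1 u ^+ 2)%:E)%E.
  have mDe : measurable_fun setT (fun z => (D z)%:E) by exact/measurable_EFinP.
  have mF : measurable_fun setT (fun x => nnI mu (fun h => D (x, h))).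
    by apply: (measurable_fun_fubini_tonelli_F _ mDe) => z; rewrite lee_fin.
  apply: (@le_trans _ _ (\int[mu]_x ((2 ^+ (m * N))%:E * nnI mu (fun h => D (x, h))))%E).
    apply: ge0_le_integral => //.
    - by move=> x _; rewrite lee_fin sqr_ge0.
    - by apply/measurable_EFinP; exact: measurable_funX.
    - exact: measurable_funeM.
  rewrite ge0_integralZl_EFin //; last by move=> x _; apply: integral_ge0 => h _; rewrite lee_fin.
  have -> : (\int[mu]_x nnI mu (fun h => D (x, h)) = \int[mu]_h nnI mu (fun x => D (x, h)))%E.
    by apply: (fubini_tonelli (fun z => (D z)%:E)) => // z; rewrite lee_fin.
  have q : (\int[mu]_h nnI mu (fun x => D (x, h)) <= \int[mu]_h ((r * S1 u) ^+ 2 * \1_(box r) h)%:E)%E.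
    apply: ge0_le_integral => //.
    - by move=> h _; exact: nnI_ge0.
    - by apply: (measurable_fun_fubini_tonelli_G _ mDe) => z; rewrite lee_fin.
    - by apply/measurable_EFinP; apply: measurable_funM => //; exact: mf_box.
    move=> h _; rewrite /D /=; case: (boolP (h \in box r)) => hr; last first.
      rewrite !indicE (negbTE hr) mulr0 /nnI; under eq_integral do rewrite mul0r.
      by rewrite integral0.
    rewrite indicE hr mulr1; have hr' : `|h| <= r by move: hr; rewrite inE.
    have lt : L2 (fun x => u (x + h) - u x) by apply: L2B => //; exact: (L2_trn h lu).
    have -> : nnI mu (fun x => 1 * (u x - u (h + x)) ^+ 2) = nnI mu (fun x => (u (x + h) - u x) ^+ 2).
      by congr nnI; apply/funext => x; rewrite mul1r -sqrrN opprB [h + x]addrC.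
    rewrite nnI_Int; [|by case: lt|by move=> y; exact: sqr_ge0].
    rewrite lee_fin -nnE; apply: le_trans (nn_trn_sub hu _) _; first exact: le_trans hr' r1.
    by rewrite lerXn2r ?nnegrE ?mulr_ge0 ?S1_ge0 // ler_wpM2r ?S1_ge0.
  have E : (\int[mu]_h ((r * S1 u) ^+ 2 * \1_(box r) h)%:E = ((r * S1 u) ^+ 2 * (2 * r) ^+ N)%:E)%E.
    transitivity (nnI mu (fun h => (r * S1 u) ^+ 2 * \1_(box r) h)); first by [].
    rewrite nnIZ ?sqr_ge0 //; [|exact: mf_box].
    by rewrite nnI_indic ?mu_box ?EFinM //; exact: measurable_box.
  apply: (@le_trans _ _ ((2 ^+ (m * N))%:E * ((r * S1 u) ^+ 2 * (2 * r) ^+ N)%:E)%E).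
    rewrite lee_pmul2l ?lte_fin //; first by rewrite -E.
  rewrite -EFinM lee_fin; apply: le_of_eq.
  have E4 : (4 : R) ^+ m = (2 ^+ m) ^+ 2 by rewrite expr2 -exprMn -natrM.
  have EN : (2 : R) ^+ (m * N) = (2 ^+ m) ^+ N by rewrite exprM.
  rewrite !exprMn /r !exprVn E4 EN.
  by field; rewrite ?expf_neq0.
have l : L2 (fun x => u x - Pm m u x).
  split => //; apply: intg_ge0P; first exact: measurable_funX.
    by move=> x; exact: sqr_ge0.
  by apply: le_lt_trans big _; rewrite ltry.
split => //; rewrite nnE -lee_fin -nnI_Int //; first by case: l.
by move=> x; exact: sqr_ge0.
Qed.

Lemma L2_Pm m u : H1 u -> L2 (Pm m u).
Proof.
move=> hu; have [l _] := poincare m hu.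
have := L2B (H1_L2 hu) l; congr L2; apply/funext => x; ring.
Qed.

Lemma cell_nested m (x y : 'rV[R]_N) : cell m.+1 x = cell m.+1 y -> cell m x = cell m y.
Proof.
move=> /ffunP H; apply/ffunP => i; have := H i; rewrite !ffunE => Hi.
have half (s t : R) : Num.floor (2 ^+ m.+1 * s) = Num.floor (2 ^+ m.+1 * t) ->
    Num.floor (2 ^+ m * s) <= Num.floor (2 ^+ m * t).
  move=> st; rewrite floor_ge_int; set k := Num.floor (2 ^+ m * s).
  have k1 : k%:~R <= 2 ^+ m * s by have /andP[] := floor_itv (2 ^+ m * s).
  have : (2 * k)%:~R <= 2 ^+ m.+1 * s by rewrite exprS -mulrA intrM ler_wpM2l.
  move=> h; have : (2 * k)%:~R <= 2 ^+ m.+1 * t by rewrite -floor_ge_int -st floor_ge_int.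
  rewrite exprS -mulrA intrM.
  by rewrite ler_pM2l.
by apply/eqP; rewrite eq_le !half.
Qed.

(** The step from level m to level m+1 is the mean, over a finer cell, of u - [Pm m u]; the
    Cauchy-Schwarz factor 2^((m+1)N) competes with 4^-m from [poincare]. *)
Lemma Pm_step m u x : H1 u ->
  (Pm m.+1 u x - Pm m u x) ^+ 2 <= 4 ^+ N * (2 ^+ N / 4) ^+ m * S1 u ^+ 2.
Proof.
move=> hu; have lu := H1_L2 hu; have [l n] := poincare m hu.
have E : Pm m.+1 u x - Pm m u x = avg m.+1 (cell m.+1 x) (fun y => u y - Pm m u y).
  rewrite avgB //; last exact: L2_Pm.
  congr (_ - _); symmetry; apply: avg_cell_cst => y /cell_nested xy.
  by rewrite /Pm xy.
rewrite E; apply: le_trans (avg_sq _ _ l) _.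
apply: le_trans (ler_wpM2l _ n) _; first by rewrite exprn_ge0.
have E4 : (4 : R) ^+ N = 2 ^+ N * 2 ^+ N by rewrite -exprMn -natrM.
have E1 : (2 : R) ^+ (m.+1 * N) = 2 ^+ N * (2 ^+ N) ^+ m by rewrite mulSn exprD mulnC exprM.
rewrite E1 E4 exprMn.
by apply: le_of_eq; ring.
Qed.

Section levels.
Variables (b : R).
Hypotheses (b1 : 1 < b) (bN : 2 ^+ N <= 4 * b ^+ 2).

(** From summing the steps 2^N b^j of successive averages. *)
Definition Kb : R := 1 + 2 ^+ N / (b - 1).

Lemma Kb_gt0 : 0 < Kb.
Proof. by rewrite ltr_wpDr // divr_ge0 ?exprn_ge0 // subr_ge0 ltW. Qed.

(** Averages of level k grow at most like b^k: the condition on b says exactly that b^2 dominates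
    the ratio 2^N/4 of [Pm_step]. *)
Lemma Pm_sup k u x : H1 u -> `|Pm k u x| <= Kb * b ^+ k * S1 u.
Proof.
move=> hu; have s0 := S1_ge0 u; have bb : 0 < b - 1 by rewrite subr_gt0.
have b0 : 0 < b by exact: lt_trans b1.
have H : `|Pm k u x| <= (1 + 2 ^+ N * (b ^+ k - 1) / (b - 1)) * S1 u.
  elim: k => [|k IH].
    rewrite expr0 subrr mulr0 mul0r addr0 mul1r.
    rewrite -sqrtr_sqr; apply: sqrtr_le => //.
    apply: le_trans (avg_sq _ _ (H1_L2 hu)) _; rewrite mul0n expr0 mul1r.
    exact: nn_le_S1.
  have st : `|Pm k.+1 u x - Pm k u x| <= 2 ^+ N * b ^+ k * S1 u.
    rewrite -sqrtr_sqr; apply: sqrtr_le; first by rewrite !mulr_ge0 ?exprn_ge0 // ltW.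
    have E4 : (4 : R) ^+ N = (2 ^+ N) ^+ 2 by rewrite expr2 -exprMn -natrM.
    have Eb : (2 ^+ N / 4) ^+ k <= (b ^+ k) ^+ 2.
      rewrite -exprM mulnC exprM; apply: lerXn2r; rewrite ?nnegrE ?sqr_ge0 ?divr_ge0 ?exprn_ge0 //.
      by rewrite ler_pdivrMr // mulrC.
    apply: le_trans (Pm_step _ _ hu) _; rewrite 2![in X in _ <= X]exprMn E4 -mulrA -[X in _ <= X]mulrA.
    by apply: ler_wpM2l; [exact: sqr_ge0|apply: ler_wpM2r; [exact: sqr_ge0|exact: Eb]].
  have -> : Pm k.+1 u x = Pm k u x + (Pm k.+1 u x - Pm k u x) by ring.
  apply: le_trans (ler_normD _ _) _; apply: le_trans (lerD IH st) _.
  rewrite -mulrDl ler_wpM2r //; apply: le_of_eq.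
  by rewrite exprS; field; rewrite gt_eqF.
apply: le_trans H _; rewrite ler_wpM2r // /Kb mulrDl mul1r; apply: lerD.
  by rewrite exprn_ege1 // ltW.
rewrite mulrAC ler_wpM2l //; last by rewrite lerBlDr lerDl.
by rewrite divr_ge0 ?exprn_ge0 // ltW.
Qed.

(** Twice the bound of [Pm_sup] for functions with [S1 u <= 1]: where |u| exceeds it, u differs from
    its average of level k by at least |u|/2. *)
Definition lam k : R := 2 * Kb * b ^+ k.

Lemma lam_gt0 k : 0 < lam k.
Proof. by rewrite !mulr_gt0 ?Kb_gt0 // exprn_gt0 // (lt_trans _ b1). Qed.

Lemma lam_level (t : R) m : lam m < t -> exists j, lam (m + j) < t <= lam (m + j).+1.
Proof.
move=> mt; have lam_unb : exists j, t <= lam (m + j).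
  have b0 : 0 < b - 1 by rewrite subr_gt0.
  have k0 := Kb_gt0.
  exists (Num.truncn (t / (2 * Kb * (b - 1)))).+1; set j := _.+1.
  have tj : t <= j%:R * (2 * Kb * (b - 1)).
    rewrite -ler_pdivrMr ?mulr_gt0 //; apply/ltW; exact: truncnS_gt.
  apply: le_trans tj _; rewrite /lam mulrCA ler_pM2l ?mulr_gt0 //.
  (* Bernoulli's inequality: the levels are unbounded. *)
  have B : 1 + j%:R * (b - 1) <= b ^+ j.
    elim: (j) => [|i IH]; first by rewrite mul0r addr0 expr0.
    rewrite exprS -natr1; have : 0 <= i%:R :> R by [].
    have := b0; move: IH; set z := b ^+ i; set y := i%:R; set e := b - 1 => IH e0 y0.
    have -> : b * z = z + e * z by rewrite /e; ring.
    have : e * 1 <= e * z by rewrite ler_pM2l //; apply: le_trans IH; rewrite lerDl mulr_ge0 // ltW.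
    lra.
  have bj : b ^+ j <= b ^+ (m + j) by apply: ler_weXn2l; [exact: ltW|exact: leq_addl].
  by apply: le_trans bj; apply: le_trans B; rewrite lerDr.
pose P j := t <= lam (m + j).
have exP : exists j, P j by [].
have := ex_minnP exP; case=> -[|j]; first by rewrite /P addn0 leNgt mt.
move=> Pj minj; exists j; rewrite -addnS; apply/andP; split; last exact: Pj.
by rewrite ltNge; apply/negP => /minj; rewrite ltnn.
Qed.

Variables (s : R).
Hypotheses (s2 : 2 <= s) (bs : b `^ (s - 2) < 4).

(** The ratio of the series over levels: each level costs b^(s-2) in height and gains 1/4 from
    [poincare]. *)
Definition rho : R := b `^ (s - 2) / 4.
Definition Ctail : R := 4 * 2 ^+ N * (2 * Kb * b) `^ (s - 2) / (1 - rho).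

Lemma rho_itv : 0 <= rho < 1.
Proof. by rewrite divr_ge0 ?powR_ge0 //= ltr_pdivrMr // mul1r. Qed.

Definition utail (l : R) u : 'rV[R]_N -> R := fun x => if l < `|u x| then `|u x| `^ s else 0.

Lemma mf_pow (q : R) u : mf u -> mf (fun x => `|u x| `^ q).
Proof.
move=> mu_; apply: (measurableT_comp (measurable_powR q)).
exact: measurableT_comp.
Qed.

Lemma mf_utail l u : mf u -> mf (utail l u).
Proof.
move=> mu_; apply: measurable_fun_ifT => //; last exact: mf_pow.
by apply: measurable_fun_ltr => //; exact: measurableT_comp.
Qed.

Lemma powR_split (a : R) : 0 <= a -> a `^ s = a `^ (s - 2) * a ^+ 2.
Proof.
move=> a0; rewrite -powR_mulrn // -powRD; last first.
  by rewrite subrK; apply/implyP => /eqP s0; move: s2; rewrite s0; lra.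
by rewrite subrK.
Qed.

(** Where |u| lies between levels j and j+1 it is at most 2 |u - P_j u|, hence |u|^s is at most 4
    lam(j+1)^(s-2) |u - P_j u|^2. Summed over j with [poincare] this is a geometric series of ratio
    [rho]. *)
Lemma sobolev_tail u m : H1 u -> S1 u <= 1 ->
  (nnI mu (utail (lam m) u) <= (Ctail * rho ^+ m)%:E)%E.
Proof.
move=> hu su; have lu := H1_L2 hu; have mu_ := L2_mf lu.
have b0 : 0 < b by exact: lt_trans b1.
have /andP[rho0 rho1] := rho_itv.
pose t j x := 4 * lam (m + j).+1 `^ (s - 2) * (u x - Pm (m + j) u x) ^+ 2.
have t0 j x : 0 <= t j x by rewrite /t mulr_ge0 ?sqr_ge0 // mulr_ge0 ?powR_ge0.
have mt j : mf (t j).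
  apply: measurable_funM => //; apply: measurable_funX; apply: measurable_funB => //.
  exact: mf_Pm.
have ptw x : ((utail (lam m) u x)%:E <= \sum_(j <oo) (t j x)%:E)%E.
  rewrite /utail; case: ifP => [hl|_]; last by apply: nneseries_ge0 => j _ _; rewrite lee_fin.
  have [j /andP[h1 h2]] := lam_level hl.
  rewrite (nneseriesD1 (n := j)) //; last by move=> i _; rewrite lee_fin.
  rewrite -[X in (X <= _)%E]adde0; apply: leeD; last by apply: nneseries_ge0 => i _ _; rewrite lee_fin.
  rewrite lee_fin /t (powR_split (normr_ge0 _)).
  rewrite (_ : 4 * _ * _ = lam (m + j).+1 `^ (s - 2) * (4 * (u x - Pm (m + j) u x) ^+ 2)); last by ring.
  apply: ler_pM; [exact: powR_ge0|exact: sqr_ge0|..].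
    have l0 := ltW (lam_gt0 (m + j).+1).
    by apply: ge0_ler_powR; rewrite ?nnegrE // subr_ge0.
  have hp : `|Pm (m + j) u x| <= `|u x| / 2.
    apply: le_trans (Pm_sup _ _ hu) _.
    rewrite ler_pdivlMr //; apply: le_trans (ltW h1).
    have kb : 0 <= 2 * Kb * b ^+ (m + j) by exact: ltW (lam_gt0 _).
    rewrite /lam (_ : _ * 2 = 2 * Kb * b ^+ (m + j) * S1 u); last by ring.
    by rewrite -[X in _ <= X]mulr1; apply: ler_wpM2l.
  have : `|u x| / 2 <= `|u x - Pm (m + j) u x|.
    by apply: le_trans (lerB_dist _ _); lra.
  rewrite -[_ ^+ 2 in X in _ -> X <= _](real_normK (num_real _)).
  rewrite -[(u x - _) ^+ 2](real_normK (num_real _)).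
  rewrite normr_id => h; rewrite (_ : 4 * _ = (2 * `|u x - Pm (m + j) u x|) ^+ 2); last by ring.
  by rewrite lerXn2r ?nnegrE ?mulr_ge0 //; lra.
apply: (@le_trans _ _ (\int[mu]_x \sum_(j <oo) (t j x)%:E)%E).
  apply: ge0_le_integral => //.
  - by move=> x _; rewrite lee_fin /utail; case: ifP => // _; exact: powR_ge0.
  - by apply/measurable_EFinP; exact: mf_utail.
  - apply: ge0_emeasurable_sum; first by move=> k x _ _; rewrite lee_fin.
    by move=> k _; exact/measurable_EFinP.
rewrite integral_nneseries //; last 2 first.
- by move=> j; exact/measurable_EFinP.
- by move=> j x _; rewrite lee_fin.
pose C0 := 4 * 2 ^+ N * (2 * Kb * b) `^ (s - 2).
have C00 : 0 <= C0 by rewrite !mulr_ge0 ?powR_ge0 ?exprn_ge0.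
apply: (@le_trans _ _ (\sum_(j <oo) (C0 * rho ^+ m * rho ^+ j)%:E)%E).
  apply: lee_nneseries.
    by move=> j _ _; apply: integral_ge0 => x _; rewrite lee_fin.
  move=> j _; have [l n] := poincare (m + j) hu.
  have it : intg mu (t j) by apply: intgZ; case: l.
  rewrite -/(nnI mu (t j)) nnI_Int // lee_fin IntZ; last by case: l.
  rewrite -nnE; apply: le_trans (ler_wpM2l _ n) _; first by rewrite mulr_ge0 ?powR_ge0.
  have E : lam (m + j).+1 `^ (s - 2) = (2 * Kb * b) `^ (s - 2) * (b `^ (s - 2)) ^+ (m + j).
    rewrite /lam exprS mulrA powRM ?exprn_ge0 ?ltW //; last by rewrite !mulr_gt0 ?Kb_gt0.
    by rewrite powR_expn // ltW.
  have s0 := S1_ge0 u.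
  rewrite E -[C0 * _ * _]mulrA -exprD /C0 /rho exprMn exprVn.
  have -> : 4 * ((2 * Kb * b) `^ (s - 2) * b `^ (s - 2) ^+ (m + j)) * (2 ^+ N / 4 ^+ (m + j) * S1 u ^+ 2)
    = (4 * 2 ^+ N * (2 * Kb * b) `^ (s - 2) * (b `^ (s - 2) ^+ (m + j) / 4 ^+ (m + j))) * S1 u ^+ 2.
    by ring.
  rewrite ler_piMr //; last by rewrite expr_le1.
  by apply: mulr_ge0; [exact: C00|rewrite divr_ge0 ?exprn_ge0 ?powR_ge0].
have g : (fun n => \sum_(0 <= j < n) (C0 * rho ^+ m * rho ^+ j)%:E)%E @ \oo --> (Ctail * rho ^+ m)%:E.
  have := @cvg_geometric_series R (C0 * rho ^+ m) rho.
  rewrite ger0_norm // => /(_ rho1).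
  have -> : C0 * rho ^+ m / (1 - rho) = Ctail * rho ^+ m by rewrite /Ctail /C0; ring.
  move=> g; rewrite (_ : (fun n => _) = EFin \o series (geometric (C0 * rho ^+ m) rho)).
    by apply: cvg_EFin; [exact: nearW|exact: g].
  by apply/funext => n /=; rewrite sumEFin.
by rewrite (cvg_lim _ g).
Qed.

End levels.

End cell_averages.

(** * Sobolev embedding, nonvanishing and local compactness *)

Section subcritical.
Context (R : realType) (N : nat).
Local Notation mu := (lebesgue_rV R N).
Implicit Types u v f g : 'rV[R]_N -> R.
Local Notation L2 := (L2 mu).
Local Notation ip := (ip mu).
Local Notation nn := (nn mu).

(* [2 <= s < 2N/(N-2)], without an upper bound when [N <= 2]. *)
Definition subcrit (s : R) : Prop :=
  2 <= s /\ ((3 <= N)%N -> s * (N%:R - 2) < 2 * N%:R).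

Lemma gt1_ltr_powRr (a x y : R) : 1 < a -> (a `^ x < a `^ y) = (x < y).
Proof.
move=> a1; have a0 : 0 < a by exact: lt_trans a1.
by rewrite /powR (gt_eqF a0) ltr_expR ltr_pM2r // ln_gt0.
Qed.

(** For N at least 3, b = 2^(N/2 - 1) gives equality in the second condition, and the third becomes
    s < 2N/(N-2). For N at most 2 the second holds for every b > 1, so b may be taken as close to 1
    as s demands. *)
Lemma subcrit_level s : subcrit s ->
  exists b : R, [/\ 1 < b, 2 ^+ N <= 4 * b ^+ 2 & b `^ (s - 2) < 4].
Proof.
move=> [s2 H]; have [N3|N3] := leqP 3 N.
  have {}H := H N3; have n3 : 3 <= N%:R :> R by rewrite ler_nat.
  have e0 : 0 < N%:R / 2 - 1 :> R by lra.
  exists (2 `^ (N%:R / 2 - 1)); split.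
  - by rewrite -[ltLHS](powRr0 2) gt1_ltr_powRr ?ltr1n.
  - rewrite -powR_mulrn ?powR_ge0 // -powRrM -(powR_mulrn N) // -[4](_ : 2 `^ 2%:R = 4); last first.
      by rewrite powR_mulrn // expr2 -natrM.
    rewrite -powRD; last by rewrite pnatr_eq0 implybT.
    by rewrite ler_powR ?ler1n //; lra.
  - rewrite -powRrM -[4](_ : 2 `^ 2%:R = 4); last by rewrite powR_mulrn // expr2 -natrM.
    rewrite gt1_ltr_powRr ?ltr1n //; lra.
have n2 : (2 : R) ^+ N <= 4.
  rewrite [leRHS](_ : 4 = 2 ^+ 2); last by rewrite expr2 -natrM.
  by apply: ler_weXn2l; rewrite ?ler1n.
have s1 : 0 < s - 1 by lra.
have b1 : 1 < 2 `^ (s - 1)^-1 :> R by rewrite -[ltLHS](powRr0 2) gt1_ltr_powRr ?ltr1n ?invr_gt0.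
exists (2 `^ (s - 1)^-1); split => //.
- apply: (le_trans n2); rewrite -[X in X <= _]mulr1 ler_pM2l //.
  by rewrite exprn_ege1 // ltW.
- rewrite -powRrM; apply: (@le_lt_trans _ _ (2 `^ 1)); last first.
    by rewrite powRr1 // ltr_nat.
  apply: ler_powR; first by rewrite ler1n.
  by rewrite mulrC ler_pdivrMr //; lra.
Qed.

Lemma nnI_le_Int f g (c : R) : mf f -> (forall x, 0 <= f x <= g x) -> intg mu g ->
  \int[mu]_x g x <= c -> (nnI mu f <= c%:E)%E.
Proof.
move=> mf_ fg ig gc; apply: (@le_trans _ _ (nnI mu g)).
  apply: nnI_le => //; [exact: intg_mf ig|by move=> x; have /andP[] := fg x|by move=> x; have /andP[] := fg x].
rewrite nnI_Int // => x; have /andP[a b] := fg x; exact: le_trans b.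
Qed.

(** Three cases: t above the level l; t at most 2d, where s > 2 will make the coefficient small; t
    in between, where |t| is at most 2 |t - w|. *)
Lemma pow_le_tail s (l d t w : R) : 2 <= s -> 0 <= l -> 0 <= d -> `|w| <= d ->
  `|t| `^ s <= (if l < `|t| then `|t| `^ s else 0) +
    ((2 * d) `^ (s - 2) * t ^+ 2 + 4 * l `^ (s - 2) * (t - w) ^+ 2).
Proof.
move=> s2 l0 d0 wd; have s20 : 0 <= s - 2 by lra.
have q0 : 0 <= (2 * d) `^ (s - 2) * t ^+ 2 by rewrite mulr_ge0 ?powR_ge0 ?sqr_ge0.
have q1 : 0 <= 4 * l `^ (s - 2) * (t - w) ^+ 2 by rewrite mulr_ge0 ?sqr_ge0 // mulr_ge0 ?powR_ge0.
case: ltP => tl; first by rewrite lerDl addr_ge0.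
rewrite add0r (powR_split s2) //.
have E : `|t| ^+ 2 = t ^+ 2 by rewrite real_normK ?num_real.
have [td|td] := leP `|t| (2 * d).
  rewrite -[leLHS]addr0; apply: lerD => //; rewrite E ler_wpM2r ?sqr_ge0 //.
  by apply: ge0_ler_powR => //; rewrite nnegrE // mulr_ge0.
rewrite -[leLHS]add0r; apply: lerD => //.
rewrite (_ : 4 * _ * _ = l `^ (s - 2) * (2 * `|t - w|) ^+ 2); last first.
  by rewrite exprMn real_normK ?num_real //; ring.
apply: ler_pM; rewrite ?powR_ge0 ?sqr_ge0 //.
  by apply: ge0_ler_powR => //; rewrite nnegrE.
rewrite lerXn2r ?nnegrE ?mulr_ge0 //.
have := lerB_dist t w; lra.
Qed.

Lemma S1_0 : S1 (fun _ : 'rV[R]_N => 0 : R) = 0.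
Proof.
have h := @H1_0 R N; rewrite /S1 nn_ae0 ?sqrtr0 ?add0r //; last exact/aeW.
rewrite big1 // => i _; rewrite nn_ae0 ?sqrtr0 //.
  by have [] := weak_partial_L2 i h.
apply: weak_partial_ae => //; split; first exact: L2_0.
move=> phi tp; have lp := test_L2 tp; have lpp := test_L2 (test_partial i tp).
have Z f : ip (fun=> 0) f = 0.
  by rewrite /ip; under eq_Rintegral do rewrite mul0r; exact: Int0.
by rewrite !Z oppr0.
Qed.

Lemma S1Z a u : H1 u -> S1 (fun x => a * u x) <= `|a| * S1 u.
Proof.
move=> hu; have := S1_lin a hu (@H1_0 R N); rewrite S1_0 addr0.
by under eq_fun do rewrite addr0.
Qed.

Lemma nnI_pow_scale s (a : R) f u : mf f -> (forall x, 0 <= f x) -> mf u -> 0 < a ->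
  nnI mu (fun x => f x * `|u x| `^ s) =
  ((a `^ s)%:E * nnI mu (fun x => (f x * `|a^-1 * u x| `^ s)%R))%E.
Proof.
move=> mf_ f0 mu_ a0; rewrite -nnIZ ?powR_ge0 //.
- congr nnI; apply/funext => x; rewrite mulrCA -powRM ?(ltW a0) //; congr (_ * powR _ _).
  by rewrite normrM (ger0_norm (x := a^-1)) ?invr_ge0 ?(ltW a0) // mulVKf // gt_eqF.
- by apply: measurable_funM => //; apply: mf_pow; exact: measurable_funM.
- by move=> x; rewrite mulr_ge0 ?powR_ge0.
Qed.

Lemma unit_bound (s b : R) u : 1 < b -> 2 ^+ N <= 4 * b ^+ 2 -> 2 <= s -> b `^ (s - 2) < 4 ->
  H1 u -> S1 u <= 1 ->
  (nnI mu (fun x => (`|u x| `^ s)%R) <=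
   (Ctail N b s + (2 ^+ 2 * lam N b 0) `^ (s - 2) )%:E)%E.
Proof.
move=> b1 bN s2 bs hu su; have lu := H1_L2 hu; have mu_ := L2_mf lu.
have l0 := lam_gt0 N b1 0.
have H := sobolev_tail b1 bN s2 bs 0 hu su; rewrite expr0 mulr1 in H.
set c := _ `^ (s - 2); have c0 : 0 <= c by exact: powR_ge0.
apply: (@le_trans _ _ (nnI mu (utail s (lam N b 0) u) + nnI mu (fun x => (c * u x ^+ 2)%R))%E); last first.
  rewrite EFinD; apply: leeD => //; rewrite nnI_Int; last 2 first.
  - by apply: intgZ; case: lu.
  - by move=> x; rewrite mulr_ge0 ?sqr_ge0.
  rewrite lee_fin IntZ; last by case: lu.
  rewrite -nnE -[leRHS]mulr1 ler_wpM2l //; apply: le_trans (nn_le_S1 u) _.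
  by rewrite expr_le1 // S1_ge0.
have mt := mf_utail s (lam N b 0) mu_.
have m2 : mf (fun x => c * u x ^+ 2) by apply: measurable_funM => //; exact: measurable_funX.
have t0 x : 0 <= utail s (lam N b 0) u x by rewrite /utail; case: ifP => // _; exact: powR_ge0.
have c20 x : 0 <= c * u x ^+ 2 by rewrite mulr_ge0 ?sqr_ge0.
rewrite -nnID //; apply: nnI_le; [exact: mf_pow|exact: measurable_funD|by move=> x; exact: powR_ge0|].
move=> x; rewrite /utail; case: ltP => h; first by rewrite lerDl.
rewrite add0r (powR_split s2) // real_normK ?num_real // ler_wpM2r ?sqr_ge0 //.
apply: ge0_ler_powR; rewrite ?nnegrE ?subr_ge0 //; first by rewrite mulr_ge0 // ltW.
by apply: le_trans h _; rewrite -[leLHS]mul1r ler_pM2r // expr2 -natrM ler1n.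
Qed.

Lemma sobolev s : subcrit s -> exists2 C : R, 0 < C &
  forall u (c : R), H1 u -> 0 < c -> S1 u <= c -> (nnI mu (fun x => (`|u x| `^ s)%R) <= (C * c `^ s)%:E)%E.
Proof.
move=> ss; have [b [b1 bN bs]] := subcrit_level ss; have s2 := ss.1.
have [r0 r1] := andP (rho_itv bs).
have C0 : 0 <= Ctail N b s.
  rewrite /Ctail divr_ge0 ?subr_ge0 ?(ltW r1) //.
  by rewrite mulr_ge0 ?powR_ge0 // mulr_ge0 ?exprn_ge0.
exists (1 + (Ctail N b s + (2 ^+ 2 * lam N b 0) `^ (s - 2))).
  by rewrite ltr_pwDl // addr_ge0 ?powR_ge0.
move=> u c hu c0 uc; have mu_ := L2_mf (H1_L2 hu).
have su : S1 (fun x => c^-1 * u x) <= 1.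
  apply: le_trans (S1Z _ hu) _.
  by rewrite (ger0_norm (x := c^-1)) ?invr_ge0 ?(ltW c0) // mulrC ler_pdivrMr // mul1r.
have H := unit_bound b1 bN s2 bs (H1Z c^-1 hu) su.
rewrite (_ : (fun x => _) = fun x => 1 * `|u x| `^ s); last by apply/funext => x; rewrite mul1r.
rewrite (nnI_pow_scale s (a := c)) // mulrC EFinM lee_pmul2l ?lte_fin ?powR_gt0 //.
under [X in nnI mu X]eq_fun do rewrite mul1r.
by apply: le_trans H _; rewrite lee_fin lerDr.
Qed.

Lemma sobolev_intg s u : subcrit s -> H1 u -> intg mu (fun x => `|u x| `^ s).
Proof.
move=> ss hu; have [C C0 H] := sobolev ss; apply: intg_ge0P.
- by apply: mf_pow; apply: L2_mf (H1_L2 hu).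
- by move=> x; exact: powR_ge0.
have := H u (1 + S1 u) hu; rewrite ltr_pwDl ?S1_ge0 // lerDr => /(_ isT ler01) h.
by apply: le_lt_trans h _; rewrite ltry.
Qed.

Lemma exp_small (r e : R) : 0 <= r < 1 -> 0 < e -> exists m, r ^+ m <= e.
Proof.
move=> /andP[r0 r1] e0.
have /cvgrPdist_le /(_ _ e0) [m _ H] : (fun n : nat => r ^+ n) @ \oo --> (0 : R).
  by apply: cvg_expr; rewrite ger0_norm.
by exists m; have := H m (leqnn m); rewrite sub0r normrN ger0_norm ?exprn_ge0.
Qed.

Lemma mul_small (c e : R) : 0 <= c -> 0 < e -> exists2 d, 0 < d & d * c <= e.
Proof.
move=> c0 e0; exists (e / (1 + c)); first by rewrite divr_gt0 // ltr_pwDl.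
rewrite mulrAC ler_pdivrMr ?ltr_pwDl // ler_wpM2l ?ltW //; lra.
Qed.

(** Uniformly small averages at one fixed level force a small L^s norm. The exponent must exceed 2
    so that (2d)^(s-2) can be made small. *)
Lemma nonvanishing (s e : R) : subcrit s -> 2 < s -> 0 < e -> exists k, exists2 d : R, 0 < d &
  forall u, H1 u -> S1 u <= 1 -> (forall x, `|Pm k u x| <= d) ->
  (nnI mu (fun x => (`|u x| `^ s)%R) <= e%:E)%E.
Proof.
move=> ss s2' e0; have [b [b1 bN bs]] := subcrit_level ss; have s2 := ss.1.
have r01 := rho_itv bs; have [r0 r1] := andP r01.
have C0 : 0 <= Ctail N b s.
  rewrite /Ctail divr_ge0 ?subr_ge0 ?(ltW r1) //.
  by rewrite mulr_ge0 ?powR_ge0 // mulr_ge0 ?exprn_ge0.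
have e3 : 0 < e / 3 by lra.
have [d1 d10 d1e] := mul_small C0 e3.
(* The order of choices matters: m makes the part above the level l small, then k, depending on l,
   makes the Poincare error small, and d handles the low values. *)
have [m hm] := exp_small r01 d10.
set l := lam N b m; have l0 : 0 < l by exact: lam_gt0.
have c0 : 0 <= 4 * l `^ (s - 2) * 2 ^+ N :> R by rewrite mulr_ge0 ?exprn_ge0 // mulr_ge0 ?powR_ge0.
have [d2 d20 d2e] := mul_small c0 e3.
have q01 : 0 <= (4^-1 : R) < 1 by rewrite invr_ge0 ler0n invf_lt1 ?ltr0n ?ltr1n.
have [k hk] := exp_small q01 d20.
exists k; exists ((e / 3) `^ (s - 2)^-1 / 2); first by rewrite divr_gt0 ?powR_gt0.
set d := _ / 2; have d0 : 0 < d by rewrite divr_gt0 ?powR_gt0.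
have dE : (2 * d) `^ (s - 2) = e / 3.
  rewrite /d mulrC divfK // -powRrM mulVf ?powRr1 ?ltW //; lra.
move=> u hu su Pd; have lu := H1_L2 hu; have mu_ := L2_mf lu.
have [lw nw] := poincare k hu.
have H := sobolev_tail b1 bN s2 bs m hu su; rewrite -/l in H.
pose g x := (2 * d) `^ (s - 2) * u x ^+ 2 + 4 * l `^ (s - 2) * (u x - Pm k u x) ^+ 2.
have g0 x : 0 <= g x.
  by rewrite addr_ge0 // mulr_ge0 ?powR_ge0 ?sqr_ge0 // mulr_ge0 ?powR_ge0.
have ig : intg mu g by apply: intgD; apply: intgZ; [case: lu|case: lw].
apply: (@le_trans _ _ (nnI mu (utail s l u) + nnI mu g)%E).
  rewrite -nnID //; last 3 first.
  - exact: mf_utail.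
  - exact: intg_mf ig.
  - by move=> x; rewrite /utail; case: ifP => // _; exact: powR_ge0.
  apply: nnI_le; [exact: mf_pow| |by move=> x; exact: powR_ge0|].
    by apply: measurable_funD; [exact: mf_utail|exact: intg_mf ig].
  move=> x; exact: (pow_le_tail (u x) s2 (ltW l0) (ltW d0) (Pd x)).
have -> : e = e / 3 + (e / 3 + e / 3) by field.
rewrite EFinD; apply: leeD.
  apply: le_trans H _; rewrite lee_fin mulrC; apply: le_trans d1e.
  by rewrite ler_wpM2r.
have i1 := lu.2; have i2 := lw.2.
rewrite nnI_Int // lee_fin IntD; [|exact: intgZ|exact: intgZ].
rewrite !IntZ // -!nnE dE; apply: lerD.
  rewrite -[leRHS]mulr1 ler_pM2l //; apply: le_trans (nn_le_S1 u) _.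
  by rewrite expr_le1 // S1_ge0.
apply: le_trans (ler_wpM2l _ nw) _; first by rewrite mulr_ge0 ?powR_ge0.
apply: le_trans d2e; rewrite [d2 * _]mulrC.
have s1 : S1 u ^+ 2 <= 1 by rewrite expr_le1 // S1_ge0.
have -> : 4 * l `^ (s - 2) * (2 ^+ N * 4^-1 ^+ k * S1 u ^+ 2) =
  (4 * l `^ (s - 2) * 2 ^+ N) * (4^-1 ^+ k * S1 u ^+ 2) by ring.
apply: ler_wpM2l => //; apply: le_trans hk; rewrite -[leRHS]mulr1 ler_wpM2l //.
Qed.

Section rellich.
Variables (F : set_system nat) (FF : Filter F) (z : nat -> 'rV[R]_N -> R) (C : R).
Hypotheses (hz : forall n, H1 (z n)) (zC : forall n, S1 (z n) <= C).
Hypothesis z0 : wcvg mu F z (fun=> 0).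

(** Only finitely many cells of level k meet the box; weak convergence sends the average on each of
    them to 0, and [poincare] bounds the rest uniformly in n. *)
Lemma rellich2 (M e : R) : 0 <= M -> 0 < e ->
  \forall n \near F, (nnI mu (fun x => (\1_(box M) x * z n x ^+ 2)%R) <= e%:E)%E.
Proof.
move=> M0 e0; have e2 : 0 < e / 2 by lra.
have C0 : 0 <= C by apply: le_trans (zC 0); exact: S1_ge0.
have c0 : 0 <= 2 * 2 ^+ N * C ^+ 2 by rewrite mulr_ge0 ?sqr_ge0 // mulr_ge0 ?exprn_ge0.
have [d2 d20 d2e] := mul_small c0 e2.
have q01 : 0 <= (4^-1 : R) < 1 by rewrite invr_ge0 ler0n invf_lt1 ?ltr0n ?ltr1n.
have [k hk] := exp_small q01 d20.
have b0 : 0 <= 2 * (2 * M) ^+ N by rewrite mulr_ge0 ?exprn_ge0 // mulr_ge0.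
have [d d0 de] := mul_small b0 e2.
pose K := (Num.truncn (2 ^+ k * M)).+1.
(* Integer vectors with entries between -K and K, indexed by a finite type so that finitely many
   limits can be intersected. *)
pose c (j : {ffun 'I_N -> 'I_(K + K).+1}) : {ffun 'I_N -> int} := [ffun i => (j i)%:Z - K%:Z].
have Hj : \forall n \near F, forall j, `|avg k (c j) (z n)| <= Num.sqrt d.
  apply: filter_forall => j.
  have [l1 _] := L2_cellset R k (c j).
  have : avg k (c j) (z n) @[n --> F] --> 2 ^+ (k * N) * ip (fun=> 0) (\1_(cellset k (c j))).
    under eq_fun do rewrite avgE ipC.
    by apply: cvgMl_tmp; exact: z0.
  have -> : ip (fun=> 0) (\1_(cellset k (c j))) = 0.
    by rewrite /ip; under eq_Rintegral do rewrite mul0r; exact: Int0.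
  rewrite mulr0 => /cvgrPdist_le /(_ (Num.sqrt d)); rewrite sqrtr_gt0 => /(_ d0).
  by apply: filterS => n; rewrite sub0r normrN.
apply: filterS Hj => n Hj.
have [lw nw] := poincare k (hz n).
have Pb x : `|x| <= M -> `|Pm k (z n) x| <= Num.sqrt d.
  move=> xM; have -> : Pm k (z n) x = avg k (c [ffun i => inord (absz (Num.floor (2 ^+ k * x ord0 i) + K%:Z))]) (z n).
    congr avg; apply/ffunP => i; rewrite !ffunE /=.
    have xi : `|2 ^+ k * x ord0 i| <= 2 ^+ k * M.
      rewrite normrM ger0_norm ?exprn_ge0 // ler_wpM2l ?exprn_ge0 //.
      by apply: le_trans xM; exact: coord_norm_le.
    have kM : 2 ^+ k * M < K%:R by exact: truncnS_gt.
    set t := 2 ^+ k * x ord0 i in xi *.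
    have : - K%:R < t < K%:R by rewrite -ltr_norml; exact: le_lt_trans kM.
    move=> /andP[t1 t2].
    have f1 : - K%:Z <= Num.floor t by rewrite floor_ge_int intrN; exact: ltW.
    have f2 : Num.floor t < K%:Z by rewrite floor_lt_int.
    have f0 : 0 <= Num.floor t + K%:Z by rewrite -lerBlDr sub0r.
    rewrite inordK; first by rewrite gez0_abs // addrK.
    rewrite ltnS -lez_nat gez0_abs // PoszD lerD2r; exact: ltW.
  exact: Hj.
have lz := H1_L2 (hz n); have mz := L2_mf lz.
pose g x := 2 * (z n x - Pm k (z n) x) ^+ 2 + 2 * d * \1_(box M) x.
have ig : intg mu g by apply: intgD; [apply: intgZ; case: lw|exact: intg_box].
apply: (nnI_le_Int (g := g)) => //.
- by apply: measurable_funM; [exact: mf_box|exact: measurable_funX].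
- move=> x; rewrite /g indicE; case: (boolP (x \in box M)) => [|_]; last first.
    by rewrite mul0r mulr0 addr0 lexx mulr_ge0 ?sqr_ge0.
  rewrite inE mul1r mulr1 sqr_ge0 /= => /Pb h.
  have : Pm k (z n) x ^+ 2 <= d.
    rewrite -[d](sqr_sqrtr (ltW d0)) -[_ ^+ 2](real_normK (num_real _)).
    by rewrite lerXn2r ?nnegrE ?sqrtr_ge0.
  set y := z n x; set w := Pm _ _ _; have := sqr_ge0 (y - w - w); nra.
rewrite IntD; [|by apply: intgZ; case: lw|exact: intg_box].
rewrite IntZ; last by case: lw.
have -> : \int[mu]_x (2 * d * \1_(box M) x) = 2 * d * (2 * M) ^+ N.
  apply: EFin_inj; rewrite -nnI_Int; [|exact: intg_box|]; last first.
    by move=> x; rewrite indicE mulr_ge0 // mulr_ge0 // ltW.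
  rewrite nnIZ ?nnI_indic ?mu_box //; first exact: measurable_box.
  - exact: mf_box.
  - by rewrite mulr_ge0 // ltW.
rewrite -nnE (_ : e = e / 2 + e / 2); last by field.
apply: lerD; last by apply: le_trans de; rewrite mulrA [d * 2]mulrC.
apply: (@le_trans _ _ (2 * (2 ^+ N * (4^-1) ^+ k * S1 (z n) ^+ 2))); first by rewrite ler_pM2l.
apply: le_trans d2e.
have -> : d2 * (2 * 2 ^+ N * C ^+ 2) = 2 * (2 ^+ N * d2 * C ^+ 2) by ring.
rewrite ler_pM2l // ler_pM ?sqr_ge0 ?mulr_ge0 ?exprn_ge0 ?invr_ge0 //.
  by rewrite ler_wpM2l ?exprn_ge0.
by rewrite lerXn2r ?nnegrE ?S1_ge0.
Qed.

(** From the power 2 to the power s: the part above a high level is uniformly small by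
    [sobolev_tail], and below it |z|^s is at most l^(s-2) z^2. *)
Lemma rellich s (M e : R) : subcrit s -> 0 <= M -> 0 < e ->
  \forall n \near F, (nnI mu (fun x => (\1_(box M) x * `|z n x| `^ s)%R) <= e%:E)%E.
Proof.
move=> ss M0 e0; have [b [b1 bN bs]] := subcrit_level ss; have s2 := ss.1.
have r01 := rho_itv bs; have [r0 r1] := andP r01.
have CC0 : 0 <= Ctail N b s.
  rewrite /Ctail divr_ge0 ?subr_ge0 ?(ltW r1) //.
  by rewrite mulr_ge0 ?powR_ge0 // mulr_ge0 ?exprn_ge0.
have C0 : 0 <= C by apply: le_trans (zC 0); exact: S1_ge0.
pose a : R := 1 + C; have a0 : 0 < a by rewrite ltr_pwDl.
have as0 : 0 < a `^ s by rewrite powR_gt0.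
have e2 : 0 < e / 2 / a `^ s by rewrite !divr_gt0.
have [d1 d10 d1e] := mul_small CC0 e2.
have [m hm] := exp_small r01 d10.
set l := lam N b m; have l0 : 0 < l by exact: lam_gt0.
have [d d0 de] := mul_small (powR_ge0 l (s - 2)) e2.
have d0' : 0 < d * a ^+ 2 by rewrite mulr_gt0 // exprn_gt0.
apply: filterS (rellich2 M0 d0') => n Hn.
have mz := L2_mf (H1_L2 (hz n)); have mb := @mf_box R N M.
have b0 x : 0 <= \1_(box M) x :> R by rewrite indicE.
have maz : mf (fun x => a^-1 * z n x) by exact: measurable_funM.
rewrite (nnI_pow_scale s (a := a)) //.
have -> : e = a `^ s * (e / a `^ s) by rewrite mulrCA mulfV ?mulr1 ?gt_eqF.
rewrite EFinM lee_pmul2l ?lte_fin //.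
have su : S1 (fun x => a^-1 * z n x) <= 1.
  apply: le_trans (S1Z _ (hz n)) _.
  rewrite (ger0_norm (x := a^-1)) ?invr_ge0 ?(ltW a0) // mulrC ler_pdivrMr // mul1r.
  by apply: le_trans (zC n) _; rewrite lerDr.
have H := sobolev_tail b1 bN s2 bs m (H1Z a^-1 (hz n)) su; rewrite -/l in H.
have m2 : mf (fun x => \1_(box M) x * z n x ^+ 2) by apply: measurable_funM => //; exact: measurable_funX.
have c0 : 0 <= l `^ (s - 2) * a ^- 2 by rewrite mulr_ge0 ?powR_ge0 ?invr_ge0 ?sqr_ge0.
apply: (@le_trans _ _ (nnI mu (utail s l (fun x => a^-1 * z n x)%R) +
   nnI mu (fun x => (l `^ (s - 2) * a ^- 2) * (\1_(box M) x * z n x ^+ 2))%R)%E).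
  rewrite -nnID; last 4 first.
  - exact: mf_utail.
  - exact: measurable_funM.
  - by move=> x; rewrite /utail; case: ifP => // _; exact: powR_ge0.
  - by move=> x; rewrite mulr_ge0 // mulr_ge0 ?sqr_ge0.
  apply: nnI_le.
  - by apply: measurable_funM => //; exact: mf_pow.
  - by apply: measurable_funD; [exact: mf_utail|exact: measurable_funM].
  - by move=> x; rewrite mulr_ge0 ?powR_ge0.
  move=> x; rewrite /utail; case: ltP => h.
    apply: (@le_trans _ _ (`|a^-1 * z n x| `^ s)).
      by rewrite -[leRHS]mul1r ler_wpM2r ?powR_ge0 // indicE; case: (_ \in _).
    by rewrite lerDl mulr_ge0 // mulr_ge0 ?sqr_ge0.
  rewrite add0r mulrCA; apply: ler_wpM2l => //.
  rewrite (powR_split s2) // real_normK ?num_real // exprMn exprVn -mulrA; apply: ler_wpM2r.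
    by rewrite mulr_ge0 ?invr_ge0 ?sqr_ge0.
  by apply: ge0_ler_powR; rewrite ?nnegrE ?subr_ge0 // ltW.
rewrite (_ : e / _ = e / 2 / a `^ s + e / 2 / a `^ s); last by field; rewrite gt_eqF.
rewrite EFinD; apply: leeD.
  apply: le_trans H _; rewrite lee_fin mulrC; apply: le_trans d1e.
  by rewrite ler_wpM2r.
rewrite nnIZ //; last by move=> x; rewrite mulr_ge0 ?sqr_ge0.
apply: (@le_trans _ _ ((l `^ (s - 2) * a ^- 2)%:E * (d * a ^+ 2)%:E)%E).
  by apply: lee_wpmul2l => //; rewrite lee_fin.
rewrite -EFinM lee_fin; apply: le_trans de; apply: le_of_eq.
by field; rewrite gt_eqF.
Qed.

End rellich.

End subcritical.

(** * The nonlocal form *)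

Section powers.
Context (R : realType).
Implicit Types a b c s t x : R.

Lemma powRVK x a : 0 < x -> 0 <= a -> (a `^ x^-1) `^ x = a.
Proof. by move=> x0 a0; rewrite -powRrM mulVf ?powRr1 // gt_eqF. Qed.

Lemma powRKV x a : 0 < x -> 0 <= a -> (a `^ x) `^ x^-1 = a.
Proof. by move=> x0 a0; rewrite -powRrM mulfV ?powRr1 // gt_eqF. Qed.

(** The weighted inequality of means, from concavity of the logarithm. *)
Lemma amgm3 a b c s t x : 0 <= a -> 0 <= b -> 0 <= c -> 0 < s -> 0 < t -> 0 < x ->
  s + t + x = 1 -> a `^ s * b `^ t * c `^ x <= s * a + t * b + x * c.
Proof.
move=> a0 b0 c0 s0 t0 x0 E.
have P : 0 <= s * a + t * b + x * c by rewrite !addr_ge0 // mulr_ge0 // ltW.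
have [->|an] := eqVneq a 0; first by rewrite powR0 ?gt_eqF // !mul0r mulr0 add0r addr_ge0 // mulr_ge0 // ltW.
have [bE|bn] := eqVneq b 0; first by rewrite {1}bE powR0 ?gt_eqF // mulr0 mul0r.
have [cE|cn] := eqVneq c 0; first by rewrite {1}cE powR0 ?gt_eqF // mulr0.
have {a0 an}a0 : 0 < a by rewrite lt_neqAle eq_sym an.
have {b0 bn}b0 : 0 < b by rewrite lt_neqAle eq_sym bn.
have {c0 cn}c0 : 0 < c by rewrite lt_neqAle eq_sym cn.
set m := s * a + t * b + x * c.
have m0 : 0 < m by rewrite !addr_gt0 // mulr_gt0.
(* The tangent of ln at the weighted mean m; the weighted sum of the linear terms cancels. *)
have L y : 0 < y -> ln y <= ln m + (y / m - 1).
  move=> y0; have ym : 0 < y / m by rewrite divr_gt0.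
  have := @le_ln1Dx R (y / m - 1); rewrite ltrBrDl subrr => /(_ ym).
  rewrite addrC subrK lnM ?posrE ?invr_gt0 // lnV ?posrE //; lra.
rewrite /powR !gt_eqF // -!expRD -[leRHS]lnK ?posrE // ler_expR.
have h1 := ler_wpM2l (ltW s0) (L a a0); rewrite mulrDr in h1.
have h2 := ler_wpM2l (ltW t0) (L b b0); rewrite mulrDr in h2.
have h3 := ler_wpM2l (ltW x0) (L c c0); rewrite mulrDr in h3.
have Z : s * (a / m - 1) + t * (b / m - 1) + x * (c / m - 1) = 0.
  have -> : s * (a / m - 1) + t * (b / m - 1) + x * (c / m - 1) = m / m - (s + t + x) by rewrite /m; ring.
  by rewrite E mulfV ?subrr // gt_eqF.
have Z2 : s * ln m + t * ln m + x * ln m = ln m by rewrite -!mulrDl E mul1r.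
move: h1 h2 h3 Z Z2.
move: (s * (a / m - 1)) (t * (b / m - 1)) (x * (c / m - 1)).
move: (s * ln a) (t * ln b) (x * ln c) (s * ln m) (t * ln m) (x * ln m) => *; lra.
Qed.

Lemma powR_superadd a b r : 0 <= a -> 0 <= b -> 1 <= r -> a `^ r + b `^ r <= (a + b) `^ r.
Proof.
move=> a0 b0 r1; have r0 : 0 < r by lra.
have r10 : 0 <= r - 1 by lra.
have H c : 0 <= c -> c <= a + b -> c `^ r <= c * (a + b) `^ (r - 1).
  move=> c0 cab; rewrite -mulr_powRB1 //; apply: ler_wpM2l => //.
  by apply: ge0_ler_powR => //; rewrite nnegrE // addr_ge0.
apply: le_trans (lerD (H a a0 _) (H b b0 _)) _; rewrite ?lerDl ?lerDr //.
by rewrite -mulrDl mulr_powRB1 // addr_ge0.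
Qed.

Lemma powR_add_le a b r : 0 <= r -> `|a + b| `^ r <= (2 * `|a|) `^ r + (2 * `|b|) `^ r.
Proof.
move=> r0; wlog ab : a b / `|a| <= `|b|.
  by move=> H; case: (leP `|a| `|b|) => [|/ltW] h; [exact: H|rewrite addrC [leRHS]addrC; exact: H].
rewrite -[leLHS]add0r; apply: lerD; first exact: powR_ge0.
apply: ge0_ler_powR; rewrite ?nnegrE ?mulr_ge0 //.
have := ler_normD a b; lra.
Qed.

End powers.

Section Lx_bounds.
Context (R : realType) (N : nat).
Local Notation mu := (lebesgue_rV R N).
Implicit Types f g : 'rV[R]_N -> R.

(* Lebesgue exponents are recorded by their reciprocals: [x] stands for L^(1/x). *)
Definition pw (x : R) f : \bar R := nnI mu (fun y => `|f y| `^ x^-1).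

(** The L^(1/x) norm is at most s. A positive bound in place of the norm allows dividing by it
    without treating the zero function apart. *)
Definition bd (x s : R) f : Prop := [/\ mf f, 0 < s & (pw x f <= (s `^ x^-1)%:E)%E].

Lemma bd_mf x s f : bd x s f -> mf f. Proof. by case. Qed.

Lemma bd_gt0 x s f : bd x s f -> 0 < s. Proof. by case. Qed.

Lemma bd_lty x s f : bd x s f -> (pw x f < +oo)%E.
Proof. by move=> [_ _ h]; apply: le_lt_trans h _; rewrite ltry. Qed.

Lemma pw_mono x f g : 0 < x -> mf f -> mf g -> (forall y, `|f y| <= `|g y|) -> (pw x f <= pw x g)%E.
Proof.
move=> x0 mf_ mg fg; apply: nnI_le; [exact: mf_pow|exact: mf_pow|by move=> y; exact: powR_ge0|].
by move=> y; apply: ge0_ler_powR; rewrite ?nnegrE // invr_ge0 ltW.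
Qed.

Lemma bd_mono x s t f g : 0 < x -> mf f -> (forall y, `|f y| <= `|g y|) -> s <= t -> bd x s g -> bd x t f.
Proof.
move=> x0 mf_ fg st [mg s0 h]; split => //; first exact: lt_le_trans st.
apply: le_trans (pw_mono x0 mf_ mg fg) _; apply: le_trans h _; rewrite lee_fin.
by apply: ge0_ler_powR => //; rewrite ?nnegrE ?invr_ge0 ?(ltW x0) ?(ltW s0) // (le_trans (ltW s0)).
Qed.

Lemma bdW x s t f : 0 < x -> s <= t -> bd x s f -> bd x t f.
Proof. by move=> x0 st h; apply: (bd_mono x0 (bd_mf h) _ st h). Qed.

Lemma bdZ x s f c : 0 < x -> c != 0 -> bd x s f -> bd x (`|c| * s) (fun y => c * f y).
Proof.
move=> x0 c0 [mf_ s0 h]; split; [exact: measurable_funM|by rewrite mulr_gt0 // normr_gt0|].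
rewrite /pw; have -> : (fun y => `|c * f y| `^ x^-1) = fun y => `|c| `^ x^-1 * `|f y| `^ x^-1.
  by apply/funext => y; rewrite normrM powRM.
rewrite nnIZ ?powR_ge0 //; last exact: mf_pow.
by rewrite powRM ?(ltW s0) // EFinM; apply: lee_wpmul2l; rewrite ?lee_fin ?powR_ge0.
Qed.

(** A cheap substitute for Minkowski's inequality; the factor 2 comes from bounding |a + b| by twice
    the larger term. *)
Lemma bdD x s t f g : 0 < x -> x <= 1 -> bd x s f -> bd x t g -> bd x (2 * (s + t)) (fun y => f y + g y).
Proof.
move=> x0 x1 bf bg; have [mf_ s0 hf] := bf; have [mg t0 hg] := bg.
have [m2f s20 h2f] : bd x (`|2| * s) (fun y => 2 * f y) by apply: bdZ.
have [m2g t20 h2g] : bd x (`|2| * t) (fun y => 2 * g y) by apply: bdZ.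
have n2 : `|2 : R| = 2 by rewrite ger0_norm.
rewrite n2 in s20 h2f t20 h2g.
split; [exact: measurable_funD|by rewrite mulr_gt0 // addr_gt0|].
apply: (@le_trans _ _ (pw x (fun y => 2 * f y)%R + pw x (fun y => 2 * g y)%R)%E).
  rewrite /pw -nnID; [|exact: mf_pow|exact: mf_pow|by move=> y; exact: powR_ge0|by move=> y; exact: powR_ge0].
  apply: nnI_le; [by apply: mf_pow; exact: measurable_funD|by apply: measurable_funD; exact: mf_pow|..].
    by move=> y; exact: powR_ge0.
  move=> y; rewrite !normrM n2; apply: powR_add_le; by rewrite invr_ge0 ltW.
apply: le_trans (leeD h2f h2g) _; rewrite -EFinD lee_fin mulrDr; apply: powR_superadd => //; try exact: ltW.
by rewrite -[1]invr1 lef_pV2 ?posrE.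
Qed.

Lemma bd_ex x f : 0 < x -> mf f -> (pw x f < +oo)%E -> exists s, bd x s f.
Proof.
move=> x0 mf_ h.
have p0 : (0 <= pw x f)%E by apply: nnI_ge0 => y; exact: powR_ge0.
have E : pw x f = (fine (pw x f))%:E by rewrite fineK // ge0_fin_numE.
have q0 : 0 <= fine (pw x f) by rewrite fine_ge0.
exists ((1 + fine (pw x f)) `^ x); split => //; first by rewrite powR_gt0 // ltr_pwDl.
by rewrite powRKV ?addr_ge0 // E lee_fin lerDr.
Qed.

End Lx_bounds.

(** * Young's inequality for three functions *)

Section trilinear.
Context (R : realType) (N : nat).
Local Notation mu := (lebesgue_rV R N).
Local Notation mu2 := (mu \x mu)%E.
Implicit Types f g k : 'rV[R]_N -> R.

Lemma mf_fst f : mf f -> mf (fun z : 'rV[R]_N * 'rV[R]_N => f z.1).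
Proof. by move=> m; exact: (measurableT_comp m measurable_fst). Qed.

Lemma mf_snd f : mf f -> mf (fun z : 'rV[R]_N * 'rV[R]_N => f z.2).
Proof. by move=> m; exact: (measurableT_comp m measurable_snd). Qed.

Lemma mf_dif k : mf k -> mf (fun z : 'rV[R]_N * 'rV[R]_N => k (z.1 - z.2)).
Proof. by move=> m; exact: (measurableT_comp m (@measurable_rV_sub R N)). Qed.

Lemma nnI2_xy (h : 'rV[R]_N * 'rV[R]_N -> R) : mf h -> (forall z, 0 <= h z) ->
  nnI mu2 h = (\int[mu]_x nnI mu (fun y => h (x, y)))%E.
Proof. by move=> mh h0; apply: fubini_tonelli1 => [|z]; [exact/measurable_EFinP|rewrite lee_fin]. Qed.

Lemma nnI2_yx (h : 'rV[R]_N * 'rV[R]_N -> R) : mf h -> (forall z, 0 <= h z) ->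
  nnI mu2 h = (\int[mu]_y nnI mu (fun x => h (x, y)))%E.
Proof. by move=> mh h0; apply: fubini_tonelli2 => [|z]; [exact/measurable_EFinP|rewrite lee_fin]. Qed.

Lemma nnI_sub k x : mf k -> (forall y, 0 <= k y) -> nnI mu (fun y => k (x - y)) = nnI mu k.
Proof.
move=> mk k0; have mk' : mf (fun y : 'rV[R]_N => k (y + x)) by exact: (mf_comp (measurable_rV_add x) mk).
transitivity (nnI mu (fun y => k (- y + x))); first by congr nnI; apply/funext => y; rewrite addrC.
by rewrite (nnI_opp (f := fun y => k (y + x))) // nnI_trn.
Qed.

Lemma Int_nnI_mul f (c : \bar R) : mf f -> (forall x, 0 <= f x) -> (0 <= c)%E ->
  (\int[mu]_x ((f x)%:E * c) = nnI mu f * c)%E.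
Proof.
move=> mf_ f0 c0; rewrite (@ge0_integralZr _ _ _ _ setT) //; first exact/measurable_EFinP.
by move=> x _; rewrite lee_fin.
Qed.

Lemma nnI2_prod f g : mf f -> mf g -> (forall x, 0 <= f x) -> (forall x, 0 <= g x) ->
  nnI mu2 (fun z => f z.2 * g z.1) = (nnI mu f * nnI mu g)%E.
Proof.
move=> mf_ mg f0 g0; rewrite nnI2_yx; last 2 first.
- by apply: measurable_funM; [exact: mf_snd|exact: mf_fst].
- by move=> z; rewrite mulr_ge0.
rewrite -Int_nnI_mul //; last exact: nnI_ge0.
by apply: eq_integral => y _; rewrite /= nnIZ.
Qed.

Lemma nnI2_conv1 k g : mf k -> mf g -> (forall x, 0 <= k x) -> (forall x, 0 <= g x) ->
  nnI mu2 (fun z => k (z.1 - z.2) * g z.1) = (nnI mu k * nnI mu g)%E.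
Proof.
move=> mk mg k0 g0; rewrite nnI2_xy; last 2 first.
- by apply: measurable_funM; [exact: mf_dif|exact: mf_fst].
- by move=> z; rewrite mulr_ge0.
rewrite muleC -Int_nnI_mul //; last exact: nnI_ge0.
apply: eq_integral => x _ /=; under [X in nnI mu X]eq_fun do rewrite mulrC.
rewrite nnIZ ?nnI_sub //.
exact: (measurableT_comp (mf_dif mk) (measurable_pair1 x)).
Qed.

Lemma nnI2_conv2 f k : mf f -> mf k -> (forall x, 0 <= f x) -> (forall x, 0 <= k x) ->
  nnI mu2 (fun z => f z.2 * k (z.1 - z.2)) = (nnI mu f * nnI mu k)%E.
Proof.
move=> mf_ mk f0 k0; rewrite nnI2_yx; last 2 first.
- by apply: measurable_funM; [exact: mf_snd|exact: mf_dif].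
- by move=> z; rewrite mulr_ge0.
rewrite -Int_nnI_mul //; last exact: nnI_ge0.
apply: eq_integral => y _ /=; rewrite nnIZ ?nnI_trn //.
exact: (mf_comp (measurable_rV_add (- y)) mk).
Qed.

(** After normalisation to F, K, G of integral at most 1, the integrand is F^x K^(2-2x) G^x. This is
    the geometric mean of FG, FK and KG with weights 2x-1, 1-x, 1-x, and each of these products has
    double integral at most 1. *)
Lemma trilinear (x s t c : R) f g k : 2^-1 < x -> x < 1 ->
  bd x s f -> bd x t g -> bd (2 - 2 * x) c k ->
  (nnI mu2 (fun z => `|f z.2| * `|k (z.1 - z.2)| * `|g z.1|)%R <= (c * s * t)%:E)%E.
Proof.
move=> x2 x1 [mf_ s0 hf] [mg t0 hg] [mk c0 hk].
have x0 : 0 < x by lra.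
set y := 2 - 2 * x; have y0 : 0 < y by rewrite /y; lra.
pose nrm (z a : R) (h : 'rV[R]_N -> R) w := `|a^-1 * h w| `^ z^-1.
have nP (z a : R) h : mf h -> 0 < z -> 0 < a -> (pw z h <= (a `^ z^-1)%:E)%E ->
    [/\ mf (nrm z a h), forall w, 0 <= nrm z a h w, (nnI mu (nrm z a h) <= 1%:E)%E &
      forall w, `|h w| = a * nrm z a h w `^ z].
  move=> mh z0 a0 hh; split.
  - by apply: mf_pow; exact: measurable_funM.
  - by move=> w; exact: powR_ge0.
  - have [] : bd z (`|a^-1| * a) (fun w => a^-1 * h w) by apply: bdZ => //; rewrite invr_neq0 ?gt_eqF.
    by rewrite gtr0_norm ?invr_gt0 // mulVf ?gt_eqF // powR1.
  - by move=> w; rewrite /nrm powRVK // normrM gtr0_norm ?invr_gt0 // mulVKf // gt_eqF.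
have [mF F0 F1 FE] := nP x s f mf_ x0 s0 hf.
have [mG G0 G1 GE] := nP x t g mg x0 t0 hg.
have [mK K0 K1 KE] := nP y c k mk y0 c0 hk.
move: (nrm x s f) (nrm x t g) (nrm y c k) mF F0 F1 FE mG G0 G1 GE mK K0 K1 KE => F G K.
move=> mF F0 F1 FE mG G0 G1 GE mK K0 K1 KE.
have mFz := mf_snd mF; have mGz := mf_fst mG; have mKz := mf_dif mK.
pose A (z : 'rV[R]_N * 'rV[R]_N) := F z.2 * G z.1.
pose B (z : 'rV[R]_N * 'rV[R]_N) := F z.2 * K (z.1 - z.2).
pose C (z : 'rV[R]_N * 'rV[R]_N) := K (z.1 - z.2) * G z.1.
have A0 z : 0 <= A z by rewrite mulr_ge0.
have B0 z : 0 <= B z by rewrite mulr_ge0.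
have C0 z : 0 <= C z by rewrite mulr_ge0.
have mA : mf A by exact: measurable_funM.
have mB : mf B by exact: measurable_funM.
have mC : mf C by exact: measurable_funM.
have le1 (a b : \bar R) : (0 <= a -> a <= 1%:E -> 0 <= b -> b <= 1%:E -> a * b <= 1%:E)%E.
  by move=> a0 a1 b0 b1; rewrite -[leRHS]mule1; exact: lee_pmul.
have IA : (nnI mu2 A <= 1%:E)%E by rewrite nnI2_prod //; apply: le1 => //; exact: nnI_ge0.
have IB : (nnI mu2 B <= 1%:E)%E by rewrite nnI2_conv2 //; apply: le1 => //; exact: nnI_ge0.
have IC : (nnI mu2 C <= 1%:E)%E by rewrite nnI2_conv1 //; apply: le1 => //; exact: nnI_ge0.
have th : 0 < 2 * x - 1 by lra.
have th2 : 0 < 1 - x by lra.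
have q0 : 0 <= c * s * t by rewrite !mulr_ge0 // ltW.
pose H z := c * s * t * ((2 * x - 1) * A z + (1 - x) * B z + (1 - x) * C z).
have mH : mf H by repeat (apply: measurable_funM || apply: measurable_funD).
apply: (@le_trans _ _ (nnI mu2 H)).
  apply: nnI_le => //.
  - apply: measurable_funM; [apply: measurable_funM|].
    + by apply: measurableT_comp => //; exact: mf_snd.
    + by apply: measurableT_comp => //; exact: mf_dif.
    + by apply: measurableT_comp => //; exact: mf_fst.
  move=> z; rewrite FE KE GE.
  rewrite (_ : s * _ * _ * _ = c * s * t * (F z.2 `^ x * K (z.1 - z.2) `^ y * G z.1 `^ x)); last by ring.
  apply: ler_wpM2l => //.
  have th3 : 2 * x - 1 + (1 - x) + (1 - x) = 1 by ring.
  apply: le_trans (amgm3 (A0 z) (B0 z) (C0 z) th th2 th2 th3); rewrite /A /B /C !powRM //.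
  rewrite [leRHS](_ : _ = (F z.2 `^ (2 * x - 1) * F z.2 `^ (1 - x)) *
      (K (z.1 - z.2) `^ (1 - x) * K (z.1 - z.2) `^ (1 - x)) *
      (G z.1 `^ (2 * x - 1) * G z.1 `^ (1 - x))); last by ring.
  rewrite -!powRD; last 3 first.
  - by apply/implyP => /eqP ?; exfalso; lra.
  - by apply/implyP => /eqP ?; exfalso; lra.
  - by apply/implyP => /eqP ?; exfalso; lra.
  rewrite (_ : 2 * x - 1 + (1 - x) = x); last by ring.
  by rewrite (_ : 1 - x + (1 - x) = y) // /y; ring.
have mHA : mf (fun z => (2 * x - 1) * A z) by exact: measurable_funM.
have mHB : mf (fun z => (1 - x) * B z) by exact: measurable_funM.
have mHC : mf (fun z => (1 - x) * C z) by exact: measurable_funM.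
have HA0 z : 0 <= (2 * x - 1) * A z by rewrite mulr_ge0 // ltW.
have HB0 z : 0 <= (1 - x) * B z by rewrite mulr_ge0 // ltW.
have HC0 z : 0 <= (1 - x) * C z by rewrite mulr_ge0 // ltW.
rewrite nnIZ //; last 2 first.
- by apply: measurable_funD => //; exact: measurable_funD.
- by move=> z; rewrite !addr_ge0.
rewrite !nnID //; last 2 first.
- exact: measurable_funD.
- by move=> z; rewrite addr_ge0.
rewrite !nnIZ //; try exact: ltW.
rewrite -[leRHS]mule1; apply: lee_wpmul2l; first by rewrite lee_fin.
have -> : 1%E = ((2 * x - 1)%:E * 1%:E + (1 - x)%:E * 1%:E + (1 - x)%:E * 1%:E)%E :> \bar R.
  by rewrite -!EFinM -!EFinD; congr EFin; ring.
by apply: leeD; [apply: leeD|]; apply: lee_wpmul2l => //; rewrite lee_fin ltW.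
Qed.

End trilinear.

Opaque nnI.

Section cutoff.
Context (R : realType) (N : nat).
Local Notation mu := (lebesgue_rV R N).
Implicit Types f g k : 'rV[R]_N -> R.

Definition inn (M : R) f : 'rV[R]_N -> R := fun x => \1_(box M) x * f x.
Definition out (M : R) f : 'rV[R]_N -> R := fun x => \1_(~` box M) x * f x.

Lemma innE M f x : inn M f x = if `|x| <= M then f x else 0.
Proof.
rewrite /inn indicE; case: ifP => h; first by rewrite mem_set ?mul1r.
by rewrite memNset ?mul0r // /box /= h.
Qed.

Lemma outE M f x : out M f x = if `|x| <= M then 0 else f x.
Proof.
rewrite /out indicE; case: ifP => h; first by rewrite memNset ?mul0r //; apply.
by rewrite mem_set ?mul1r // /box /= h.
Qed.

Lemma mf_inn M f : mf f -> mf (inn M f).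
Proof. by move=> m; apply: measurable_funM => //; exact: mf_box. Qed.

Lemma mf_out M f : mf f -> mf (out M f).
Proof.
move=> m; apply: measurable_funM => //; apply/measurable_indicP.
by apply: measurableC; exact: measurable_box.
Qed.

Lemma abs_inn_le M f x : `|inn M f x| <= `|f x|.
Proof. by rewrite innE; case: ifP => // _; rewrite normr0. Qed.

Lemma abs_out_le M f x : `|out M f x| <= `|f x|.
Proof. by rewrite outE; case: ifP => // _; rewrite normr0. Qed.

(** Dominated convergence: at each point the part outside a large box is eventually 0. *)
Lemma bd_tail (x s e : R) f : 0 < x -> bd x s f -> 0 < e ->
  exists M, forall L, M <= L -> bd x e (out L f).
Proof.
move=> x0 b e0; have [mf_ s0 h] := b.
have ip : intg mu (fun y => `|f y| `^ x^-1).
  by apply: intg_ge0P (bd_lty b); [exact: mf_pow|move=> y; exact: powR_ge0].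
have mo n : mf (fun y => `|out n f y| `^ x^-1) by apply: mf_pow; exact: mf_out.
have D : (\int[mu]_y (`|out n%:R f y| `^ x^-1)) @[n --> \oo] --> \int[mu]_y (0 : R).
  apply: (dct (g := fun y => `|f y| `^ x^-1)) => //.
    move=> n y; rewrite ger0_norm ?powR_ge0 //; apply: ge0_ler_powR; rewrite ?nnegrE //.
      by rewrite invr_ge0 ltW.
    exact: abs_out_le.
  apply: aeW => y; apply: cvg_near_cst; exists (Num.truncn `|y|).+1 => // n /= yn.
  rewrite outE ifT ?normr0 ?powR0 ?invr_neq0 ?gt_eqF //.
  by apply: le_trans (ltW (truncnS_gt _)) _; rewrite ler_nat.
rewrite Int0 in D; move/cvgrPdist_le : D => /(_ (e `^ x^-1)); rewrite powR_gt0 // => /(_ isT).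
move=> [n _ /(_ n (leqnn n))] /=; rewrite sub0r normrN ger0_norm; last by apply: Int_ge0 => y; exact: powR_ge0.
move=> H; have io : intg mu (fun y => `|out n%:R f y| `^ x^-1).
  apply: intg_le ip => // y; rewrite ger0_norm ?powR_ge0 //; apply: ge0_ler_powR; rewrite ?nnegrE //.
    by rewrite invr_ge0 ltW.
  exact: abs_out_le.
have bn : bd x e (out n%:R f).
  split => //; first exact: mf_out.
  by rewrite /pw nnI_Int ?lee_fin // => y; exact: powR_ge0.
exists n%:R => L nL; apply: bd_mono bn => //; first exact: mf_out.
move=> y; rewrite !outE; case: (leP `|y| n%:R) => yn; first by rewrite (le_trans yn nL).
by case: ifP => //; rewrite normr0.
Qed.

End cutoff.

Opaque pw.

(** * The bilinear form of a split kernel *)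

Section form.
Context (R : realType) (N : nat).
Local Notation mu := (lebesgue_rV R N).
Local Notation mu2 := (mu \x mu)%E.
Implicit Types f g k : 'rV[R]_N -> R.

Definition kern k f g (z : 'rV[R]_N * 'rV[R]_N) : R := f z.2 * k (z.1 - z.2) * g z.1.

Definition form k f g : R := \int[mu2]_z kern k f g z.

(** One bound in both Lebesgue spaces: each half of the kernel is paired with its own space. *)
Definition adm (x1 x2 s : R) f : Prop := bd x1 s f /\ bd x2 s f.

(* Each half [k_i] is in the space dual, for Young's inequality, to two factors in L^(1/x_i). *)
Definition good_kernel (x1 x2 : R) k : Prop :=
  [/\ 2^-1 < x1 < 1, 2^-1 < x2 < 1, forall z, k (- z) = k z, forall z, z != 0 -> 0 < k z &
   exists k1 k2, [/\ mf k1 /\ mf k2, forall z, 0 <= k1 z /\ 0 <= k2 z,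
     forall z, k z = k1 z + k2 z, (pw (2 - 2 * x1) k1 < +oo)%E & (pw (2 - 2 * x2) k2 < +oo)%E]].

Lemma mf_kern k f g : mf k -> mf f -> mf g -> mf (kern k f g).
Proof.
move=> mk mf_ mg; apply: measurable_funM; last exact: mf_fst.
by apply: measurable_funM; [exact: mf_snd|exact: mf_dif].
Qed.

Lemma kern_bound x1 x2 (c1 c2 s t : R) k k1 k2 f g :
  2^-1 < x1 < 1 -> 2^-1 < x2 < 1 -> mf k -> (forall z, `|k z| <= `|k1 z| + `|k2 z|) ->
  bd (2 - 2 * x1) c1 k1 -> bd (2 - 2 * x2) c2 k2 -> adm x1 x2 s f -> adm x1 x2 t g ->
  (nnI mu2 (fun z => `|kern k f g z|)%R <= ((c1 + c2) * s * t)%:E)%E.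
Proof.
move=> /andP[a1 b1] /andP[a2 b2] mk kk h1 h2 [f1 f2] [g1 g2].
have T1 := trilinear a1 b1 f1 g1 h1; have T2 := trilinear a2 b2 f2 g2 h2.
have mf_ := bd_mf f1; have mg := bd_mf g1; have mk1 := bd_mf h1; have mk2 := bd_mf h2.
have m k' : mf k' -> mf (fun z : 'rV[R]_N * 'rV[R]_N => `|f z.2| * `|k' (z.1 - z.2)| * `|g z.1|).
  move=> mk'; apply: measurable_funM; [apply: measurable_funM|];
    apply: measurableT_comp => //; [exact: mf_snd|exact: mf_dif|exact: mf_fst].
apply: (@le_trans _ _ (nnI mu2 (fun z => `|f z.2| * `|k1 (z.1 - z.2)| * `|g z.1|)%R +
   nnI mu2 (fun z => `|f z.2| * `|k2 (z.1 - z.2)| * `|g z.1|)%R)%E).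
  rewrite -nnID; [|exact: m|exact: m|by move=> z; rewrite !mulr_ge0|by move=> z; rewrite !mulr_ge0].
  apply: nnI_le.
  - by apply: measurableT_comp => //; exact: mf_kern.
  - by apply: measurable_funD; exact: m.
  - by move=> z; exact: normr_ge0.
  - by move=> z; rewrite /kern !normrM -mulrDl -mulrDr ler_wpM2r // ler_wpM2l.
by apply: le_trans (leeD T1 T2) _; rewrite -EFinD lee_fin -!mulrDl.
Qed.

Section fixed_kernel.
Variables (k : 'rV[R]_N -> R) (x1 x2 : R).
Hypothesis KS : good_kernel x1 x2 k.
Local Notation adm := (adm x1 x2).
Local Notation form := (form k).

Lemma gk_x1 : 2^-1 < x1 /\ x1 < 1. Proof. by case: KS => /andP[]. Qed.

Lemma gk_x2 : 2^-1 < x2 /\ x2 < 1. Proof. by case: KS => _ /andP[]. Qed.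

Lemma gk_gt0 : 0 < x1 /\ 0 < x2.
Proof. by have [? _] := gk_x1; have [? _] := gk_x2; split; lra. Qed.

Lemma gk_mf : mf k.
Proof.
case: KS => _ _ _ _ [k1 [k2 [[m1 m2] _ E _ _]]].
by rewrite (_ : k = fun z => k1 z + k2 z); [exact: measurable_funD|exact/funext].
Qed.

Lemma gk_ge0 z : 0 <= k z.
Proof.
case: KS => _ _ _ _ [k1 [k2 [_ k0 E _ _]]]; rewrite E.
by have [? ?] := k0 z; exact: addr_ge0.
Qed.

Lemma gk_even z : k (- z) = k z. Proof. by case: KS. Qed.

Lemma adm_mf s f : adm s f -> mf f. Proof. by case=> /bd_mf. Qed.

Lemma adm_gt0 s f : adm s f -> 0 < s. Proof. by case=> /bd_gt0. Qed.

Lemma adm_mono s t f g : mf f -> (forall y, `|f y| <= `|g y|) -> s <= t -> adm s g -> adm t f.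
Proof.
have [a1 a2] := gk_gt0.
by move=> mf_ fg st [h1 h2]; split; [apply: bd_mono h1|apply: bd_mono h2].
Qed.

Lemma admW s t f : s <= t -> adm s f -> adm t f.
Proof. by move=> st h; apply: (adm_mono (adm_mf h) _ st h). Qed.

Lemma admZ s f c : c != 0 -> adm s f -> adm (`|c| * s) (fun y => c * f y).
Proof. by have [a1 a2] := gk_gt0; move=> c0 [h1 h2]; split; exact: bdZ. Qed.

Lemma admD s t f g : adm s f -> adm t g -> adm (2 * (s + t)) (fun y => f y + g y).
Proof.
have [a1 a2] := gk_gt0; have [_ b1] := gk_x1; have [_ b2] := gk_x2.
by move=> [h1 h2] [l1 l2]; split; apply: bdD => //; exact: ltW.
Qed.

Lemma adm_tail s f e : adm s f -> 0 < e -> exists M, forall L, M <= L -> adm e (out L f).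
Proof.
have [a1 a2] := gk_gt0; move=> [h1 h2] e0.
have [M1 H1] := bd_tail a1 h1 e0; have [M2 H2] := bd_tail a2 h2 e0.
exists (Num.max M1 M2) => L; rewrite ge_max => /andP[l1 l2]; split; [exact: H1|exact: H2].
Qed.

Lemma form_bound : exists2 c : R, 0 < c & forall s t f g, adm s f -> adm t g ->
  (nnI mu2 (fun z => `|kern k f g z|)%R <= (c * s * t)%:E)%E.
Proof.
have [a1 b1] := gk_x1; have [a2 b2] := gk_x2.
case: KS => i1 i2 _ _ [k1 [k2 [[m1 m2] k0 E p1 p2]]].
have y1 : 0 < 2 - 2 * x1 by lra.
have y2 : 0 < 2 - 2 * x2 by lra.
have [c1 B1] := bd_ex y1 m1 p1; have [c2 B2] := bd_ex y2 m2 p2.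
exists (c1 + c2); first by rewrite addr_gt0 ?(bd_gt0 B1) ?(bd_gt0 B2).
move=> s t f g af ag; apply: (kern_bound i1 i2 gk_mf _ B1 B2 af ag) => z.
by rewrite E ler_normD.
Qed.

(** If the supports are further apart than L, only the part of the kernel outside the box of radius
    L is seen, and its two halves have small norms. *)
Lemma form_tail e : 0 < e -> exists2 L : R, 0 <= L & forall s t f g, adm s f -> adm t g ->
  (forall x y, f y != 0 -> g x != 0 -> L < `|x - y|) ->
  (nnI mu2 (fun z => `|kern k f g z|)%R <= (e * s * t)%:E)%E.
Proof.
move=> e0; have [a1 b1] := gk_x1; have [a2 b2] := gk_x2.
case: KS => i1 i2 _ _ [k1 [k2 [[m1 m2] k0 E p1 p2]]].
have y1 : 0 < 2 - 2 * x1 by lra.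
have y2 : 0 < 2 - 2 * x2 by lra.
have e2 : 0 < e / 2 by rewrite divr_gt0.
have [c1 B1] := bd_ex y1 m1 p1; have [c2 B2] := bd_ex y2 m2 p2.
have [M1 H1] := bd_tail y1 B1 e2; have [M2 H2] := bd_tail y2 B2 e2.
pose L := Num.max 0 (Num.max M1 M2); have L0 : 0 <= L by rewrite le_max lexx.
have B1' : bd (2 - 2 * x1) (e / 2) (out L k1) by apply: H1; rewrite /L !le_max lexx !orbT.
have B2' : bd (2 - 2 * x2) (e / 2) (out L k2) by apply: H2; rewrite /L !le_max lexx !orbT.
exists L => // s t f g af ag sep.
have -> : e = e / 2 + e / 2 by field.
have -> : (fun z => `|kern k f g z|) = (fun z => `|kern (out L k) f g z|).
  apply/funext => z; rewrite /kern; congr (`|_|).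
  have [->|f0] := eqVneq (f z.2) 0; first by rewrite !mul0r.
  have [->|g0] := eqVneq (g z.1) 0; first by rewrite !mulr0.
  by rewrite outE leNgt (sep _ _ f0 g0).
apply: (kern_bound i1 i2 _ _ B1' B2' af ag); first by apply: mf_out; exact: gk_mf.
by move=> z; rewrite !outE; case: ifP => _; rewrite ?normr0 ?addr0 // E ler_normD.
Qed.

Lemma form_intg s t f g : adm s f -> adm t g -> intg mu2 (kern k f g).
Proof.
move=> af ag; have [c c0 H] := form_bound; apply: intgP.
  by apply: mf_kern; [exact: gk_mf|exact: adm_mf af|exact: adm_mf ag].
by apply: le_lt_trans (H _ _ _ _ af ag) _; rewrite ltry.
Qed.

Lemma abs_form_le s t c f g : adm s f -> adm t g ->
  (nnI mu2 (fun z => `|kern k f g z|)%R <= c%:E)%E -> `|form f g| <= c.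
Proof.
move=> af ag h; have i := form_intg af ag; apply: le_trans (Int_abs i) _.
by rewrite -lee_fin -nnI_Int //; exact: intg_abs.
Qed.

Lemma form_le : exists2 c : R, 0 < c & forall s t f g, adm s f -> adm t g ->
  `|form f g| <= c * s * t.
Proof.
have [c c0 H] := form_bound; exists c => // s t f g af ag.
exact: (abs_form_le af ag (H _ _ _ _ af ag)).
Qed.

Lemma form_tail_le e : 0 < e -> exists2 L : R, 0 <= L & forall s t f g, adm s f -> adm t g ->
  (forall x y, f y != 0 -> g x != 0 -> L < `|x - y|) -> `|form f g| <= e * s * t.
Proof.
move=> e0; have [L L0 H] := form_tail e0; exists L => // s t f g af ag sep.
exact: (abs_form_le af ag (H _ _ _ _ af ag sep)).
Qed.

Lemma form_linl s t r a f1 f2 g : adm s f1 -> adm t f2 -> adm r g ->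
  form (fun x => a * f1 x + f2 x) g = a * form f1 g + form f2 g.
Proof.
move=> h1 h2 h3; have i1 := form_intg h1 h3; have i2 := form_intg h2 h3.
rewrite /form -IntZ // -IntD //; last exact: intgZ.
by apply: eq_Rintegral => z _; rewrite /kern; ring.
Qed.

Lemma form_linr s t r a f1 f2 g : adm s f1 -> adm t f2 -> adm r g ->
  form g (fun x => a * f1 x + f2 x) = a * form g f1 + form g f2.
Proof.
move=> h1 h2 h3; have i1 := form_intg h3 h1; have i2 := form_intg h3 h2.
rewrite /form -IntZ // -IntD //; last exact: intgZ.
by apply: eq_Rintegral => z _; rewrite /kern; ring.
Qed.

Lemma form_ge0 f g : (forall x, 0 <= f x) -> (forall x, 0 <= g x) -> 0 <= form f g.
Proof. by move=> f0 g0; apply: Int_ge0 => z; rewrite !mulr_ge0 // gk_ge0. Qed.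

Lemma form_mono s t f g f' g' : (forall x, 0 <= f x <= f' x) -> (forall x, 0 <= g x <= g' x) ->
  mf f -> mf g -> adm s f' -> adm t g' -> form f g <= form f' g'.
Proof.
move=> ff gg mf_ mg af ag.
have pf y : `|f y| <= `|f' y| by have /andP[a b] := ff y; rewrite !ger0_norm // (le_trans a).
have pg y : `|g y| <= `|g' y| by have /andP[a b] := gg y; rewrite !ger0_norm // (le_trans a).
apply: Int_le; [|exact: form_intg af ag|].
  exact: (form_intg (adm_mono mf_ pf (lexx _) af) (adm_mono mg pg (lexx _) ag)).
move=> z; rewrite /kern; have /andP[a b] := ff z.2; have /andP[c d] := gg z.1.
by apply: ler_pM => //; rewrite ?mulr_ge0 ?gk_ge0 // ler_wpM2r // gk_ge0.
Qed.

Lemma formC s t f g : adm s f -> adm t g -> form f g = form g f.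
Proof.
move=> af ag; have i := form_intg ag af.
have ms : measurable_fun setT (fun z : 'rV[R]_N * 'rV[R]_N => (z.2, z.1)).
  by apply: measurable_fun_pair; [exact: measurable_snd|exact: measurable_fst].
rewrite /form -(Int_comp ms _ i); last first.
  move=> h mh h0; rewrite nnI2_xy; [|exact: (mf_comp ms mh)|by move=> z].
  by rewrite [RHS]nnI2_yx.
by apply: eq_Rintegral => z _; rewrite /kern /= -opprB gk_even; ring.
Qed.

Lemma form_trn s t (a : 'rV[R]_N) f g : adm s f -> adm t g -> form (trn a f) (trn a g) = form f g.
Proof.
move=> af ag; have i := form_intg af ag.
have m1 := @measurable_rV_add R N a.
have ms2 : measurable_fun setT (fun z : 'rV[R]_N * 'rV[R]_N => (z.1, z.2 + a)).
  by apply: measurable_fun_pair; [exact: measurable_fst|exact: (measurableT_comp m1 measurable_snd)].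
have ms : measurable_fun setT (fun z : 'rV[R]_N * 'rV[R]_N => (z.1 + a, z.2 + a)).
  by apply: measurable_fun_pair;
   [exact: (measurableT_comp m1 measurable_fst)|exact: (measurableT_comp m1 measurable_snd)].
rewrite /form -(Int_comp ms _ i); last first.
  move=> h mh h0; transitivity (nnI mu2 (fun z => h (z.1, z.2 + a))).
    have mhs : mf (fun z : 'rV[R]_N * 'rV[R]_N => h (z.1 + a, z.2 + a)) by exact: (measurableT_comp mh ms).
    rewrite (nnI2_yx mhs); last by move=> z; exact: h0.
    rewrite nnI2_yx; [|exact: (measurableT_comp mh ms2)|by move=> z; exact: h0].
    apply: eq_integral => y _ /=.
    apply: (nnI_trn a (f := fun x : 'rV[R]_N => h (x, y + a))) => [|x]; last exact: h0.
    exact: (measurableT_comp mh (measurable_pair2 _)).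
  rewrite nnI2_xy; [|exact: (measurableT_comp mh ms2)|by move=> z; exact: h0].
  rewrite (nnI2_xy mh h0); apply: eq_integral => x _ /=.
  apply: (nnI_trn a (f := fun y : 'rV[R]_N => h (x, y))) => [|y]; last exact: h0.
  exact: (measurableT_comp mh (measurable_pair1 _)).
apply: eq_Rintegral => z _; rewrite /kern /trn /=.
by congr (_ * k _ * _); rewrite opprD addrACA subrr addr0.
Qed.

Lemma ae_neq (x : 'rV[R]_N) : (0 < N)%N -> {ae mu, forall y, y != x}.
Proof.
move=> N0; pose A : set 'rV[R]_N := [set y | box 0 (y + - x)].
have mA : measurable A.
  by rewrite -[A]setTI; apply: (measurable_rV_add (- x)) => //; exact: measurable_box.
exists A; split => //; last first.
  by move=> y /= /negP; rewrite negbK => /eqP ->; rewrite /A /box /= subrr normr0.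
rewrite -nnI_indic //; transitivity (nnI mu (fun y : 'rV[R]_N => \1_(box 0) (y + - x) : R)).
  by congr nnI; apply/funext => y; rewrite !indicE.
rewrite (nnI_trn (- x) (f := \1_(box 0))); [|exact: mf_box|by move=> y; rewrite indicE].
by rewrite nnI_indic ?mu_box ?mulr0 ?expr0n ?gtn_eqF //; exact: measurable_box.
Qed.

(** The kernel is positive off the diagonal, which is null when N > 0. A single slice at a point x
    with g(x) nonzero therefore forces f to vanish almost everywhere; if there is no such slice, g
    vanishes. *)
Lemma form_eq0 s t f g : (0 < N)%N -> adm s f -> adm t g -> (forall x, 0 <= f x) -> (forall x, 0 <= g x) ->
  form f g = 0 -> {ae mu, forall x, f x = 0} \/ {ae mu, forall x, g x = 0}.
Proof.
move=> N0 af ag f0 g0 E; have i := form_intg af ag.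
have mK := mf_kern gk_mf (adm_mf af) (adm_mf ag).
have K0 z : 0 <= kern k f g z by rewrite !mulr_ge0 // gk_ge0.
pose F x := nnI mu (fun y => kern k f g (x, y)).
have F0 x : (0 <= F x)%E by apply: nnI_ge0.
have mF : measurable_fun setT F.
  apply: (measurable_fun_fubini_tonelli_F (fun z => (kern k f g z)%:E)) => [|z]; last by rewrite lee_fin.
  exact/measurable_EFinP.
have H : {ae mu, forall x, F x = 0%E}.
  have : (\int[mu]_x `|F x| = 0)%E.
    transitivity (nnI mu2 (kern k f g)).
      by rewrite nnI2_xy //; apply: eq_integral => x _; rewrite gee0_abs.
    by rewrite nnI_Int // -/(form f g) E.
  by move/(ae_eq_integral_abs mu measurableT mF); apply: filterS => x; apply.
case: (pselect (exists x, g x <> 0 /\ F x = 0%E)) => [[x [gx Fx]]|no]; [left|right].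
  have : {ae mu, forall y, kern k f g (x, y) = 0}.
    apply: nnI_eq0 => //; exact: (measurableT_comp mK (measurable_pair1 x)).
  apply: filterS2 (ae_neq x N0) => y yx /eqP; rewrite /kern /= !mulf_eq0.
  have kp : 0 < k (x - y) by case: KS => _ _ _ + _; apply; rewrite subr_eq0 eq_sym.
  by rewrite (gt_eqF kp) orbF => /orP[/eqP //|/eqP].
apply: filterS H => x Fx; apply: contrapT => gx; apply: no; by exists x.
Qed.

(** No integrability is assumed: the real integral is by definition the finite part of a difference
    of two nonnegative integrals, each measurable in x by Tonelli. *)
Lemma mf_convolution (h f : 'rV[R]_N -> R) : mf h -> mf f -> mf (convolution h f).
Proof.
move=> mh mf_; have m : mf (fun z : 'rV[R]_N * 'rV[R]_N => h (z.1 - z.2) * f z.2).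
  by apply: measurable_funM; [exact: mf_dif|exact: mf_snd].
have me : measurable_fun setT (fun z : 'rV[R]_N * 'rV[R]_N => (h (z.1 - z.2) * f z.2)%:E).
  exact/measurable_EFinP.
have mp := measurable_fun_fubini_tonelli_F _ (measurable_funepos me) (funepos_ge0 _).
have mn := measurable_fun_fubini_tonelli_F _ (measurable_funeneg me) (funeneg_ge0 _).
have mD := emeasurable_funB (mp mu) (mn mu).
have := measurableT_comp (fine_measurable measurableT) mD.
congr (measurable_fun setT _); apply/funext => x /=; rewrite /convolution /Rintegral; congr fine.
rewrite [RHS]integralE; congr (_ - _)%E; apply: eq_integral => y _.
  by rewrite !funeposE.
by rewrite !funenegE.
Qed.

(** Fubini's theorem links the form to the expression used in the action. *)
Lemma form_convolution s t f g : adm s f -> adm t g ->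
  form f g = \int[mu]_x (convolution k f x * g x).
Proof.
move=> af ag; have i := form_intg af ag.
have mc := mf_convolution gk_mf (adm_mf af).
have mK := mf_kern gk_mf (adm_mf af) (adm_mf ag).
rewrite /form /Rintegral -(integral12_prod_meas1 i); congr fine.
apply: ae_eq_integral => //.
- exact: measurable_fubini_F i.
- by apply/measurable_EFinP; apply: measurable_funM => //; exact: adm_mf ag.
have ia := intg_abs i.
have : {ae mu, forall x, (nnI mu (fun y => `|kern k f g (x, y)|)%R < +oo)%E}.
  have iF := integrable_fubini_F ia.
  have := integrable_ae measurableT iF; apply: filterS => x /(_ I); rewrite fin_numE => /andP[_ h].
  by rewrite ltey.
apply: filterS => x fx _; rewrite /fubini_F /=.
have ix : intg mu (fun y => kern k f g (x, y)).
  by apply: intgP => //; exact: (measurableT_comp mK (measurable_pair1 x)).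
rewrite -[LHS]fineK; last exact: integrable_fin_num.
congr EFin; rewrite -/(Rintegral mu setT (fun y => kern k f g (x, y))) /kern /=.
(* Where g(x) = 0 the slice says nothing about integrability of the convolution integrand, but both
   sides are 0. *)
have [g0|g0] := eqVneq (g x) 0.
  by rewrite g0 mulr0; under eq_Rintegral do rewrite mulr0; exact: Int0.
have ic : intg mu (fun y => k (x - y) * f y).
  have := intgZr (g x)^-1 ix; congr (intg mu _); apply/funext => y; rewrite /kern /=.
  by rewrite mulfK // mulrC.
rewrite mulrC -IntZ //; apply: eq_Rintegral => y _; ring.
Qed.

End fixed_kernel.

End form.

Lemma powR_mono (R : realType) (a b r : R) : 0 <= r -> 0 <= a -> a <= b -> a `^ r <= b `^ r.
Proof. by move=> r0 a0 ab; apply: ge0_ler_powR; rewrite ?nnegrE // (le_trans a0). Qed.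

(** * Powers of the norm, the Gamma function and the Riesz kernel *)

Section power_integrals.
Context (R : realType) (N : nat).
Local Notation mu := (lebesgue_rV R N).
Implicit Types f g k : 'rV[R]_N -> R.

(** Domination by a series of multiples of box indicators with geometric integrals; it stands in for
    polar coordinates. *)
Lemma layer_lty f (a r : nat -> R) (C q : R) : mf f -> (forall x, 0 <= f x) ->
  (forall j, 0 <= a j) -> (forall j, 0 <= r j) ->
  (forall x, f x != 0 -> exists2 j, `|x| <= r j & f x <= a j) ->
  0 <= q < 1 -> (forall j, a j * (2 * r j) ^+ N <= C * q ^+ j) -> (nnI mu f < +oo)%E.
Proof.
move=> mf_ f0 a0 r0 H /andP[q0 q1] B.
pose t j (x : 'rV[R]_N) := a j * \1_(box (r j)) x.
have t0 j x : 0 <= t j x by rewrite /t indicE mulr_ge0.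
have mt j : mf (t j) by apply: measurable_funM => //; exact: mf_box.
apply: (@le_lt_trans _ _ (\int[mu]_x \sum_(j <oo) (t j x)%:E)%E).
  apply: ge0_le_integral => //.
  - by move=> x _; rewrite lee_fin.
  - exact/measurable_EFinP.
  - apply: ge0_emeasurable_sum; first by move=> k x _ _; rewrite lee_fin.
    by move=> k _; exact/measurable_EFinP.
  move=> x _; have [->|fx] := eqVneq (f x) 0.
    by apply: nneseries_ge0 => j _ _; rewrite lee_fin.
  have [j xj fj] := H x fx.
  rewrite (nneseriesD1 (n := j)) //; last by move=> i _; rewrite lee_fin.
  rewrite -[X in (X <= _)%E]adde0; apply: leeD; last by apply: nneseries_ge0 => i _ _; rewrite lee_fin.
  by rewrite lee_fin /t indicE mem_set ?mulr1.
rewrite integral_nneseries //; last 2 first.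
- by move=> j; exact/measurable_EFinP.
- by move=> j x _; rewrite lee_fin.
apply: (@le_lt_trans _ _ (\sum_(j <oo) (C * q ^+ j)%:E)%E).
  apply: lee_nneseries => [j _ _|j _]; first by apply: integral_ge0 => x _; rewrite lee_fin.
  have mb := @measurable_box R N (r j).
  have Ej : nnI mu (t j) = (a j * (2 * r j) ^+ N)%:E.
    rewrite (nnIZ mu (f := \1_(box (r j))) (mf_box (r j)) (a0 j)); last by move=> x; rewrite indicE.
    by rewrite (nnI_indic mb) (mu_box N (r0 j)) -EFinM.
  by change (nnI mu (t j) <= (C * q ^+ j)%:E)%E; rewrite Ej lee_fin.
have g : (fun n => \sum_(0 <= j < n) (C * q ^+ j)%:E)%E @ \oo --> (C / (1 - q))%:E.
  have := @cvg_geometric_series R C q; rewrite ger0_norm // => /(_ q1) g.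
  rewrite (_ : (fun n => _) = EFin \o series (geometric C q)).
    by apply: cvg_EFin; [exact: nearW|exact: g].
  by apply/funext => n /=; rewrite sumEFin.
by rewrite (cvg_lim _ g) // ltry.
Qed.

Lemma dyadic (t : R) : 0 < t -> t <= 1 -> exists j, 2^-1 ^+ j.+1 < t <= 2^-1 ^+ j.
Proof.
move=> t0 t1; have h : 0 <= (2^-1 : R) < 1 by rewrite invr_ge0 ler0n invf_lt1 ?ltr0n ?ltr1n.
have t2 : 0 < t / 2 by rewrite divr_gt0.
have [m hm] := exp_small h t2.
pose P j := (2^-1 : R) ^+ j.+1 < t.
have exP : exists j, P j.
  exists m; rewrite /P; apply: (@le_lt_trans _ _ (2^-1 ^+ m)); last by apply: le_lt_trans hm _; lra.
  by rewrite exprS ler_piMl ?exprn_ge0 // invf_le1 ?ler1n.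
case: (ex_minnP exP) => -[|j] Pj minj; first by exists 0; rewrite expr0 t1 andbT; exact: Pj.
exists j.+1; apply/andP; split; first exact: Pj.
by rewrite leNgt; apply/negP => /minj; rewrite ltnn.
Qed.

Lemma mf_norm : mf (fun x : 'rV[R]_N => `|x|).
Proof. by apply: mf_continuous; exact: norm_continuous. Qed.

Lemma mf_norm_pow (p : R) : mf (fun x : 'rV[R]_N => `|x| `^ p).
Proof. by apply: (measurableT_comp (measurable_powR p)); exact: mf_norm. Qed.

Lemma inn_ge0 M f x : (forall x, 0 <= f x) -> 0 <= inn M f x.
Proof. by move=> f0; rewrite innE; case: ifP. Qed.

Lemma out_ge0 M f x : (forall x, 0 <= f x) -> 0 <= out M f x.
Proof. by move=> f0; rewrite outE; case: ifP. Qed.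

Lemma near_power (p : R) : 0 <= p -> p < N%:R -> (nnI mu (inn 1 (fun x => (`|x| `^ (- p))%R)) < +oo)%E.
Proof.
move=> p0 pN; pose h : R := 2^-1.
have h0 : 0 < h by rewrite invr_gt0.
have h1 : h <= 1 by rewrite invf_le1 ?ler1n.
have b1 : 1 < 2 `^ p :> R \/ p = 0.
  have [->|pn] := eqVneq p 0; [by right|left].
  by rewrite -[ltLHS](powRr0 2) gt1_ltr_powRr ?ltr1n // lt_neqAle eq_sym pn.
apply: (@layer_lty _ (fun j => (h ^+ j.+1) `^ (- p)) (fun j => h ^+ j) (2 `^ p * 2 ^+ N) (2 `^ p / 2 ^+ N)).
- by apply: mf_inn; exact: mf_norm_pow.
- by move=> x; apply: inn_ge0 => y; exact: powR_ge0.
- by move=> j; exact: powR_ge0.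
- by move=> j; rewrite exprn_ge0 // ltW.
- move=> x; rewrite innE; case: ifP => [x1 fx|]; last by rewrite eqxx.
  have [x0|x0] := eqVneq x 0.
    (* The origin: the power of 0 with a nonzero exponent has the value 0, so it does no harm. *)
    exists 0; first by rewrite expr0.
    rewrite x0 normr0; have [->|pn] := eqVneq p 0; first by rewrite oppr0 !powRr0.
    by rewrite powR0 ?oppr_eq0 // powR_ge0.
  have xp : 0 < `|x| by rewrite normr_gt0.
  have [j /andP[j1 j2]] := dyadic xp x1; exists j => //.
  rewrite !powRN lef_pV2 ?posrE ?powR_gt0 ?exprn_gt0 //.
  by apply: ge0_ler_powR; rewrite ?nnegrE ?exprn_ge0 // ?ltW.
- rewrite divr_ge0 ?powR_ge0 ?exprn_ge0 //= ltr_pdivrMr ?exprn_gt0 // mul1r.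
  by rewrite -powR_mulrn // gt1_ltr_powRr ?ltr1n.
move=> j; apply: le_of_eq.
have Eh : h `^ (- p) = 2 `^ p.
  have := powRM p (ltW h0) (ler0n R 2); rewrite /h mulVf // powR1 powRN => E.
  by rewrite -[RHS](mulKf (x := 2^-1 `^ p)) -?E ?mulr1 // gt_eqF // powR_gt0.
rewrite powR_expn ?(ltW h0) // Eh /h exprVn !exprMn exprS !exprVn exprAC; field.
by rewrite !expf_neq0.
Qed.

Lemma far_power (p : R) : N%:R < p -> (nnI mu (out 1 (fun x => (`|x| `^ (- p))%R)) < +oo)%E.
Proof.
move=> pN; have p0 : 0 < p by apply: le_lt_trans pN.
apply: (@layer_lty _ (fun j => (2 ^+ j) `^ (- p)) (fun j => 2 ^+ j.+1) (4 ^+ N) (2 ^+ N / 2 `^ p)).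
- by apply: mf_out; exact: mf_norm_pow.
- by move=> x; apply: out_ge0 => y; exact: powR_ge0.
- by move=> j; exact: powR_ge0.
- by move=> j; rewrite exprn_ge0.
- move=> x; rewrite outE; case: ifP => [|/negbT]; first by rewrite eqxx.
  rewrite -ltNge => x1 _; have x0 : 0 < `|x| by apply: lt_trans x1.
  have xi : 0 < `|x|^-1 by rewrite invr_gt0.
  have xi1 : `|x|^-1 <= 1 by rewrite invf_le1 // ltW.
  have [j /andP[j1 j2]] := dyadic xi xi1; exists j.
    by move: j1; rewrite exprVn ltf_pV2 ?posrE ?exprn_gt0 // => /ltW.
  move: j2; rewrite exprVn lef_pV2 ?posrE ?exprn_gt0 // => j2.
  rewrite !powRN lef_pV2 ?posrE ?powR_gt0 ?exprn_gt0 //.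
  by apply: ge0_ler_powR; rewrite ?nnegrE ?exprn_ge0 // ?ltW.
- rewrite divr_ge0 ?powR_ge0 ?exprn_ge0 //= ltr_pdivrMr ?powR_gt0 // mul1r.
  by rewrite -powR_mulrn // gt1_ltr_powRr ?ltr1n.
move=> j; apply: le_of_eq.
have E4 : (4 : R) ^+ N = (2 ^+ N) ^+ 2 by rewrite expr2 -exprMn -natrM.
rewrite powR_expn // powRN E4 exprS !exprMn !exprVn [2 ^+ j ^+ N]exprAC; field.
by rewrite expf_neq0 // gt_eqF // powR_gt0.
Qed.

End power_integrals.

Section gamma.
Context (R : realType).
Local Notation leb := (@lebesgue_measure R).

Lemma nnI_rV1 (g : R -> R) : mf g -> (forall t, 0 <= g t) ->
  nnI (lebesgue_rV R 1) (fun x => g (x ord0 ord0)) = nnI leb g.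
Proof.
move=> mg g0; have := @nnI_prod R 1 (fun=> g) (fun=> mg) (fun=> g0); rewrite big_ord1 => <-.
by congr nnI; apply/funext => x; rewrite big_ord1.
Qed.

Lemma norm_rV1 (x : 'rV[R]_1) : `|x| = `|x ord0 ord0|.
Proof.
apply/eqP; rewrite eq_le coord_norm_le andbT; apply: rV_norm_le => // i.
by rewrite [i]ord1.
Qed.

Lemma expR_pow_ge m (t : R) : 0 < t -> t ^+ m <= m%:R ^+ m * expR t.
Proof.
move=> t0; case: m => [|m]; first by rewrite !expr0 mul1r -[1]expR0 ler_expR ltW.
have m0 : 0 < m.+1%:R :> R by [].
have h : t / m.+1%:R <= expR (t / m.+1%:R).
  by apply: le_trans (expR_ge1Dx _); rewrite lerDr.
have : (t / m.+1%:R) ^+ m.+1 <= expR (t / m.+1%:R) ^+ m.+1.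
  by rewrite lerXn2r ?nnegrE ?expR_ge0 // divr_ge0 // ltW.
rewrite -expRM_natl mulrCA mulfV ?mulr1 ?gt_eqF // exprMn exprVn ler_pdivrMr ?exprn_gt0 //.
by rewrite mulrC.
Qed.

(** The substance is integrability, since an infinite integral would have the real value 0; it
    follows from the two power integrals in dimension one. *)
Lemma Gamma_gt0 (s : R) : 0 < s -> 0 < Gamma s.
Proof.
move=> s0; rewrite /Gamma Rintegral_mkcond.
pose g := (fun t : R => t `^ (s - 1) * expR (- t)) \_ `]0, +oo[.
have gE t : g t = if 0 < t then t `^ (s - 1) * expR (- t) else 0.
  rewrite /g patchE; case: ifPn; first by rewrite inE /= in_itv /= andbT => ->.
  by rewrite notin_setE /= in_itv /= andbT => /negP/negbTE ->.
have g0 t : 0 <= g t by rewrite gE; case: ifP => // _; rewrite mulr_ge0 ?powR_ge0 ?expR_ge0.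
have mg : mf g.
  rewrite (_ : g = fun t => if 0 < t then t `^ (s - 1) * expR (- t) else 0); last exact/funext.
  apply: measurable_fun_ifT => //; first by apply: measurable_fun_ltr.
  apply: measurable_funM; first exact: measurable_powR.
  by apply: measurableT_comp => //; exact: measurable_funN.
(* Beyond 1, exp(-t) is at most m^m t^-m, and m > s + 1 leaves at most a multiple of t^-2; below 1
   the integrand is at most t^-p with p < 1. *)
pose m := (Num.truncn (s + 1)).+1.
have ms : s + 1 < m%:R by exact: truncnS_gt.
pose p := Num.max 0 (1 - s).
have p01 : 0 <= p < 1 by rewrite le_max lexx /= gt_max ltr01 /= ltrBlDr ltrDl.
have /andP[p0 p1] := p01.
pose F (x : 'rV[R]_1) := inn 1 (fun x => `|x| `^ (- p)) x + m%:R ^+ m * out 1 (fun x => `|x| `^ (- 2)) x.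
have mF1 : mf (inn 1 (fun x : 'rV[R]_1 => `|x| `^ (- p))) by apply: mf_inn; exact: mf_norm_pow.
have mF2 : mf (out 1 (fun x : 'rV[R]_1 => `|x| `^ (- 2))) by apply: mf_out; exact: mf_norm_pow.
have ig : intg leb g.
  apply: intg_ge0P => //; rewrite -nnI_rV1 //.
  apply: (@le_lt_trans _ _ (nnI (lebesgue_rV R 1) F)).
    apply: nnI_le => //.
    - exact: mf_coord.
    - by apply: measurable_funD => //; exact: measurable_funM.
    move=> x; rewrite /F innE outE norm_rV1 gE; set t := x ord0 ord0.
    have R0 : 0 <= `|t| `^ (- p) :> R by exact: powR_ge0.
    have R1 : 0 <= m%:R ^+ m * `|t| `^ (- 2) :> R by rewrite mulr_ge0 ?powR_ge0 ?exprn_ge0.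
    case: ifP => [t0|_]; last by case: ifP => _; rewrite ?mulr0 ?addr0 ?add0r.
    rewrite gtr0_norm //; case: (leP t 1) => t1.
      rewrite mulr0 addr0 -[leRHS]mulr1; apply: ler_pM; rewrite ?powR_ge0 ?expR_ge0 //.
        apply: ger_powR; first by rewrite t0.
        by rewrite lerNl opprB le_max lexx orbT.
      by rewrite -[leRHS]expR0 ler_expR oppr_le0 ltW.
    rewrite add0r expRN -ler_pdivlMr ?invr_gt0 ?expR_gt0 // invrK.
    have := expR_pow_ge m t0 => h.
    apply: (@le_trans _ _ (t ^+ m * t `^ (- 2))); last first.
      by rewrite mulrAC; apply: ler_wpM2r; [exact: powR_ge0|].
    rewrite -powR_mulrn ?(ltW t0) // -powRD; last by rewrite (gt_eqF t0) implybT.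
    by apply: ler_powR; [exact: ltW|lra].
  rewrite /F nnID //; last 3 first.
  - exact: measurable_funM.
  - by move=> x; apply: inn_ge0 => y; exact: powR_ge0.
  - by move=> x; rewrite mulr_ge0 ?exprn_ge0 //; apply: out_ge0 => y; exact: powR_ge0.
  rewrite nnIZ ?exprn_ge0 //; last by move=> x; apply: out_ge0 => y; exact: powR_ge0.
  apply: lte_add_pinfty; first exact: near_power.
  by apply: lte_mul_pinfty; rewrite ?lee_fin ?exprn_ge0 //; apply: far_power; rewrite ltr1n.
rewrite lt_neqAle Int_ge0 // andbT eq_sym; apply/negP => /eqP E.
have [A [mA A0 HA]] := Int_eq0 ig g0 E.
have : (leb `[1%R, 2%R] <= leb A)%E.
  apply: le_measure; rewrite ?inE // => t /=; rewrite in_itv /= => /andP[t1 _].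
  have t0 : 0 < t by apply: lt_le_trans t1.
  apply: HA => /=; rewrite gE t0 => /eqP; rewrite mulf_eq0 gt_eqF ?powR_gt0 //= gt_eqF ?expR_gt0 //.
rewrite A0 lebesgue_measure_itv /= lte_fin ltr1n -EFinB lee_fin; lra.
Qed.

End gamma.

Section riesz_potential.
Context (R : realType) (N : nat) (alpha : R).
Hypothesis alpha_itv : 0 < alpha < N%:R.
Local Notation mu := (lebesgue_rV R N).

Lemma riesz_const_gt0 : 0 < riesz_const N alpha.
Proof.
have /andP[a0 aN] := alpha_itv; rewrite /riesz_const divr_gt0 //.
  by apply: Gamma_gt0; rewrite divr_gt0 // subr_gt0.
rewrite !mulr_gt0 ?powR_gt0 ?pi_gt0 //.
by apply: Gamma_gt0; rewrite divr_gt0.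
Qed.

Lemma enorm_gt0 (x : 'rV[R]_N) : x != 0 -> 0 < enorm x.
Proof. by move=> x0; apply: lt_le_trans (norm_le_enorm x); rewrite normr_gt0. Qed.

Lemma enormN (x : 'rV[R]_N) : enorm (- x) = enorm x.
Proof. by rewrite /enorm; congr Num.sqrt; apply: eq_bigr => i _; rewrite !mxE sqrrN. Qed.

Lemma mf_enorm : mf (@enorm R N).
Proof.
rewrite (_ : @enorm R N = fun x => (\sum_(i < N) x ord0 i ^+ 2) `^ 2^-1).
  apply: (measurableT_comp (measurable_powR 2^-1)); apply: measurable_sum => i.
  by apply: measurable_funX; exact: measurable_coord.
by apply/funext => x; rewrite /enorm powR12_sqrt // sumr_ge0 // => i _; exact: sqr_ge0.
Qed.

Lemma riesz_ge0 (x : 'rV[R]_N) : 0 <= riesz alpha x.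
Proof. by rewrite /riesz divr_ge0 ?powR_ge0 // ltW // riesz_const_gt0. Qed.

Lemma riesz_gt0 (x : 'rV[R]_N) : x != 0 -> 0 < riesz alpha x.
Proof. by move=> x0; rewrite /riesz divr_gt0 ?powR_gt0 ?enorm_gt0 // riesz_const_gt0. Qed.

Lemma riesz_le (x : 'rV[R]_N) : riesz alpha x <= riesz_const N alpha * `|x| `^ (- (N%:R - alpha)).
Proof.
have /andP[a0 aN] := alpha_itv; have d0 : 0 < N%:R - alpha by rewrite subr_gt0.
rewrite /riesz; apply: ler_wpM2l; first exact/ltW/riesz_const_gt0.
have [->|x0] := eqVneq x 0.
  have -> : enorm (0 : 'rV[R]_N) = 0.
    by rewrite /enorm big1 ?sqrtr0 // => i _; rewrite mxE expr0n.
  by rewrite powR0 ?gt_eqF // invr0 powR_ge0.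
rewrite powRN lef_pV2 ?posrE ?powR_gt0 ?enorm_gt0 ?normr_gt0 //.
by apply: powR_mono; [exact: ltW|exact: normr_ge0|exact: norm_le_enorm].
Qed.

Lemma mf_riesz : mf (@riesz R N alpha).
Proof.
rewrite (_ : @riesz R N alpha = fun x => riesz_const N alpha * enorm x `^ (- (N%:R - alpha))).
  by apply: measurable_funM => //; apply: (measurableT_comp (measurable_powR _)); exact: mf_enorm.
by apply/funext => x; rewrite /riesz powRN.
Qed.

Lemma pw_riesz_inn (y : R) : 0 < y -> N%:R - alpha < N%:R * y -> (pw y (inn 1 (riesz alpha) : 'rV[R]_N -> R) < +oo)%E.
Proof.
move=> y0 h; have /andP[a0 aN] := alpha_itv; have d0 : 0 < N%:R - alpha by rewrite subr_gt0.
have yi : 0 < y^-1 by rewrite invr_gt0.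
have cc := riesz_const_gt0.
have p0 : 0 <= (N%:R - alpha) / y by rewrite divr_ge0 // ltW.
have pN : (N%:R - alpha) / y < N%:R by rewrite ltr_pdivrMr.
apply: (@le_lt_trans _ _ ((riesz_const N alpha `^ y^-1)%:E *
   nnI mu (inn 1 (fun x => (`|x| `^ (- ((N%:R - alpha) / y)))%R)))%E); last first.
  by apply: lte_mul_pinfty; rewrite ?lee_fin ?powR_ge0 //; exact: near_power.
have mi : mf (inn 1 (fun x : 'rV[R]_N => `|x| `^ (- ((N%:R - alpha) / y)))) by apply: mf_inn; exact: mf_norm_pow.
rewrite -nnIZ ?powR_ge0 //; last by move=> x; apply: inn_ge0 => z; exact: powR_ge0.
apply: nnI_le; [by apply: mf_pow; apply: mf_inn; exact: mf_riesz|exact: measurable_funM|by move=> x; exact: powR_ge0|].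
move=> x; rewrite !innE; case: ifP => _; last by rewrite normr0 mulr0 powR0 // gt_eqF.
rewrite ger0_norm ?riesz_ge0 // -mulNr powRrM -powRM ?powR_ge0 ?(ltW cc) //.
by apply: powR_mono; [exact: ltW|exact: riesz_ge0|exact: riesz_le].
Qed.

Lemma pw_riesz_out (y : R) : 0 < y -> N%:R * y < N%:R - alpha -> (pw y (out 1 (riesz alpha) : 'rV[R]_N -> R) < +oo)%E.
Proof.
move=> y0 h; have /andP[a0 aN] := alpha_itv; have d0 : 0 < N%:R - alpha by rewrite subr_gt0.
have yi : 0 < y^-1 by rewrite invr_gt0.
have cc := riesz_const_gt0.
have pN : N%:R < (N%:R - alpha) / y by rewrite ltr_pdivlMr.
apply: (@le_lt_trans _ _ ((riesz_const N alpha `^ y^-1)%:E *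
   nnI mu (out 1 (fun x => (`|x| `^ (- ((N%:R - alpha) / y)))%R)))%E); last first.
  by apply: lte_mul_pinfty; rewrite ?lee_fin ?powR_ge0 //; exact: far_power.
have mi : mf (out 1 (fun x : 'rV[R]_N => `|x| `^ (- ((N%:R - alpha) / y)))) by apply: mf_out; exact: mf_norm_pow.
rewrite -nnIZ ?powR_ge0 //; last by move=> x; apply: out_ge0 => z; exact: powR_ge0.
apply: nnI_le; [by apply: mf_pow; apply: mf_out; exact: mf_riesz|exact: measurable_funM|by move=> x; exact: powR_ge0|].
move=> x; rewrite !outE; case: ifP => _; first by rewrite normr0 mulr0 powR0 // gt_eqF.
rewrite ger0_norm ?riesz_ge0 // -mulNr powRrM -powRM ?powR_ge0 ?(ltW cc) //.
by apply: powR_mono; [exact: ltW|exact: riesz_ge0|exact: riesz_le].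
Qed.

(** The halves are the restrictions to the unit box and to its complement. The kernel behaves like
    |z|^-(N-alpha), so the first lies in L^(1/y) for y above 1 - alpha/N and the second for y below
    it. *)
Lemma riesz_good x1 x2 : 2^-1 < x1 < 1 -> 2^-1 < x2 < 1 ->
  N%:R - alpha < N%:R * (2 - 2 * x1) -> N%:R * (2 - 2 * x2) < N%:R - alpha ->
  good_kernel x1 x2 (@riesz R N alpha).
Proof.
move=> h1 h2 n1 n2; have /andP[a1 b1] := h1; have /andP[a2 b2] := h2; split; [exact: h1|exact: h2|by move=> z; rewrite /riesz enormN|exact: riesz_gt0|].
exists (inn 1 (riesz alpha)), (out 1 (riesz alpha)); split.
- by split; [apply: mf_inn|apply: mf_out]; exact: mf_riesz.
- by move=> z; split; [apply: inn_ge0|apply: out_ge0]; exact: riesz_ge0.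
- by move=> z; rewrite innE outE; case: ifP; rewrite ?addr0 ?add0r.
- by apply: pw_riesz_inn => //; lra.
- by apply: pw_riesz_out => //; lra.
Qed.

End riesz_potential.

Transparent nn.

Lemma ipE d (T : measurableType d) (R : realType) (mu : {measure set T -> \bar R}) (f g : T -> R) :
  ip mu f g = \int[mu]_x (f x * g x).
Proof. by []. Qed.

Lemma nn_ip d (T : measurableType d) (R : realType) (mu : {measure set T -> \bar R}) (f : T -> R) :
  nn mu f = ip mu f f.
Proof. by []. Qed.

Lemma eq_add (V : zmodType) (a b c e : V) : a = b -> c = e -> a + c = b + e.
Proof. by move=> -> ->. Qed.

Lemma cvg_sum_seq (R : realType) (I J : Type) (s : seq I) (F : set_system J) (FF : Filter F)
    (f : I -> J -> R) (l : I -> R) : (forall i, f i n @[n --> F] --> l i) ->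
  \sum_(i <- s) f i n @[n --> F] --> \sum_(i <- s) l i.
Proof.
move=> H; elim: s => [|i s IH].
  by rewrite big_nil; under eq_fun do rewrite big_nil; exact: cvg_cst.
by rewrite big_cons; under eq_fun do rewrite big_cons; exact: cvgD.
Qed.

Opaque nn ip.

(** * The constrained maximum *)

Section energy.
Context (R : realType) (N : nat).
Local Notation mu := (lebesgue_rV R N).
Implicit Types u v w f g A : 'rV[R]_N -> R.
Local Notation L2 := (L2 mu).
Local Notation ip := (ip mu).
Local Notation nn := (nn mu).
Local Notation wp := weak_partial.

(** All that is retained of A and B besides their periods. *)
Definition weight A : Prop :=
  [/\ mf A, exists2 a : R, 0 < a & forall x, a <= A x & exists a : R, forall x, A x <= a].

Definition qi A u w : R := \sum_(i < N) ip (wp i u) (wp i w) + ip (fun x => A x * u x) w.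

Section fixed_weight.
Variable A : 'rV[R]_N -> R.
Hypothesis wA : weight A.
Local Notation qi := (qi A).

Lemma weight_gt0 x : 0 < A x.
Proof. by case: wA => _ [a a0 H] _; apply: lt_le_trans (H x). Qed.

Lemma L2_weight u : L2 u -> L2 (fun x => A x * u x).
Proof.
move=> lu; case: wA => mA _ [a aA].
apply: (L2_mono _ _ (L2Z a lu)); first by apply: measurable_funM => //; case: lu.
move=> x; rewrite !normrM ler_wpM2r // (ger0_norm (ltW (weight_gt0 x))).
by apply: le_trans (aA x) _; exact: ler_norm.
Qed.

Lemma qiC u w : qi u w = qi w u.
Proof.
rewrite /qi; apply: eq_add; first by apply: eq_bigr => i _; rewrite ipC.
by rewrite !ipE; apply: eq_Rintegral => x _; ring.
Qed.

Lemma qi_linl a u v w : H1 u -> H1 v -> H1 w ->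
  qi (fun x => a * u x + v x) w = a * qi u w + qi v w.
Proof.
move=> hu hv hw; have lu := H1_L2 hu; have lv := H1_L2 hv; have lw := H1_L2 hw.
have hl := H1_lin a hu hv.
rewrite /qi mulrDr addrACA; apply: eq_add.
  rewrite mulr_sumr -big_split; apply: eq_bigr => i _ /=.
  have du := weak_partial_L2 i hu; have dv := weak_partial_L2 i hv; have dw := weak_partial_L2 i hw.
  rewrite -ipZl // -ipDl //; last exact: L2Z.
  apply: ip_ae; [exact: L2_mf (weak_partial_L2 i hl)| |exact: L2_mf dw|exact: weak_partial_lin].
  exact: L2_mf (L2D (L2Z a du) dv).
have Lu := L2_weight lu; have Lv := L2_weight lv.
rewrite -ipZl // -ipDl //; last exact: L2Z.
by rewrite !ipE; apply: eq_Rintegral => x _; ring.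
Qed.

Lemma qi_linr a u v w : H1 u -> H1 v -> H1 w ->
  qi w (fun x => a * u x + v x) = a * qi w u + qi w v.
Proof. by move=> hu hv hw; rewrite !(qiC w) qi_linl. Qed.

Lemma qiB u v w : H1 u -> H1 v -> H1 w -> qi w (fun x => u x - v x) = qi w u - qi w v.
Proof.
move=> hu hv hw; have := qi_linr (-1) hv hu hw; rewrite mulN1r addrC => <-.
by rewrite (_ : (fun x => u x - v x) = fun x => -1 * v x + u x) //; apply/funext => x; ring.
Qed.

Lemma qiZZ c u : H1 u -> qi (fun x => c * u x) (fun x => c * u x) = c ^+ 2 * qi u u.
Proof.
move=> hu; have h0 := @H1_0 R N; have hc := H1Z c hu.
have Z w : H1 w -> qi (fun=> 0) w = 0.
  move=> hw; have := qi_linl (-1) h0 h0 hw.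
  by rewrite (_ : (fun x => _) = fun=> 0); [lra|apply/funext => x; ring].
have E w : H1 w -> qi (fun x => c * u x) w = c * qi u w.
  move=> hw; have := qi_linl c hu h0 hw; rewrite Z // addr0 => <-.
  by rewrite (_ : (fun x => c * u x) = fun x => c * u x + 0) //; apply/funext => x; rewrite addr0.
by rewrite E // qiC E //; ring.
Qed.

Lemma qi_add u w : H1 u -> H1 w ->
  qi (fun x => u x + w x) (fun x => u x + w x) = qi u u + 2 * qi u w + qi w w.
Proof.
move=> hu hw; have hD := H1D hu hw.
have E : (fun x => u x + w x) = fun x => 1 * u x + w x by apply/funext => x; rewrite mul1r.
rewrite {1}E qi_linl // {1}E {1}E !qi_linr // (qiC w u); ring.
Qed.

Lemma ip_weight_ge0 u : 0 <= ip (fun x => A x * u x) u.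
Proof.
rewrite ipE; apply: Int_ge0 => x; rewrite -mulrA -expr2 mulr_ge0 ?sqr_ge0 //.
exact: ltW (weight_gt0 x).
Qed.

Lemma nn_partial_le_qi i u : nn (wp i u) <= qi u u.
Proof.
have h : nn (wp i u) <= \sum_(j < N) ip (wp j u) (wp j u).
  have -> : \sum_(j < N) ip (wp j u) (wp j u) = \sum_(j < N) nn (wp j u).
    by apply: eq_bigr => j _; rewrite nn_ip.
  rewrite (bigD1 i) //= lerDl.
  by apply: sumr_ge0 => j _; exact: nn_ge0.
by apply: (le_trans h); rewrite /qi lerDl ip_weight_ge0.
Qed.

Lemma qi_ge0 u : 0 <= qi u u.
Proof. by rewrite addr_ge0 ?ip_weight_ge0 // sumr_ge0 // => i _; rewrite -nn_ip nn_ge0. Qed.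

Lemma nn_le_qi : exists2 a : R, 0 < a & forall u, H1 u -> a * nn u <= qi u u.
Proof.
case: (wA) => mA [a a0 aA] _; exists a => // u hu; have lu := H1_L2 hu.
apply: (@le_trans _ _ (ip (fun x => A x * u x) u)); last first.
  by rewrite lerDr sumr_ge0 // => i _; rewrite -nn_ip nn_ge0.
rewrite nnE ipE -IntZ; last by case: lu.
apply: Int_le; [by apply: intgZ; case: lu|exact: (L2_intgM (L2_weight lu) lu)|].
by move=> x; rewrite -mulrA -expr2 ler_wpM2r ?sqr_ge0.
Qed.

Lemma S1_le_qi : exists2 C : R, 0 < C & forall u, H1 u -> S1 u <= C * Num.sqrt (qi u u).
Proof.
have [a a0 Ha] := nn_le_qi.
exists ((Num.sqrt a)^-1 + N%:R); first by rewrite ltr_wpDr // invr_gt0 sqrtr_gt0.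
move=> u hu; rewrite /S1 mulrDl; apply: lerD.
  rewrite mulrC ler_pdivlMr ?sqrtr_gt0 // -sqrtrM ?nn_ge0 // mulrC.
  by rewrite ler_wsqrtr // Ha.
rewrite mulr_natl -[in X in _ *+ X](card_ord N) -sumr_const; apply: ler_sum => i _.
by rewrite ler_wsqrtr // nn_partial_le_qi.
Qed.

Lemma qi_le_S1 : exists2 C : R, 0 < C & forall u, H1 u -> qi u u <= C * S1 u ^+ 2.
Proof.
case: (wA) => mA _ [a aA].
exists (1 + (N%:R + `|a|)); first by rewrite ltr_pwDl // addr_ge0.
move=> u hu; have lu := H1_L2 hu; have s0 := sqr_ge0 (S1 u).
apply: (@le_trans _ _ ((N%:R + `|a|) * S1 u ^+ 2)); last first.
  by rewrite ler_wpM2r // lerDr.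
rewrite mulrDl; apply: lerD.
  rewrite mulr_natl -[in X in _ *+ X](card_ord N) -sumr_const; apply: ler_sum => i _.
  rewrite -nn_ip -[nn _]sqr_sqrtr ?nn_ge0 // lerXn2r ?nnegrE ?sqrtr_ge0 ?S1_ge0 //.
  rewrite /S1 (bigD1 i) //= addrCA lerDl addr_ge0 ?sqrtr_ge0 //.
  by apply: sumr_ge0 => j _; exact: sqrtr_ge0.
apply: (@le_trans _ _ (`|a| * nn u)); last by rewrite ler_wpM2l // nn_le_S1.
rewrite nnE ipE -IntZ; last by case: lu.
apply: Int_le; [exact: (L2_intgM (L2_weight lu) lu)|by apply: intgZ; case: lu|].
move=> x; rewrite -mulrA -expr2 ler_wpM2r ?sqr_ge0 //.
by apply: le_trans (aA x) _; exact: ler_norm.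
Qed.

Lemma qi_abs u : H1 u -> qi (fun x => `|u x|) (fun x => `|u x|) <= qi u u.
Proof.
move=> hu; rewrite /qi; apply: lerD.
  by apply: ler_sum => i _; rewrite -!nn_ip; exact: nn_weak_partial_abs.
rewrite !ipE; apply: le_of_eq; apply: eq_Rintegral => x _.
by rewrite -!mulrA -!expr2 real_normK // num_real.
Qed.

Lemma qi_trn a u : H1 u -> (forall x, A (x + a) = A x) -> qi (trn a u) (trn a u) = qi u u.
Proof.
move=> hu per; have lu := H1_L2 hu; rewrite /qi; apply: eq_add.
  apply: eq_bigr => i _; have du := weak_partial_L2 i hu.
  rewrite -!nn_ip -(nn_trn a du); apply: nn_ae.
  - exact: L2_mf (weak_partial_L2 i (H1_trn a hu)).
  - exact: L2_mf (L2_trn a du).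
  - exact: weak_partial_trn.
rewrite -(ip_trn a (L2_weight lu) lu) !ipE; apply: eq_Rintegral => x _.
by rewrite /trn per.
Qed.

Lemma qi_ae u v w : H1 u -> mf v -> H1 w -> {ae mu, forall x, u x = v x} -> qi u w = qi v w.
Proof.
move=> hu mv hw uv; have hv := H1_ae mv uv hu; have mu_ := L2_mf (H1_L2 hu).
have mA : mf A by case: wA.
rewrite /qi; apply: eq_add.
  apply: eq_bigr => i _; apply: ip_ae; try exact: L2_mf (weak_partial_L2 i _).
  apply: (weak_partial_ae hu); apply: (weak_ae mv mu_ _ (weak_partialP i hv)).
  by apply: filterS uv => x ->.
apply: ip_ae; [exact: measurable_funM|exact: measurable_funM|exact: L2_mf (H1_L2 hw)|].
by apply: filterS uv => x ->.
Qed.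

End fixed_weight.

Section weak_limits.
Variables (F : set_system nat) (FF : UltraFilter F).

(** The weak limits of the derivatives are the derivatives of the weak limit, because the defining
    identity is tested against fixed L^2 functions. *)
Lemma H1_weak_limit (u : nat -> 'rV[R]_N -> R) (C : R) : (forall n, H1 (u n)) -> (forall n, S1 (u n) <= C) ->
  exists2 w, H1 w & wcvg mu F u w /\ forall i, wcvg mu F (fun n => wp i (u n)) (wp i w).
Proof.
move=> hu uC.
have ub n : nn (u n) <= C ^+ 2.
  apply: le_trans (nn_le_S1 _) _; rewrite lerXn2r ?nnegrE ?S1_ge0 //.
  by apply: le_trans (uC n); exact: S1_ge0.
have db i n : nn (wp i (u n)) <= C ^+ 2.
  rewrite -[nn _]sqr_sqrtr ?nn_ge0 // lerXn2r ?nnegrE ?sqrtr_ge0 //.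
    by apply: le_trans (uC n); exact: S1_ge0.
  apply: le_trans (uC n); rewrite /S1 (bigD1 i) //= addrCA lerDl addr_ge0 ?sqrtr_ge0 //.
  by apply: sumr_ge0 => j _; exact: sqrtr_ge0.
have [w lw cw] := @L2_weak_limit _ _ _ mu F FF _ _ (fun n => H1_L2 (hu n)) ub.
have W i : weak i w (xget (fun=> 0) [set g | L2 g /\ wcvg mu F (fun n => wp i (u n)) g]) /\
    wcvg mu F (fun n => wp i (u n)) (xget (fun=> 0) [set g | L2 g /\ wcvg mu F (fun n => wp i (u n)) g]).
  set g := xget _ _; have [lg cg] : L2 g /\ wcvg mu F (fun n => wp i (u n)) g.
    have [g0 lg0 cg0] := @L2_weak_limit _ _ _ mu F FF _ _ (fun n => weak_partial_L2 i (hu n)) (db i).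
    exact: (@xgetPex _ (fun=> 0) [set g | L2 g /\ wcvg mu F (fun n => wp i (u n)) g] (ex_intro _ g0 (conj lg0 cg0))).
  split => //; split => // phi tp.
  have c1 := cw _ (test_L2 (test_partial i tp)); have c2 := cg _ (test_L2 tp).
  apply: (@cvg_unique _ (@Rhausdorff R) (ip (u n) (partial i phi) @[n --> F])) => //.
  rewrite (_ : (fun n => _) = fun n => - ip (wp i (u n)) phi); first exact: cvgN.
  by apply/funext => n; have [_ ->] := weak_partialP i (hu n).
have hw : H1 w by apply/H1P; split => // i; eexists; exact: (W i).1.
exists w => //; split => // i f lf; have [W1 W2] := W i.
rewrite (ip_ae (g := xget (fun=> 0) [set g | L2 g /\ wcvg mu F (fun n => wp i (u n)) g])); first exact: W2.
- exact: L2_mf (weak_partial_L2 i hw).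
- by case: W1 => /L2_mf.
- exact: L2_mf lf.
- exact: weak_partial_ae.
Qed.

Lemma qi_wcvg A (u : nat -> 'rV[R]_N -> R) w f : weight A -> H1 f -> H1 w -> (forall n, H1 (u n)) ->
  wcvg mu F u w -> (forall i, wcvg mu F (fun n => wp i (u n)) (wp i w)) ->
  qi A (u n) f @[n --> F] --> qi A w f.
Proof.
move=> wA hf hw hu c1 c2; rewrite /qi; apply: cvgD.
  by apply: cvg_sum_seq => i; apply: c2; exact: weak_partial_L2.
have E g : ip (fun x => A x * g x) f = ip g (fun x => A x * f x).
  by rewrite !ipE; apply: eq_Rintegral => x _; ring.
rewrite E (_ : (fun n => _) = fun n => ip (u n) (fun x => A x * f x)); last by apply/funext => n; exact: E.
by apply: c1; apply: L2_weight => //; exact: H1_L2.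
Qed.

End weak_limits.

Definition pwf (p : R) u : 'rV[R]_N -> R := fun x => `|u x| `^ p.

Lemma pwf_ge0 p u x : 0 <= pwf p u x. Proof. exact: powR_ge0. Qed.

Lemma abs_pwf p u x : `|pwf p u x| = pwf p u x. Proof. by rewrite ger0_norm ?pwf_ge0. Qed.

Lemma mf_pwf p u : mf u -> mf (pwf p u). Proof. exact: mf_pow. Qed.

Lemma pw_pwf p u x : pw x (pwf p u) = nnI mu (fun y => `|u y| `^ (p / x)).
Proof.
transitivity (nnI mu (fun y => `|pwf p u y| `^ x^-1)); first by [].
by congr nnI; apply/funext => y; rewrite abs_pwf /pwf -powRrM.
Qed.

(** The L^(1/x) norm of |u|^p is a power of the L^(p/x) norm of u, so the subcritical embedding
    applies with exponent p/x. *)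
Lemma bd_pwf p x : 0 < x -> subcrit N (p / x) -> exists2 K : R, 0 < K &
  forall u c, H1 u -> 0 < c -> S1 u <= c -> bd x (K * c `^ p) (pwf p u).
Proof.
move=> x0 sc; have [C C0 H] := sobolev sc.
exists (C `^ x); first exact: powR_gt0.
move=> u c hu c0 uc; split; [exact: mf_pwf (L2_mf (H1_L2 hu))|by rewrite mulr_gt0 ?powR_gt0|].
rewrite pw_pwf; apply: le_trans (H u c hu c0 uc) _.
by rewrite powRM ?powR_ge0 // powRKV ?(ltW C0) // -powRrM.
Qed.

Lemma adm_pwf p x1 x2 : 0 < x1 -> 0 < x2 -> subcrit N (p / x1) -> subcrit N (p / x2) ->
  exists2 K : R, 0 < K & forall u c, H1 u -> 0 < c -> S1 u <= c -> adm x1 x2 (K * c `^ p) (pwf p u).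
Proof.
move=> x10 x20 s1 s2; have [K1 k1 H1_] := bd_pwf x10 s1; have [K2 k2 H2_] := bd_pwf x20 s2.
exists (K1 + K2); first by rewrite addr_gt0.
move=> u c hu c0 uc; split.
  by apply: bdW (H1_ u c hu c0 uc) => //; rewrite ler_wpM2r ?powR_ge0 // lerDl ltW.
by apply: bdW (H2_ u c hu c0 uc) => //; rewrite ler_wpM2r ?powR_ge0 // lerDr ltW.
Qed.

(** With (1 + d)^r = 1 + e, either y is at most d x and the first term suffices, or x is less than
    y/d and the second does. *)
Lemma growth (r e : R) : 0 < r -> 0 < e -> exists2 C : R, 0 < C &
  forall x y, 0 <= x -> 0 <= y -> (x + y) `^ r <= (1 + e) * x `^ r + C * y `^ r.
Proof.
move=> r0 e0; pose d := (1 + e) `^ r^-1 - 1.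
have d0 : 0 < d.
  by rewrite subr_gt0 -[ltLHS](powRr0 (1 + e)) gt1_ltr_powRr ?invr_gt0 // ltrDl.
have dE : (1 + d) `^ r = 1 + e by rewrite /d addrC subrK powRVK // addr_ge0 // ltW.
exists ((1 + d^-1) `^ r); first by rewrite powR_gt0 // ltr_pwDl // invr_ge0 ltW.
move=> x y x0 y0; have [h|h] := leP y (d * x).
  rewrite -[leLHS]addr0; apply: lerD; last by rewrite mulr_ge0 ?powR_ge0.
  have d1 : 0 <= 1 + d by rewrite addr_ge0 // ltW.
  rewrite -dE -(powRM r d1 x0); apply: powR_mono; [exact: ltW|exact: addr_ge0|].
  by rewrite mulrDl mul1r lerD2l.
rewrite -[leLHS]add0r; apply: lerD; first by rewrite mulr_ge0 ?powR_ge0 // addr_ge0 // ltW.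
have di : 0 <= d^-1 by rewrite invr_ge0 ltW.
have d1 : 0 <= 1 + d^-1 by rewrite addr_ge0.
rewrite -(powRM r d1 y0); apply: powR_mono; [exact: ltW|exact: addr_ge0|].
rewrite mulrDl mul1r addrC lerD2l mulrC ler_pdivlMr // mulrC; exact: ltW.
Qed.

End energy.

(** * The two functionals on pairs *)

Section quadratic_form_of_pairs.
Context (R : realType) (N : nat).
Local Notation mu := (lebesgue_rV R N).
Variables (k : 'rV[R]_N -> R) (x1 x2 p q : R) (A B : 'rV[R]_N -> R).
Hypotheses (N0 : (0 < N)%N) (KS : good_kernel x1 x2 k) (wA : weight A) (wB : weight B).
Hypotheses (p1 : 1 < p) (q1 : 1 < q).
Hypotheses (sp1 : subcrit N (p / x1)) (sp2 : subcrit N (p / x2)).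
Hypotheses (sq1 : subcrit N (q / x1)) (sq2 : subcrit N (q / x2)).
Implicit Types u v w f g : 'rV[R]_N -> R.
Local Notation adm := (adm x1 x2).
Local Notation form := (form k).
Local Notation L2 := (L2 mu).
Local Notation ip := (ip mu).

Definition Dw u v : R := form (pwf p u) (pwf q v).
Definition Qw u v : R := qi A u u + qi B v v.

Lemma admp : exists2 K : R, 0 < K & forall u c, H1 u -> 0 < c -> S1 u <= c -> adm (K * c `^ p) (pwf p u).
Proof. by have [a b] := gk_gt0 KS; exact: adm_pwf. Qed.

Lemma admq : exists2 K : R, 0 < K & forall u c, H1 u -> 0 < c -> S1 u <= c -> adm (K * c `^ q) (pwf q u).
Proof. by have [a b] := gk_gt0 KS; exact: adm_pwf. Qed.

Lemma admp_ex u : H1 u -> exists s, adm s (pwf p u).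
Proof.
move=> hu; have [K K0 H] := admp; exists (K * (1 + S1 u) `^ p).
by apply: H => //; rewrite ?ltr_pwDl ?S1_ge0 // lerDr.
Qed.

Lemma admq_ex u : H1 u -> exists s, adm s (pwf q u).
Proof.
move=> hu; have [K K0 H] := admq; exists (K * (1 + S1 u) `^ q).
by apply: H => //; rewrite ?ltr_pwDl ?S1_ge0 // lerDr.
Qed.

Lemma Dw_ge0 u v : 0 <= Dw u v.
Proof. by apply: (form_ge0 KS) => x; exact: pwf_ge0. Qed.

Lemma Qw_ge0 u v : 0 <= Qw u v.
Proof. by rewrite addr_ge0 // qi_ge0. Qed.

Lemma S1_le_Qw : exists2 C : R, 0 < C & forall u v, H1 u -> H1 v ->
  S1 u <= C * Num.sqrt (Qw u v) /\ S1 v <= C * Num.sqrt (Qw u v).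
Proof.
have [C C0 HC] := S1_le_qi wA; have [D D0 HD] := S1_le_qi wB.
exists (C + D); first exact: addr_gt0.
move=> u v hu hv; have s0 := sqrtr_ge0 (Qw u v); split.
  apply: le_trans (HC u hu) _; rewrite mulrDl; apply: (@le_trans _ _ (C * Num.sqrt (Qw u v))).
    by rewrite ler_pM2l // ler_wsqrtr // lerDl qi_ge0.
  by rewrite lerDl mulr_ge0 // ltW.
apply: le_trans (HD v hv) _; rewrite mulrDl; apply: (@le_trans _ _ (D * Num.sqrt (Qw u v))).
  by rewrite ler_pM2l // ler_wsqrtr // lerDr qi_ge0.
by rewrite lerDr mulr_ge0 // ltW.
Qed.

Lemma pwfZ (r : R) c u : 0 <= c -> pwf r (fun x => c * u x) = fun x => c `^ r * pwf r u x.
Proof. by move=> c0; apply/funext => x; rewrite /pwf normrM powRM // ger0_norm. Qed.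

Lemma formZZ s t (a b : R) f g : adm s f -> adm t g ->
  form (fun x => a * f x) (fun x => b * g x) = a * b * form f g.
Proof.
move=> af ag; have i := form_intg KS af ag; rewrite /form -IntZ //.
by apply: eq_Rintegral => z _; rewrite /kern; ring.
Qed.

Lemma DwZ c u v : H1 u -> H1 v -> 0 <= c -> Dw (fun x => c * u x) (fun x => c * v x) = c `^ (p + q) * Dw u v.
Proof.
move=> hu hv c0; have [s as_] := admp_ex hu; have [t at_] := admq_ex hv.
rewrite /Dw !pwfZ // (formZZ _ _ as_ at_) -powRD //.
by rewrite gt_eqF // addr_gt0 // (lt_trans ltr01).
Qed.

Lemma QwZ c u v : H1 u -> H1 v -> Qw (fun x => c * u x) (fun x => c * v x) = c ^+ 2 * Qw u v.
Proof. move=> hu hv; rewrite /Qw (qiZZ wA c hu) (qiZZ wB c hv).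
ring. Qed.

Lemma Dw_abs u v : Dw (fun x => `|u x|) (fun x => `|v x|) = Dw u v.
Proof. have E r w : pwf r (fun x => `|w x|) = pwf r w by apply/funext => x; rewrite /pwf normr_id.
by rewrite /Dw !E. Qed.

Lemma Qw_abs u v : H1 u -> H1 v -> Qw (fun x => `|u x|) (fun x => `|v x|) <= Qw u v.
Proof. by move=> hu hv; apply: lerD; apply: qi_abs. Qed.

Lemma Dw_trn a u v : H1 u -> H1 v -> Dw (trn a u) (trn a v) = Dw u v.
Proof.
move=> hu hv; have [s as_] := admp_ex hu; have [t at_] := admq_ex hv.
exact: (form_trn KS a as_ at_).
Qed.

Lemma Dw_eq0 u v : H1 u -> H1 v -> Dw u v = 0 -> {ae mu, forall x, u x = 0} \/ {ae mu, forall x, v x = 0}.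
Proof.
move=> hu hv E; have [s as_] := admp_ex hu; have [t at_] := admq_ex hv.
have Z (r : R) f : 1 < r -> {ae mu, forall x, pwf r f x = 0} -> {ae mu, forall x, f x = 0}.
  move=> r1; apply: filterS => x /eqP; rewrite powR_eq0 normr_eq0 => /andP[/eqP //].
have [h|h] := form_eq0 KS N0 as_ at_ (@pwf_ge0 R N p u) (@pwf_ge0 R N q v) E.
  by left; exact: Z h.
by right; exact: Z h.
Qed.

Lemma Dw_bound : exists2 C : R, 0 < C & forall u v c, H1 u -> H1 v -> 0 < c -> S1 u <= c -> S1 v <= c ->
  Dw u v <= C * c `^ (p + q).
Proof.
have [K K0 HK] := admp; have [L L0 HL] := admq; have [C C0 HC] := form_le KS.
exists (C * K * L); first by rewrite !mulr_gt0.
move=> u v c hu hv c0 uc vc; apply: le_trans (ler_norm _) _.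
apply: le_trans (HC _ _ _ _ (HK u c hu c0 uc) (HL v c hv c0 vc)) _.
rewrite powRD; last by rewrite (gt_eqF c0) implybT.
by apply: le_of_eq; ring.
Qed.

Lemma Dw_unit_bound : exists2 C : R, 0 < C & forall u v, H1 u -> H1 v -> Qw u v <= 1 -> Dw u v <= C.
Proof.
have [C C0 HC] := S1_le_Qw; have [D D0 HD] := Dw_bound.
exists (D * C `^ (p + q)); first by rewrite mulr_gt0 ?powR_gt0.
move=> u v hu hv Q1; have [a b] := HC u v hu hv.
have s1 : Num.sqrt (Qw u v) <= 1 by rewrite -[leRHS]sqrtr1 ler_wsqrtr.
by apply: HD => //; [apply: le_trans a _|apply: le_trans b _]; rewrite -[leRHS]mulr1 ler_pM2l.
Qed.

Definition Smax : R := sup [set Dw w.1 w.2 | w in [set w | [/\ H1 w.1, H1 w.2 & Qw w.1 w.2 <= 1]]].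

Lemma qi0 A' : weight A' -> qi A' (fun _ : 'rV[R]_N => 0) (fun=> 0) = 0.
Proof.
move=> wA'; have := qiZZ wA' 0 (@H1_0 R N).
have E : (fun _ : 'rV[R]_N => 0 * 0 : R) = fun=> 0 by apply/funext => x; rewrite mul0r.
by rewrite E expr0n /= => ->; rewrite mul0r.
Qed.

Lemma Smax_has_sup : has_sup [set Dw w.1 w.2 | w in [set w | [/\ H1 w.1, H1 w.2 & Qw w.1 w.2 <= 1]]].
Proof.
have h0 := @H1_0 R N; have [C C0 HC] := Dw_unit_bound; split.
  exists (Dw (fun=> 0) (fun=> 0)); exists (fun=> 0, fun=> 0) => //=; split => //.
  by rewrite /Qw !qi0 // addr0 ler01.
by exists C => _ [w [hu hv Q1] <-]; exact: HC.
Qed.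

Lemma Dw_le_Smax1 u v : H1 u -> H1 v -> Qw u v <= 1 -> Dw u v <= Smax.
Proof.
by move=> hu hv Q1; apply: sup_upper_bound; [exact: Smax_has_sup|exists (u, v)].
Qed.

(** Degree p + q against degree 2. The bound t, in place of Qw itself, avoids dividing by a possibly
    zero value. *)
Lemma Dw_le_Smax u v t : H1 u -> H1 v -> 0 < t -> Qw u v <= t -> Dw u v <= Smax * t `^ ((p + q) / 2).
Proof.
move=> hu hv t0 Qt; pose c := (Num.sqrt t)^-1.
have st : 0 < Num.sqrt t by rewrite sqrtr_gt0.
have c0 : 0 < c by rewrite invr_gt0.
have c2 : c ^+ 2 * t = 1 by rewrite /c exprVn sqr_sqrtr ?ltW // mulVf // gt_eqF.
have := Dw_le_Smax1 (H1Z c hu) (H1Z c hv); rewrite QwZ // DwZ ?(ltW c0) // => h.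
have {}h : c `^ (p + q) * Dw u v <= Smax by apply: h; rewrite -c2 ler_wpM2l ?sqr_ge0.
have E : c `^ (p + q) * t `^ ((p + q) / 2) = 1.
  set g := (p + q) / 2; have -> : p + q = 2 * g by rewrite /g; field.
  rewrite powRrM (powR_mulrn 2 (ltW c0)).
  by rewrite -powRM ?sqr_ge0 ?(ltW t0) // c2 powR1.
rewrite -[X in X <= _]mulr1 -[X in _ * X <= _]E mulrA [Dw u v * _]mulrC.
by apply: ler_wpM2r; [exact: powR_ge0|].
Qed.

Lemma H1_nontrivial : exists2 u : 'rV[R]_N -> R, H1 u & ~ {ae mu, forall x, u x = 0}.
Proof.
pose u := bumpbox (fun _ : 'I_N => -1) (fun=> 1) 0 : 'rV[R]_N -> R.
have tu : test_function u by exact: bumpbox_test.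
have hu : H1 u.
  apply/H1P; split; first exact: test_L2.
  by move=> i; exists (partial i u); exact: test_weak.
exists u => // h.
have bp (t : R) : 0 < t -> 0 < bump 1 t by move=> t0; rewrite /bump t0 hornerE mul1r expR_gt0.
have up x : `|x| <= 2^-1 -> 0 < u x.
  move=> xh; apply: prodr_gt0 => i _; have := le_trans (coord_norm_le x i) xh.
  rewrite ler_norml => /andP[a b]; apply: mulr_gt0; apply: bp; lra.
case: h => D [mD D0 HD].
have : (mu (box 2^-1) <= mu D)%E.
  apply: le_measure; rewrite ?inE //; first exact: measurable_box.
  by move=> x /= /up ux; apply: HD => /= u0; move: ux; rewrite u0 ltxx.
by rewrite D0 mu_box // mulfV // expr1n lee_fin ler10.
Qed.

(** A nonzero bump used in both components has Dw > 0 by positivity of the kernel. *)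
Lemma Smax_gt0 : 0 < Smax.
Proof.
have [u hu un] := H1_nontrivial.
have Dp : 0 < Dw u u.
  rewrite lt_neqAle Dw_ge0 andbT eq_sym; apply/negP => /eqP /(Dw_eq0 hu hu) [] //.
have t0 : 0 < 1 + Qw u u by rewrite ltr_pwDl // Qw_ge0.
have tq : Qw u u <= 1 + Qw u u by rewrite lerDr.
have := lt_le_trans Dp (Dw_le_Smax hu hu t0 tq).
by rewrite pmulr_lgt0 // powR_gt0.
Qed.

End quadratic_form_of_pairs.

Lemma inn_fun (R : realType) (N : nat) (M : R) (f : 'rV[R]_N -> R) (r : R) x :
  0 < r -> `|inn M f x| `^ r = \1_(box M) x * `|f x| `^ r.
Proof.
move=> r0; rewrite /inn indicE; case: (_ \in _); first by rewrite !mul1r.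
by rewrite !mul0r normr0 powR0 // gt_eqF.
Qed.

Lemma split_arith (R : realFieldType) (e eta s d d' W a b D1 D2 : R) : 0 < e -> 0 <= W -> d <= d' ->
  a <= D1 -> b <= D2 -> eta * (2 * (1 + e) ^+ 2 * (s * s)) <= e / 2 -> d' * W <= e / 2 ->
  (1 + e) ^+ 2 * (a + b + 2 * (eta * s * s)) + W * d <= (1 + e) ^+ 2 * (D1 + D2) + e.
Proof.
move=> e0 W0 dd h1 h2 he hd.
have h3 : W * d <= e / 2 by apply: le_trans hd; rewrite mulrC ler_wpM2r.
have -> : (1 + e) ^+ 2 * (a + b + 2 * (eta * s * s)) =
  (1 + e) ^+ 2 * (a + b) + eta * (2 * (1 + e) ^+ 2 * (s * s)) by ring.
have h4 : (1 + e) ^+ 2 * (a + b) <= (1 + e) ^+ 2 * (D1 + D2) by rewrite ler_wpM2l ?sqr_ge0 // lerD.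
have -> : (1 + e) ^+ 2 * (D1 + D2) + e = (1 + e) ^+ 2 * (D1 + D2) + e / 2 + e / 2 by field.
by apply: lerD => //; exact: lerD.
Qed.

(** * Splitting the nonlocal term along a weakly convergent sequence *)

Section splitting.
Context (R : realType) (N : nat).
Local Notation mu := (lebesgue_rV R N).
Implicit Types u v w z f g : 'rV[R]_N -> R.

(** Inside the box of radius M the fixed function u is the main term, outside the box of radius M'
    the remainder z is. Everything else, including the whole shell between the two, goes into the
    last term, which will be small. *)
Lemma split_dominate (r e : R) : 0 < r -> 0 < e -> exists2 C : R, 0 < C &
  forall u z w (M M' : R) x, M <= M' -> `|w x| <= `|u x| + `|z x| ->
  pwf r w x <= (1 + e) * (1 * inn M (pwf r u) x + out M' (pwf r z) x) +
    C * (1 * inn M' (pwf r z) x + out M (pwf r u) x).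
Proof.
move=> r0 e0; have [C C0 H] := growth r0 e0.
exists (C + (1 + e)); first by rewrite addr_gt0 // addr_gt0.
move=> u z w M M' x MM wuz; rewrite !innE !outE.
have h1 := H _ _ (normr_ge0 (u x)) (normr_ge0 (z x)).
have h2 := H _ _ (normr_ge0 (z x)) (normr_ge0 (u x)).
have h : pwf r w x <= (`|u x| + `|z x|) `^ r by apply: powR_mono => //; exact: ltW.
have {}h1 : pwf r w x <= (1 + e) * pwf r u x + C * pwf r z x by exact: le_trans h h1.
have {}h2 : pwf r w x <= (1 + e) * pwf r z x + C * pwf r u x.
  by apply: le_trans h _; rewrite addrC.
have a := pwf_ge0 r u x; have b := pwf_ge0 r z x.
have e1 : 0 <= 1 + e by rewrite addr_ge0 // ltW.
case: (leP `|x| M) => xM.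
  rewrite (le_trans xM MM); nra.
case: (leP `|x| M') => xM'; nra.
Qed.

Variables (k : 'rV[R]_N -> R) (x1 x2 : R).
Hypothesis KS : good_kernel x1 x2 k.
Local Notation adm := (adm x1 x2).
Local Notation form := (form k).

Section filter.
Variables (F : set_system nat) (FF : Filter F).

Lemma adm_rellich (r C M d : R) (z : nat -> 'rV[R]_N -> R) :
  0 < r -> subcrit N (r / x1) -> subcrit N (r / x2) ->
  (forall n, H1 (z n)) -> (forall n, S1 (z n) <= C) -> wcvg mu F z (fun=> 0) -> 0 <= M -> 0 < d ->
  \forall n \near F, adm d (inn M (pwf r (z n))).
Proof.
move=> r0 s1 s2 hz zC z0 M0 d0; have [a b] := gk_gt0 KS.
have E x : 0 < x -> forall n, pw x (inn M (pwf r (z n))) = nnI mu (fun y => \1_(box M) y * `|z n y| `^ (r / x)).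
  move=> x0 n; transitivity (nnI mu (fun y => `|inn M (pwf r (z n)) y| `^ x^-1)); first by [].
  by congr nnI; apply/funext => y; rewrite inn_fun ?invr_gt0 // abs_pwf /pwf -powRrM.
have m n : mf (inn M (pwf r (z n))) by apply: mf_inn; exact: mf_pwf (L2_mf (H1_L2 (hz n))).
have p1 : 0 < d `^ x1^-1 by exact: powR_gt0.
have p2 : 0 < d `^ x2^-1 by exact: powR_gt0.
have R1 := rellich FF hz zC z0 s1 M0 p1; have R2 := rellich FF hz zC z0 s2 M0 p2.
apply: filterS2 R1 R2 => n h1 h2; split; split => //; first by rewrite E.
by rewrite E.
Qed.

End filter.

(** Bilinear expansion: the diagonal terms are kept, the cross terms are at most eta, and each term
    with a factor r or r' is of order d. *)
Lemma form_split2 s d T c eta (e : R) (a1 a2 b1 b2 r r' : 'rV[R]_N -> R) :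
  (forall s t f g, adm s f -> adm t g -> `|form f g| <= c * s * t) -> 0 < e -> 0 <= c -> d <= 1 ->
  T = 2 * ((1 + e) * (4 * s) + 1) ->
  adm s a1 -> adm s a2 -> adm s b1 -> adm s b2 -> adm d r -> adm d r' ->
  `|form a1 b2| <= eta -> `|form a2 b1| <= eta ->
  form (fun x => (1 + e) * (1 * a1 x + a2 x) + r x) (fun x => (1 + e) * (1 * b1 x + b2 x) + r' x) <=
  (1 + e) ^+ 2 * (form a1 b1 + form a2 b2 + 2 * eta) + ((1 + e) * c * (4 * s) + c * T) * d.
Proof.
move=> Hc e0 c0 d1 TE A1 A2 B1 B2 Ar Ar' h1 h2.
have s0 := adm_gt0 A1; have d0 := adm_gt0 Ar.
have e1 : 0 < 1 + e by rewrite addr_gt0.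
have one (f : 'rV[R]_N -> R) : (fun x => 1 * f x) = f by apply/funext => x; rewrite mul1r.
have AD (a a' : 'rV[R]_N -> R) : adm s a -> adm s a' -> adm (4 * s) (fun x => 1 * a x + a' x).
  move=> h h'; have := admD KS h h'; rewrite (_ : 2 * (s + s) = 4 * s); last by ring.
  by congr adm; apply/funext => x; rewrite mul1r.
have P := AD _ _ A1 A2; have P' := AD _ _ B1 B2.
have G : adm T (fun x => (1 + e) * (1 * b1 x + b2 x) + r' x).
  have := admD KS (admZ KS (lt0r_neq0 e1) P') Ar'; apply: (admW KS).
  by rewrite TE ler_pM2l // gtr0_norm // lerD2l.
rewrite (form_linl KS (1 + e) P Ar G) (form_linr KS (1 + e) P' Ar' P).
rewrite (form_linl KS 1 A1 A2 P') (form_linr KS 1 B1 B2 A1) (form_linr KS 1 B1 B2 A2) !mul1r.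
have q1 := Hc _ _ _ _ P Ar'; have q2 := Hc _ _ _ _ Ar G.
have -> : (1 + e) ^+ 2 * (form a1 b1 + form a2 b2 + 2 * eta) + ((1 + e) * c * (4 * s) + c * T) * d =
  (1 + e) * ((1 + e) * (form a1 b1 + eta + (eta + form a2 b2)) + c * (4 * s) * d) + c * d * T by ring.
apply: lerD; last exact: le_trans (ler_norm _) q2.
rewrite ler_pM2l //; apply: lerD; last exact: le_trans (ler_norm _) q1.
rewrite ler_pM2l //; apply: lerD; first by rewrite lerD2l; exact: le_trans (ler_norm _) h1.
by rewrite lerD2r; exact: le_trans (ler_norm _) h2.
Qed.

Variables (p q : R) (A B : 'rV[R]_N -> R).
Hypotheses (p1 : 1 < p) (q1 : 1 < q).
Hypotheses (sp1 : subcrit N (p / x1)) (sp2 : subcrit N (p / x2)).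
Hypotheses (sq1 : subcrit N (q / x1)) (sq2 : subcrit N (q / x2)).
Local Notation Dw := (Dw k p q).
Variables (F : set_system nat) (FF : Filter F).

(** A one-sided splitting of Brezis-Lieb type, which is all that the comparison with the supremum
    requires. The radius M makes the tails of u and v small, the gap M' - M makes the two main terms
    interact weakly, and local compactness makes z and y small inside the larger box. *)
Lemma Dw_split (un vn z y : nat -> 'rV[R]_N -> R) u v (C e : R) : 0 < C -> 0 < e ->
  H1 u -> H1 v -> S1 u <= C -> S1 v <= C ->
  (forall n, H1 (un n)) -> (forall n, H1 (vn n)) ->
  (forall n, H1 (z n)) -> (forall n, S1 (z n) <= C) -> wcvg mu F z (fun=> 0) ->
  (forall n, H1 (y n)) -> (forall n, S1 (y n) <= C) -> wcvg mu F y (fun=> 0) ->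
  (forall n x, `|un n x| <= `|u x| + `|z n x|) -> (forall n x, `|vn n x| <= `|v x| + `|y n x|) ->
  \forall n \near F, Dw (un n) (vn n) <= (1 + e) ^+ 2 * (Dw u v + Dw (z n) (y n)) + e.
Proof.
move=> C0 e0 hu hv uC vC hun hvn hz zC z0 hy yC y0 uz vy.
have p0 : 0 < p by exact: lt_trans ltr01 p1.
have q0 : 0 < q by exact: lt_trans ltr01 q1.
have [K K0 HK] := admp KS sp1 sp2; have [L L0 HL] := admq KS sq1 sq2.
pose s := K * C `^ p + L * C `^ q.
have s0 : 0 < s by rewrite addr_gt0 // mulr_gt0 // powR_gt0.
have sp w : H1 w -> S1 w <= C -> adm s (pwf p w).
  move=> hw wC; apply: (admW KS _ (HK w C hw C0 wC)).
  by rewrite /s lerDl mulr_ge0 ?powR_ge0 // ltW.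
have sq w : H1 w -> S1 w <= C -> adm s (pwf q w).
  move=> hw wC; apply: (admW KS _ (HL w C hw C0 wC)).
  by rewrite /s lerDr mulr_ge0 ?powR_ge0 // ltW.
have [c c0 Hc] := form_le KS.
have e1 : 0 < 1 + e by rewrite addr_gt0.
pose T := 2 * ((1 + e) * (4 * s) + 1).
have T0 : 0 < T by rewrite mulr_gt0 // addr_gt0 // !mulr_gt0.
have e2 : 0 < e / 2 by rewrite divr_gt0.
have w1 : 0 <= 2 * (1 + e) ^+ 2 * (s * s) by rewrite !mulr_ge0 ?sqr_ge0 ?ltW.
have [eta eta0 etae] := mul_small w1 e2.
have w2 : 0 <= (1 + e) * c * (4 * s) + c * T.
  by apply/ltW; apply: addr_gt0; [rewrite !mulr_gt0|rewrite mulr_gt0].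
have [d' d'0 d'e] := mul_small w2 e2.
pose d := Num.min 1 d'; have d0 : 0 < d by rewrite lt_min ltr01.
have d1 : d <= 1 by rewrite ge_min lexx.
have dd : d <= d' by rewrite ge_min lexx orbT.
have [Cp Cp0 HCp] := split_dominate p0 e0; have [Cq Cq0 HCq] := split_dominate q0 e0.
(* Adding two functions doubles the sum of their bounds, so 4 Cp dp = d. *)
pose dp := d / (4 * Cp); have dp0 : 0 < dp by rewrite divr_gt0 // mulr_gt0.
pose dq := d / (4 * Cq); have dq0 : 0 < dq by rewrite divr_gt0 // mulr_gt0.
have [M1 HM1] := adm_tail KS (sp u hu uC) dp0; have [M2 HM2] := adm_tail KS (sq v hv vC) dq0.
pose M := Num.max 0 (Num.max M1 M2).
have M0 : 0 <= M by rewrite le_max lexx.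
have om1 : adm dp (out M (pwf p u)) by apply: HM1; rewrite !le_max lexx !orbT.
have om2 : adm dq (out M (pwf q v)) by apply: HM2; rewrite !le_max lexx !orbT.
have [Lt Lt0 HLt] := form_tail_le KS eta0.
pose M' := M + Lt; have MM' : M <= M' by rewrite lerDl.
have M'0 : 0 <= M' by exact: le_trans MM'.
have R1 := adm_rellich FF p0 sp1 sp2 hz zC z0 M'0 dp0.
have R2 := adm_rellich FF q0 sq1 sq2 hy yC y0 M'0 dq0.
apply: filterS2 R1 R2 => n r1 r2.
have small (Cc dd' : R) f g : 0 < Cc -> dd' = d / (4 * Cc) -> adm dd' f -> adm dd' g ->
    adm d (fun x => Cc * (1 * f x + g x)).
  move=> Cc0 dE af ag; have := admZ KS (lt0r_neq0 Cc0) (admD KS af ag).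
  rewrite gtr0_norm // (_ : Cc * (2 * (dd' + dd')) = d); last by rewrite dE; field; rewrite gt_eqF.
  by congr adm; apply/funext => x; rewrite mul1r.
have Ar := small _ _ _ _ Cp0 erefl r1 om1; have Ar' := small _ _ _ _ Cq0 erefl r2 om2.
have mw (r : R) w : H1 w -> mf (pwf r w) by move=> hw; exact: mf_pwf (L2_mf (H1_L2 hw)).
have ai (t r : R) w : H1 w -> adm t (pwf r w) -> adm t (inn M (pwf r w)).
  move=> hw; apply: (adm_mono KS _ _ (lexx t)); first by apply: mf_inn; exact: mw.
  exact: abs_inn_le.
have ao (t r : R) w : H1 w -> adm t (pwf r w) -> adm t (out M' (pwf r w)).
  move=> hw; apply: (adm_mono KS _ _ (lexx t)); first by apply: mf_out; exact: mw.
  exact: abs_out_le.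
have A1 := ai _ _ _ hu (sp u hu uC); have B1 := ai _ _ _ hv (sq v hv vC).
have A2 := ao _ _ _ (hz n) (sp _ (hz n) (zC n)); have B2 := ao _ _ _ (hy n) (sq _ (hy n) (yC n)).
have sep f g x y' : inn M f y' != 0 -> out M' g x != 0 -> Lt < `|x - y'| /\ Lt < `|y' - x|.
  rewrite innE outE; case: ifP => [yM _|_]; last by rewrite eqxx.
  case: ifP => [|/negbT]; first by rewrite eqxx.
  rewrite -ltNge => xM' _; rewrite (distrC y' x).
  suff h : Lt < `|x - y'| by [].
  apply: lt_le_trans (lerB_dist x y'); rewrite ltrBrDr.
  by apply: le_lt_trans xM'; rewrite /M' addrC lerD2r.
have c1 : `|form (inn M (pwf p u)) (out M' (pwf q (y n)))| <= eta * s * s.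
  by apply: HLt A1 B2 _ => x y' h1 h2; have [] := sep _ _ _ _ h1 h2.
have c2 : `|form (out M' (pwf p (z n))) (inn M (pwf q v))| <= eta * s * s.
  by apply: HLt A2 B1 _ => x y' h1 h2; have [] := sep _ _ _ _ h2 h1.
have S2 := form_split2 Hc e0 (ltW c0) d1 erefl A1 A2 B1 B2 Ar Ar' c1 c2.
apply: le_trans (_ : form (fun x => (1 + e) * (1 * inn M (pwf p u) x + out M' (pwf p (z n)) x) +
      Cp * (1 * inn M' (pwf p (z n)) x + out M (pwf p u) x))
    (fun x => (1 + e) * (1 * inn M (pwf q v) x + out M' (pwf q (y n)) x) +
      Cq * (1 * inn M' (pwf q (y n)) x + out M (pwf q v) x)) <= _).
  have AF (a1 a2 r : 'rV[R]_N -> R) : adm s a1 -> adm s a2 -> adm d r ->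
      exists t, adm t (fun x => (1 + e) * (1 * a1 x + a2 x) + r x).
    move=> h1 h2 h3; have h := admD KS (admZ KS (lt0r_neq0 e1) (admD KS h1 h2)) h3.
    exists (2 * (`|1 + e| * (2 * (s + s)) + d)); move: h; congr adm; apply/funext => x.
    by rewrite mul1r.
  have [t1 T1] := AF _ _ _ A1 A2 Ar; have [t2 T2] := AF _ _ _ B1 B2 Ar'.
  apply: (form_mono KS _ _ _ _ T1 T2).
  - by move=> x; rewrite pwf_ge0 /=; apply: HCp.
  - by move=> x; rewrite pwf_ge0 /=; apply: HCq.
  - exact: mw.
  - exact: mw.
apply: le_trans S2 _.
have le1 : form (inn M (pwf p u)) (inn M (pwf q v)) <= Dw u v.
  apply: (form_mono KS _ _ _ _ (sp u hu uC) (sq v hv vC)); try by apply: mf_inn; exact: mw.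
  - by move=> x; rewrite innE; case: ifP => _; rewrite ?lexx pwf_ge0.
  - by move=> x; rewrite innE; case: ifP => _; rewrite ?lexx pwf_ge0.
have le2 : form (out M' (pwf p (z n))) (out M' (pwf q (y n))) <= Dw (z n) (y n).
  apply: (form_mono KS _ _ _ _ (sp _ (hz n) (zC n)) (sq _ (hy n) (yC n))); try by apply: mf_out; exact: mw.
  - by move=> x; rewrite outE; case: ifP => _; rewrite ?lexx pwf_ge0.
  - by move=> x; rewrite outE; case: ifP => _; rewrite ?lexx pwf_ge0.
exact: split_arith e0 w2 dd le1 le2 etae d'e.
Qed.

End splitting.

Lemma DwE (R : realType) (N : nat) (k : 'rV[R]_N -> R) (p q : R) (u v : 'rV[R]_N -> R) :
  Dw k p q u v = form k (pwf p u) (pwf q v).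
Proof. by []. Qed.

Opaque S1 form Dw Smax.

Lemma S1B (R : realType) (N : nat) (f g : 'rV[R]_N -> R) : H1 f -> H1 g ->
  S1 (fun x => f x - g x) <= S1 f + S1 g.
Proof.
move=> hf hg; have E : (fun x => f x - g x) = fun x => -1 * g x + f x by apply/funext => x; ring.
rewrite E.
have h := S1_lin (-1) hg hf.
apply: (le_trans h).
have -> : `|-1| = 1 :> R by rewrite normrN1.
rewrite mul1r.
by move: (S1 f) (S1 g) => a b; rewrite addrC.
Qed.

Lemma gap_arith (R : realFieldType) (e a b c d f g : R) :
  f + g - (c + d) <= e / 2 -> a + b <= 1 ->
  a - 2 * c + f + (b - 2 * d + g) <= 1 - (f + g) + e.
Proof. move=> h1 h2; lra. Qed.

Lemma half_gap (R : realFieldType) (s : R) n : 0 < s -> s / 2 <= s - s / 2 / n.+1%:R.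
Proof.
move=> s0; have : s / 2 / n.+1%:R <= s / 2.
  by rewrite ler_pdivrMr ?ltr0n // ler_peMr ?ler1n // ltW // divr_gt0.
move: (s / 2 / n.+1%:R) => t; lra.
Qed.

(** * Periodic weights *)

Section periodic_weights.
Context (R : realType) (N : nat).
Implicit Types A : 'rV[R]_N -> R.
Local Notation e i := (delta_mx ord0 i : 'rV[R]_N).

Lemma box_compact (M : R) : compact (box M : set 'rV[R]_N).
Proof.
have [M0|M0] := leP 0 M; last first.
  rewrite (_ : box M = set0); first exact: compact0.
  apply/seteqP; split => x //; rewrite /box /= => xM.
  by have := le_lt_trans (le_trans (normr_ge0 x) xM) M0; rewrite ltxx.
rewrite (_ : box M = [set v | forall i, `[- M, M]%classic (v ord0 i)]).
  by have := @rV_compact R N (fun=> `[- M, M]%classic) (fun=> @segment_compact R (- M) M).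
apply/seteqP; split => x /=.
  by move=> xr i; rewrite /= in_itv /= -ler_norml; apply: le_trans xr; exact: coord_norm_le.
by move=> H; apply: rV_norm_le => // i; have := H i; rewrite /= in_itv /= -ler_norml.
Qed.

Definition per A (a : 'rV[R]_N) : Prop := forall x, A (x + a) = A x.

Lemma perD A a b : per A a -> per A b -> per A (a + b).
Proof. by move=> pa pb x; rewrite addrA pb pa. Qed.

Lemma perN A a : per A a -> per A (- a).
Proof. by move=> pa x; rewrite -(pa (x - a)) subrK. Qed.

Lemma per_int A a (n : int) : per A a -> per A (n%:~R *: a).
Proof.
move=> pa; have P m : per A (m%:R *: a).
  elim: m => [|m IH] x; first by rewrite scale0r addr0.
  by rewrite -natr1 scalerDl scale1r addrA pa IH.
case: n => n; first exact: P.
have -> : (Negz n)%:~R = - n.+1%:R :> R by rewrite NegzE intrN.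
by rewrite scaleNr; apply: perN; exact: P.
Qed.

(** Rounding down each coordinate to a multiple of its period; T, the sum of the periods, serves all
    coordinates. *)
Lemma lattice (tau : 'I_N -> R) : (forall i, 0 < tau i) -> exists2 T : R, 0 <= T &
  forall x : 'rV[R]_N, exists2 a, `|x - a| <= T & forall A, (forall i, per A (tau i *: e i)) -> per A a.
Proof.
move=> t0; pose T := \sum_(i < N) tau i; have T0 : 0 <= T by apply: sumr_ge0 => i _; exact: ltW.
exists T => // x; pose n i : int := Num.floor (x ord0 i / tau i).
exists (\sum_(i < N) (n i)%:~R *: (tau i *: e i)).
  apply: rV_norm_le => // i; rewrite !mxE summxE (bigD1 i) //= big1 => [|j ji]; last first.
    by rewrite !mxE eqxx /= [i == j]eq_sym (negbTE ji) !mulr0.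
  rewrite addr0 !mxE !eqxx /= mulr1.
  have := floor_itv (x ord0 i / tau i); rewrite -/(n i) ler_pdivlMr // ltr_pdivrMr // intrD mulrDl mul1r.
  move=> /andP[h1 h2]; rewrite ger0_norm ?subr_ge0 //; apply: (@le_trans _ _ (tau i)).
    by rewrite lerBlDl ltW.
  by rewrite /T (bigD1 i) //= lerDl; apply: sumr_ge0 => j _; exact: ltW.
move=> A pA; elim/big_ind: _ => [x'|a b|i _]; first by rewrite addr0.
  exact: perD.
exact: per_int.
Qed.

(** The upper bound holds on a compact box by continuity and is carried everywhere by the
    periods. *)
Lemma weight_periodic A (a0 : R) (tau : 'I_N -> R) : (forall i, 0 < tau i) -> continuous A -> 0 < a0 ->
  (forall x, a0 <= A x) -> (forall i, per A (tau i *: e i)) -> weight A.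
Proof.
move=> t0 cA a00 aA pA; split; [exact: mf_continuous|by exists a0|].
have [T T0 HT] := lattice t0.
have /compact_bounded [M [_ HM]] : compact [set A x | x in box T].
  by apply: continuous_compact; [exact: continuous_subspaceT|exact: box_compact].
exists (M + 1) => x; have [a xa pa] := HT x.
have := HM (M + 1) _ (A (x - a)); rewrite ltrDl ltr01 => /(_ isT) h.
rewrite -(perN (pa A pA) x); apply: le_trans (ler_norm _) _; apply: h.
by exists (x - a).
Qed.

End periodic_weights.

Section maximiser.
Context (R : realType) (N : nat).
Local Notation mu := (lebesgue_rV R N).
Variables (k : 'rV[R]_N -> R) (x1 x2 p q : R) (A B : 'rV[R]_N -> R).
Hypotheses (N0 : (0 < N)%N) (KS : good_kernel x1 x2 k) (wA : weight A) (wB : weight B).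
Hypotheses (p1 : 1 < p) (q1 : 1 < q).
Hypotheses (sp1 : subcrit N (p / x1)) (sp2 : subcrit N (p / x2)).
Hypotheses (sq1 : subcrit N (q / x1)) (sq2 : subcrit N (q / x2)).
Hypotheses (tp1 : 2 < p / x1) (tp2 : 2 < p / x2).
Variable T : R.
Hypothesis T0 : 0 <= T.
Hypothesis Hlat : forall x : 'rV[R]_N, exists2 a, `|x - a| <= T & per A a /\ per B a.
Implicit Types u v w f g : 'rV[R]_N -> R.
Local Notation Dw := (Dw k p q).
Local Notation Qw := (Qw A B).
Local Notation S := (Smax k p q A B).
Local Notation ip := (ip mu).
Local Notation nn := (nn mu).

(** The integral of |u| over the unit box centred at x. *)
Definition mass1 x u : R := ip (trn (- x) (\1_(box 1))) (fun y => `|u y|).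

Lemma L2_box1 x : L2 mu (trn (- x) (\1_(box 1) : 'rV[R]_N -> R)).
Proof. by apply: L2_trn; have := L2_box N 1 (1 : R); under eq_fun do rewrite mul1r. Qed.

(** A dyadic cell containing x lies in the unit box around x. *)
Lemma Pm_le_mass1 m x u : H1 u -> `|Pm m u x| <= 2 ^+ (m * N) * mass1 x u.
Proof.
move=> hu; have lu := H1_L2 hu; have [l1 _] := L2_cellset R m (cell m x).
rewrite /Pm avgE normrM ger0_norm ?exprn_ge0 // ler_pM2l ?exprn_gt0 //.
have i1 := L2_intgM l1 lu; rewrite ipE; apply: le_trans (Int_abs i1) _.
rewrite /mass1 ipE; apply: Int_le; [exact: intg_abs|exact: (L2_intgM (L2_box1 x) (L2_abs lu))|].
move=> y; rewrite normrM ler_wpM2r // /trn !indicE.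
case: (boolP (y \in _)); last by rewrite normr0.
rewrite inE /cellset /= => yx; rewrite normr1 mem_set // /box /=.
apply: le_trans (cell_dist yx) _; by rewrite invf_le1 ?exprn_gt0 // exprn_ege1 // ler1n.
Qed.

Lemma mass1Z c x u : H1 u -> 0 <= c -> mass1 x (fun y => c * u y) = c * mass1 x u.
Proof.
move=> hu c0; rewrite /mass1 -(ipZr c (L2_abs (H1_L2 hu)) (L2_box1 x)) !ipE.
by apply: eq_Rintegral => y _; rewrite normrM (ger0_norm c0).
Qed.

(** If all local masses of u were small, |u|^p would be small in both Lebesgue norms by
    [nonvanishing], and the form with it, whatever v is. *)
Lemma mass_bound : exists2 d : R, 0 < d & forall u v, H1 u -> H1 v -> Qw u v <= 1 -> S / 2 <= Dw u v ->
  exists x, d <= mass1 x u.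
Proof.
have S0 : 0 < S by apply: (Smax_gt0 N0 KS wA wB).
have [x10 x20] := gk_gt0 KS.
have [C C0 HC] := S1_le_Qw wA wB.
have [L L0 HL] := admq KS sq1 sq2; have [c c0 Hc] := form_le KS.
pose t := L * C `^ q; have t0 : 0 < t by rewrite mulr_gt0 // powR_gt0.
(* Chosen so that the bound c d t of the form is S/4, below the assumed S/2. *)
pose d := S / (4 * (c * t)); have d0 : 0 < d by apply: (divr_gt0 S0); apply: mulr_gt0 => //; exact: mulr_gt0.
have NV x : 0 < x -> subcrit N (p / x) -> 2 < p / x -> exists2 dl : R, 0 < dl & forall u, H1 u -> S1 u <= C ->
    (forall y, mass1 y u < dl) -> bd x d (pwf p u).
  move=> x0 sp tp; have e0 : 0 < d `^ x^-1 / C `^ (p / x) by rewrite divr_gt0 ?powR_gt0.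
  have [m [dl dl0 H]] := nonvanishing sp tp e0.
  exists (C * (dl / 2 ^+ (m * N))); first by rewrite !mulr_gt0 // invr_gt0 exprn_gt0.
  move=> u hu uC um; have hs := H1Z C^-1 hu; have Ci : 0 < C^-1 by rewrite invr_gt0.
  have mu_ := L2_mf (H1_L2 hu).
  have su : S1 (fun y => C^-1 * u y) <= 1.
    by apply: le_trans (S1Z _ hu) _; rewrite (gtr0_norm Ci) mulrC ler_pdivrMr // mul1r.
  have hP y : `|Pm m (fun y => C^-1 * u y) y| <= dl.
    apply: le_trans (Pm_le_mass1 m y hs) _; rewrite mass1Z ?(ltW Ci) //.
    rewrite mulrC -ler_pdivlMr ?exprn_gt0 // mulrC ler_pdivrMr // mulrC ltW //.
  have h := H _ hs su hP; split => //; first exact: mf_pwf.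
  rewrite pw_pwf (_ : (fun y => _) = fun y => 1 * `|u y| `^ (p / x)); last by apply/funext => y; rewrite mul1r.
  rewrite (nnI_pow_scale (p / x) (a := C)) //.
  under [X in nnI mu X]eq_fun do rewrite mul1r.
  apply: (@le_trans _ _ ((C `^ (p / x))%:E * (d `^ x^-1 / C `^ (p / x))%:E)%E).
    by apply: lee_wpmul2l => //; rewrite lee_fin powR_ge0.
  by rewrite -EFinM lee_fin mulrC divfK // gt_eqF // powR_gt0.
have [d1 d10 H1_] := NV x1 x10 sp1 tp1; have [d2 d20 H2_] := NV x2 x20 sp2 tp2.
exists (Num.min d1 d2); first by rewrite lt_min d10.
move=> u v hu hv Q1 D1; have [uC vC] := HC u v hu hv.
have s1 : Num.sqrt (Qw u v) <= 1 by rewrite -[leRHS]sqrtr1 ler_wsqrtr.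
have {}uC : S1 u <= C by apply: le_trans uC _; rewrite -[leRHS]mulr1 ler_pM2l.
have {}vC : S1 v <= C by apply: le_trans vC _; rewrite -[leRHS]mulr1 ler_pM2l.
apply: contrapT => no; have lt y : mass1 y u < Num.min d1 d2.
  by rewrite ltNge; apply/negP => h; apply: no; exists y.
have ad : adm x1 x2 d (pwf p u).
  split; [apply: H1_ => // y|apply: H2_ => // y]; apply: lt_le_trans (lt y) _; rewrite ge_min lexx ?orbT //.
have := le_trans (ler_norm _) (Hc _ _ _ _ ad (HL v C hv C0 vC)).
rewrite -/t -DwE => h; have := le_trans D1 h.
have -> : c * d * t = S / 4 by rewrite /d; field; rewrite !gt_eqF.
by rewrite ler_pM2l // lef_pV2 ?posrE // ler_nat.
Qed.

Lemma maximising_sequence : exists2 d : R, 0 < d & exists u v : nat -> 'rV[R]_N -> R, forall n,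
  [/\ H1 (u n), H1 (v n), Qw (u n) (v n) <= 1, S - S / 2 / n.+1%:R <= Dw (u n) (v n) &
    d <= ip (\1_(box (1 + T))) (u n)].
Proof.
have S0 : 0 < S by apply: (Smax_gt0 N0 KS wA wB).
have [d d0 Hd] := mass_bound; exists d => //.
suff H n : exists w : ('rV[R]_N -> R) * ('rV[R]_N -> R), [/\ H1 w.1, H1 w.2, Qw w.1 w.2 <= 1,
    S - S / 2 / n.+1%:R <= Dw w.1 w.2 & d <= ip (\1_(box (1 + T))) w.1].
  by have [f Hf] := choice H; exists (fun n => (f n).1), (fun n => (f n).2).
have e0 : 0 < S / 2 / n.+1%:R by rewrite !divr_gt0.
have [u [v [hu hv Q1 HD]]] : exists u v : 'rV[R]_N -> R,
    [/\ H1 u, H1 v, Qw u v <= 1 & S - S / 2 / n.+1%:R < Dw u v].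
  have [_ [[u v] /= [hu hv Q1] <-] HD] := sup_adherent e0 (Smax_has_sup KS wA wB sp1 sp2 sq1 sq2).
  by exists u, v.
(* Absolute values keep Dw and do not increase Qw; for a nonnegative function the mass is a linear
   functional, which passes to weak limits. *)
pose au : 'rV[R]_N -> R := fun x => `|u x|; pose av : 'rV[R]_N -> R := fun x => `|v x|.
have hau : H1 au by exact: H1_abs. have hav : H1 av by exact: H1_abs.
have Qa : Qw au av <= 1 by apply: le_trans (Qw_abs _ _ _ _) Q1.
have Da : Dw au av = Dw u v by exact: Dw_abs.
have D2 : S / 2 <= Dw au av.
  by rewrite Da; apply: le_trans (ltW HD); exact: half_gap.
have [x hx] := Hd _ _ hau hav Qa D2.
(* A common period of A and B within T of x: shifting by it preserves Qw and Dw and brings the mass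
   into the box of radius 1 + T around the origin. *)
have [a xa [pa pb]] := Hlat x.
exists (trn a au, trn a av); split => /=; [exact: H1_trn|exact: H1_trn|..].
- by rewrite /Qw (qi_trn wA hau pa) (qi_trn wB hav pb).
- by rewrite (Dw_trn KS sp1 sp2 sq1 sq2 a hau hav) Da; exact: ltW HD.
apply: le_trans hx _; rewrite /mass1.
have lb : L2 mu (\1_(box (1 + T)) : 'rV[R]_N -> R).
  by have := L2_box N (1 + T) (1 : R); under eq_fun do rewrite mul1r.
have la := H1_L2 hau.
rewrite -(ip_trn (- a) lb (L2_trn a la)) !ipE.
apply: Int_le; [exact: (L2_intgM (L2_box1 x) (L2_abs la))|exact: (L2_intgM (L2_trn (- a) lb) (L2_trn (- a) (L2_trn a la)))|].
move=> y; rewrite /trn subrK /au normr_id; apply: ler_wpM2r; first exact: normr_ge0.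
rewrite !indicE; case: (boolP (y - x \in _)) => [|_]; last by case: (_ \in _).
rewrite inE => yx; rewrite mem_set; first exact: lexx.
rewrite /box /=.
have -> : y - a = (y - x) + (x - a) by rewrite addrA subrK.
by apply: le_trans (ler_normD _ _) _; exact: lerD.
Qed.

(** The limit e -> 0 in the splitting inequality. The power (c + e)^g is handled by [growth], which
    also covers c = 0. *)
Lemma limit_gap (D c g K : R) : 1 <= g -> 0 <= D -> 0 <= c -> 0 <= K ->
  (forall e : R, 0 < e -> e <= 1 -> K - e <= (1 + e) ^+ 2 * (D + K * (c + e) `^ g) + e) ->
  K <= D + K * c `^ g.
Proof.
move=> g1 D0 c0 K0 H; apply/ler_addgt0Pr => eps eps0.
have g0 : 0 < g by exact: lt_le_trans g1.
pose X := D + K * c `^ g; have X0 : 0 <= X by rewrite addr_ge0 // mulr_ge0 // powR_ge0.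
have W : 0 <= 2 + 3 * X + 4 * (K * (c `^ g + 1)).
  by rewrite !addr_ge0 // ?mulr_ge0 // addr_ge0 // powR_ge0.
have [eta' eta'0 he'] := mul_small W eps0.
pose eta := Num.min 1 eta'; have eta0 : 0 < eta by rewrite lt_min ltr01.
have eta1 : eta <= 1 by rewrite ge_min lexx.
have he : eta * (2 + 3 * X + 4 * (K * (c `^ g + 1))) <= eps.
  by apply: le_trans he'; rewrite ler_wpM2r // ge_min lexx orbT.
have [C C0 HC] := growth g0 eta0.
pose e := Num.min eta (eta / C).
have e0 : 0 < e by rewrite lt_min eta0 divr_gt0.
have ee : e <= eta by rewrite ge_min lexx.
have e1 : e <= 1 by exact: le_trans eta1.
have Ce : C * e `^ g <= eta.
  apply: (@le_trans _ _ (C * e)); last by rewrite mulrC -ler_pdivlMr // ge_min lexx orbT.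
  by rewrite ler_pM2l //; apply: ge1r_powR => //; rewrite e0.
have h1 : K * (c + e) `^ g <= K * ((1 + eta) * c `^ g + eta).
  by rewrite ler_wpM2l //; apply: le_trans (HC c e c0 (ltW e0)) _; rewrite lerD2l.
have := H e e0 e1; move: h1 he X0 K0 eta0 e0 ee eta1 (powR_ge0 c g) D0; rewrite /X.
move: (K * (c + e) `^ g) (c `^ g) => Y G; clear; move=> h1 he X0 K0 eta0 e0 ee eta1 G0 D0 h.
have Y0 : (1 + e) ^+ 2 * (D + Y) <= (1 + e) ^+ 2 * (D + K * ((1 + eta) * G + eta)).
  by rewrite ler_wpM2l ?sqr_ge0 // lerD2l.
have Z0 : 0 <= D + K * ((1 + eta) * G + eta).
  by rewrite addr_ge0 // mulr_ge0 // addr_ge0 ?mulr_ge0 // ?addr_ge0 // ltW.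
have Y1 : (1 + e) ^+ 2 * (D + K * ((1 + eta) * G + eta)) <= (1 + 3 * eta) * (D + K * ((1 + eta) * G + eta)).
  rewrite ler_wpM2r //; nra.
have KG : 0 <= K * (G + 1) by rewrite mulr_ge0 // addr_ge0.
have Y2 : (1 + 3 * eta) * (D + K * ((1 + eta) * G + eta)) <=
    D + K * G + eta * (3 * (D + K * G) + 4 * (K * (G + 1))).
  rewrite (_ : D + K * ((1 + eta) * G + eta) = D + K * G + eta * (K * (G + 1))); last by ring.
  move: (K * (G + 1)) KG (D + K * G) X0 => V V0 X X0.
  have : eta * (eta * V) <= eta * V by rewrite ler_wpM2l ?(ltW eta0) // ler_piMl.
  nra.
have := le_trans Y0 (le_trans Y1 Y2); nra.
Qed.

Lemma maximiser_exists : exists u v : 'rV[R]_N -> R,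
  [/\ H1 u /\ H1 v, forall x, 0 <= u x, forall x, 0 <= v x, Qw u v = 1 & Dw u v = S].
Proof.
have S0 : 0 < S by apply: (Smax_gt0 N0 KS wA wB).
have [C C0 HC] := S1_le_Qw wA wB.
have [d d0 [u [v Huv]]] := maximising_sequence.
have [F [FF Foo]] := ultra_seq.
have hu n : H1 (u n) by case: (Huv n).
have hv n : H1 (v n) by case: (Huv n).
have Q1 n : Qw (u n) (v n) <= 1 by case: (Huv n).
have s1 n : Num.sqrt (Qw (u n) (v n)) <= 1 by rewrite -[leRHS]sqrtr1 ler_wsqrtr.
have uC n : S1 (u n) <= C.
  by have [h _] := HC _ _ (hu n) (hv n); apply: le_trans h _; rewrite -[leRHS]mulr1 ler_pM2l.
have vC n : S1 (v n) <= C.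
  by have [_ h] := HC _ _ (hu n) (hv n); apply: le_trans h _; rewrite -[leRHS]mulr1 ler_pM2l.
have [w hw [cw dw]] := H1_weak_limit FF hu uC.
have [r hr [cr dr]] := H1_weak_limit FF hv vC.
pose z n x := u n x - w x; pose y n x := v n x - r x.
have hz n : H1 (z n) by exact: H1B.
have hy n : H1 (y n) by exact: H1B.
have z0 : wcvg mu F z (fun=> 0) by apply: wcvg_sub0 => // [n|]; exact: H1_L2.
have y0 : wcvg mu F y (fun=> 0) by apply: wcvg_sub0 => // [n|]; exact: H1_L2.
pose C' := C + S1 w + S1 r; have C'0 : 0 < C' by rewrite ltr_wpDr ?S1_ge0 // ltr_wpDr ?S1_ge0.
have zC n : S1 (z n) <= C'.
  apply: le_trans (S1B (hu n) hw) _; rewrite /C' -[leLHS]addr0; apply: lerD (S1_ge0 r).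
  exact: lerD.
have yC n : S1 (y n) <= C'.
  apply: le_trans (S1B (hv n) hr) _; rewrite /C' lerD2r -[leLHS]addr0; apply: lerD (S1_ge0 w).
  exact: vC.
have wC : S1 w <= C' by rewrite /C' addrAC lerDr addr_ge0 ?S1_ge0 // ltW.
have rC : S1 r <= C' by rewrite /C' lerDr addr_ge0 ?S1_ge0 // ltW.
pose t := Qw w r.
(* Expanding Qw(u_n - w, v_n - r), the mixed terms converge to t by weak convergence, so the
   remainder keeps at most 1 - t. *)
have zQ e : 0 < e -> \forall n \near F, Qw (z n) (y n) <= 1 - t + e.
  move=> e0; have c1 := qi_wcvg FF wA hw hw hu cw dw; have c2 := qi_wcvg FF wB hr hr hv cr dr.
  have c3 : (fun n => qi A (u n) w + qi B (v n) r) @ F --> t by apply: cvgD.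
  move/cvgrPdist_le : c3 => /(_ (e / 2)).
  rewrite divr_gt0 // => /(_ isT); apply: filterS => n /= hn.
  have E A' f g : weight A' -> H1 f -> H1 g ->
      qi A' (fun x => f x - g x) (fun x => f x - g x) = qi A' f f - 2 * qi A' f g + qi A' g g.
    move=> wA' hf hg; have hfg := H1B hf hg.
    by rewrite qiB // ![qi _ (fun x => _ - _) _]qiC // !qiB // (qiC _ g f); ring.
  rewrite /Qw (E A) // (E B) //.
  have := Q1 n; rewrite /Qw; move: hn; rewrite /t /Qw ler_norml => /andP[_].
  move: (qi A (u n) (u n)) (qi B (v n) (v n)) (qi A (u n) w) (qi B (v n) r) (qi A w w) (qi B r r).
  exact: gap_arith.
have t1 : t <= 1.
  apply/ler_addgt0Pr => e e0; have [n hn] := filter_ex (zQ e e0).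
  have := le_trans (Qw_ge0 wA wB (z n) (y n)) hn.
  by rewrite addrAC subr_ge0.
(* The mass in the fixed box survives in the weak limit, so w is not zero. *)
have t0 : 0 < t.
  have lb : L2 mu (\1_(box (1 + T)) : 'rV[R]_N -> R).
    by have := L2_box N (1 + T) (1 : R); under eq_fun do rewrite mul1r.
  have wb : d <= ip w (\1_(box (1 + T))).
    apply: (cvgr_to_ge (cw _ lb)); apply: filterE => n.
    by have [_ _ _ _] := Huv n; rewrite ipC.
  have lw := H1_L2 hw; have h := ip_CS lw lb.
  have [a a0 Ha] := nn_le_qi wA.
  have nw : 0 < nn w.
    rewrite lt_neqAle nn_ge0 andbT eq_sym; apply/negP => /eqP n0.
    move: h; rewrite n0 mul0r => h; have : ip w (\1_(box (1 + T))) ^+ 2 = 0 by apply: le_anti; rewrite h sqr_ge0.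
    by move/eqP; rewrite sqrf_eq0 => /eqP i0; move: wb; rewrite i0 leNgt d0.
  apply: lt_le_trans (_ : a * nn w <= t); first by rewrite mulr_gt0.
  by apply: le_trans (Ha w hw) _; rewrite /t /Qw lerDl qi_ge0.
pose g := (p + q) / 2; have g1 : 1 < g by rewrite /g ltr_pdivlMr // mul1r; exact: ltrD.
(* Splitting, with the remainder estimated by the supremum at the level Qw <= 1 - t + e. *)
have gap : S <= Dw w r + S * (1 - t) `^ g.
  apply: limit_gap; [exact: ltW|exact: (Dw_ge0 p q KS)|by rewrite subr_ge0|exact: ltW|].
  move=> e e0 e1.
  have uz n x : `|u n x| <= `|w x| + `|z n x|.
    by apply: le_trans (ler_normD _ _); rewrite /z addrC subrK.
  have vy n x : `|v n x| <= `|r x| + `|y n x|.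
    by apply: le_trans (ler_normD _ _); rewrite /y addrC subrK.
  have sp := Dw_split KS p1 q1 sp1 sp2 sq1 sq2 (@ultra_proper _ F FF) C'0 e0 hw hr wC rC hu hv hz zC z0 hy yC y0 uz vy.
  have near_S : \forall n \near F, S - e <= Dw (u n) (v n).
    apply: Foo; have Se : 0 < e / (S / 2) by rewrite !divr_gt0.
    exists (Num.truncn (S / 2 / e)) => // n /= hn; have [_ _ _ + _] := Huv n; apply: le_trans.
    rewrite lerD2l lerN2 ler_pdivrMr ?ltr0n // -ler_pdivrMl // mulrC.
    by apply: le_trans (ltW (truncnS_gt _)) _; rewrite ler_nat.
  have [n [[h1 h2] h3]] := filter_ex (filterI (filterI sp near_S) (zQ e e0)).
  apply: le_trans h2 _; apply: le_trans h1 _; rewrite lerD2r ler_wpM2l ?sqr_ge0 // lerD2l.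
  have te : 0 < 1 - t + e by rewrite ltr_wpDl // subr_ge0.
  exact: (Dw_le_Smax KS wA wB p1 q1 sp1 sp2 sq1 sq2 (hz n) (hy n) te h3).
have strict (s : R) : 0 < s -> s < 1 -> s `^ g < s.
  move=> s0 s1'; rewrite -(mulr_powRB1 (ltW s0)) ?(lt_trans ltr01 g1) // -[ltRHS]mulr1 ltr_pM2l //.
  have gg : 0 < g - 1 by rewrite subr_gt0.
  by have := gt0_ltr_powR gg; move=> /(_ s 1); rewrite powR1; apply => //; rewrite nnegrE // ltW.
have Dt := Dw_le_Smax KS wA wB p1 q1 sp1 sp2 sq1 sq2 hw hr t0 (lexx _); rewrite -/g in Dt.
(* For 0 < t < 1 both t^g < t and (1-t)^g < 1-t, so the supremum would be smaller than itself. *)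
have tE : t = 1.
  apply/eqP; rewrite eq_le t1 leNgt; apply/negP => tl.
  have a := strict t t0 tl.
  have b : (1 - t) `^ g < 1 - t by apply: strict; rewrite ?subr_gt0 // ltrBlDr ltrDl.
  have : S <= S * (t `^ g + (1 - t) `^ g) by rewrite mulrDr; apply: le_trans gap _; rewrite lerD2r.
  rewrite -[X in X <= _]mulr1 ler_pM2l // leNgt => /negP; apply.
  by apply: lt_le_trans (ltrD a b) _; rewrite addrC subrK.
have DS : Dw w r = S.
  apply: le_anti; move: Dt gap; rewrite tE subrr powR1 mulr1 powR0 ?mulr0 ?addr0 => [-> ->//|].
  by rewrite gt_eqF // (lt_trans ltr01).
pose au : 'rV[R]_N -> R := fun x => `|w x|; pose av : 'rV[R]_N -> R := fun x => `|r x|.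
have hau : H1 au by exact: H1_abs. have hav : H1 av by exact: H1_abs.
have Qa : Qw au av <= 1 by apply: le_trans (Qw_abs _ _ hw hr) _; rewrite -/t tE.
have Da : Dw au av = S by rewrite -DS; exact: Dw_abs.
exists au, av; split => //; [by move=> x; exact: normr_ge0..|].
apply/eqP; rewrite eq_le Qa leNgt; apply/negP => ql.
(* Absolute values might have lowered Qw; then Dw = S at a level s < 1 would contradict S s^g < S.
   The maximum with 1/2 keeps s positive. *)
pose s := Num.max (Qw au av) 2^-1; have s0 : 0 < s by rewrite lt_max invr_gt0 ltr0n orbT.
have sl : s < 1 by rewrite gt_max ql invf_lt1 ?ltr0n // ltr1n.
have := Dw_le_Smax KS wA wB p1 q1 sp1 sp2 sq1 sq2 hau hav s0; rewrite le_max lexx Da => /(_ isT).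
rewrite -/g -[X in X <= _]mulr1 ler_pM2l // leNgt => /negP; apply.
exact: lt_trans (strict s s0 sl) sl.
Qed.

End maximiser.

(** * First-order expansion of the nonlocal term *)

Section power_expansion.
Context (R : realType).
Implicit Types a b c e r : R.

Lemma powR_inv c r : 0 < c -> c^-1 `^ r = (c `^ r)^-1.
Proof.
move=> c0; have ci : 0 <= c^-1 by rewrite invr_ge0 ltW.
have := powRM r ci (ltW c0); rewrite mulVf ?gt_eqF // powR1 => E.
by rewrite -[LHS]mulr1 -(@mulfV _ (c `^ r)) ?gt_eqF ?powR_gt0 // mulrA -E mul1r.
Qed.

(** Differentiability of the power at 1, the only point where it is needed since other points are
    reached by scaling. *)
Lemma powR_tangent r e : 0 < e -> exists2 d : R, 0 < d < 1 &
  forall t, `|t| <= d -> `|(1 + t) `^ r - 1 - r * t| <= e * `|t|.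
Proof.
move=> e0; have /is_derive_cvgP := is_derive1_powR r (@ltr01 R).
rewrite powR1 mulr1 => /cvgrPdist_le /(_ e e0) /nbhs_ballP [d /= d0 H].
exists (Num.min (d / 2) 2^-1).
  by rewrite lt_min divr_gt0 // invr_gt0 ltr0n /= gt_min invf_lt1 ?ltr0n // ltr1n orbT.
move=> t td; have [->|tn] := eqVneq t 0; first by rewrite addr0 powR1 mulr0 normr0 !subrr normr0 mulr0.
have := H t; rewrite /ball /= sub0r normrN => h.
have {h} : `|r - t^-1 *: ((t *: 1 + 1) `^ r - 1 `^ r)| <= e.
  rewrite powR1; apply: h => //; apply: le_lt_trans td _; rewrite gt_min; apply/orP; left.
  by rewrite ltr_pdivrMr // ltr_pMr // ltr1n.
rewrite powR1 [t%:A]mulr1 [_ *: _]/(t^-1 * _) => h.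
have -> : (1 + t) `^ r - 1 - r * t = - (r - t^-1 * ((t + 1) `^ r - 1)) * t.
  by rewrite [t + 1]addrC; field.
by rewrite normrM normrN ler_wpM2r.
Qed.

Definition phi r (t : R) : R := `|t| `^ (r - 2) * t.

Lemma abs_phi r t : 1 < r -> `|phi r t| = `|t| `^ (r - 1).
Proof.
move=> r1; rewrite /phi normrM (ger0_norm (powR_ge0 _ _)).
have [->|t0] := eqVneq t 0; first by rewrite normr0 mulr0 powR0 // subr_eq0 gt_eqF.
have tp : 0 < `|t| by rewrite normr_gt0.
rewrite -[X in _ * X]powRr1 // -powRD; last by rewrite (gt_eqF tp) implybT.
by congr powR; ring.
Qed.

Lemma phi_pos r t : 0 < t -> phi r t = t `^ (r - 1).
Proof.
move=> t0; rewrite /phi gtr0_norm // -{2}[t]powRr1 ?ltW // -powRD; last by rewrite (gt_eqF t0) implybT.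
by congr powR; ring.
Qed.

Lemma phiN r t : phi r (- t) = - phi r t.
Proof. by rewrite /phi normrN mulrN. Qed.

(** For |b| small against |a| the tangent estimate at 1 is scaled by a, with the sign of a handled
    by oddness; otherwise |a| is at most a multiple of |b| and every term is absorbed by |b|^r. *)
Lemma powR_expansion r e : 1 < r -> 0 < e -> exists2 C : R, 0 < C & forall a b,
  `| `|a + b| `^ r - `|a| `^ r - r * phi r a * b| <= e * (`|a| `^ (r - 1) * `|b|) + C * `|b| `^ r.
Proof.
move=> r1 e0; have r0 : 0 < r by exact: lt_trans r1.
have r10 : 0 < r - 1 by rewrite subr_gt0.
have [d /andP[d0 d1] Hd] := powR_tangent r e0.
pose K := 1 + d^-1; have di : 0 < d^-1 by rewrite invr_gt0.
have K0 : 0 < K by rewrite addr_gt0.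
exists (K `^ r + K `^ r + r * K `^ (r - 1)).
  by rewrite addr_gt0 ?mulr_gt0 ?addr_gt0 // powR_gt0.
move=> a b.
have P0 : 0 <= K `^ r + K `^ r + r * K `^ (r - 1) by rewrite !addr_ge0 ?mulr_ge0 ?powR_ge0 // ltW.
have [ba|ba] := leP `|b| (d * `|a|); last first.
  rewrite -[leLHS]add0r; apply: lerD; first by rewrite !mulr_ge0 ?powR_ge0 // ltW.
  have aK : `|a| <= K * `|b|.
    rewrite mulrDl mul1r; apply: (@le_trans _ _ (d^-1 * `|b|)); last by rewrite lerDr.
    by rewrite mulrC ler_pdivlMr // mulrC ltW.
  have abK : `|a + b| <= K * `|b|.
    apply: le_trans (ler_normD _ _) _; rewrite addrC mulrDl mul1r lerD2l.
    by rewrite mulrC ler_pdivlMr // mulrC ltW.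
  apply: le_trans (ler_normB _ _) _; rewrite mulrDl; apply: lerD.
    apply: le_trans (ler_normB _ _) _; rewrite mulrDl !(ger0_norm (powR_ge0 _ _)).
    by apply: lerD; rewrite -powRM ?(ltW K0) //; apply: powR_mono => //; exact: ltW.
  rewrite 2!normrM (gtr0_norm r0) abs_phi // -!mulrA ler_pM2l //.
  rewrite -(mulr_powRB1 (normr_ge0 b) r0) [leRHS]mulrCA mulrC; apply: ler_wpM2l => //.
  by rewrite -powRM ?(ltW K0) //; apply: powR_mono => //; exact: ltW.
rewrite -[leLHS]addr0; apply: lerD; last by rewrite mulr_ge0 ?powR_ge0.
have P a' b' : 0 < a' -> `|b'| <= d * a' ->
    `| `|a' + b'| `^ r - a' `^ r - r * a' `^ (r - 1) * b'| <= e * (a' `^ (r - 1) * `|b'|).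
  move=> a0 h; pose t := b' / a'; have bt : b' = a' * t by rewrite /t mulrC divfK // gt_eqF.
  have td : `|t| <= d by rewrite /t normrM normfV (gtr0_norm a0) ler_pdivrMr.
  have t1 : 0 <= 1 + t by move: (le_trans td (ltW d1)); rewrite ler_norml => /andP[+ _]; rewrite -subr_ge0 opprK addrC.
  have -> : a' + b' = a' * (1 + t) by rewrite bt; ring.
  rewrite normrM (gtr0_norm a0) (ger0_norm t1) powRM ?(ltW a0) //.
  have aE : a' `^ r = a' * a' `^ (r - 1) by rewrite mulr_powRB1 ?ltW.
  have -> : a' `^ r * (1 + t) `^ r - a' `^ r - r * a' `^ (r - 1) * b' = a' `^ r * ((1 + t) `^ r - 1 - r * t).
    by rewrite aE bt; ring.
  rewrite normrM (ger0_norm (powR_ge0 _ _)) bt normrM (gtr0_norm a0).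
  rewrite [leRHS](_ : _ = a' `^ r * (e * `|t|)); last by rewrite aE; ring.
  by rewrite ler_wpM2l ?powR_ge0 // Hd.
have [a0|a0|a0] := ltgtP a 0; last first.
- have b0 : b = 0 by apply/eqP; rewrite -normr_le0; apply: le_trans ba _; rewrite a0 normr0 mulr0.
  by rewrite a0 b0 addr0 normr0 !mulr0 subrr subr0 normr0.
- rewrite (gtr0_norm a0) in ba *; rewrite phi_pos //; exact: P.
rewrite (ltr0_norm a0) in ba *.
have na : 0 < - a by rewrite oppr_gt0.
have := P (- a) (- b) na; rewrite normrN => /(_ ba).
rewrite -opprD normrN -(phi_pos r na) phiN.
by rewrite (_ : r * - phi r a * - b = r * phi r a * b) //; ring.
Qed.

Lemma young_pow r a b : 1 < r -> 0 <= a -> 0 <= b -> a `^ (r - 1) * b <= a `^ r + b `^ r.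
Proof.
move=> r1 a0 b0; have r0 : 0 < r by exact: lt_trans r1.
have r10 : 0 <= r - 1 by rewrite subr_ge0 ltW.
have [ab|/ltW ab] := leP a b.
  rewrite -[leLHS]add0r; apply: lerD; first exact: powR_ge0.
  by rewrite -(mulr_powRB1 b0 r0) mulrC ler_wpM2l // powR_mono.
rewrite -[leLHS]addr0; apply: lerD; last exact: powR_ge0.
by rewrite -(mulr_powRB1 a0 r0) [leRHS]mulrC ler_wpM2l // powR_ge0.
Qed.

End power_expansion.

Section differentiability.
Context (R : realType) (N : nat).
Local Notation mu := (lebesgue_rV R N).
Variables (k : 'rV[R]_N -> R) (x1 x2 : R).
Hypothesis KS : good_kernel x1 x2 k.
Implicit Types u v h f g : 'rV[R]_N -> R.
Local Notation adm := (adm x1 x2).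
Local Notation form := (form k).

Lemma mf_phi r u : mf u -> mf (fun x => phi r (u x)).
Proof. by move=> m; apply: measurable_funM => //; exact: mf_pow. Qed.

Section one_power.
Variables (r : R) (u : 'rV[R]_N -> R).
Hypotheses (r1 : 1 < r) (s1 : subcrit N (r / x1)) (s2 : subcrit N (r / x2)) (hu : H1 u).

Definition rem h x := pwf r (fun y => u y + h y) x - pwf r u x - r * phi r (u x) * h x.

(** Young's inequality is applied to u/c and h/n with c and n bounds of their norms, so that the
    result is linear in n. *)
Lemma adm_mixed : exists2 K : R, 0 < K & forall h n, H1 h -> 0 < n -> S1 h <= n ->
  adm (K * n) (fun x => `|u x| `^ (r - 1) * `|h x|).
Proof.
have r0 : 0 < r by exact: lt_trans r1.
have [a b] := gk_gt0 KS; have [K K0 HK] := adm_pwf a b s1 s2.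
pose c := 1 + S1 u; have c0 : 0 < c by rewrite ltr_pwDl // S1_ge0.
have uc : S1 u <= c by rewrite lerDr.
exists (4 * (K * c `^ (r - 1))); first by rewrite mulr_gt0 // mulr_gt0 // powR_gt0.
move=> h n hh n0 hn.
have au := HK u c hu c0 uc; have ah := HK h n hh n0 hn.
have pos1 : 0 < c^-1 * n by rewrite mulr_gt0 // invr_gt0.
have pos2 : 0 < c `^ (r - 1) * (n `^ (r - 1))^-1 by rewrite mulr_gt0 ?invr_gt0 ?powR_gt0.
have := admD KS (admZ KS (lt0r_neq0 pos1) au) (admZ KS (lt0r_neq0 pos2) ah).
rewrite !gtr0_norm //.
have cE : c `^ r = c * c `^ (r - 1) by rewrite mulr_powRB1 ?ltW.
have nE : n `^ r = n * n `^ (r - 1) by rewrite mulr_powRB1 ?ltW.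
have np : n `^ (r - 1) != 0 by rewrite gt_eqF // powR_gt0.
apply: (adm_mono KS).
- apply: measurable_funM; first exact: mf_pow (L2_mf (H1_L2 hu)).
  by apply: measurableT_comp => //; exact: L2_mf (H1_L2 hh).
- move=> x; rewrite [leLHS]ger0_norm; last by rewrite mulr_ge0 ?powR_ge0.
  rewrite [leRHS]ger0_norm; last by rewrite addr_ge0 // mulr_ge0 ?pwf_ge0 // ltW.
  have yp := @young_pow R r (c^-1 * `|u x|) (n^-1 * `|h x|) r1 _ _.
  have ci : 0 <= c^-1 by rewrite invr_ge0 ltW.
  have ni : 0 <= n^-1 by rewrite invr_ge0 ltW.
  have {yp} := yp (mulr_ge0 ci (normr_ge0 _)) (mulr_ge0 ni (normr_ge0 _)).
  rewrite !powRM // !powR_inv //.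
  move=> yp; have cn : 0 <= c `^ (r - 1) * n by rewrite mulr_ge0 ?powR_ge0 // ltW.
  have := ler_wpM2l cn yp; rewrite /pwf cE nE.
  move: (`|u x| `^ (r - 1)) (`|u x| `^ r) (`|h x|) (`|h x| `^ r) => U1 U H1_ H.
  have cp : c `^ (r - 1) != 0 by rewrite gt_eqF // powR_gt0.
  have c00 : c != 0 by rewrite gt_eqF. have n00 : n != 0 by rewrite gt_eqF.
  move: (c `^ (r - 1)) (n `^ (r - 1)) cp np => C' N' cp np.
  rewrite (_ : C' * n * (C'^-1 * U1 * (n^-1 * H1_)) = U1 * H1_); last by field; rewrite cp n00.
  by rewrite (_ : C' * n * _ = c^-1 * n * U + C' * N'^-1 * H) //; field; rewrite cp np c00 n00.
have c00 : c != 0 by rewrite gt_eqF.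
rewrite cE nE; apply: le_of_eq.
by move: (c `^ (r - 1)) (n `^ (r - 1)) np => C' N' np; field; rewrite np c00.
Qed.

Lemma adm_dif : exists2 K : R, 0 < K & forall h n, H1 h -> 0 < n -> S1 h <= n ->
  adm (K * n) (fun x => r * phi r (u x) * h x).
Proof.
have r0 : 0 < r by exact: lt_trans r1.
have [K K0 HK] := adm_mixed; exists (r * K); first exact: mulr_gt0.
move=> h n hh n0 hn; have := admZ KS (lt0r_neq0 r0) (HK h n hh n0 hn); rewrite gtr0_norm // mulrA.
apply: (adm_mono KS) => //.
  apply: measurable_funM; last exact: L2_mf (H1_L2 hh).
  by apply: measurable_funM => //; apply: mf_phi; exact: L2_mf (H1_L2 hu).
by move=> x; rewrite 2!normrM abs_phi // 2!normrM (ger0_norm (powR_ge0 _ _)) normr_id -!mulrA.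
Qed.

(** The term C |h|^r contributes n^r, which is small against n because r > 1; this determines d. *)
Lemma adm_rem e : 0 < e -> exists2 d : R, 0 < d <= 1 & forall h n, H1 h -> 0 < n -> n <= d -> S1 h <= n ->
  adm (e * n) (rem h).
Proof.
move=> e0; have r10 : 0 < r - 1 by rewrite subr_gt0.
have r0 : 0 < r by exact: lt_trans r1.
have [a b] := gk_gt0 KS; have [K K0 HK] := adm_pwf a b s1 s2.
have [L L0 HL] := adm_mixed.
pose e1 := e / (4 * L); have e10 : 0 < e1 by rewrite divr_gt0 // mulr_gt0.
have [C C0 HC] := powR_expansion r1 e10.
pose d := Num.min 1 ((e / (4 * (C * K))) `^ (r - 1)^-1).
have d0 : 0 < d by rewrite lt_min ltr01 powR_gt0 // divr_gt0 // mulr_gt0 // mulr_gt0.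
exists d; first by rewrite d0 ge_min lexx.
move=> h n hh n0 nd hn; have am := HL h n hh n0 hn; have ah := HK h n hh n0 hn.
have nr : C * K * n `^ (r - 1) <= e / 4.
  have CK : 0 < C * K by exact: mulr_gt0.
  have -> : e / 4 = C * K * (e / (4 * (C * K))) by field; rewrite !gt_eqF.
  rewrite ler_pM2l //; apply: (@le_trans _ _ (((e / (4 * (C * K))) `^ (r - 1)^-1) `^ (r - 1))).
    by apply: powR_mono; [exact: ltW|exact: ltW|apply: le_trans nd _; rewrite ge_min lexx orbT].
  by rewrite powRVK // ltW // divr_gt0 // mulr_gt0.
have := admD KS (admZ KS (lt0r_neq0 e10) am) (admZ KS (lt0r_neq0 C0) ah); rewrite !gtr0_norm //.
have mh := L2_mf (H1_L2 hh); have mu_ := L2_mf (H1_L2 hu).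
apply: (adm_mono KS).
- apply: measurable_funB; first by apply: measurable_funB; apply: mf_pwf => //; exact: measurable_funD.
  by apply: measurable_funM => //; apply: measurable_funM => //; exact: mf_phi.
- move=> x; rewrite [leRHS]ger0_norm; last first.
    by apply: addr_ge0; (apply: mulr_ge0; first exact: ltW);
      [apply: mulr_ge0; rewrite ?powR_ge0|exact: pwf_ge0].
  exact: HC.
have nE : n `^ r = n * n `^ (r - 1) by rewrite mulr_powRB1 ?ltW.
rewrite nE; have -> : e1 * (L * n) = e / 4 * n by rewrite /e1; field; rewrite gt_eqF.
have -> : 2 * (e / 4 * n + C * (K * (n * n `^ (r - 1)))) = 2 * (e / 4 + C * K * n `^ (r - 1)) * n by ring.
rewrite ler_pM2r // -ler_pdivlMl //.
by rewrite (_ : 2^-1 * e = e / 4 + e / 4) ?lerD2l //; field.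
Qed.

End one_power.

Variables (p q : R).
Hypotheses (p1 : 1 < p) (q1 : 1 < q).
Hypotheses (sp1 : subcrit N (p / x1)) (sp2 : subcrit N (p / x2)).
Hypotheses (sq1 : subcrit N (q / x1)) (sq2 : subcrit N (q / x2)).
Local Notation Dw := (Dw k p q).

Definition dDw u v h g : R :=
  form (fun x => p * phi p (u x) * h x) (pwf q v) + form (pwf p u) (fun x => q * phi q (v x) * g x).

Lemma Dw_expand u v e : H1 u -> H1 v -> 0 < e -> exists2 d : R, 0 < d & forall h g n,
  H1 h -> H1 g -> 0 < n -> n <= d -> S1 h <= n -> S1 g <= n ->
  `|Dw (fun x => u x + h x) (fun x => v x + g x) - Dw u v - dDw u v h g| <= e * n.
Proof.
move=> hu hv e0; have [s au] := admp_ex KS sp1 sp2 hu; have [t av] := admq_ex KS sq1 sq2 hv.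
have s0 := adm_gt0 au; have t0 := adm_gt0 av.
have [c c0 Hc] := form_le KS.
have [K K0 HK] := adm_dif p1 sp1 sp2 hu; have [L L0 HL] := adm_dif q1 sq1 sq2 hv.
pose e1 := e / (4 * (c * (s + t))).
have cst0 : 0 < c * (s + t) by rewrite mulr_gt0 // addr_gt0.
have e10 : 0 < e1 by rewrite divr_gt0 // mulr_gt0.
have [d1 /andP[d10 d11] H1_] := adm_rem p1 sp1 sp2 hu e10.
have [d2 /andP[d20 d21] H2_] := adm_rem q1 sq1 sq2 hv e10.
pose W := c * (2 * (e1 + K)) * (2 * (e1 + L)).
have W0 : 0 <= W by apply/ltW; rewrite /W !mulr_gt0 // addr_gt0.
have e2 : 0 < e / 2 by rewrite divr_gt0.
have [d3 d30 d3e] := mul_small W0 e2.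
exists (Num.min d3 (Num.min d1 d2)); first by rewrite !lt_min d30 d10.
move=> h g n hh hg n0; rewrite !le_min => /andP[n3 /andP[n1 n2]] hn gn.
have ar := H1_ h n hh n0 n1 hn; have as_ := H2_ g n hg n0 n2 gn.
have ad := HK h n hh n0 hn; have ae := HL g n hg n0 gn.
have adr := admD KS ar ad; have aes := admD KS as_ ae.
pose f' := pwf p (fun x => u x + h x); pose g' := pwf q (fun x => v x + g x).
pose dr x := rem p u h x + p * phi p (u x) * h x.
pose ds x := rem q v g x + q * phi q (v x) * g x.
have fE : f' = fun x => 1 * pwf p u x + dr x.
  by apply/funext => x; rewrite /f' /dr /rem; ring.
have gE : g' = fun x => 1 * pwf q v x + ds x.
  by apply/funext => x; rewrite /g' /ds /rem; ring.
have adr2 : adm (2 * (e1 * n + K * n)) dr by [].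
have aes2 : adm (2 * (e1 * n + L * n)) ds by [].
have one (f : 'rV[R]_N -> R) : (fun x => 1 * f x) = f by apply/funext => x; rewrite mul1r.
have drE : dr = fun x => 1 * rem p u h x + p * phi p (u x) * h x by apply/funext => x; rewrite mul1r.
have dsE : ds = fun x => 1 * rem q v g x + q * phi q (v x) * g x by apply/funext => x; rewrite mul1r.
have X1 : form dr (pwf q v) = form (rem p u h) (pwf q v) + form (fun x => p * phi p (u x) * h x) (pwf q v).
  by rewrite drE (form_linl KS 1 ar ad av) mul1r.
have X2 : form (pwf p u) ds = form (pwf p u) (rem q v g) + form (pwf p u) (fun x => q * phi q (v x) * g x).
  by rewrite dsE (form_linr KS 1 as_ ae au) mul1r.
have aG : adm (2 * (`|1| * t + 2 * (e1 * n + L * n))) g'.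
  by rewrite gE; apply: (admD KS _ aes2); apply: (admZ KS (oner_neq0 R)).
have E : Dw (fun x => u x + h x) (fun x => v x + g x) - Dw u v - dDw u v h g =
    form (rem p u h) (pwf q v) + form (pwf p u) (rem q v g) + form dr ds.
  rewrite !DwE -/f' -/g' /dDw.
  rewrite fE (form_linl KS 1 au adr2 aG) mul1r gE (form_linr KS 1 av aes2 au) mul1r.
  rewrite (form_linr KS 1 av aes2 adr2) mul1r X1 X2.
  move: (form (pwf p u) (pwf q v)) (form (pwf p u) (rem q v g)) (form (rem p u h) (pwf q v)) (form dr ds).
  move: (form (pwf p u) (fun x => q * phi q (v x) * g x)) (form (fun x => p * phi p (u x) * h x) (pwf q v)).
  by move=> *; ring.
rewrite E; have b1 := Hc _ _ _ _ ar av; have b2 := Hc _ _ _ _ au as_; have b3 := Hc _ _ _ _ adr2 aes2.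
apply: le_trans (ler_normD _ _) _; apply: le_trans (lerD (le_trans (ler_normD _ _) (lerD b1 b2)) b3) _.
have W3 : c * (2 * (e1 * n + K * n)) * (2 * (e1 * n + L * n)) <= e / 2 * n.
  have -> : c * (2 * (e1 * n + K * n)) * (2 * (e1 * n + L * n)) = n * W * n by rewrite /W; ring.
  by rewrite ler_pM2r //; apply: le_trans d3e; rewrite ler_wpM2r.
have W12 : c * (e1 * n) * t + c * s * (e1 * n) <= e / 2 * n.
  have -> : c * (e1 * n) * t + c * s * (e1 * n) = e / 4 * n by rewrite /e1; field; rewrite !gt_eqF // addr_gt0.
  by rewrite ler_pM2r // ler_pM2l // lef_pV2 ?posrE // ler_nat.
have -> : e * n = e / 2 * n + e / 2 * n by field.
exact: lerD.
Qed.

End differentiability.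

Transparent S1.

(** * The action and its critical points *)

Lemma sqrt_nn_le_S1 (R : realType) (N : nat) (u : 'rV[R]_N -> R) :
  Num.sqrt (nn (lebesgue_rV R N) u) <= S1 u.
Proof. by rewrite /S1 lerDl sumr_ge0 // => i _; exact: sqrtr_ge0. Qed.

Lemma sqrt_nn_partial_le_S1 (R : realType) (N : nat) (u : 'rV[R]_N -> R) i :
  Num.sqrt (nn (lebesgue_rV R N) (weak_partial i u)) <= S1 u.
Proof.
rewrite /S1 (bigD1 i) //= addrCA lerDl addr_ge0 ?sqrtr_ge0 //.
by apply: sumr_ge0 => j _; exact: sqrtr_ge0.
Qed.

Opaque S1.

Lemma quad_abs (R : realDomainType) (t z y : R) : `|t| <= 1 -> 0 <= y ->
  `|2 * t * z + t ^+ 2 * y| <= `|t| * (2 * `|z| + y).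
Proof.
move=> t1 y0; apply: le_trans (ler_normD _ _) _; rewrite mulrDr; apply: lerD.
  by rewrite !normrM ger0_norm // mulrCA mulrA.
rewrite normrM normrX (ger0_norm y0) expr2 -mulrA ler_wpM2l //.
by rewrite ler_piMl.
Qed.

Lemma expansion_arith (R : realFieldType) (a t g z y d D Q e c X : R) : a * a = t ^+ 2 ->
  - (e * (a * c)) <= D - Q - t * d -> D <= Q + g / 2 * (2 * t * z + t ^+ 2 * y) + e / 2 * (a * X) ->
  t * (d - g * z) <= a * (e * (c + X / 2) + g / 2 * y * a).
Proof.
move=> E h1 h2; rewrite -subr_ge0.
have -> : a * (e * (c + X / 2) + g / 2 * y * a) - t * (d - g * z) = (D - Q - t * d - - (e * (a * c))) +
   (Q + g / 2 * (2 * t * z + t ^+ 2 * y) + e / 2 * (a * X) - D) + g / 2 * y * (a * a - t ^+ 2) by field.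
by rewrite E subrr mulr0 addr0 addr_ge0 // subr_ge0.
Qed.

Lemma linear_homogeneous (R : realType) (V : lmodType R) (P : set V) (K : V -> R) (t : R) f : P 0 -> P f ->
  (forall (a : R) (f g : V), P f -> P g -> K (a *: f + g) = a * K f + K g) -> K 0 = 0 /\ K (t *: f) = t * K f.
Proof.
move=> P0 Pf lin; have K0 : K 0 = 0.
  have := lin 1 0 0 P0 P0; rewrite scaler0 addr0 mul1r => /eqP.
  by rewrite -subr_eq subrr eq_sym => /eqP.
by split=> //; have := lin t f 0 Pf P0; rewrite K0 !addr0.
Qed.

Section frechet.
Context (R : realType) (N : nat).
Local Notation mu := (lebesgue_rV R N).
Local Notation F := ('rV[R]_N -> R).
Local Notation wp := weak_partial.
Implicit Types (u v h g : F) (w : F * F).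

Lemma weight1 : weight (cst 1 : F).
Proof. by split; [exact: measurable_cst|exists 1|exists 1]. Qed.

Lemma qi_intg A u h : weight A -> H1 u -> H1 h ->
  intg mu (fun x => \sum_(i < N) wp i u x * wp i h x) /\ intg mu (fun x => A x * u x * h x).
Proof.
move=> wA hu hh; split.
  by apply: intg_sum => i _; apply: L2_intgM; exact: weak_partial_L2.
by apply: L2_intgM; [apply: L2_weight => //|]; exact: H1_L2.
Qed.

Lemma qi_Int A u h : weight A -> H1 u -> H1 h ->
  \int[mu]_x (\sum_(i < N) wp i u x * wp i h x + A x * u x * h x) = qi A u h.
Proof.
move=> wA hu hh; have [i1 i2] := qi_intg wA hu hh.
rewrite IntD // /qi ipE; apply: eq_add => //.
rewrite Int_sum; last by move=> i _; apply: L2_intgM; exact: weak_partial_L2.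
by apply: eq_bigr => i _; rewrite ipE.
Qed.

Lemma Int_H1_sq u : H1 u -> \int[mu]_x (grad_sq u x + u x ^+ 2) = qi (cst 1) u u.
Proof.
move=> hu; rewrite -(qi_Int weight1 hu hu); apply: eq_Rintegral => x _.
by rewrite /grad_sq mul1r expr2; congr (_ + _); apply: eq_bigr => i _; rewrite expr2.
Qed.

Lemma normHE w : H1pair w -> normH w = Num.sqrt (Qw (cst 1) (cst 1) w.1 w.2).
Proof. by move=> [hu hv]; rewrite /normH /Qw !Int_H1_sq. Qed.

Lemma H1pair0 : H1pair (0 : F * F).
Proof. by split; exact: H1_0. Qed.

Lemma H1pair_lin (a : R) w z : H1pair w -> H1pair z -> H1pair (a *: w + z).
Proof. by move=> [a1 a2] [b1 b2]; split; exact: H1_lin. Qed.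

Lemma normHZ (t : R) w : H1pair w -> normH (t *: w + 0) = `|t| * normH w.
Proof.
move=> hw; have hz := H1pair_lin t hw H1pair0; rewrite !normHE //; case: hw => hu hv.
have E : Qw (cst 1) (cst 1) (t *: w + 0).1 (t *: w + 0).2 = t ^+ 2 * Qw (cst 1) (cst 1) w.1 w.2.
  rewrite /Qw mulrDr -!qiZZ //; try exact: weight1.
  by rewrite !addr0.
by rewrite E sqrtrM ?sqr_ge0 // sqrtr_sqr.
Qed.

Lemma S1_le_normH : exists2 C : R, 0 < C & forall w, H1pair w -> S1 w.1 <= C * normH w /\ S1 w.2 <= C * normH w.
Proof.
have [C C0 H] := S1_le_Qw weight1 weight1; exists C => // w hw; rewrite normHE //.
by case: hw => hu hv; exact: H.
Qed.

(** Both derivatives are compared along small multiples of h. This is what gives access to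
    [pairing], whose derivative is chosen without further information. *)
Lemma frechet_unique (J L L' : F * F -> R) (w h : F * F) : is_frechet_derivative J w L -> is_frechet_derivative J w L' ->
  H1pair h -> L h = L' h.
Proof.
move=> [lin _ D] [lin' _ D'] hh.
have nh : 0 <= normH h by exact: sqrtr_ge0.
apply/eqP; rewrite -subr_eq0 -normr_le0; apply/ler_addgt0Pr => e e0; rewrite add0r.
have w0 : 0 <= 2 * normH h by rewrite mulr_ge0.
have [e1 e10 e1e] := mul_small w0 e0.
have [d d0 Hd] := D e1 e10; have [d' d'0 Hd'] := D' e1 e10.
have m0 : 0 < Num.min d d' / 2 by rewrite divr_gt0 // lt_min d0.
have [t t0 ht] := mul_small nh m0.
have hz := H1pair_lin t hh H1pair0.
have small : normH (t *: h + 0) < Num.min d d'.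
  rewrite normHZ // (gtr0_norm t0); apply: le_lt_trans ht _.
  by rewrite ltr_pdivrMr // ltr_pMr ?ltr1n // lt_min d0.
move: small; rewrite lt_min => /andP[sd sd'].
have E1 : L (t *: h + 0) = t * L h by rewrite addr0; have [] := linear_homogeneous t H1pair0 hh lin.
have E2 : L' (t *: h + 0) = t * L' h by rewrite addr0; have [] := linear_homogeneous t H1pair0 hh lin'.
have := Hd _ hz sd; have := Hd' _ hz sd'; rewrite E1 E2 normHZ // (gtr0_norm t0).
move: (J (w + _) - J w) => z h1 h2.
have : `|t * (L h - L' h)| <= t * (e1 * (2 * normH h)).
  have -> : t * (L h - L' h) = (z - t * L' h) - (z - t * L h) by ring.
  apply: le_trans (ler_normB _ _) _; apply: le_trans (lerD h1 h2) _.
  by apply: le_of_eq; ring.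
rewrite normrM (gtr0_norm t0) ler_pM2l // => h3; exact: le_trans h3 e1e.
Qed.

End frechet.

Section action_functional.
Context (R : realType) (N : nat).
Local Notation mu := (lebesgue_rV R N).
Local Notation F := ('rV[R]_N -> R).
Local Notation wp := weak_partial.
Variables (alpha p q x1 x2 : R) (A B : F).
Local Notation k := (@riesz R N alpha).
Hypotheses (N0 : (0 < N)%N) (KS : good_kernel x1 x2 k) (wA : weight A) (wB : weight B).
Hypotheses (p1 : 1 < p) (q1 : 1 < q).
Hypotheses (sp1 : subcrit N (p / x1)) (sp2 : subcrit N (p / x2)).
Hypotheses (sq1 : subcrit N (q / x1)) (sq2 : subcrit N (q / x2)).
Implicit Types (u v h g : F) (w : F * F).
Local Notation Dw := (Dw k p q).
Local Notation Qw := (Qw A B).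
Local Notation S := (Smax k p q A B).
Local Notation dDw := (dDw k p q).
Local Notation form := (form k).

Lemma actionE u v : H1 u -> H1 v -> action alpha p q A B (u, v) = 2^-1 * Qw u v - 2 / (p + q) * Dw u v.
Proof.
move=> hu hv; have [s au] := admp_ex KS sp1 sp2 hu; have [t av] := admq_ex KS sq1 sq2 hv.
have [i1 i2] := qi_intg wA hu hu; have [i3 i4] := qi_intg wB hv hv.
rewrite /action /= DwE (form_convolution KS au av) /Qw -(qi_Int wA hu hu) -(qi_Int wB hv hv).
rewrite -IntD; [|exact: intgD|exact: intgD].
congr (_ * _ - _); apply: eq_Rintegral => x _; rewrite !real_normK ?num_real // addrA.
rewrite /grad_sq; congr (_ + _ + _ + _); try by rewrite -mulrA -expr2.
Qed.

Definition Lexp u v w : R := qi A u w.1 + qi B v w.2 - 2 / (p + q) * dDw u v w.1 w.2.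

Lemma pq0 : 0 < p + q. Proof. by rewrite addr_gt0 // (lt_trans ltr01). Qed.

Lemma dDw_bound u v : H1 u -> H1 v -> exists2 C : R, 0 < C & forall h g n, H1 h -> H1 g -> 0 < n ->
  S1 h <= n -> S1 g <= n -> `|dDw u v h g| <= C * n.
Proof.
move=> hu hv; have [s au] := admp_ex KS sp1 sp2 hu; have [t av] := admq_ex KS sq1 sq2 hv.
have s0 := adm_gt0 au; have t0 := adm_gt0 av.
have [c c0 Hc] := form_le KS.
have [K K0 HK] := adm_dif KS p1 sp1 sp2 hu; have [L L0 HL] := adm_dif KS q1 sq1 sq2 hv.
exists (c * K * t + c * s * L); first by rewrite addr_gt0 // !mulr_gt0.
move=> h g n hh hg n0 hn gn; have ad := HK h n hh n0 hn; have ae := HL g n hg n0 gn.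
apply: le_trans (ler_normD _ _) _; apply: le_trans (lerD (Hc _ _ _ _ ad av) (Hc _ _ _ _ au ae)) _.
by apply: le_of_eq; ring.
Qed.

Lemma dDw_lin u v (a : R) h g h' g' : H1 u -> H1 v -> H1 h -> H1 g -> H1 h' -> H1 g' ->
  dDw u v (fun x => a * h x + h' x) (fun x => a * g x + g' x) = a * dDw u v h g + dDw u v h' g'.
Proof.
move=> hu hv hh hg hh' hg'; have [s au] := admp_ex KS sp1 sp2 hu; have [t av] := admq_ex KS sq1 sq2 hv.
have [K K0 HK] := adm_dif KS p1 sp1 sp2 hu; have [L L0 HL] := adm_dif KS q1 sq1 sq2 hv.
have P (f : F) : 0 < 1 + S1 f /\ S1 f <= 1 + S1 f by rewrite ltr_pwDl ?S1_ge0 // lerDr.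
have [a1 a2] := P h; have [b1 b2] := P h'; have [c1 c2] := P g; have [d1 d2] := P g'.
have A1 := HK h _ hh a1 a2; have A2 := HK h' _ hh' b1 b2.
have A3 := HL g _ hg c1 c2; have A4 := HL g' _ hg' d1 d2.
have E1 : (fun x => p * phi p (u x) * (a * h x + h' x)) =
    fun x => a * (p * phi p (u x) * h x) + p * phi p (u x) * h' x by apply/funext => x; ring.
have E2 : (fun x => q * phi q (v x) * (a * g x + g' x)) =
    fun x => a * (q * phi q (v x) * g x) + q * phi q (v x) * g' x by apply/funext => x; ring.
rewrite /dDw E1 E2 (form_linl KS a A1 A2 av) (form_linr KS a A3 A4 au).
move: (form (fun x => p * phi p (u x) * h x) _) (form (fun x => p * phi p (u x) * h' x) _).
move: (form _ (fun x => q * phi q (v x) * g x)) (form _ (fun x => q * phi q (v x) * g' x)).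
by move=> *; ring.
Qed.

Lemma formZl s t (a : R) f g : adm x1 x2 s f -> adm x1 x2 t g -> form (fun x => a * f x) g = a * form f g.
Proof.
move=> af ag; have := formZZ KS a 1 af ag; rewrite mulr1 => <-.
by congr form; apply/funext => x; rewrite mul1r.
Qed.

Lemma formZr s t (a : R) f g : adm x1 x2 s f -> adm x1 x2 t g -> form f (fun x => a * g x) = a * form f g.
Proof.
move=> af ag; have := formZZ KS 1 a af ag; rewrite mul1r => <-.
by congr form; apply/funext => x; rewrite mul1r.
Qed.

Lemma qi_0r (A' f : F) : weight A' -> H1 f -> qi A' f (fun=> 0) = 0.
Proof.
move=> wA' hf; have L (a : R) (g h : F) : H1 g -> H1 h -> qi A' f (a *: g + h) = a * qi A' f g + qi A' f h.
  by move=> hg hh; exact: qi_linr.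
by have [] := linear_homogeneous 1 (@H1_0 R N) (@H1_0 R N) L.
Qed.

Lemma qiZr (A' f g : F) (t : R) : weight A' -> H1 f -> H1 g -> qi A' f (fun x => t * g x) = t * qi A' f g.
Proof.
move=> wA' hf hg; have L (a : R) (g1 h : F) : H1 g1 -> H1 h -> qi A' f (a *: g1 + h) = a * qi A' f g1 + qi A' f h.
  by move=> hg' hh; exact: qi_linr.
by have [] := linear_homogeneous t (@H1_0 R N) hg L.
Qed.

Lemma dDw_Z u v (t : R) h g : H1 u -> H1 v -> H1 h -> H1 g ->
  dDw u v (fun x => t * h x) (fun x => t * g x) = t * dDw u v h g.
Proof.
move=> hu hv hh hg; have L (a : R) (w z : F * F) : H1pair w -> H1pair z ->
    dDw u v (a *: w + z).1 (a *: w + z).2 = a * dDw u v w.1 w.2 + dDw u v z.1 z.2.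
  by move=> [a1 a2] [b1 b2]; exact: dDw_lin.
have hw : H1pair (h, g) by split.
by have [] := linear_homogeneous t (@H1pair0 R N) hw L.
Qed.

Lemma qi_bound A' u : weight A' -> H1 u -> exists2 C : R, 0 <= C & forall h, H1 h -> `|qi A' u h| <= C * S1 h.
Proof.
move=> wA' hu; exists (\sum_(i < N) Num.sqrt (nn mu (wp i u)) + Num.sqrt (nn mu (fun x => A' x * u x))).
  by rewrite addr_ge0 ?sqrtr_ge0 // sumr_ge0 // => i _; exact: sqrtr_ge0.
move=> h hh; apply: le_trans (ler_normD _ _) _; rewrite mulrDl; apply: lerD.
  apply: le_trans (ler_norm_sum _ _ _) _; rewrite mulr_suml; apply: ler_sum => i _.
  apply: le_trans (ip_le_sqrt (weak_partial_L2 i hu) (weak_partial_L2 i hh)) _.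
  by rewrite ler_wpM2l ?sqrtr_ge0 // sqrt_nn_partial_le_S1.
apply: le_trans (ip_le_sqrt (L2_weight wA' (H1_L2 hu)) (H1_L2 hh)) _.
by rewrite ler_wpM2l ?sqrtr_ge0 // sqrt_nn_le_S1.
Qed.

Lemma action_expand u v e : H1 u -> H1 v -> 0 < e -> exists2 d : R, 0 < d & forall h g n,
  H1 h -> H1 g -> 0 < n -> n <= d -> S1 h <= n -> S1 g <= n ->
  `|action alpha p q A B (fun x => u x + h x, fun x => v x + g x) - action alpha p q A B (u, v) - Lexp u v (h, g)|
    <= e * n.
Proof.
move=> hu hv e0; have e2 : 0 < e / 2 by rewrite divr_gt0.
have pq := pq0.
have c0 : 0 < 2 / (p + q) by rewrite divr_gt0.
have e3 : 0 < e / 2 / (2 / (p + q)) by rewrite !divr_gt0.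
have [d1 d10 H1_] := Dw_expand KS p1 q1 sp1 sp2 sq1 sq2 hu hv e3.
have [C C0 HC] := qi_le_S1 wA; have [D D0 HD] := qi_le_S1 wB.
have CD : 0 <= C + D by rewrite addr_ge0 // ltW.
have [d2 d20 d2e] := mul_small CD e0.
exists (Num.min d1 d2); first by rewrite lt_min d10.
move=> h g n hh hg n0; rewrite le_min => /andP[n1 n2] hn gn.
have hD := H1D hu hh; have hE := H1D hv hg.
rewrite !actionE // /Lexp /Qw /= !qi_add //.
have := H1_ h g n hh hg n0 n1 hn gn.
have QQ : qi A h h + qi B g g <= e * n.
  have S2 f : S1 f <= n -> S1 f ^+ 2 <= n ^+ 2 by move=> fn; rewrite lerXn2r ?nnegrE ?S1_ge0 // ltW.
  apply: le_trans (lerD (HC h hh) (HD g hg)) _.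
  apply: (@le_trans _ _ ((C + D) * n ^+ 2)).
    by rewrite mulrDl; apply: lerD; rewrite ler_pM2l // S2.
  rewrite expr2 mulrA ler_pM2r // mulrC; apply: le_trans d2e; rewrite ler_wpM2r //.
have Q0 : 0 <= qi A h h + qi B g g by rewrite addr_ge0 // qi_ge0.
move: (Dw (fun x => u x + h x) (fun x => v x + g x)) (Dw u v) (dDw u v h g) (qi A u h) (qi B v g).
move: (qi A u u) (qi B v v) QQ Q0; move: (qi A h h) (qi B g g) => a b c d QQ Q0 D1 D2 D3 z1 z2 h1.
have -> : 2^-1 * (c + 2 * z1 + a + (d + 2 * z2 + b)) - 2 / (p + q) * D1 - (2^-1 * (c + d) - 2 / (p + q) * D2) -
   (z1 + z2 - 2 / (p + q) * D3) = 2^-1 * (a + b) - 2 / (p + q) * (D1 - D2 - D3) by field; rewrite gt_eqF.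
apply: le_trans (ler_normB _ _) _.
have -> : e * n = 2^-1 * (e * n) + 2 / (p + q) * (e / 2 / (2 / (p + q)) * n) by field; rewrite gt_eqF.
apply: lerD; rewrite normrM ger0_norm ?invr_ge0 ?(ltW c0) //.
  by rewrite ger0_norm // ler_pM2l ?invr_gt0.
by rewrite ler_pM2l.
Qed.

(** Passes from all admissible n above C M to n = C M itself, which may be 0. *)
Lemma limit_size (C d e X M : R) : 0 < d -> 0 <= e -> C * M < d -> 0 <= C * M ->
  (forall n, 0 < n -> n <= d -> C * M <= n -> X <= e * n) -> X <= e * (C * M).
Proof.
move=> d0 e0 Cd CM H; apply/ler_addgt0Pr => t t0.
have [s s0 hs] := mul_small e0 t0.
have sd : 0 < d - C * M by rewrite subr_gt0.
pose n := C * M + Num.min s (d - C * M).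
have m0 : 0 < Num.min s (d - C * M) by rewrite lt_min s0.
apply: le_trans (H n _ _ _) _.
- by rewrite ltr_wpDl.
- by rewrite -lerBrDl ge_min lexx orbT.
- by rewrite lerDl ltW.
rewrite mulrDr lerD2l; apply: le_trans hs; rewrite mulrC; apply: ler_wpM2r => //.
by rewrite ge_min lexx.
Qed.

Lemma action_frechet u v : H1 u -> H1 v ->
  is_frechet_derivative (action alpha p q A B) (u, v) (Lexp u v).
Proof.
move=> hu hv; have pq := pq0; have [C C0 HC] := @S1_le_normH R N.
split.
- move=> a [h g] [h' g'] [/= hh hg] [/= hh' hg'].
  have E1 : (a *: (h, g) + (h', g')).1 = fun x => a * h x + h' x by [].
  have E2 : (a *: (h, g) + (h', g')).2 = fun x => a * g x + g' x by [].
  rewrite /Lexp E1 E2 (qi_linr wA a hh hh' hu) (qi_linr wB a hg hg' hv) (dDw_lin a hu hv hh hg hh' hg') /=.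
  move: (dDw u v h g) (dDw u v h' g') (qi A u h) (qi A u h') (qi B v g) (qi B v g') => *.
  by ring.
- have [Ca Ca0 HCa] := qi_bound wA hu; have [Cb Cb0 HCb] := qi_bound wB hv.
  have [Cd Cd0 HCd] := dDw_bound hu hv.
  have c0 : 0 <= 2 / (p + q) by rewrite divr_ge0 // ltW.
  pose W := Ca + Cb + 2 / (p + q) * Cd; have W0 : 0 <= W by rewrite !addr_ge0 // mulr_ge0 // ltW.
  exists (W * C) => -[h g] hw; have [/= hn gn] := HC _ hw; case: (hw) => /= hh hg.
  have nh : 0 <= normH (h, g) by exact: sqrtr_ge0.
  have CM : 0 <= C * normH (h, g) by rewrite mulr_ge0 // ltW.
  rewrite -mulrA; apply: (@limit_size C (C * normH (h, g) + 1)) => //; rewrite ?ltrDl ?ltr_wpDl //.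
  move=> n n0 _ nn_; rewrite /Lexp /=.
  have h1 := le_trans hn nn_; have g1 := le_trans gn nn_.
  have -> : W * n = (Ca * n + Cb * n) + 2 / (p + q) * (Cd * n) by rewrite /W; ring.
  apply: le_trans (ler_normB _ _) _; apply: lerD.
    apply: le_trans (ler_normD _ _) _; apply: lerD.
      exact: le_trans (HCa h hh) (ler_wpM2l Ca0 h1).
    exact: le_trans (HCb g hg) (ler_wpM2l Cb0 g1).
  have X := HCd h g n hh hg n0 h1 g1; rewrite normrM (ger0_norm c0).
  exact: (ler_wpM2l c0 X).
move=> e e0; have eC : 0 < e / C by rewrite divr_gt0.
have [d d0 Hd] := action_expand hu hv eC.
exists (d / C); first by rewrite divr_gt0.
move=> [h g] hw; have [/= hn gn] := HC _ hw; case: (hw) => /= hh hg hd.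
have nh : 0 <= normH (h, g) by exact: sqrtr_ge0.
have CM : 0 <= C * normH (h, g) by rewrite mulr_ge0 // ltW.
have -> : e * normH (h, g) = e / C * (C * normH (h, g)) by field; rewrite gt_eqF.
apply: (@limit_size C d) => //; [exact: ltW|by rewrite mulrC -ltr_pdivlMr|].
move=> n n0 nd nn_; apply: Hd => //; [exact: le_trans hn nn_|exact: le_trans gn nn_].
Qed.

(** In the direction (u, v) the two parts of the derivative of Dw add up to (p + q) Dw, which
    cancels the factor 1/(p + q) of the action. *)
Lemma pairingE u v : H1 u -> H1 v -> pairing alpha p q A B (u, v) = Qw u v - 2 * Dw u v.
Proof.
move=> hu hv; have pq := pq0; have Fr := action_frechet hu hv.
have Fx : is_frechet_derivative (action alpha p q A B) (u, v) (frechet_derivative (action alpha p q A B) (u, v)).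
  exact: (@xgetPex _ (cst 0) [set L | is_frechet_derivative (action alpha p q A B) (u, v) L] (ex_intro _ _ Fr)).
rewrite /pairing (frechet_unique Fx Fr); last by split.
rewrite /Lexp /= /dDw.
have [s au] := admp_ex KS sp1 sp2 hu; have [t av] := admq_ex KS sq1 sq2 hv.
have E (r : R) (w : F) : 1 < r -> (fun x => r * phi r (w x) * w x) = fun x => r * pwf r w x.
  move=> r1; apply/funext => x; rewrite /phi /pwf -!mulrA; congr (_ * _).
  rewrite -expr2 -real_normK ?num_real //; have [->|w0] := eqVneq (w x) 0.
    by rewrite normr0 expr0n mulr0 powR0 // gt_eqF // (lt_trans ltr01).
  have wp0 : 0 < `|w x| by rewrite normr_gt0.
  rewrite -powR_mulrn // -powRD; last by rewrite (gt_eqF wp0) implybT.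
  by congr powR; ring.
rewrite !E // (formZl p au av) (formZr q au av) -DwE /Qw.
move: (Dw u v) (qi A u u) (qi B v v) => *; field.
by rewrite gt_eqF.
Qed.

Local Notation gg := ((p + q) / 2).

Lemma gg1 : 1 < gg. Proof. by rewrite ltr_pdivlMr // mul1r; exact: ltrD. Qed.

(* The value of [Qw] at a maximiser rescaled onto the Nehari set. *)
Definition Qs : R := (2 * S) `^ (- (gg - 1)^-1).

Lemma S_gt0 : 0 < S. Proof. exact: (Smax_gt0 N0 KS wA wB). Qed.

Lemma Qs_gt0 : 0 < Qs. Proof. by rewrite powR_gt0 // mulr_gt0 // S_gt0. Qed.

Lemma QsE : 2 * S * Qs `^ (gg - 1) = 1.
Proof.
have s0 : 0 < 2 * S by rewrite mulr_gt0 // S_gt0.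
have g0 : gg - 1 != 0 by rewrite gt_eqF // subr_gt0 gg1.
by rewrite /Qs -powRrM mulNr mulVf // powRN powRr1 ?ltW // mulfV // gt_eqF.
Qed.

Lemma Qs_pow : S * Qs `^ gg = Qs / 2.
Proof.
have g0 : 0 < gg by apply: lt_trans gg1.
rewrite -(mulr_powRB1 (ltW Qs_gt0) g0); have := QsE.
move: (Qs `^ (gg - 1)) => z zE.
have -> : S * (Qs * z) = Qs / 2 * (2 * S * z) by field.
by rewrite zE mulr1.
Qed.

Lemma Qw_nontrivial u v : H1 u -> H1 v -> nontrivial (u, v) -> 0 < Qw u v.
Proof.
move=> hu hv nt; rewrite lt_neqAle Qw_ge0 // andbT eq_sym; apply/negP => /eqP Q0.
have [a a0 Ha] := nn_le_qi wA; have [b b0 Hb] := nn_le_qi wB.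
have qa := qi_ge0 wA u; have qb := qi_ge0 wB v.
have Z (c : R) (A' : F) f : 0 < c -> H1 f -> qi A' f f = 0 -> c * nn mu f <= qi A' f f -> {ae mu, forall x, f x = 0}.
  move=> c0 hf E; rewrite E pmulr_rle0 // => n0; apply: nn_eq0; first exact: H1_L2.
  by apply/eqP; rewrite eq_le n0 nn_ge0.
have E1 : qi A u u = 0 by apply/eqP; rewrite eq_le qa andbT -Q0 /Qw lerDl.
have E2 : qi B v v = 0 by apply/eqP; rewrite eq_le qb andbT -Q0 /Qw lerDr.
by apply: nt; split => /=; [exact: (Z a A u a0 hu E1 (Ha u hu))|exact: (Z b B v b0 hv E2 (Hb v hv))].
Qed.

(** On the Nehari set Qw = 2 Dw is at most 2 S Qw^g, which forces Qw >= Qs; the action is there a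
    fixed multiple of Qw. *)
Lemma nehari_level u v : nehari alpha p q A B (u, v) ->
  (2^-1 - (p + q)^-1) * Qs <= action alpha p q A B (u, v).
Proof.
move=> [[/= hu hv] nt]; rewrite pairingE // => /eqP; rewrite subr_eq0 => /eqP QD.
have Q0 := Qw_nontrivial hu hv nt; have pq := pq0.
have -> : action alpha p q A B (u, v) = (2^-1 - (p + q)^-1) * Qw u v.
  have -> : Qw u v = 2 * Dw u v by [].
  by rewrite actionE // QD; field; rewrite gt_eqF.
have c0 : 0 < 2^-1 - (p + q)^-1.
  by rewrite subr_gt0 ltf_pV2 ?posrE //; exact: ltrD.
rewrite ler_pM2l //.
have := Dw_le_Smax KS wA wB p1 q1 sp1 sp2 sq1 sq2 hu hv Q0 (lexx _) => h.
have g0 : 0 < gg by apply: lt_trans gg1.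
have g10 : 0 < gg - 1 by rewrite subr_gt0 gg1.
rewrite leNgt; apply/negP => QQ.
have := gt0_ltr_powR g10; move=> /(_ (Qw u v) Qs).
rewrite !nnegrE !ltW ?Qs_gt0 // => /(_ isT isT QQ) lt1.
have : Qw u v <= Qw u v * (2 * S * Qw u v `^ (gg - 1)).
  move: h; rewrite -(mulr_powRB1 (ltW Q0) g0) => h; rewrite [X in X <= _]QD.
  have -> : Qw u v * (2 * S * Qw u v `^ (gg - 1)) = 2 * (S * (Qw u v * Qw u v `^ (gg - 1))) by ring.
  by rewrite ler_pM2l.
rewrite -[X in X <= _]mulr1 ler_pM2l // leNgt => /negP; apply.
by rewrite -[ltRHS]QsE ltr_pM2l // mulr_gt0 // S_gt0.
Qed.

Section optimal.
Variables (u v : F).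
Hypotheses (hu : H1 u) (hv : H1 v) (Qo : Qw u v = Qs) (Do : Dw u v = Qs / 2).

Lemma optimal_nontrivial : nontrivial (u, v).
Proof.
move=> [/= u0 v0]; have h0 := @H1_0 R N; have := Qs_gt0; rewrite -Qo.
have -> : Qw u v = 0; last by rewrite ltxx.
have Z (A' f : F) : weight A' -> H1 f -> {ae mu, forall x, f x = 0} -> qi A' f f = 0.
  move=> wA' hf f0; have m0 : mf (fun _ : 'rV[R]_N => 0 : R) by exact: measurable_cst.
  rewrite (qi_ae wA' hf m0 hf f0) (qiC A') (qi_ae wA' hf m0 h0 f0).
  exact: qi0.
by rewrite /Qw !Z // addr0.
Qed.

Lemma optimal_action : action alpha p q A B (u, v) = (2^-1 - (p + q)^-1) * Qs.
Proof. by have pq := pq0; rewrite actionE // Qo Do; field; rewrite gt_eqF. Qed.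

Lemma optimal_ground : (action alpha p q A B (u, v))%:E = ground_level alpha p q A B.
Proof.
apply/eqP; rewrite eq_le; apply/andP; split.
  apply: le_ereal_inf_tmp => _ [[u' v'] Hw <-]; rewrite lee_fin optimal_action.
  exact: nehari_level.
apply: ereal_inf_lbound; exists (u, v) => //; split; [by split|exact: optimal_nontrivial|].
by rewrite pairingE // Qo Do; field.
Qed.

(** The inequality Dw <= S Qw^g holds for all pairs and is an equality at (u, v). Comparing the
    first-order terms of both sides along (u + t h, v + t g) for both signs of t gives the
    equation. *)
Lemma optimal_Lexp h g : H1 h -> H1 g -> Lexp u v (h, g) = 0.
Proof.
move=> hh hg; have pq := pq0; have Q0 := Qs_gt0; have g1 := gg1.
have g0 : 0 < gg by apply: lt_trans g1.
pose z := qi A u h + qi B v g; pose z2 := Qw h g; pose d := dDw u v h g.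
have z20 : 0 <= z2 by exact: Qw_ge0.
suff E : d - gg * z = 0.
  have -> : Lexp u v (h, g) = - (2 / (p + q)) * (d - gg * z) by rewrite /Lexp /= -/d /z; field; rewrite gt_eqF.
  by rewrite E mulr0.
pose c := 1 + S1 h + S1 g; have c0 : 0 < c by rewrite ltr_wpDr ?S1_ge0 // ltr_wpDr ?S1_ge0.
have hc : S1 h <= c by rewrite /c addrAC lerDr addr_ge0 ?S1_ge0.
have gc : S1 g <= c by rewrite /c lerDr addr_ge0 ?S1_ge0.
pose X := 2 * `|z| + z2; have X0 : 0 <= X by rewrite addr_ge0 // mulr_ge0.
have key e : 0 < e -> exists2 dl : R, 0 < dl & forall t, `|t| <= dl ->
    t * (d - gg * z) <= `|t| * (e * (c + X / 2) + gg / 2 * z2 * `|t|).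
  move=> e0; have [d1 d10 HD] := Dw_expand KS p1 q1 sp1 sp2 sq1 sq2 hu hv e0.
  have [d2 /andP[d20 d21] HT] := powR_tangent gg e0.
  have [d3 d30 h3] := mul_small (ltW c0) d10.
  have QdX : 0 < d2 * Qs by rewrite mulr_gt0.
  have [d4 d40 h4] := mul_small X0 QdX.
  exists (Num.min 1 (Num.min d3 d4)); first by rewrite !lt_min ltr01 d30.
  move=> t; rewrite !le_min => /and3P[t1 t3 t4].
  have [->|tn] := eqVneq t 0; first by rewrite normr0 !mul0r.
  have tp : 0 < `|t| by rewrite normr_gt0.
  have ht := H1Z t hh; have gt := H1Z t hg.
  have sz (f : F) : H1 f -> S1 f <= c -> S1 (fun x => t * f x) <= `|t| * c.
    by move=> hf fc; apply: le_trans (S1Z t hf) _; rewrite ler_wpM2l.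
  have n0 : 0 < `|t| * c by rewrite mulr_gt0.
  have n1 : `|t| * c <= d1 by apply: le_trans h3; rewrite ler_wpM2r // ltW.
  have := HD _ _ _ ht gt n0 n1 (sz h hh hc) (sz g hg gc).
  have -> : dDw u v (fun x => t * h x) (fun x => t * g x) = t * d.
    exact: dDw_Z.
  rewrite Do ler_norml => /andP[lo _].
  pose x := 2 * t * z + t ^+ 2 * z2.
  have xX : `|x| <= `|t| * X.
    exact: quad_abs.
  have Qt : Qw (fun y => u y + t * h y) (fun y => v y + t * g y) = Qs * (1 + x / Qs).
    have -> : Qw (fun y => u y + t * h y) (fun y => v y + t * g y) = Qw u v + x.
      rewrite /Qw !qi_add // (qiZr t wA) // (qiZr t wB) // !qiZZ // /x /z /z2 /Qw.
      move: (qi A u u) (qi B v v) (qi A u h) (qi B v g) (qi A h h) (qi B g g) => *; ring.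
    by rewrite Qo mulrDr mulr1 mulrCA mulfV ?gt_eqF // mulr1.
  have xd : `|x / Qs| <= d2.
    rewrite normrM normfV (gtr0_norm Q0) ler_pdivrMr //.
    by apply: le_trans xX _; apply: le_trans h4; rewrite ler_wpM2r.
  have x1' : 0 < 1 + x / Qs.
    by move: (le_lt_trans xd d21); rewrite ltr_norml => /andP[+ _]; rewrite -subr_gt0 opprK addrC.
  have Qtp : 0 < Qs * (1 + x / Qs) by rewrite mulr_gt0.
  have hut := H1D hu ht; have hvt := H1D hv gt.
  have := Dw_le_Smax KS wA wB p1 q1 sp1 sp2 sq1 sq2 hut hvt Qtp; rewrite Qt lexx => /(_ isT).
  rewrite powRM ?(ltW Q0) ?(ltW x1') // mulrA Qs_pow => up.
  have := HT _ xd; rewrite ler_norml => /andP[_ tg].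
  have tg2 : (1 + x / Qs) `^ gg <= 1 + gg * (x / Qs) + e * (`|x| / Qs).
    have -> : 1 + gg * (x / Qs) + e * (`|x| / Qs) = e * (`|x| / Qs) + gg * (x / Qs) + 1 by ring.
    by move: tg; rewrite normrM normfV (gtr0_norm Q0) !lerBlDr.
  have Q2 : 0 < Qs / 2 by rewrite divr_gt0.
  have up2 : Dw (fun y => u y + t * h y) (fun y => v y + t * g y) <= Qs / 2 + gg / 2 * x + e / 2 * (`|t| * X).
    apply: le_trans up _; apply: (@le_trans _ _ (Qs / 2 * (1 + gg * (x / Qs) + e * (`|x| / Qs)))).
      by rewrite ler_pM2l.
    have -> : Qs / 2 * (1 + gg * (x / Qs) + e * (`|x| / Qs)) = Qs / 2 + gg / 2 * x + e / 2 * `|x|.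
      by field; rewrite gt_eqF.
    by rewrite lerD2l ler_pM2l // divr_gt0.
  move: lo up2; rewrite /x; move: (Dw _ _) => D lo up2.
  by apply: expansion_arith lo up2; rewrite -expr2 real_normK ?num_real.
apply/eqP; rewrite -normr_le0; apply/ler_addgt0Pr => e e0; rewrite add0r.
have e2 : 0 < e / 2 by rewrite divr_gt0.
have W0 : 0 <= c + X / 2 by rewrite addr_ge0 ?(ltW c0) // divr_ge0.
have [e1 e10 he1] := mul_small W0 e2.
have [dl dl0 Hdl] := key e1 e10.
have V0 : 0 <= gg / 2 * z2 by rewrite mulr_ge0 // divr_ge0 // ltW.
have [tau tau0 htau] := mul_small V0 e2.
(* One step size for both signs: it lies in the range of [key] and makes the quadratic term at most
   e/2. *)
pose t := Num.min dl tau; have t0 : 0 < t by rewrite lt_min dl0.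
have tdl : t <= dl by rewrite ge_min lexx.
have bound (s : R) : `|s| = t -> s * (d - gg * z) <= t * e.
  move=> st; apply: le_trans (Hdl s _) _; rewrite st //.
  rewrite ler_pM2l // (_ : e = e / 2 + e / 2); last by field.
  apply: lerD => //; apply: le_trans htau; rewrite mulrC ler_wpM2r // ge_min lexx orbT //.
have := bound t (gtr0_norm t0); have := bound (- t); rewrite normrN (gtr0_norm t0) => /(_ erefl).
rewrite mulNr -mulrN !ler_pM2l // => b1 b2.
by rewrite ler_norml b2 andbT lerNl.
Qed.

Lemma optimal_critical : critical_point (action alpha p q A B) (u, v).
Proof.
split; first by split.
have [lin [C HC] D] := action_frechet hu hv; split.
- by move=> *; rewrite mulr0 addr0.
- by exists 0 => *; rewrite normr0 mul0r.
move=> e e0; have [d d0 Hd] := D e e0; exists d => // -[h g] hw hd.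
by have := Hd _ hw hd; case: hw => /= hh hg; rewrite optimal_Lexp.
Qed.

Lemma optimal_weak_form : weak_form alpha p q A B (u, v).
Proof.
have pq := pq0; have [s au] := admp_ex KS sp1 sp2 hu; have [t av] := admq_ex KS sq1 sq2 hv.
have h0 := @H1_0 R N.
have z0 (f : F) : (fun x => f x * 0) = fun=> 0 by apply/funext => x; rewrite mulr0.
have F0l : form (fun=> 0) (pwf q v) = 0.
  have -> : (fun=> 0) = fun x => 0 * pwf p u x by apply/funext => x; rewrite mul0r.
  by rewrite (formZl 0 au av) mul0r.
have F0r : form (pwf p u) (fun=> 0) = 0.
  have -> : (fun=> 0) = fun x => 0 * pwf q v x by apply/funext => x; rewrite mul0r.
  by rewrite (formZr 0 au av) mul0r.
have P (f : F) : 0 < 1 + S1 f /\ S1 f <= 1 + S1 f by rewrite ltr_pwDl ?S1_ge0 // lerDr.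
split => /= f hf; have [a1 a2] := P f.
- have [K K0 HK] := adm_dif KS p1 sp1 sp2 hu; have A1 := HK f _ hf a1 a2.
  have := optimal_Lexp hf h0; rewrite /Lexp /= /dDw z0 F0r addr0 (qi_0r wB hv) addr0 => /eqP.
  rewrite subr_eq0 => /eqP E; rewrite (qi_Int wA hu hf) E (formC KS A1 av) (form_convolution KS av A1).
  have p0 : p != 0 by rewrite gt_eqF // (lt_trans ltr01).
  have A2 := admZ KS (invr_neq0 p0) A1.
  have := formZr p av A2; rewrite (form_convolution KS av A2).
  have -> : (fun x => p * (p^-1 * (p * phi p (u x) * f x))) = fun x => p * phi p (u x) * f x.
    by apply/funext => x; rewrite mulrA mulfV // mul1r.
  rewrite (form_convolution KS av A1) => ->; rewrite mulrA; congr (_ * _); first by ring.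
  by apply: eq_Rintegral => x _; rewrite -mulrA mulKf // /phi -!mulrA.
have [K K0 HK] := adm_dif KS q1 sq1 sq2 hv; have A1 := HK f _ hf a1 a2.
have := optimal_Lexp h0 hf; rewrite /Lexp /= /dDw z0 F0l add0r (qi_0r wA hu) add0r => /eqP.
rewrite subr_eq0 => /eqP E; rewrite (qi_Int wB hv hf) E (form_convolution KS au A1).
have q0 : q != 0 by rewrite gt_eqF // (lt_trans ltr01).
have A2 := admZ KS (invr_neq0 q0) A1.
have := formZr q au A2; rewrite (form_convolution KS au A2).
have -> : (fun x => q * (q^-1 * (q * phi q (v x) * f x))) = fun x => q * phi q (v x) * f x.
  by apply/funext => x; rewrite mulrA mulfV // mul1r.
rewrite (form_convolution KS au A1) => ->; rewrite mulrA; congr (_ * _); first by ring.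
by apply: eq_Rintegral => x _; rewrite -mulrA mulKf // /phi -!mulrA.
Qed.

End optimal.

End action_functional.

(** * The heat flow *)

Lemma heat_time_arith (R : realFieldType) (H S n s P : R) : s != 0 -> P != 0 ->
  H * (- (n / 2) * ((4 * P * s)^-1 * (4 * P)) + - (S / 4) * (- s ^- 2)) = (S / (4 * s ^+ 2) - n / (2 * s)) * H.
Proof.
by move=> h1 h; field; rewrite h1 h.
Qed.

Section heat_kernel.
Context (R : realType) (N : nat).
Local Notation mu := (lebesgue_rV R N).
Local Notation e i := (delta_mx ord0 i : 'rV[R]_N).
Implicit Types (x y z : 'rV[R]_N) (s t c : R) (i : 'I_N).

Definition sqn z : R := \sum_(i < N) z ord0 i ^+ 2.

Lemma sqn_ge0 z : 0 <= sqn z.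
Proof. by apply: sumr_ge0 => i _; exact: sqr_ge0. Qed.

Lemma coord_sq_le z i : z ord0 i ^+ 2 <= sqn z.
Proof. by rewrite /sqn (bigD1 i) //= lerDl sumr_ge0 // => j _; exact: sqr_ge0. Qed.

Lemma sqn_shift z i t : sqn (z + t *: e i) = sqn z + (2 * t * z ord0 i + t ^+ 2).
Proof.
rewrite /sqn (bigD1 i) //= [in RHS](bigD1 i) //= !mxE !eqxx mulr1.
rewrite (eq_bigr (fun j => z ord0 j ^+ 2)); last first.
  by move=> j ji; rewrite !mxE (negbTE ji) andbF mulr0 addr0.
by ring.
Qed.

Lemma sqn_shift_ge z i t : `|t| <= 1 -> sqn z / 2 - 1 <= sqn (z + t *: e i).
Proof.
move=> t1; rewrite sqn_shift; have h := coord_sq_le z i.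
have t2 : t ^+ 2 <= 1 by rewrite -real_normK ?num_real // expr_le1.
move: (z ord0 i) (sqn z) h => a r h; have := sqr_ge0 (a + 2 * t).
have -> : (a + 2 * t) ^+ 2 = a ^+ 2 + 4 * (t * a) + 4 * t ^+ 2 by ring.
rewrite -(mulrA 2 t a); move: (a ^+ 2) (t * a) (t ^+ 2) h t2 => p q w; lra.
Qed.

Lemma sqnN z : sqn (- z) = sqn z.
Proof. by apply: eq_bigr => i _; rewrite mxE sqrrN. Qed.

Lemma mf_sqn : mf sqn.
Proof. by apply: measurable_sum => i; apply: measurable_funX; exact: measurable_coord. Qed.

Definition gauss c z : R := expR (- c * sqn z).

Lemma gauss_gt0 c z : 0 < gauss c z. Proof. exact: expR_gt0. Qed.

Lemma mf_gauss c : mf (gauss c).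
Proof. by apply: measurableT_comp => //; apply: measurable_funM => //; exact: mf_sqn. Qed.

Lemma gauss_mono c c' z : c <= c' -> gauss c' z <= gauss c z.
Proof. by move=> cc; rewrite ler_expR ler_wpM2r ?sqn_ge0 // lerN2. Qed.

Lemma gauss_shift c z i t : 0 < c -> `|t| <= 1 -> gauss c (z + t *: e i) <= expR c * gauss (c / 2) z.
Proof.
move=> c0 t1; rewrite /gauss -expRD ler_expR; have h := sqn_shift_ge z i t1.
by move: (sqn _) (sqn z) h => a b h; nra.
Qed.

(** A polynomial factor is absorbed by half of the exponent. *)
Lemma gauss_poly c : 0 < c -> exists2 C : R, 0 < C & forall z, (1 + sqn z) * gauss c z <= C * gauss (c / 2) z.
Proof.
move=> c0; exists (1 + (c / 2)^-1); first by rewrite addr_gt0 // invr_gt0 divr_gt0.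
move=> z; have -> : gauss c z = gauss (c / 2) z * gauss (c / 2) z.
  by rewrite /gauss -expRD; congr expR; field.
rewrite mulrA; apply: ler_wpM2r; first exact/ltW/gauss_gt0.
rewrite /gauss mulNr expRN ler_pdivrMr ?expR_gt0 //; have := expR_ge1Dx (c / 2 * sqn z).
have := sqn_ge0 z; move: (sqn z) (expR _) => r E r0 h.
have c2 : 0 < c / 2 by rewrite divr_gt0.
apply: (@le_trans _ _ ((1 + (c / 2)^-1) * (1 + c / 2 * r))).
  rewrite mulrDl mul1r mulrDr mulr1 mulrA mulVf ?gt_eqF // mul1r.
  rewrite -subr_ge0 (_ : _ - _ = c / 2 * r + (c / 2)^-1); last by ring.
  by rewrite addr_ge0 ?mulr_ge0 ?invr_ge0 // ltW.
by rewrite ler_pM2l // addr_gt0 // invr_gt0.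
Qed.

(** (4 pi s)^(-N/2) exp(-|z|^2/(4s)) written as a single exponential, so that each derivative is one
    chain rule. *)
Definition heat s z : R := expR (- (N%:R / 2 * ln (4 * pi * s)) - sqn z / (4 * s)).

Lemma heat_gt0 s z : 0 < heat s z. Proof. exact: expR_gt0. Qed.

Lemma heatE s z : heat s z = expR (- (N%:R / 2 * ln (4 * pi * s))) * gauss (4 * s)^-1 z.
Proof. by rewrite /heat /gauss -expRD mulNr [sqn z / _]mulrC. Qed.

Lemma mf_heat s : mf (heat s).
Proof. by rewrite (funext (heatE s)); apply: measurable_funM => //; exact: mf_gauss. Qed.

Lemma heatN s z : heat s (- z) = heat s z.
Proof. by rewrite /heat sqnN. Qed.

(** The kernel is a product of one-dimensional normal densities of variance 2s. *)
Lemma heat_mass s : 0 < s -> nnI mu (heat s) = 1%E.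
Proof.
move=> s0; pose w := Num.sqrt (2 * s); have s20 : 0 < 2 * s by rewrite mulr_gt0.
have w0 : w != 0 by rewrite gt_eqF // sqrtr_gt0.
have w2 : w ^+ 2 = 2 * s by rewrite sqr_sqrtr // ltW.
have E z : heat s z = \prod_(i < N) normal_pdf 0 w (z ord0 i).
  rewrite normal_pdfE //; have P : normal_peak w = expR (- (2^-1 * ln (4 * pi * s))).
    rewrite /normal_peak w2 -powR12_sqrt; last by rewrite pmulrn_lge0 // mulr_ge0 ?pi_ge0 // ltW.
    rewrite -powRN /powR gt_eqF; last by rewrite pmulrn_lgt0 // mulr_gt0 ?pi_gt0.
    by rewrite mulNr; congr (expR (- (_ * ln _))); ring.
  have Q t : normal_fun 0 w t = expR (- (t ^+ 2 / (4 * s))).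
    by rewrite /normal_fun subr0 w2 mulNr; congr (expR (- (_ / _))); ring.
  rewrite big_split /= prodr_const card_ord P -expRM_natl (eq_bigr _ (fun i _ => Q (z ord0 i))) -expR_sum -expRD.
  rewrite /heat /sqn mulr_suml sumrN; apply: (f_equal expR); apply: eq_add => //.
  by rewrite mulrN mulrA.
rewrite (_ : heat s = fun z => \prod_(i < N) normal_pdf 0 w (z ord0 i)); last exact: funext.
rewrite (@nnI_prod R N (fun=> normal_pdf 0 w)); last 2 first.
- by move=> i; exact: measurable_normal_pdf.
- by move=> i t; exact: normal_pdf_ge0.
Transparent nnI.
rewrite big1 // => i _; exact: integral_normal_pdf.
Opaque nnI.
Qed.

Lemma intg_gauss c : 0 < c -> intg mu (gauss c).
Proof.
move=> c0; have s0 : 0 < (4 * c)^-1 by rewrite invr_gt0 mulr_gt0.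
have ih : intg mu (heat (4 * c)^-1).
  apply: intg_ge0P; [exact: mf_heat|by move=> z; exact/ltW/heat_gt0|by rewrite heat_mass // ltry].
have := intgZ (expR (N%:R / 2 * ln (4 * pi * (4 * c)^-1))) ih; congr (intg mu _); apply/funext => z.
rewrite heatE mulrA -expRD subrr expR0 mul1r; have c4 : 4 != 0 :> R by [].
by have -> : (4 * (4 * c)^-1)^-1 = c by rewrite invfM invrK mulKf.
Qed.

Lemma L2_gauss c : 0 < c -> L2 mu (gauss c).
Proof.
move=> c0; split; first exact: mf_gauss.
have c2 : 0 < 2 * c by rewrite mulr_gt0.
have := intg_gauss c2; congr (intg mu _); apply/funext => z.
by rewrite expr2 /gauss -expRD; congr expR; ring.
Qed.

Definition dheat s i z : R := - (z ord0 i / (2 * s)) * heat s z.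
Definition ddheat s i z : R := (z ord0 i ^+ 2 / (4 * s ^+ 2) - (2 * s)^-1) * heat s z.
Definition theat s z : R := (sqn z / (4 * s ^+ 2) - N%:R / (2 * s)) * heat s z.

(** The heat equation: [theat] will turn out to be the time derivative. *)
Lemma sum_ddheat s z : \sum_(i < N) ddheat s i z = theat s z.
Proof.
rewrite /ddheat -mulr_suml; congr (_ * _); rewrite sumrB -mulr_suml; congr (_ - _).
by rewrite sumr_const card_ord -[_ *+ N]mulr_natl.
Qed.

Lemma is_derive_slice (f : 'rV[R]_N -> R) x i d :
  is_derive (0 : R) 1 (fun t : R => f (x + t *: e i)) d -> is_derive x (e i) f d.
Proof.
move=> /is_derive_cvgP H; apply/is_derive_cvgP; apply: cvg_trans H; apply: near_eq_cvg; apply: nearW => h /=.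
by rewrite [h%:A]mulr1 !addr0 scale0r addr0 [x + _]addrC.
Qed.

Lemma is_derive_lin (a b t : R) : is_derive t 1 (fun t : R => a + b * t) b.
Proof.
have H := @is_deriveD _ _ _ _ _ _ _ _ _ (is_derive_cst (a : R) t (1 : R))
  (@is_deriveZ _ _ _ _ b _ _ _ (is_derive_id t (1 : R))).
by apply: (is_derive_eq H); rewrite add0r /GRing.scale /= mulr1.
Qed.

Lemma is_derive_heat s x i : s != 0 -> is_derive x (e i) (heat s) (dheat s i x).
Proof.
move=> s0; apply: is_derive_slice.
have D1 := is_derive_lin (2 * x ord0 i) 1 0.
have D2 := is_deriveM (is_derive_id (0 : R) (1 : R)) D1.
pose a := - (N%:R / 2 * ln (4 * pi * s)) - sqn x / (4 * s).
have D3 := @is_deriveD _ _ _ _ _ _ _ _ _ (is_derive_cst (a : R) (0 : R) (1 : R))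
  (@is_deriveZ _ _ _ _ (- (4 * s)^-1) _ _ _ D2).
have D4 := is_derive1_comp (is_derive_expR _) D3.
have E : (fun t : R => heat s (x + t *: e i)) = expR \o (cst a + (- (4 * s)^-1) \*: (id * (fun t : R => 2 * x ord0 i + 1 * t))).
  apply/funext => t /=; rewrite /heat sqn_shift; congr expR; rewrite /a.
  change (- (N%:R / 2 * ln (4 * pi * s)) - (sqn x + (2 * t * x ord0 i + t ^+ 2)) / (4 * s) =
    - (N%:R / 2 * ln (4 * pi * s)) - sqn x / (4 * s) + - (4 * s)^-1 * (t * (2 * x ord0 i + 1 * t))).
  by ring.
rewrite E; apply: (is_derive_eq D4).
change (expR (a + - (4 * s)^-1 * (0 * (2 * x ord0 i + 1 * 0))) *
  (0 + - (4 * s)^-1 * (0 * 1 + (2 * x ord0 i + 1 * 0) * 1)) = dheat s i x).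
rewrite !mul0r mulr0 addr0 /dheat /heat -/a invfM [(2 * s)^-1]invfM.
have -> : (4 : R)^-1 = 2^-1 * 2^-1 by field.
by field.
Qed.

Lemma is_derive_dheat s x i : s != 0 -> is_derive x (e i) (dheat s i) (ddheat s i x).
Proof.
move=> s0; apply: is_derive_slice.
have D1 := is_derive_lin (- (x ord0 i / (2 * s))) (- (2 * s)^-1) 0.
have D2 := slice_derive x (0 : R) (fun y => is_derive_heat y i s0).
have D3 := is_deriveM D1 D2.
have E : (fun t : R => dheat s i (x + t *: e i)) =
  (fun t : R => - (x ord0 i / (2 * s)) + - (2 * s)^-1 * t) * (fun t : R => heat s (x + t *: e i)).
  apply/funext => t; rewrite /dheat !mxE !eqxx mulr1; change ((- ((x ord0 i + t) / (2 * s))) * heat s (x + t *: e i) =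
   (- (x ord0 i / (2 * s)) + - (2 * s)^-1 * t) * heat s (x + t *: e i)).
  by congr (_ * _); ring.
rewrite E; apply: (is_derive_eq D3); rewrite scale0r addr0.
change ((- (x ord0 i / (2 * s)) + - (2 * s)^-1 * 0) * dheat s i x + heat s x * (- (2 * s)^-1) = ddheat s i x).
by rewrite /ddheat /dheat; field.
Qed.

Lemma is_derive_theat s z : 0 < s -> is_derive s 1 (fun s : R => heat s z) (theat s z).
Proof.
move=> s0; have p0 : 0 < 4 * pi :> R by rewrite mulr_gt0 ?pi_gt0.
have D1 := is_derive_lin 0 (4 * pi) s.
have D2 : is_derive (0 + 4 * pi * s) 1 (@ln R) (0 + 4 * pi * s)^-1.
  by apply: is_derive1_ln; rewrite add0r mulr_gt0.
have D3 := @is_derive1_comp R (@ln R) (fun t : R => 0 + 4 * pi * t) s _ _ D2 D1.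
have D4 : is_derive s 1 (fun t : R => t^-1) (- s ^- 2).
  have H := @is_deriveV R (@id R) s 1 1 _ (is_derive_id s (1 : R)).
  by apply: (is_derive_eq (H _)); rewrite ?gt_eqF // /GRing.scale /= mulr1.
have D5 := is_deriveD (@is_deriveZ _ _ _ _ (- (N%:R / 2)) _ _ _ D3) (@is_deriveZ _ _ _ _ (- (sqn z / 4)) _ _ _ D4).
have D6 := is_derive1_comp (is_derive_expR _) D5.
have E : (fun s : R => heat s z) = expR \o ((- (N%:R / 2)) \*: (@ln R \o (fun t : R => 0 + 4 * pi * t)) +
   (- (sqn z / 4)) \*: (fun t : R => t^-1)).
  apply/funext => t; change (heat t z = expR (- (N%:R / 2) * ln (0 + 4 * pi * t) + - (sqn z / 4) * t^-1)).
  by rewrite /heat add0r mulNr; congr (expR (_ + _)); rewrite invfM; ring.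
rewrite E; apply: (is_derive_eq D6).
have -> : ((- (N%:R / 2)) \*: (@ln R \o (fun t : R => 0 + 4 * pi * t)) + (- (sqn z / 4)) \*: (fun t : R => t^-1)) s =
   - (N%:R / 2) * ln (0 + 4 * pi * s) + - (sqn z / 4) * s^-1 by [].
have -> : - (N%:R / 2) * ln (0 + 4 * pi * s) + - (sqn z / 4) * s^-1 = - (N%:R / 2 * ln (4 * pi * s)) - sqn z / (4 * s).
  by rewrite add0r invfM; ring.
rewrite -/(heat s z) /theat; change (heat s z * (- (N%:R / 2) * ((0 + 4 * pi * s)^-1 * (4 * pi)) + - (sqn z / 4) * (- s ^- 2)) =
  (sqn z / (4 * s ^+ 2) - N%:R / (2 * s)) * heat s z).
have pn : pi != 0 :> R by rewrite gt_eqF // pi_gt0.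
have sn : s != 0 by rewrite gt_eqF.
rewrite add0r; exact: heat_time_arith.
Qed.

(** One Gaussian bound for the kernel and its derivatives, uniform for times between s0/2 and 2 s0;
    it licenses differentiation under the integral and membership in [diff_dom]. *)
Lemma heat_envelope (s0 : R) : 0 < s0 -> exists C c : R, [/\ 0 < C, 0 < c &
  forall s z, s0 / 2 <= s -> s <= 2 * s0 -> [/\ heat s z <= C * gauss c z, `|theat s z| <= C * gauss c z &
     forall i, `|dheat s i z| <= C * gauss c z /\ `|ddheat s i z| <= C * gauss c z]].
Proof.
move=> s0p; pose c := (8 * s0)^-1; have c0 : 0 < c by rewrite invr_gt0 mulr_gt0.
have [D D0 HD] := gauss_poly c0.
pose K := expR (- (N%:R / 2 * ln (4 * pi * (s0 / 2)))); have K0 : 0 < K by exact: expR_gt0.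
have h2 : 0 < s0 / 2 by rewrite divr_gt0.
pose M := 1 + (4 * (s0 / 2) ^+ 2)^-1 + (1 + N%:R) / (2 * (s0 / 2)).
have a1 : 0 < (4 * (s0 / 2) ^+ 2)^-1 by rewrite invr_gt0 mulr_gt0 // exprn_gt0.
have a2 : 0 < (2 * (s0 / 2))^-1 by rewrite invr_gt0 mulr_gt0.
have n0 : 0 <= N%:R :> R by [].
have M1 : 1 <= M by rewrite /M -addrA lerDl addr_ge0 ?ltW // mulr_gt0 // ltr_pwDl.
have M0 : 0 < M by apply: lt_le_trans M1.
exists (M * K * D), (c / 2); split; [by rewrite !mulr_gt0|by rewrite divr_gt0|].
move=> s z h s2; have sp : 0 < s by apply: lt_le_trans h.
have B : heat s z <= K * gauss c z.
  rewrite heatE; apply: ler_pM; [exact: expR_ge0|exact: expR_ge0| |].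
    rewrite /K ler_expR lerN2; apply: ler_wpM2l; first by rewrite divr_ge0.
    have p4 : 0 < 4 * pi :> R by rewrite mulr_gt0 ?pi_gt0.
    have q1 : 0 < 4 * pi * s by exact: mulr_gt0.
    have q2 : 0 < 4 * pi * (s0 / 2) by exact: mulr_gt0.
    by rewrite ler_ln ?posrE // ler_pM2l.
  apply: gauss_mono; rewrite lef_pV2 ?posrE ?mulr_gt0 //.
  apply: (@le_trans _ _ (4 * (2 * s0))); first by rewrite ler_pM2l.
  by rewrite mulrA ler_pM2r // -natrM.
have R0 := sqn_ge0 z.
have W (w : R) : `|w| <= M * (1 + sqn z) -> `|w * heat s z| <= M * K * D * gauss (c / 2) z.
  move=> hw; rewrite normrM (gtr0_norm (heat_gt0 _ _)).
  apply: (@le_trans _ _ (M * (1 + sqn z) * (K * gauss c z))).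
    by apply: ler_pM => //; exact/ltW/heat_gt0.
  have -> : M * (1 + sqn z) * (K * gauss c z) = M * K * ((1 + sqn z) * gauss c z) by ring.
  by rewrite -[leRHS]mulrA ler_pM2l // mulr_gt0.
have b1 : (4 * s ^+ 2)^-1 <= (4 * (s0 / 2) ^+ 2)^-1.
  rewrite lef_pV2 ?posrE ?mulr_gt0 ?exprn_gt0 // ler_pM2l // lerXn2r ?nnegrE //; exact: ltW.
have b2 : (2 * s)^-1 <= (2 * (s0 / 2))^-1 by rewrite lef_pV2 ?posrE ?mulr_gt0 // ler_pM2l.
have b10 : 0 < (4 * s ^+ 2)^-1 by rewrite invr_gt0 mulr_gt0 // exprn_gt0.
have b20 : 0 < (2 * s)^-1 by rewrite invr_gt0 mulr_gt0.
have poly (r n : R) : 0 <= r -> r <= sqn z -> 0 <= n -> n <= 1 + N%:R ->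
    `|r / (4 * s ^+ 2) - n / (2 * s)| <= M * (1 + sqn z).
  move=> r0 rs n0' nN; apply: le_trans (ler_normB _ _) _.
  rewrite !ger0_norm ?mulr_ge0 ?(ltW b10) ?(ltW b20) //.
  apply: (@le_trans _ _ (sqn z * (4 * (s0 / 2) ^+ 2)^-1 + (1 + N%:R) * (2 * (s0 / 2))^-1)).
    by apply: lerD; apply: ler_pM => //; exact: ltW.
  have : 0 <= (1 + N%:R) * (2 * (s0 / 2))^-1 :> R by rewrite mulr_ge0 ?addr_ge0 // ltW.
  rewrite /M; move: (_ * _^-1) (_^-1) a1 (sqn z) R0 => a b b0 r' r0' a0.
  by rewrite -subr_ge0 (_ : _ - _ = 1 + r' + b + a * r') ?addr_ge0 ?mulr_ge0 ?(ltW b0) //; ring.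
split.
- have : `|1 * heat s z| <= M * K * D * gauss (c / 2) z.
    by apply: W; rewrite normr1; apply: le_trans M1 _; rewrite ler_peMr ?(ltW M0) // lerDl.
  by rewrite mul1r (gtr0_norm (heat_gt0 _ _)).
- by apply: W; apply: poly => //; rewrite lerDr.
move=> i; split; last first.
  by apply: W; rewrite -[(2 * s)^-1]mul1r; apply: poly; rewrite ?sqr_ge0 ?coord_sq_le // lerDl.
apply: W; rewrite normrN normrM (gtr0_norm b20).
have z1 : `|z ord0 i| <= 1 + sqn z.
  apply: le_trans (_ : 1 + z ord0 i ^+ 2 <= _); last by rewrite lerD2l coord_sq_le.
  by rewrite -real_normK ?num_real //; move: `|_| (normr_ge0 (z ord0 i)) => a a0; nra.
rewrite mulrC; apply: ler_pM => //; first exact: ltW.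
apply: le_trans b2 _; rewrite /M; apply: (@le_trans _ _ ((1 + N%:R) * (2 * (s0 / 2))^-1)).
  by rewrite ler_peMl ?(ltW a2) // lerDl.
by rewrite lerDr addr_ge0 // ltW.
Qed.

Lemma mf_dheat s i : mf (dheat s i).
Proof.
apply: measurable_funM; last exact: mf_heat.
by apply: measurableT_comp => //; apply: measurable_funM => //; exact: measurable_coord.
Qed.

Lemma mf_ddheat s i : mf (ddheat s i).
Proof.
apply: measurable_funM; last exact: mf_heat.
apply: measurable_funB => //; apply: measurable_funM => //.
by apply: measurable_funX; exact: measurable_coord.
Qed.

Lemma heat_diff_dom s i : 0 < s -> (exists M, diff_dom i (heat s) (dheat s i) M) /\
  exists M, diff_dom i (dheat s i) (ddheat s i) M.
Proof.
move=> s0; have [C [c [C0 c0 H]]] := heat_envelope s0.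
have s1 : s / 2 <= s by rewrite ler_pdivrMr // ler_peMr ?ler1n // ltW.
have s2 : s <= 2 * s by rewrite ler_peMl ?ler1n // ltW.
have c2 : 0 < c / 2 by rewrite divr_gt0.
have L (f : 'rV[R]_N -> R) : mf f -> (forall z, `|f z| <= C * gauss c z) -> L2 mu f.
  move=> mf_ h; apply: (L2_mono mf_ _ (L2Z C (L2_gauss c0))) => z.
  by apply: le_trans (h z) (ler_norm _).
have B (f : 'rV[R]_N -> R) : (forall z, `|f z| <= C * gauss c z) -> forall x t, `|t| <= 1 ->
    `|f (x + t *: e i)| <= C * expR c * gauss (c / 2) x.
  move=> h x t t1; apply: le_trans (h _) _; rewrite -mulrA ler_pM2l //; exact: gauss_shift.
have LM : L2 mu (fun z => C * expR c * gauss (c / 2) z) by apply/L2Z/L2_gauss.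
have h1 z : `|heat s z| <= C * gauss c z by rewrite gtr0_norm ?heat_gt0 //; have [] := H s z s1 s2.
have h2 z : `|dheat s i z| <= C * gauss c z by have [_ _ /(_ i) []] := H s z s1 s2.
have h3 z : `|ddheat s i z| <= C * gauss c z by have [_ _ /(_ i) []] := H s z s1 s2.
split; exists (fun z => C * expR c * gauss (c / 2) z); split => //.
- by apply: L => //; exact: mf_heat.
- exact: mf_dheat.
- by move=> x; apply: is_derive_heat; rewrite gt_eqF.
- exact: B.
- by apply: L => //; exact: mf_dheat.
- exact: mf_ddheat.
- by move=> x; apply: is_derive_dheat; rewrite gt_eqF.
exact: B.
Qed.

Lemma diff_dom_trn i (phi dphi M : 'rV[R]_N -> R) a : diff_dom i phi dphi M ->
  diff_dom i (trn a phi) (trn a dphi) (trn a M).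
Proof.
move=> [lp md lM D B]; split; [exact: L2_trn|exact: mf_trn|exact: L2_trn| |].
  move=> x; apply: is_derive_slice; have := slice_derive (x + a) (0 : R) D; rewrite scale0r addr0.
  by congr is_derive; apply/funext => t; rewrite /trn addrAC.
by move=> x t t1; rewrite /trn addrAC; exact: B.
Qed.

End heat_kernel.

Opaque qi.

Lemma nonincreasing_of_derive (R : realType) (f df : R -> R) (s t : R) : s <= t ->
  (forall r, s <= r -> r <= t -> is_derive r 1 f (df r) /\ df r <= 0) -> f t <= f s.
Proof.
move=> st H; have der (r : R) : s <= r -> r <= t -> derivable f r 1 by move=> a b; have [[]] := H r a b.
apply: (@ler0_derive1_nincr R f s t) => //.
- by move=> r; rewrite in_itv /= => /andP[a b]; apply: der; exact: ltW.
- move=> r; rewrite in_itv /= => /andP[a b]; have [D d0] := H r (ltW a) (ltW b).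
  by rewrite derive1E (is_derive_val D).
apply: derivable_within_continuous => r; rewrite in_itv /= => /andP[a b]; exact: der.
Qed.

Lemma mf_reflect (R : realType) (N : nat) (f : 'rV[R]_N -> R) a : mf f -> mf (fun x : 'rV[R]_N => f (a - x)).
Proof.
move=> mf_; have := mf_comp (@measurable_rV_opp R N) (mf_comp (measurable_rV_add a) mf_).
by congr (measurable_fun _ _); apply/funext => z /=; rewrite addrC.
Qed.

(** * Convolution with the heat kernel *)

Section heat_convolution.
Context (R : realType) (N : nat).
Local Notation mu := (lebesgue_rV R N).
Local Notation e i := (delta_mx ord0 i : 'rV[R]_N).
Local Notation F := ('rV[R]_N -> R).
Local Notation wp := weak_partial.
Local Notation L2 := (L2 mu).
Local Notation ip := (ip mu).
Local Notation nn := (nn mu).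
Implicit Types (x y z : 'rV[R]_N) (s t c : R) (i : 'I_N) (u psi g : F).

Lemma L2_heat s : 0 < s -> L2 (@heat R N s).
Proof.
move=> s0; rewrite (funext (heatE s)); apply/L2Z/L2_gauss.
by rewrite invr_gt0 mulr_gt0.
Qed.

Lemma heat_weak s i x : 0 < s -> weak i (trn x (heat s)) (trn x (dheat s i)).
Proof. by move=> s0; have [[M /(diff_dom_trn x) dd] _] := heat_diff_dom i s0; exact: diff_dom_weak dd. Qed.

Lemma H1_heat s x : 0 < s -> H1 (trn x (@heat R N s)).
Proof.
move=> s0; apply/H1P; split; first exact/L2_trn/L2_heat.
by move=> i; exists (trn x (dheat s i)); exact: heat_weak.
Qed.

Definition hconv s u x : R := convolution (heat s) u x.

Lemma hconvE s u x : hconv s u x = ip u (trn (- x) (heat s)).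
Proof.
rewrite ipE; apply: eq_Rintegral => y _; rewrite /trn mulrC; congr (_ * _).
by rewrite -heatN opprB.
Qed.

Lemma mf_hconv s u : mf u -> mf (hconv s u).
Proof. by move=> m; apply: mf_convolution => //; exact: mf_heat. Qed.

Lemma hconv_derive s u x : L2 u -> 0 < s ->
  is_derive s 1 (fun s : R => hconv s u x) (ip u (trn (- x) (theat s))).
Proof.
move=> lu s0; have [C [c [C0 c0 H]]] := @heat_envelope R N s s0.
pose f (r : R) y := u y * heat r (y - x).
pose G y := `|u y| * (C * gauss c (y - x)).
have inside : `](s / 2), (2 * s)[%classic s.
  rewrite /= in_itv /=; apply/andP; split; first by rewrite ltr_pdivrMr // ltr_pMr // ltr1n.
  by rewrite ltr_pMl // ltr1n.
have rng (r : R) : `](s / 2), (2 * s)[%classic r -> [/\ s / 2 <= r, r <= 2 * s & 0 < r].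
  rewrite /= in_itv /= => /andP[a b]; split; [exact: ltW|exact: ltW|].
  by apply: lt_trans a; rewrite divr_gt0.
have lt (r : R) : 0 < r -> L2 (trn (- x) (heat r)) by move=> r0; exact/L2_trn/L2_heat.
have D (r : R) y : 0 < r -> is_derive r 1 (fun r : R => f r y) (u y * theat r (y - x)).
  by move=> r0; apply: is_deriveZ; exact: is_derive_theat.
have i1 (r : R) : `](s / 2), (2 * s)[%classic r -> intg mu (f r).
  by move=> /rng [_ _ r0]; exact: (L2_intgM lu (lt r r0)).
have i2 : intg mu G.
  by apply: (L2_intgM (L2_abs lu) (g := trn (- x) (fun y => C * gauss c y))); apply/L2_trn/L2Z/L2_gauss.
have d1 (r : R) y : `](s / 2), (2 * s)[%classic r -> [set: 'rV[R]_N] y -> derivable (f^~ y) r 1.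
  by move=> /rng [_ _ r0] _; have [] := D r y r0.
have G0 y : 0 <= G y by rewrite mulr_ge0 // mulr_ge0 ?(ltW C0) //; exact/ltW/gauss_gt0.
have PE (r : R) y : 0 < r -> partial1of2 f r y = u y * theat r (y - x).
  by move=> r0; rewrite /partial1of2 derive1E (is_derive_val (D r y r0)).
have Gu (r : R) y : `](s / 2), (2 * s)[%classic r -> [set: 'rV[R]_N] y -> `|partial1of2 f r y| <= G y.
  move=> /rng [h1 h2 r0] _; rewrite PE // normrM /G; apply: ler_wpM2l => //.
  by have [_ h _] := H r (y - x) h1 h2.
have := @cvg_differentiation_under_integral R _ _ mu f setT measurableT s _ _ inside i1 d1 G G0 i2 Gu.
move=> cv; apply/is_derive_cvgP.
have E : \int[mu]_y partial1of2 f s y = ip u (trn (- x) (theat s)).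
  by rewrite ipE; apply: eq_Rintegral => y _; rewrite PE.
rewrite -E; apply: cvg_trans cv; apply: near_eq_cvg; apply: nearW => h /=.
rewrite [h%:A]mulr1; congr (_ *: (_ - _)); by rewrite hconvE ipE.
Qed.

(** By the heat equation and integration by parts the pairing is minus the gradient part of [qi];
    the weight term is added and subtracted to make the full form appear, so that the equation for u
    can be inserted. *)
Lemma theat_pairing A s u x : weight A -> H1 u -> 0 < s ->
  ip u (trn (- x) (theat s)) = ip (fun y => A y * u y) (trn (- x) (heat s)) - qi A u (trn (- x) (heat s)).
Proof.
Transparent qi.
move=> wA hu s0; have lu := H1_L2 hu; have hh := H1_heat (- x) s0.
have P i : ip (wp i u) (wp i (trn (- x) (heat s))) = - ip u (trn (- x) (ddheat s i)).
  have [[M /(diff_dom_trn (- x)) d1] [M' /(diff_dom_trn (- x)) d2]] := heat_diff_dom i s0.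
  rewrite -(weak_ibp lu (weak_partialP i hu) d2) ipC [RHS]ipC; apply: ip_ae.
  - exact: L2_mf (weak_partial_L2 i hh).
  - by case: d2 => -[].
  - exact: L2_mf (weak_partial_L2 i hu).
  by apply: weak_partial_ae => //; exact: heat_weak.
rewrite /qi (eq_bigr _ (fun i _ => P i)) sumrN opprD opprK addrCA subrr addr0.
Opaque qi.
rewrite (eq_bigr _ (fun i _ => ipE _ _ _)) ipE -Int_sum; last first.
  move=> i _; have [_ [M' /(diff_dom_trn (- x)) d2]] := heat_diff_dom i s0.
  by apply: L2_intgM lu _; exact: diff_dom_L2 d2.
by apply: eq_Rintegral => y _; rewrite -mulr_sumr /trn sum_ddheat.
Qed.

Lemma hconv_intg s u x : L2 u -> 0 < s -> intg mu (fun y => heat s (x - y) * u y).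
Proof.
move=> lu s0; have := L2_intgM lu (L2_trn (- x) (L2_heat s0)); congr (intg mu _); apply/funext => y.
by rewrite /trn mulrC -heatN opprB.
Qed.

Lemma hconv_ge0 s u x : (forall y, 0 <= u y) -> 0 <= hconv s u x.
Proof. by move=> u0; apply: Int_ge0 => y; rewrite mulr_ge0 // ltW // heat_gt0. Qed.

Lemma hconv_gt0 s u x : L2 u -> 0 < s -> (forall y, 0 <= u y) -> ~ {ae mu, forall y, u y = 0} -> 0 < hconv s u x.
Proof.
move=> lu s0 u0 nz; rewrite lt_neqAle hconv_ge0 // andbT eq_sym; apply/negP => /eqP E; apply: nz.
have := Int_eq0 (hconv_intg x lu s0) _ E; move=> /(_ (fun y => mulr_ge0 (ltW (heat_gt0 _ _)) (u0 y))).
by apply: filterS => y /eqP; rewrite mulf_eq0 gt_eqF ?heat_gt0 //= => /eqP.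
Qed.

(** The correlation of psi with u shifted by z. *)
Definition shift_corr u psi z : R := convolution (fun w => u (- w)) psi z.

Lemma shift_corrE u psi z : shift_corr u psi z = ip (trn (- z) u) psi.
Proof.
by rewrite ipE; apply: eq_Rintegral => y _; rewrite /trn opprB.
Qed.

Lemma shift_corr_intg u psi z : L2 u -> L2 psi -> intg mu (fun x => u (x - z) * psi x).
Proof. by move=> lu lp; exact: (L2_intgM (L2_trn (- z) lu) lp). Qed.

(** Tonelli: testing h_s * u against psi is averaging the correlation with the density h_s. *)
Lemma heat_corr s u psi : L2 u -> L2 psi -> 0 < s -> (forall y, 0 <= u y) -> (forall y, 0 <= psi y) ->
  nnI mu (fun x => psi x * hconv s u x) = nnI mu (fun z => heat s z * shift_corr u psi z).
Proof.
move=> lu lp s0 u0 p0.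
pose h (w : 'rV[R]_N * 'rV[R]_N) := psi w.1 * (heat s w.2 * u (w.1 - w.2)).
have mp := L2_mf lp; have mu_ := L2_mf lu; have mh : mf (@heat R N s) by exact: mf_heat.
have h0 y := ltW (@heat_gt0 R N s y).
have mH : mf h.
  by apply: measurable_funM; [exact: mf_fst|apply: measurable_funM; [exact: mf_snd|exact: mf_dif]].
have H0 w : 0 <= h w by rewrite !mulr_ge0.
have E1 x : (psi x * hconv s u x)%:E = nnI mu (fun z => h (x, z)).
  have i := hconv_intg x lu s0.
  have mk : mf (fun z => heat s z * u (x - z)).
    apply: measurable_funM => //.
    exact: mf_reflect.
  rewrite /h /= nnIZ //; last by move=> z; rewrite mulr_ge0.
  rewrite EFinM; congr (_ * _)%E; rewrite -(nnI_sub x mk); last by move=> z; rewrite mulr_ge0.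
  rewrite -(nnI_Int i); last by move=> y; rewrite mulr_ge0.
  by congr nnI; apply/funext => y; rewrite opprB [x + (y - x)]addrC subrK.
have E2 z : (heat s z * shift_corr u psi z)%:E = nnI mu (fun x => h (x, z)).
  have i := shift_corr_intg z lu lp.
  have E : (fun x => h (x, z)) = fun x => heat s z * (u (x - z) * psi x) by apply/funext => x; rewrite /h /=; ring.
  rewrite E nnIZ //; last 2 first.
  - exact: intg_mf i.
  - by move=> x; rewrite mulr_ge0.
  by rewrite EFinM shift_corrE ipE (nnI_Int i) // => x; rewrite mulr_ge0.
have -> : nnI mu (fun x => psi x * hconv s u x) = (\int[mu]_x nnI mu (fun z => h (x, z)))%E.
  Transparent nnI.
  by apply: eq_integral => x _; rewrite E1.
have -> : nnI mu (fun z => heat s z * shift_corr u psi z) = (\int[mu]_z nnI mu (fun x => h (x, z)))%E.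
  by apply: eq_integral => z _; rewrite E2.
Opaque nnI.
by rewrite -nnI2_xy // nnI2_yx.
Qed.

(** From t <= exp(t) with t = |z|^2/(8s): the factor exp(|z|^2/(8s)) turns the kernel at time s into
    2^(N/2) times the kernel at time 2s. *)
Lemma sqn_heat_le s z : 0 < s -> sqn z * heat s z <= 8 * s * expR (N%:R / 2 * ln 2) * heat (2 * s) z.
Proof.
move=> s0; have h : sqn z / (8 * s) <= expR (sqn z / (8 * s)).
  by apply: le_trans (expR_ge1Dx _); rewrite lerDr.
have s8 : 0 < 8 * s by rewrite mulr_gt0.
have p4 : 0 < 4 * pi :> R by rewrite mulr_gt0 // pi_gt0.
have E : heat s z * expR (sqn z / (8 * s)) = expR (N%:R / 2 * ln 2) * heat (2 * s) z.
  have -> : heat (2 * s) z = expR (- (N%:R / 2 * ln (4 * pi * (2 * s))) - sqn z / (4 * (2 * s))) by [].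
  have -> : 4 * pi * (2 * s) = 2 * (4 * pi * s) by ring.
  have p0 : 0 < 4 * pi * s by exact: mulr_gt0.
  rewrite lnM ?posrE // /heat -2!expRD; move: (ln 2) (ln _) (sqn z) => a b r.
  by apply: (f_equal expR); field; rewrite gt_eqF.
rewrite -[leRHS]mulrA -E.
have -> : 8 * s * (heat s z * expR (sqn z / (8 * s))) = 8 * s * expR (sqn z / (8 * s)) * heat s z by ring.
apply: ler_wpM2r; first exact/ltW/heat_gt0.
by rewrite -ler_pdivrMl // mulrC.
Qed.

Lemma heat_norm_small (d : R) : 0 < d -> exists2 s0 : R, 0 < s0 <= 1 &
  (nnI mu (fun z => heat s0 z * `|z|)%R <= d%:E)%E.
Proof.
move=> d0; have d2 : 0 < d / 2 by rewrite divr_gt0.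
pose c : R := 8 * expR (N%:R / 2 * ln 2); have c0 : 0 < c by rewrite mulr_gt0 // expR_gt0.
have w0 : 0 <= c / (d / 2) by rewrite divr_ge0 // ltW.
have [s1 s10 hs] := mul_small w0 d2.
pose s := Num.min s1 1; have s0 : 0 < s by rewrite lt_min s10 ltr01.
have s11 : s <= s1 by rewrite ge_min lexx.
exists s; first by rewrite s0 ge_min lexx orbT.
have h0 y := ltW (@heat_gt0 R N s y).
have s20 : 0 < 2 * s by rewrite mulr_gt0.
have h20 y := ltW (@heat_gt0 R N (2 * s) y).
(* |z| is at most d/2 + |z|^2/(d/2), so the first moment is reduced to the mass and the second
   moment. *)
have B z : heat s z * `|z| <= (d / 2) * heat s z + (s * c / (d / 2)) * heat (2 * s) z.
  have z2 : `|z| ^+ 2 <= sqn z.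
    by rewrite -[sqn z]sqr_sqrtr ?sqn_ge0 // lerXn2r ?nnegrE ?sqrtr_ge0 //; exact: norm_le_enorm.
  have zd : `|z| <= d / 2 + sqn z / (d / 2).
    rewrite -(ler_pM2r d2) mulrDl divfK ?gt_eqF //; apply: le_trans (_ : (d / 2) * (d / 2) + `|z| ^+ 2 <= _).
      by move: `|z| (normr_ge0 z) (d / 2) => a a0 b; have := sqr_ge0 (a - b); rewrite sqrrB; nra.
    by rewrite lerD2l.
  apply: le_trans (ler_wpM2l (h0 z) zd) _; rewrite mulrDr [heat s z * _]mulrC lerD2l.
  rewrite mulrA [heat s z * _]mulrC [leRHS]mulrAC ler_pM2r ?invr_gt0 //.
  by apply: le_trans (sqn_heat_le z s0) _; rewrite /c [8 * s]mulrC !mulrA.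
have k0 : 0 <= s * c / (d / 2) by rewrite divr_ge0 ?mulr_ge0 // ltW.
have mh r : mf (@heat R N r) by exact: mf_heat.
have mr : mf (fun z => (d / 2) * heat s z + (s * c / (d / 2)) * heat (2 * s) z).
  by apply: measurable_funD; apply: measurable_funM.
apply: (@le_trans _ _ (nnI mu (fun z => (d / 2) * heat s z + (s * c / (d / 2)) * heat (2 * s) z)%R)).
  apply: nnI_le => //; last by move=> z; rewrite mulr_ge0.
  by apply: measurable_funM => //; exact: mf_norm.
have n1 z : 0 <= (d / 2) * heat s z by rewrite mulr_ge0 // ltW.
have n2 z : 0 <= (s * c / (d / 2)) * heat (2 * s) z by rewrite mulr_ge0.
rewrite nnID //; [|exact: measurable_funM|exact: measurable_funM].
rewrite !nnIZ ?(ltW d2) // !heat_mass // !mule1 -EFinD lee_fin -mulrA.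
have -> : d = d / 2 + d / 2 by field.
rewrite (_ : (d / 2 + d / 2) / 2 = d / 2); last by field.
rewrite lerD2l; apply: le_trans hs; rewrite ler_wpM2r //.
Qed.

(** Translations of an H^1 function are Lipschitz in L^2 for |z| <= 1; for larger z the crude bound
    2 |u| is already at most a multiple of |z|. *)
Lemma shift_corr_close u psi : H1 u -> L2 psi -> exists2 C : R, 0 <= C & forall z,
  `|shift_corr u psi z - ip u psi| <= C * `|z|.
Proof.
move=> hu lp; have lu := H1_L2 hu; pose P := Num.sqrt (nn psi).
exists ((2 * Num.sqrt (nn u) + S1 u) * P); first by rewrite mulr_ge0 ?sqrtr_ge0 // addr_ge0 ?S1_ge0 // mulr_ge0 ?sqrtr_ge0.
move=> z; have lt := L2_trn (- z) lu; rewrite shift_corrE -ipBl //.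
apply: le_trans (ip_le_sqrt (L2B lt lu) lp) _; rewrite mulrAC ler_wpM2r ?sqrtr_ge0 //.
have [z1|z1] := leP `|z| 1.
  apply: (@le_trans _ _ (S1 u * `|z|)); last by rewrite ler_wpM2r // lerDr mulr_ge0 ?sqrtr_ge0.
  apply: sqrtr_le; first by rewrite mulr_ge0 ?S1_ge0.
  have := @nn_trn_sub R N (- z) u hu; rewrite normrN => /(_ z1); rewrite mulrC; apply: le_trans.
  by apply: le_of_eq.
apply: le_trans (sqrt_nn_sub lt lu) _; rewrite nn_trn //.
have n0 := sqrtr_ge0 (nn u); have := S1_ge0 u; move: (Num.sqrt _) (S1 u) `|z| z1 n0 => a b r r1 a0 b0.
apply: (@le_trans _ _ ((2 * a + b) * 1)); first by rewrite mulr1 (_ : 2 * a = a + a) ?lerDl //; ring.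
by rewrite ler_wpM2l ?(ltW r1) // addr_ge0 // mulr_ge0.
Qed.

(** The correlation is close to its value at 0 up to C|z|, and the first moment of h_s is small. A
    small time s that serves one given psi is all that the comparisons require. *)
Lemma heat_approx u psi (eps : R) : H1 u -> L2 psi -> (forall y, 0 <= u y) -> (forall y, 0 <= psi y) -> 0 < eps ->
  exists2 s : R, 0 < s <= 1 & ((ip u psi)%:E <= nnI mu (fun x => psi x * hconv s u x)%R + eps%:E)%E /\
    (nnI mu (fun x => psi x * hconv s u x)%R <= (ip u psi + eps)%:E)%E.
Proof.
move=> hu lp u0 p0 e0; have lu := H1_L2 hu; have [C C0 H] := shift_corr_close hu lp.
have [d d0 dC] := mul_small C0 e0; have [s s01 hs] := heat_norm_small d0.
have /andP[s0 _] := s01; exists s => //; rewrite heat_corr //.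
have h0 y := ltW (@heat_gt0 R N s y).
have mh : mf (@heat R N s) by exact: mf_heat.
have mc : mf (shift_corr u psi).
  exact: (mf_convolution (mf_comp (@measurable_rV_opp R N) (L2_mf lu)) (L2_mf lp)).
have c0 z : 0 <= shift_corr u psi z by apply: Int_ge0 => y; rewrite mulr_ge0.
have ip0 : 0 <= ip u psi.
  by rewrite ipE; apply: Int_ge0 => y; rewrite mulr_ge0.
have mn : mf (fun z : 'rV[R]_N => heat s z * `|z|) by apply: measurable_funM => //; exact: mf_norm.
have n0 z : 0 <= heat s z * `|z| by rewrite mulr_ge0.
have m1 : mf (fun z => heat s z * shift_corr u psi z) by exact: measurable_funM.
have m2 : mf (fun z => C * (heat s z * `|z|)) by exact: measurable_funM.
have m3 : mf (fun z => ip u psi * heat s z) by exact: measurable_funM.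
have z1 z : 0 <= heat s z * shift_corr u psi z by rewrite mulr_ge0.
have z2 z : 0 <= C * (heat s z * `|z|) by rewrite mulr_ge0.
have z3 z : 0 <= ip u psi * heat s z by rewrite mulr_ge0.
have small : (nnI mu (fun z => C * (heat s z * `|z|))%R <= eps%:E)%E.
  rewrite nnIZ //; apply: (@le_trans _ _ (C%:E * d%:E)%E); first exact: lee_wpmul2l.
  by rewrite -EFinM lee_fin mulrC.
have E3 : nnI mu (fun z => ip u psi * heat s z) = (ip u psi)%:E by rewrite nnIZ // heat_mass // mule1.
split.
  apply: (@le_trans _ _ (nnI mu (fun z => heat s z * shift_corr u psi z + C * (heat s z * `|z|))%R)); last first.
    by rewrite nnID //; exact: leeD2l.
  rewrite -[leLHS]E3; apply: nnI_le => //; first exact: measurable_funD.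
  move=> z; rewrite mulrCA -mulrDr [leLHS]mulrC; apply: ler_wpM2l => //.
  by have := H z; rewrite distrC => h; rewrite -lerBlDl; apply: le_trans h; exact: ler_norm.
rewrite EFinD; apply: (@le_trans _ _ (nnI mu (fun z => ip u psi * heat s z + C * (heat s z * `|z|))%R)); last first.
  by rewrite nnID // E3; exact: leeD2l.
apply: nnI_le => //; first exact: measurable_funD.
move=> z; rewrite mulrCA [ip u psi * _]mulrC -mulrDr; apply: ler_wpM2l => //.
by rewrite -lerBlDl; apply: le_trans (H z); exact: ler_norm.
Qed.

(** The test function is the indicator of the bad set g < u inside a bounded box. One of u, g in L^2
    makes the smaller integral finite, so that it can be subtracted. *)
Lemma ae_le_of_test u g : mf u -> mf g -> (forall x, 0 <= u x) -> (forall x, 0 <= g x) -> L2 u \/ L2 g ->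
  (forall psi, L2 psi -> (forall x, 0 <= psi x) -> (forall x, psi x != 0 -> g x < u x) ->
     (nnI mu (fun x => psi x * u x)%R <= nnI mu (fun x => psi x * g x)%R)%E) ->
  {ae mu, forall x, u x <= g x}.
Proof.
move=> mu_ mg u0 g0 l2 H.
pose D : set 'rV[R]_N := [set x | g x < u x].
have mD : measurable D by rewrite -[D]setTI; exact: measurable_fun_ltr.
suff K n : {ae mu, forall x, \1_(D `&` box n%:R) x = 0 :> R}.
  have := ae_foralln K; apply: filterS => x Hx; rewrite leNgt; apply/negP => xD.
  have [n hn] : exists n : nat, `|x| <= n%:R.
    by exists (Num.truncn `|x|).+1; apply/ltW; exact: truncnS_gt.
  have := Hx n; rewrite indicE mem_set //; apply/eqP; exact: oner_neq0.
pose psi : F := \1_(D `&` box n%:R).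
have mS : measurable (D `&` box n%:R : set 'rV[R]_N) by apply: measurableI => //; exact: measurable_box.
have psi01 x : psi x = 0 \/ psi x = 1 by rewrite /psi indicE; case: (_ \in _); [right|left].
have mp : mf psi by exact: measurable_indic.
have p0 x : 0 <= psi x by case: (psi01 x) => ->.
have lp : L2 psi.
  apply: (L2_mono mp _ (@L2_box R N n%:R 1)) => x; rewrite mul1r /psi !indicE.
  case: (boolP (x \in D `&` box n%:R)); last by rewrite normr0.
  by rewrite inE => -[_ xb]; rewrite mem_set.
have pD x : psi x != 0 -> g x < u x.
  by rewrite /psi indicE; case: (boolP (x \in _)) => [|_]; [rewrite inE => -[]|rewrite eqxx].
have := H psi lp p0 pD.
have d0 x : 0 <= psi x * (u x - g x).
  have [->|/pD h] := eqVneq (psi x) 0; first by rewrite mul0r.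
  by rewrite mulr_ge0 // subr_ge0 ltW.
have md : mf (fun x => psi x * (u x - g x)) by apply: measurable_funM => //; exact: measurable_funB.
have mpg : mf (fun x => psi x * g x) by exact: measurable_funM.
have pg0 x : 0 <= psi x * g x by rewrite mulr_ge0.
have -> : (fun x => psi x * u x) = fun x => psi x * g x + psi x * (u x - g x).
  by apply/funext => x; ring.
rewrite nnID // => h.
have fin : (nnI mu (fun x => psi x * g x)%R < +oo)%E.
  case: l2 => [lu|lg].
    apply: (@le_lt_trans _ _ (nnI mu (fun x => psi x * u x)%R)).
      apply: nnI_le => //; first exact: measurable_funM.
      move=> x; have [->|/pD k] := eqVneq (psi x) 0; first by rewrite !mul0r.
      by rewrite ler_wpM2l // ltW.
    have i := L2_intgM lp lu; rewrite nnI_Int ?ltry // => x; rewrite mulr_ge0 //.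
  by have i := L2_intgM lp lg; rewrite nnI_Int ?ltry.
have fn : nnI mu (fun x => psi x * g x) \is a fin_num by rewrite ge0_fin_numE // nnI_ge0.
have z : nnI mu (fun x => psi x * (u x - g x)) = 0%E.
  apply/eqP; rewrite eq_le nnI_ge0 // andbT.
  move: h; move: (nnI mu (fun x => psi x * g x)) fn (nnI mu (fun x => psi x * (u x - g x))) => a fa b.
  by rewrite -[leRHS]adde0 leeD2lE.
have := nnI_eq0 md d0 z; apply: filterS => x /eqP; rewrite mulf_eq0 => /orP[/eqP //|/eqP E].
by have [//|/pD] := eqVneq (psi x) 0; rewrite -subr_gt0 E ltxx.
Qed.

Lemma nnI_ip u psi : L2 u -> L2 psi -> (forall x, 0 <= u x) -> (forall x, 0 <= psi x) ->
  nnI mu (fun x => psi x * u x) = (ip u psi)%:E.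
Proof.
move=> lu lp u0 p0; rewrite ipE -(nnI_Int (L2_intgM lu lp)); last by move=> x; rewrite mulr_ge0.
by congr nnI; apply/funext => x; rewrite mulrC.
Qed.

(** A bound on h_s * u that is uniform in small times descends to u; the minimum with g serves
    because the bound holds only almost everywhere. *)
Lemma hconv_upper u g : H1 u -> (forall x, 0 <= u x) -> mf g -> (forall x, 0 <= g x) ->
  {ae mu, forall x, forall s, 0 < s -> s <= 1 -> hconv s u x <= g x} -> {ae mu, forall x, u x <= g x}.
Proof.
move=> hu u0 mg g0 H; have lu := H1_L2 hu; have mu_ := L2_mf lu.
apply: ae_le_of_test => //; first by left.
move=> psi lp p0 _; have mp := L2_mf lp.
rewrite (nnI_ip lu lp u0 p0); apply/lee_addgt0Pr => eps e0.
have [s /andP[s0 s1] [h _]] := heat_approx hu lp u0 p0 e0.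
apply: le_trans h _; apply: leeD2r.
have mh := mf_hconv s mu_.
have -> : nnI mu (fun x => psi x * hconv s u x) = nnI mu (fun x => psi x * Num.min (hconv s u x) (g x)).
  apply: nnI_ae; [exact: measurable_funM|by apply: measurable_funM => //; exact: measurable_minr|].
  by apply: filterS H => x /(_ s s0 s1) hx; rewrite min_l.
apply: nnI_le; [by apply: measurable_funM => //; exact: measurable_minr|exact: measurable_funM| |].
  by move=> x; rewrite mulr_ge0 // le_min hconv_ge0 // g0.
by move=> x; rewrite ler_wpM2l // ge_min lexx orbT.
Qed.

Lemma hconv_lower u g : H1 u -> (forall x, 0 <= u x) -> mf g -> (forall x, 0 <= g x) ->
  (forall x s, 0 < s -> s <= 1 -> g x <= hconv s u x) -> {ae mu, forall x, g x <= u x}.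
Proof.
move=> hu u0 mg g0 H; have lu := H1_L2 hu; have mu_ := L2_mf lu.
apply: ae_le_of_test => //; first by right.
move=> psi lp p0 _; have mp := L2_mf lp.
rewrite (nnI_ip lu lp u0 p0); apply/lee_addgt0Pr => eps e0; rewrite -EFinD.
have [s /andP[s0 s1] [_ h]] := heat_approx hu lp u0 p0 e0.
apply: le_trans h; have mh := mf_hconv s mu_.
apply: nnI_le; [exact: measurable_funM|exact: measurable_funM| |].
  by move=> x; rewrite mulr_ge0.
by move=> x; rewrite ler_wpM2l // H.
Qed.

End heat_convolution.

Lemma powR_le_expR (R : realType) (r t : R) : 0 < r -> 0 < t -> t `^ r <= r `^ r * expR t.
Proof.
move=> r0 t0; have tr : 0 < t / r by rewrite divr_gt0.
have h : t / r <= expR (t / r) by apply: le_trans (expR_ge1Dx _); rewrite lerDr.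
have := powR_mono (ltW r0) (ltW tr) h.
have -> : expR (t / r) `^ r = expR t by rewrite /powR gt_eqF ?expR_gt0 // expRK mulrC divfK ?gt_eqF.
move=> h2; rewrite -{1}[t](@divfK _ r) ?gt_eqF // powRM ?(ltW tr) ?(ltW r0) // mulrC.
by apply: ler_wpM2l => //; exact: powR_ge0.
Qed.

(** * Comparison along the heat flow *)

Section flow.
Context (R : realType) (N : nat).
Local Notation mu := (lebesgue_rV R N).
Local Notation F := ('rV[R]_N -> R).
Local Notation L2 := (L2 mu).
Local Notation ip := (ip mu).
Implicit Types (x y z : 'rV[R]_N) (s t c : R).
Variables (A u f : F).
Hypotheses (wA : weight A) (hu : H1 u) (u0 : forall x, 0 <= u x) (mf_ : mf f) (f0 : forall x, 0 <= f x).
Hypothesis eqn : forall phi, H1 phi -> (forall x, 0 <= phi x) ->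
  intg mu (fun x => f x * phi x) /\ qi A u phi = \int[mu]_x (f x * phi x).

Let flux x s : R := ip (fun y => A y * u y) (trn (- x) (heat s)) - \int[mu]_y (f y * trn (- x) (heat s) y).

Lemma flow_derive x s : 0 < s -> is_derive s 1 (fun s : R => hconv s u x) (flux x s).
Proof.
move=> s0; have hh := H1_heat (- x) s0; apply: is_derive_eq (hconv_derive x (H1_L2 hu) s0) _.
have [_ E] := eqn hh (fun y => ltW (heat_gt0 _ _)).
by rewrite (theat_pairing x wA hu s0) /flux E.
Qed.

(** With L an upper bound of A, dropping the nonnegative source leaves a derivative of h_r * u at
    most L h_r * u. Hence exp(-L r) h_r * u does not increase, and its value at time 1 bounds those
    at earlier times from below. *)
Lemma flow_lower : exists2 c : R, 0 < c & {ae mu, forall x, c * hconv 1 u x <= u x}.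
Proof.
have [mA [a a0 Aa] [L AL]] := wA; have lu := H1_L2 hu.
have L0 : 0 <= L by apply: le_trans (AL 0); apply: le_trans (Aa 0); exact: ltW.
exists (expR (- L)); first exact: expR_gt0.
apply: hconv_lower => //.
- by apply: measurable_funM => //; exact: (mf_hconv _ (L2_mf lu)).
- by move=> x; rewrite mulr_ge0 ?expR_ge0 // hconv_ge0.
move=> x s s0 s1.
pose g (r : R) := expR (- L * r) * hconv r u x.
have De (r : R) : is_derive r 1 (fun r : R => expR (- L * r)) (expR (- L * r) * (- L)).
  have D1 := is_derive_lin 0 (- L) r.
  have D2 := @is_derive1_comp R expR (fun t : R => 0 + - L * t) r _ _ (is_derive_expR _) D1.
  have E : (fun r : R => expR (- L * r)) = expR \o (fun t : R => 0 + - L * t) by apply/funext => t /=; rewrite add0r.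
  by rewrite E; apply: (is_derive_eq D2); rewrite add0r.
have : g 1 <= g s.
  apply: (nonincreasing_of_derive (df := fun r => expR (- L * r) * flux x r + hconv r u x * (expR (- L * r) * - L))) => //.
  move=> r sr r1; have r0 : 0 < r by apply: lt_le_trans sr.
  split; first exact: (is_deriveM (De r) (flow_derive x r0)).
  have -> : expR (- L * r) * flux x r + hconv r u x * (expR (- L * r) * - L) =
    expR (- L * r) * (flux x r - L * hconv r u x) by ring.
  rewrite pmulr_rle0 ?expR_gt0 // subr_le0 /flux.
  have lh := L2_trn (- x) (@L2_heat R N r r0).
  apply: (@le_trans _ _ (ip (fun y => A y * u y) (trn (- x) (heat r)))).
    rewrite gerBl; apply: Int_ge0 => y; rewrite mulr_ge0 //; exact/ltW/heat_gt0.
  have lA := L2_weight wA lu.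
  rewrite hconvE -ipZl // !ipE; apply: Int_le; [exact: L2_intgM|by apply: L2_intgM => //; exact: L2Z|].
  by move=> y; rewrite ler_wpM2r ?ler_wpM2r //; exact/ltW/heat_gt0.
rewrite /g mulr1 => h; apply: le_trans h _; rewrite ler_piMl ?hconv_ge0 //.
by rewrite -expR0 ler_expR mulNr oppr_le0 mulr_ge0 // ltW.
Qed.

Variables (k C : R) (K : F).
Hypotheses (k0 : 0 < k) (C0 : 0 < C) (mK : mf K) (K0 : forall z, 0 <= K z).
Hypothesis heat_le : forall s z, 0 < s -> s <= 1 -> z != 0 -> heat s z <= C * s `^ (k - 1) * K z.

(** Dropping the nonnegative term with A, the derivative of h_r * u is at least - C r^(k-1) K * f,
    so h_r * u + (C/k) r^k K * f does not decrease up to time 1. The exponent k > 0 is integrability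
    of r^(k-1) at time 0. *)
Lemma flow_upper : (0 < N)%N -> {ae mu, forall x, intg mu (fun y => K (x - y) * f y)} ->
  {ae mu, forall x, u x <= hconv 1 u x + C / k * convolution K f x}.
Proof.
move=> N0 iK; have [mA [a a0 Aa] [L AL]] := wA; have lu := H1_L2 hu.
have Ck : 0 < C / k by rewrite divr_gt0.
have c0 x : 0 <= convolution K f x by apply: Int_ge0 => y; rewrite mulr_ge0.
apply: hconv_upper => //.
- apply: measurable_funD; first by exact: (mf_hconv _ (L2_mf lu)).
  by apply: measurable_funM => //; exact: mf_convolution.
- by move=> x; rewrite addr_ge0 ?hconv_ge0 // mulr_ge0 // ltW.
apply: filterS iK => x ix s s0 s1; pose E := convolution K f x.
pose g (r : R) := - (hconv r u x + C / k * E * r `^ k).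
have gs : g 1 <= g s.
  apply: (nonincreasing_of_derive (df := fun r => - (flux x r + C / k * E * (k * r `^ (k - 1))))) => //.
  move=> r sr r1; have r0 : 0 < r by apply: lt_le_trans sr.
  split.
    apply: is_deriveN; apply: is_deriveD; first exact: flow_derive.
    by apply: is_deriveZ; exact: is_derive1_powR.
  rewrite oppr_le0 /flux.
  have -> : C / k * E * (k * r `^ (k - 1)) = C * r `^ (k - 1) * E by field; rewrite gt_eqF.
  have lh := L2_trn (- x) (@L2_heat R N r r0); have hh := H1_heat (- x) r0.
  have [i1 _] := eqn hh (fun y => ltW (heat_gt0 _ _)).
  rewrite -addrA addr_ge0 //.
    rewrite ipE; apply: Int_ge0 => y; rewrite !mulr_ge0 //; last exact/ltW/heat_gt0.
    by apply: le_trans (Aa y); exact: ltW.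
  rewrite addrC subr_ge0 /E -IntZ //.
  apply: Int_le_ae => //; first exact: intgZ.
  apply: filterS (ae_neq x N0) => y yx; rewrite mulrC mulrA ler_wpM2r //.
  have := heat_le r0 r1 (z := x - y); rewrite /trn -heatN opprB; apply.
  by rewrite subr_eq0 eq_sym.
move: gs; rewrite /g powR1 mulr1 lerN2 => h; apply: le_trans _ h.
by rewrite lerDl; apply: mulr_ge0; [apply: mulr_ge0; [exact: ltW|exact: c0]|exact: powR_ge0].
Qed.

End flow.

(** * A majorant of the heat kernel *)

Section parabolic_kernel.
Context (R : realType) (N : nat).
Local Notation mu := (lebesgue_rV R N).
Implicit Types (z : 'rV[R]_N) (s k : R).

(* A time-uniform majorant of the heat kernel; the faster decay outside the unit ball makes it integrable at infinity. *)
Definition majorant k : 'rV[R]_N -> R :=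
  fun z => inn 1 (fun z => `|z| `^ (- (2 * k))) z + out 1 (fun z => `|z| `^ (- (2 * (k + N%:R)))) z.

Lemma majorant_ge0 k z : 0 <= majorant k z.
Proof. by rewrite addr_ge0 ?inn_ge0 ?out_ge0 // => y; exact: powR_ge0. Qed.

Lemma mf_majorant k : mf (majorant k).
Proof. by apply: measurable_funD; [apply: mf_inn|apply: mf_out]; exact: mf_norm_pow. Qed.

(** exp(-t) is at most r^r t^-r, with t = |z|^2/(4s): powers of 1/|z| are traded for powers of s. *)
Lemma heat_power (r : R) : 0 < r -> exists2 C : R, 0 < C & forall s z, 0 < s -> z != 0 ->
  heat s z <= C * s `^ (r - N%:R / 2) * `|z| `^ (- (2 * r)).
Proof.
move=> r0; have p4 : 0 < 4 * pi :> R by rewrite mulr_gt0 // pi_gt0.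
exists ((4 * pi) `^ (- (N%:R / 2)) * (r `^ r * 4 `^ r)).
  by rewrite !mulr_gt0 ?powR_gt0.
move=> s z s0 z0; have z1 : 0 < `|z| by rewrite normr_gt0.
have z2 : `|z| ^+ 2 <= sqn z.
  by rewrite -[sqn z]sqr_sqrtr ?sqn_ge0 // lerXn2r ?nnegrE ?sqrtr_ge0 //; exact: norm_le_enorm.
have s4 : 0 < 4 * s by rewrite mulr_gt0.
pose t := `|z| ^+ 2 / (4 * s); have t0 : 0 < t by rewrite divr_gt0 // exprn_gt0.
have E : expR (- (sqn z / (4 * s))) <= r `^ r * (4 `^ r * s `^ r * `|z| `^ (- (2 * r))).
  apply: (@le_trans _ _ (expR (- t))); first by rewrite ler_expR lerN2 ler_pM2r ?invr_gt0.
  have -> : 4 `^ r * s `^ r * `|z| `^ (- (2 * r)) = (t `^ r)^-1.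
    rewrite /t powRM ?exprn_ge0 ?invr_ge0 ?(ltW s4) // powR_inv ?(ltW s4) // powRM ?(ltW s0) // invfM invrK mulrC.
    by rewrite powRN powRrM powR_mulrn // normr_ge0.
  rewrite expRN ler_pdivlMr ?powR_gt0 // mulrC ler_pdivrMr ?expR_gt0 //.
  exact: powR_le_expR.
have -> : heat s z = (4 * pi) `^ (- (N%:R / 2)) * s `^ (- (N%:R / 2)) * expR (- (sqn z / (4 * s))).
  rewrite -powRM ?(ltW s0) ?(ltW p4) // /powR gt_eqF; last exact: mulr_gt0.
  by rewrite -expRD mulNr.
apply: le_trans (ler_wpM2l _ E) _; first by rewrite mulr_ge0 ?powR_ge0.
rewrite powRD; last by rewrite (gt_eqF s0) implybT.
by apply: le_of_eq; ring.
Qed.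

(** Inside the unit box the power bound is used with k, outside with k + N; for s <= 1 the extra
    power of s in the second is harmless. *)
Lemma heat_le_majorant k : 0 < k -> exists2 C : R, 0 < C & forall s z, 0 < s -> s <= 1 -> z != 0 ->
  heat s z <= C * s `^ (k - N%:R / 2) * majorant k z.
Proof.
move=> k0; have [C C0 H] := heat_power k0.
have kN : 0 < k + N%:R by rewrite ltr_wpDr.
have [D D0 H'] := heat_power kN.
exists (C + D); first exact: addr_gt0.
move=> s z s0 s1 z0; rewrite /majorant innE outE; case: ifP => _.
  rewrite addr0; apply: le_trans (H s z s0 z0) _; rewrite -!mulrA ler_wpM2r ?mulr_ge0 ?powR_ge0 //.
  by rewrite lerDl ltW.
rewrite add0r; apply: le_trans (H' s z s0 z0) _; rewrite ler_wpM2r ?powR_ge0 //.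
apply: ler_pM; rewrite ?powR_ge0 ?(ltW D0) //; first by rewrite lerDr ltW.
rewrite /powR (gt_eqF s0) ler_expR; apply: ler_wnM2r; first exact: ln_le0.
by rewrite lerD2r lerDl.
Qed.

Lemma pw_majorant k (y : R) : 0 < k -> 0 < y -> y <= 1 -> 2 * k < N%:R * y -> (pw y (majorant k) < +oo)%E.
Proof.
move=> k0 y0 y1 ky; have yi : 0 < y^-1 by rewrite invr_gt0.
pose a := 2 * k / y; pose b := 2 * (k + N%:R) / y.
have kN : 0 < k + N%:R by rewrite ltr_wpDr.
have a0 : 0 <= a by rewrite divr_ge0 ?mulr_ge0 // ltW.
have aN : a < N%:R by rewrite ltr_pdivrMr.
have bN : N%:R < b.
  rewrite ltr_pdivlMr //; apply: (@le_lt_trans _ _ N%:R); first by rewrite ler_piMr.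
  rewrite mulrDr (_ : 2 * N%:R = N%:R + N%:R :> R); last by ring.
  by rewrite addrA ltrDr ltr_wpDr // mulr_gt0.
have E : (fun z => `|majorant k z| `^ y^-1) =
    fun z => inn 1 (fun z => `|z| `^ (- a)) z + out 1 (fun z => `|z| `^ (- b)) z.
  apply/funext => z; rewrite ger0_norm ?majorant_ge0 // /majorant !innE !outE.
  by case: ifP => _; rewrite ?addr0 ?add0r -powRrM mulNr.
Transparent pw.
rewrite /pw E nnID.
Opaque pw.
- by apply: lte_add_pinfty; [exact: near_power|exact: far_power].
- by apply: mf_inn; exact: mf_norm_pow.
- by apply: mf_out; exact: mf_norm_pow.
- by move=> z; apply: inn_ge0 => w; exact: powR_ge0.
- by move=> z; apply: out_ge0 => w; exact: powR_ge0.
Qed.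

End parabolic_kernel.

(** * Integrability and decay *)

Lemma product_shuffle (R : comPzRingType) (t a b u c d : R) :
  t * (a * b * u * c * d) = (t * u) * (a * d) * (b * c).
Proof. by ring. Qed.

Lemma powR_cancel (R : realType) (w t : R) : 0 < t -> t `^ w * t^-1 `^ w = 1.
Proof. by move=> t0; rewrite -powRM ?invr_ge0 ?(ltW t0) // divff ?powR1 // gt_eqF. Qed.

(** The free parameter t cancels; it will be chosen as the value of a convolution to make the
    resulting inequality homogeneous. *)
Lemma young_identity (R : realType) (A B t x y : R) : 0 <= A -> 0 <= B -> 0 < t -> 0 < x -> x < 1 -> 0 < y -> y < 1 ->
  0 < x + y - 1 -> A `^ y * B `^ x = t `^ (x + y - 1) * ((A * B / t) `^ (x + y - 1) * B `^ (1 - y) * A `^ (1 - x)).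
Proof.
move=> A0 B0 t0 x0 x1 y0 y1 w0.
have P (c s r q : R) : 0 <= c -> 0 < q -> s + r = q -> c `^ s * c `^ r = c `^ q \/ s = 0 \/ r = 0.
  move=> c0 q0 E; have [->|cn] := eqVneq c 0; last by left; rewrite -powRD ?E // cn implybT.
  have [s0|s0] := eqVneq s 0; first by right; left.
  by left; rewrite !(powR0 s0) (powR0 (lt0r_neq0 q0)) mul0r.
rewrite powRM ?invr_ge0 ?mulr_ge0 ?(ltW t0) // powRM // product_shuffle powR_cancel // mul1r.
have w0n : x + y - 1 <> 0 by apply/eqP; exact: lt0r_neq0.
have n1 : 1 - x <> 0 by apply/eqP; rewrite subr_eq0 eq_sym lt_eqF.
have n2 : 1 - y <> 0 by apply/eqP; rewrite subr_eq0 eq_sym lt_eqF.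
have [->|[//|//]] := P A (x + y - 1) (1 - x) y A0 y0 ltac:(ring).
by have [->|[//|//]] := P B (x + y - 1) (1 - y) x B0 x0 ltac:(ring).
Qed.

(** * Lebesgue spaces by reciprocal exponents *)

Section reciprocal_exponents.
Context (R : realType) (N : nat).
Local Notation mu := (lebesgue_rV R N).
Local Notation mu2 := (mu \x mu)%E.
Local Notation F := ('rV[R]_N -> R).
Implicit Types (f g k u : F).

Lemma amgm2 (a b t : R) : 0 <= a -> 0 <= b -> 0 < t -> t < 1 -> a `^ t * b `^ (1 - t) <= t * a + (1 - t) * b.
Proof.
move=> a0 b0 t0 t1; have h : 0 < (1 - t) / 2 by rewrite divr_gt0 // subr_gt0.
have E : t + (1 - t) / 2 + (1 - t) / 2 = 1 by field.
have := amgm3 a0 b0 b0 t0 h h E; have [->|bn] := eqVneq b 0.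
  have n0 : 1 - t != 0 by rewrite gt_eqF // subr_gt0.
  by rewrite (powR0 n0) !mulr0 !addr0 => _; apply: mulr_ge0 => //; exact: ltW.
rewrite -mulrA -powRD; last by rewrite bn implybT.
have -> : (1 - t) / 2 + (1 - t) / 2 = 1 - t by field.
move=> h2; apply: le_trans h2 _; rewrite -addrA -mulrDl.
by have -> : (1 - t) / 2 + (1 - t) / 2 = 1 - t by field.
Qed.

Lemma nnI_le_ae f g : mf f -> mf g -> (forall x, 0 <= f x) -> (forall x, 0 <= g x) ->
  {ae mu, forall x, f x <= g x} -> (nnI mu f <= nnI mu g)%E.
Proof.
move=> mf_ mg f0 g0 H; rewrite (@nnI_ae _ _ _ _ f (fun x => Num.min (f x) (g x))) //.
- apply: nnI_le => //; first exact: measurable_minr.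
  + by move=> x; rewrite le_min f0 g0.
  + by move=> x; rewrite ge_min lexx orbT.
- exact: measurable_minr.
by apply: filterS H => x h; rewrite min_l.
Qed.

Definition Lr (x : R) f : Prop := mf f /\ (pw x f < +oo)%E.

Lemma pwE (x : R) f : pw x f = nnI mu (fun y => `|f y| `^ x^-1).
Proof. by []. Qed.

Lemma mf_abs_pow (x : R) f : mf f -> mf (fun y => `|f y| `^ x).
Proof. by move=> m; apply: (measurableT_comp (measurable_powR x)); exact: measurableT_comp. Qed.

Lemma Lr_intg (x : R) f : Lr x f -> intg mu (fun y => `|f y| `^ x^-1).
Proof.
by move=> [m h]; apply: intg_ge0P; [exact: mf_abs_pow|move=> y; exact: powR_ge0|rewrite -pwE].
Qed.

Lemma intg_Lr (x : R) f : mf f -> intg mu (fun y => `|f y| `^ x^-1) -> Lr x f.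
Proof. by move=> m i; split => //; rewrite pwE nnI_Int ?ltry // => y; exact: powR_ge0. Qed.

Lemma Lr_le (x : R) f g : 0 < x -> mf f -> {ae mu, forall y, `|f y| <= `|g y|} -> Lr x g -> Lr x f.
Proof.
move=> x0 m H [mg lg]; split; [exact: m|apply: le_lt_trans lg]; rewrite !pwE.
apply: nnI_le_ae; [exact: mf_abs_pow|exact: mf_abs_pow|by move=> y; exact: powR_ge0|by move=> y; exact: powR_ge0|].
by apply: filterS H => y h; apply: powR_mono => //; rewrite invr_ge0 ltW.
Qed.

Lemma LrZ (x : R) f (c : R) : 0 < x -> Lr x f -> Lr x (fun y => c * f y).
Proof.
move=> x0 lf; have i := Lr_intg lf; case: lf => m lf; apply: intg_Lr; first exact: measurable_funM.
have := intgZ (`|c| `^ x^-1) i; congr (intg mu _); apply/funext => y.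
by rewrite normrM powRM.
Qed.

Lemma LrD (x : R) f g : 0 < x -> Lr x f -> Lr x g -> Lr x (fun y => f y + g y).
Proof.
move=> x0 lf lg; have m := measurable_funD lf.1 lg.1.
have i := intgD (Lr_intg (LrZ 2 x0 lf)) (Lr_intg (LrZ 2 x0 lg)).
apply: intg_Lr => //; apply: intg_le i; first exact: mf_abs_pow.
move=> y; rewrite ger0_norm ?powR_ge0 //.
have xi : 0 <= x^-1 by rewrite invr_ge0 ltW.
by have := powR_add_le (f y) (g y) xi; rewrite !normrM !(@ger0_norm _ 2).
Qed.

Lemma Lr_interp (x y z : R) f : 0 < x -> x <= y -> y <= z -> Lr x f -> Lr z f -> Lr y f.
Proof.
move=> x0 xy yz lf lg; have y0 : 0 < y by apply: lt_le_trans xy.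
have z0 : 0 < z by apply: lt_le_trans yz.
apply: intg_Lr lf.1 _; apply: intg_le (intgD (Lr_intg lf) (Lr_intg lg)); first exact: mf_abs_pow lf.1.
move=> a; rewrite ger0_norm ?powR_ge0 //; move: `|f a| (normr_ge0 (f a)) => b b0.
have [b1|b1] := leP b 1; last first.
  apply: (@le_trans _ _ (b `^ x^-1)); last by rewrite lerDl powR_ge0.
  by apply: ler_powR; [exact: ltW|rewrite lef_pV2].
apply: (@le_trans _ _ (b `^ z^-1)); last by rewrite lerDr powR_ge0.
have [->|bn] := eqVneq b 0; first by rewrite !powR0 ?invr_eq0 ?gt_eqF.
have bp : 0 < b by rewrite lt_neqAle eq_sym bn.
by rewrite /powR (negbTE bn) ler_expR; apply: ler_wnM2r; [exact: ln_le0|rewrite lef_pV2].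
Qed.

(** Hölder's inequality in qualitative form: reciprocal exponents add. *)
Lemma Lr_mul (x y : R) f g : 0 < x -> 0 < y -> Lr x f -> Lr y g -> Lr (x + y) (fun a => f a * g a).
Proof.
move=> x0 y0 lf lg; have xy : 0 < x + y by rewrite addr_gt0.
have m := measurable_funM lf.1 lg.1.
apply: intg_Lr => //; apply: intg_le (intgD (Lr_intg lf) (Lr_intg lg)); first exact: mf_abs_pow.
move=> a; rewrite ger0_norm ?powR_ge0 // normrM powRM //.
move: `|f a| `|g a| (normr_ge0 (f a)) (normr_ge0 (g a)) => b c b0 c0.
pose t := x / (x + y); have t0 : 0 < t by rewrite divr_gt0.
have t1 : t < 1 by rewrite ltr_pdivrMr // mul1r ltrDl.
have -> : b `^ (x + y)^-1 = (b `^ x^-1) `^ t.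
  by rewrite -powRrM /t; congr powR; field; rewrite !gt_eqF.
have -> : c `^ (x + y)^-1 = (c `^ y^-1) `^ (1 - t).
  by rewrite -powRrM /t; congr powR; field; rewrite !gt_eqF.
apply: le_trans (amgm2 (powR_ge0 _ _) (powR_ge0 _ _) t0 t1) _.
by apply: lerD; rewrite ler_piMl ?powR_ge0 ?(ltW t1) // gerBl ltW.
Qed.

Lemma Lr_pow (r x : R) u : 0 < r -> Lr x u -> Lr (r * x) (fun a => `|u a| `^ r).
Proof.
move=> r0 lu; have i := Lr_intg lu; have m := mf_abs_pow r lu.1; apply: intg_Lr => //.
move: i; congr (intg mu _); apply/funext => a; rewrite (ger0_norm (powR_ge0 _ _)) -powRrM invfM.
by rewrite mulVKf // gt_eqF.
Qed.

Lemma L2_Lr u : L2 mu u -> Lr 2^-1 u.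
Proof.
move=> [m i]; apply: intg_Lr => //; move: i; congr (intg mu _); apply/funext => a.
by rewrite invrK powR_mulrn // real_normK ?num_real.
Qed.

Lemma Lr_sub (x : R) k a : Lr x k -> Lr x (fun b => k (a - b)).
Proof.
move=> lk; have m := mf_reflect a lk.1.
split => //; rewrite pwE (nnI_sub (k := fun b => `|k b| `^ x^-1) a).
- by rewrite -pwE; exact: lk.2.
- exact: mf_abs_pow lk.1.
by move=> y; exact: powR_ge0.
Qed.

Section young.
Variables (x y : R) (k f : F).
Hypotheses (x0 : 0 < x) (x1 : x < 1) (y0 : 0 < y) (y1 : y < 1) (w0 : 1 < x + y).
Hypotheses (lk : Lr y k) (lf : Lr x f) (k0 : forall a, 0 <= k a) (f0 : forall a, 0 <= f a).
Let w := x + y - 1.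
Let kc a := `|k a| `^ y^-1.
Let fa a := `|f a| `^ x^-1.

Let wgt0 : 0 < w. Proof. by rewrite subr_gt0. Qed.

Lemma young_pointwise (a b t : R) : 0 <= a -> 0 <= b -> 0 < t ->
  a * b <= t `^ w * (w * (a `^ y^-1 * b `^ x^-1 / t) + (1 - y) * b `^ x^-1 + (1 - x) * a `^ y^-1).
Proof.
move=> a0 b0 t0; pose A := a `^ y^-1; pose B := b `^ x^-1.
have A0 : 0 <= A by exact: powR_ge0.
have B0 : 0 <= B by exact: powR_ge0.
have h1 : 0 < 1 - y by rewrite subr_gt0.
have h2 : 0 < 1 - x by rewrite subr_gt0.
have E : w + (1 - y) + (1 - x) = 1 by rewrite /w; ring.
have AB : 0 <= A * B / t by rewrite divr_ge0 ?mulr_ge0 // ltW.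
have := amgm3 AB B0 A0 wgt0 h1 h2 E; rewrite -/A -/B => h.
apply: le_trans (ler_wpM2l (powR_ge0 t w) h); apply: le_of_eq.
rewrite -(powRVK y0 a0) -(powRVK x0 b0) -/A -/B.
exact: young_identity.
Qed.

Let ik : intg mu kc. Proof. exact: Lr_intg. Qed.
Let if_ : intg mu fa. Proof. exact: Lr_intg. Qed.
Let H (z : 'rV[R]_N * 'rV[R]_N) := kc (z.1 - z.2) * fa z.2.

Let iH : intg mu2 H.
Proof.
have mk := intg_mf ik; have mf_ := intg_mf if_.
have a0 a : 0 <= kc a by exact: powR_ge0.
have b0 a : 0 <= fa a by exact: powR_ge0.
apply: intg_ge0P.
- by apply: measurable_funM; [exact: mf_dif|exact: mf_snd].
- by move=> z; rewrite mulr_ge0.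
have -> : H = fun z => fa z.2 * kc (z.1 - z.2) by apply/funext => z; rewrite /H mulrC.
by rewrite nnI2_conv2 // (nnI_Int ik) // (nnI_Int if_) // -EFinM ltry.
Qed.

Let aeH : {ae mu, forall a, intg mu (fun b => kc (a - b) * fa b)}.
Proof.
exact: ae_integrable1 iH.
Qed.

Let iconv : intg mu (convolution kc fa).
Proof.
have iF := integrable_fubini_F iH; have mc := mf_convolution (intg_mf ik) (intg_mf if_).
apply: le_integrable iF => //; first exact/measurable_EFinP.
move=> a _; rewrite /= /convolution /Rintegral /fubini_F /=.
pose e : \bar R := (\int[mu]_b (kc (a - b) * fa b)%:E)%E.
suff: (`|fine e|%:E <= `|e|)%E by [].
by case: e => [r| |] //=; rewrite normr0 leey.
Qed.

Let bound a : intg mu (fun b => kc (a - b) * fa b) -> intg mu (fun b => k (a - b) * f b).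
Proof.
move=> i; have lka := Lr_sub a lk.
have ika := Lr_intg lka.
have ig := intgD (intgD (intgZ w i) (intgZ (1 - y) if_)) (intgZ (1 - x) ika).
apply: intg_le ig; first exact: measurable_funM lka.1 lf.1.
move=> b; rewrite ger0_norm ?mulr_ge0 //.
have := young_pointwise (k0 (a - b)) (f0 b) ltr01; rewrite powR1 mul1r divr1.
by rewrite /kc /fa !ger0_norm.
Qed.

Lemma young_intg : {ae mu, forall a, intg mu (fun b => k (a - b) * f b)}.
Proof. by apply: filterS aeH => a; exact: bound. Qed.

(** Young's convolution inequality. With h the convolution of the two normalised powers, the
    pointwise inequality at t = h integrates to k * f <= h^w M, hence (k * f)^(1/w) is at most a
    multiple of h, which is integrable. *)
Lemma young : Lr w (convolution k f).
Proof.
pose M := w + (1 - y) * (\int[mu]_b fa b) + (1 - x) * (\int[mu]_b kc b).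
have a0 a : 0 <= kc a by exact: powR_ge0.
have b0 a : 0 <= fa a by exact: powR_ge0.
have M0 : 0 <= M.
  apply: addr_ge0; [apply: addr_ge0; first exact: ltW|]; apply: mulr_ge0; rewrite ?subr_ge0.
  - exact: ltW.
  - exact: Int_ge0.
  - exact: ltW.
  - exact: Int_ge0.
have mc := mf_convolution lk.1 lf.1.
apply: intg_Lr => //.
suff key : {ae mu, forall a, `|convolution k f a| `^ w^-1 <= M `^ w^-1 * convolution kc fa a}.
  have i := intgZ (M `^ w^-1) iconv; apply: intg_ge0P; [exact: mf_abs_pow|by move=> a; exact: powR_ge0|].
  have c0 a : 0 <= M `^ w^-1 * convolution kc fa a.
    by rewrite mulr_ge0 ?powR_ge0 //; apply: Int_ge0 => b; rewrite mulr_ge0.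
  apply: (@le_lt_trans _ _ (nnI mu (fun a => M `^ w^-1 * convolution kc fa a)%R)).
    exact: (nnI_le_ae (mf_abs_pow _ mc) (intg_mf i) (fun a => powR_ge0 _ _) c0 key).
  by rewrite nnI_Int // ltry.
apply: filterS aeH => a i; have ikf := bound i; have lka := Lr_sub a lk; have ika := Lr_intg lka.
pose h := convolution kc fa a; have h0 : 0 <= h by apply: Int_ge0 => b; rewrite mulr_ge0.
have c0 : 0 <= convolution k f a by apply: Int_ge0 => b; rewrite mulr_ge0.
rewrite ger0_norm // -/h; have wi : 0 < w^-1 by rewrite invr_gt0.
have [hz|hn] := eqVneq h 0.
  have -> : convolution k f a = 0.
    apply: Int_ae0; last exact: intg_mf ikf.
    have := Int_eq0 i (fun b => mulr_ge0 (a0 _) (b0 _)) hz; apply: filterS => b /eqP.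
    by rewrite mulf_eq0 /kc /fa !powR_eq0 !normr_eq0 => /orP[/andP[/eqP -> _]|/andP[/eqP -> _]]; rewrite ?mul0r ?mulr0.
  by rewrite hz mulr0 powR0 // gt_eqF.
have hp : 0 < h by rewrite lt_neqAle eq_sym hn.
have : convolution k f a <= h `^ w * M.
  pose q b := h `^ w * (w / h * (kc (a - b) * fa b) + (1 - y) * fa b + (1 - x) * `|k (a - b)| `^ y^-1).
  have j1 := intgD (intgD (intgZ (w / h) i) (intgZ (1 - y) if_)) (intgZ (1 - x) ika).
  have E : \int[mu]_b q b = h `^ w * M.
    have i1 := intgZ (w / h) i; have i2 := intgZ (1 - y) if_; have i3 := intgZ (1 - x) ika.
    rewrite (IntZ _ j1) (IntD (intgD i1 i2) i3) (IntD i1 i2) (IntZ _ i) (IntZ _ if_) (IntZ _ ika) /M.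
    have -> : \int[mu]_b `|k (a - b)| `^ y^-1 = \int[mu]_b kc b.
      have /(f_equal fine) := nnI_sub a (intg_mf ik) a0.
      by rewrite (nnI_Int ik) // (nnI_Int ika) // => b; exact: powR_ge0.
    by congr (_ * (_ + _ + _)); rewrite -/(convolution kc fa a) -/h mulfVK.
  rewrite -E; apply: Int_le => //; first exact: intgZ.
  move=> b; have := young_pointwise (k0 (a - b)) (f0 b) hp.
  move=> hh; apply: le_trans hh _; rewrite /q /kc /fa (ger0_norm (k0 _)) (ger0_norm (f0 _)).
  by rewrite [w * (_ / h)]mulrA [w * _ / h]mulrAC.
move=> cb; apply: le_trans (powR_mono (ltW wi) c0 cb) _.
by rewrite powRM ?powR_ge0 // powRKV // mulrC.
Qed.

End young.

Section holder.
Variables (y s t : R) (k f : F).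
Hypotheses (y0 : 0 < y) (y1 : y < 1) (bk : bd y s k) (bf : bd (1 - y) t f).
Hypotheses (k0 : forall a, 0 <= k a) (f0 : forall a, 0 <= f a).

Lemma holder_conv a : (nnI mu (fun b => k (a - b) * f b)%R <= (s * t)%:E)%E.
Proof.
have [mk s0 hk] := bk; have [mf_ t0 hf] := bf.
have y10 : 0 < 1 - y by rewrite subr_gt0.
have lk : Lr y k by split => //; exact: bd_lty bk.
have lf : Lr (1 - y) f by split => //; exact: bd_lty bf.
have lka := Lr_sub a lk.
have mka := mf_abs_pow y^-1 lka.1; have mfa := mf_abs_pow (1 - y)^-1 mf_.
pose A := s * t * y / s `^ y^-1; pose B := s * t * (1 - y) / t `^ (1 - y)^-1.
have sy : 0 < s `^ y^-1 by rewrite powR_gt0.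
have ty : 0 < t `^ (1 - y)^-1 by rewrite powR_gt0.
have A0 : 0 <= A by rewrite divr_ge0 ?(ltW sy) // !mulr_ge0 // ltW.
have B0 : 0 <= B by rewrite divr_ge0 ?(ltW ty) // !mulr_ge0 // ltW.
apply: (@le_trans _ _ (nnI mu (fun b => A * `|k (a - b)| `^ y^-1 + B * `|f b| `^ (1 - y)^-1)%R)).
  apply: nnI_le.
  - exact: measurable_funM lka.1 mf_.
  - by apply: measurable_funD; exact: measurable_funM.
  - by move=> b; rewrite mulr_ge0.
  move=> b; rewrite !ger0_norm //.
  have h1 : 0 <= (k (a - b) / s) `^ y^-1 by exact: powR_ge0.
  have h2 : 0 <= (f b / t) `^ (1 - y)^-1 by exact: powR_ge0.
  have := amgm2 h1 h2 y0 y1.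
  rewrite !powRVK ?divr_ge0 ?(ltW s0) ?(ltW t0) // => h.
  have st : 0 <= s * t by rewrite mulr_ge0 // ltW.
  have := ler_wpM2l st h.
  have -> : s * t * (k (a - b) / s * (f b / t)) = k (a - b) * f b by field; rewrite !gt_eqF.
  move=> {}h; apply: le_trans h _; apply: le_of_eq.
  rewrite !powRM ?invr_ge0 ?(ltW s0) ?(ltW t0) // !powR_inv ?(ltW s0) ?(ltW t0) // /A /B.
  by field; rewrite !gt_eqF.
rewrite nnID; [|exact: measurable_funM|exact: measurable_funM| |]; last 2 first.
- by move=> b; rewrite mulr_ge0 ?powR_ge0.
- by move=> b; rewrite mulr_ge0 ?powR_ge0.
rewrite !nnIZ //; try by move=> b; exact: powR_ge0.
have -> : s * t = A * s `^ y^-1 + B * t `^ (1 - y)^-1.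
  by rewrite /A /B !divfK ?gt_eqF // -mulrDr addrC subrK mulr1.
rewrite EFinD !EFinM; apply: leeD; [apply: lee_wpmul2l|apply: lee_wpmul2l; [by rewrite lee_fin|exact: hf]].
  by rewrite lee_fin.
rewrite (nnI_sub (k := fun b => `|k b| `^ y^-1) a); [exact: hk|exact: mf_abs_pow|by move=> b; exact: powR_ge0].
Qed.

Lemma holder_intg a : intg mu (fun b => k (a - b) * f b).
Proof.
have lk : Lr y k by split; [exact: bd_mf bk|exact: bd_lty bk].
apply: intg_ge0P; first exact: measurable_funM (Lr_sub a lk).1 (bd_mf bf).
  by move=> b; rewrite mulr_ge0.
by apply: le_lt_trans (holder_conv a) _; rewrite ltry.
Qed.

End holder.

(** If |x| > 2M, then x - b or b lies outside the box of radius M for every b, and one of the two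
    factors is in its small tail. *)
Lemma convolution_vanishes (y : R) k f : 0 < y -> y < 1 -> Lr y k -> Lr (1 - y) f ->
  (forall a, 0 <= k a) -> (forall a, 0 <= f a) -> vanishes_at_infinity (convolution k f).
Proof.
move=> y0 y1 lk lf k0 f0 e e0; have y10 : 0 < 1 - y by rewrite subr_gt0.
have [s bk] := bd_ex y0 lk.1 lk.2; have [t bf] := bd_ex y10 lf.1 lf.2.
have s0 := bd_gt0 bk; have t0 := bd_gt0 bf.
have st : 0 <= s + t by rewrite addr_ge0 // ltW.
have e2 : 0 < e / 2 by rewrite divr_gt0.
have [d d0 hd] := mul_small st e2.
have [M1 H1] := bd_tail y0 bk d0; have [M2 H2] := bd_tail y10 bf d0.
pose M := Num.max M1 M2.
have {}H1 := H1 M; have {}H2 := H2 M; rewrite le_max lexx in H1; rewrite le_max lexx orbT in H2.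
have {}H1 := H1 isT; have {}H2 := H2 isT.
(* The factor N converts the Euclidean norm into the sup norm used by the boxes. *)
exists (N%:R * (2 * Num.max M 0)) => x xM.
have xM' : 2 * Num.max M 0 < `|x|.
  have N0 : 0 <= N%:R :> R by [].
  rewrite ltNge; apply/negP => h; move: xM; rewrite ltNge => /negP; apply.
  by apply: le_trans (enorm_le_norm x) _; rewrite ler_wpM2l.
have c0 : 0 <= convolution k f x by apply: Int_ge0 => b; rewrite mulr_ge0.
rewrite ger0_norm //; apply: (@le_lt_trans _ _ (e / 2)); last by rewrite ltr_pdivrMr // ltr_pMr // ltr1n.
apply: le_trans hd; rewrite -lee_fin -(nnI_Int (holder_intg y0 y1 bk bf k0 f0 x)); last by move=> b; rewrite mulr_ge0.
have ko a : 0 <= out M k a by exact: out_ge0.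
have fo a : 0 <= out M f a by exact: out_ge0.
have h1 := holder_conv y0 y1 H1 bf ko f0 x; have h2 := holder_conv y0 y1 bk H2 k0 fo x.
have m1 : mf (fun b : 'rV[R]_N => out M k (x - b) * f b) by exact: intg_mf (holder_intg y0 y1 H1 bf ko f0 x).
have m2 : mf (fun b : 'rV[R]_N => k (x - b) * out M f b) by exact: intg_mf (holder_intg y0 y1 bk H2 k0 fo x).
apply: (@le_trans _ _ (nnI mu (fun b => out M k (x - b) * f b + k (x - b) * out M f b)%R)).
  apply: nnI_le; [exact: intg_mf (holder_intg y0 y1 bk bf k0 f0 x)|exact: measurable_funD|by move=> b; rewrite mulr_ge0|].
  move=> b; rewrite !outE; case: ifP => hb; last by rewrite lerDl mulr_ge0 //; case: ifP.
  case: ifP => hb2; last by rewrite lerDr mul0r.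
  exfalso; move: xM'; apply/negP; rewrite -leNgt.
  have -> : x = (x - b) + b by rewrite subrK.
  apply: le_trans (ler_normD _ _) _; rewrite mulr_natl mulr2n.
  by apply: lerD; rewrite le_max ?hb ?hb2.
rewrite nnID //; try by move=> b; rewrite mulr_ge0.
apply: le_trans (leeD h1 h2) _; rewrite -EFinD lee_fin.
by apply: le_of_eq; ring.
Qed.

End reciprocal_exponents.

Section gain_of_regularity.
Context (R : realType) (N : nat).
Local Notation mu := (lebesgue_rV R N).
Local Notation F := ('rV[R]_N -> R).

Lemma vanishesD (f g : F) : vanishes_at_infinity f -> vanishes_at_infinity g ->
  vanishes_at_infinity (fun x => f x + g x).
Proof.
move=> vf vg e e0; have e2 : 0 < e / 2 by rewrite divr_gt0.
have [M HM] := vf _ e2; have [L HL] := vg _ e2; exists (Num.max M L) => x; rewrite gt_max => /andP[xM xL].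
apply: le_lt_trans (ler_normD _ _) _; rewrite (_ : e = e / 2 + e / 2); last by field.
by apply: ltrD; [exact: HM|exact: HL].
Qed.

Lemma vanishesZ (c : R) (f : F) : vanishes_at_infinity f -> vanishes_at_infinity (fun x => c * f x).
Proof.
move=> vf e e0; have c0 : 0 < `|c| + 1 by rewrite ltr_wpDl.
have ec : 0 < e / (`|c| + 1) by rewrite divr_gt0.
have [M HM] := vf _ ec; exists M => x xM; rewrite normrM.
apply: (@le_lt_trans _ _ ((`|c| + 1) * `|f x|)); first by rewrite ler_wpM2r // lerDl.
by rewrite mulrC -ltr_pdivlMr // HM.
Qed.

Lemma vanishes_le (f g : F) : (forall x, `|f x| <= `|g x|) -> vanishes_at_infinity g -> vanishes_at_infinity f.
Proof. by move=> fg vg e e0; have [M HM] := vg e e0; exists M => x xM; exact: le_lt_trans (fg x) (HM x xM). Qed.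

Lemma Lr_heat (y s : R) : 0 < y -> 0 < s -> Lr y (@heat R N s).
Proof.
move=> y0 s0; rewrite (funext (heatE s)); apply: LrZ => //.
have c0 : 0 < (4 * s)^-1 by rewrite invr_gt0 mulr_gt0.
apply: intg_Lr; first exact: mf_gauss.
have cy : 0 < (4 * s)^-1 / y by rewrite divr_gt0.
have := intg_gauss N cy; congr (intg mu _); apply/funext => a.
rewrite (gtr0_norm (gauss_gt0 _ _)) /gauss [RHS]/powR gt_eqF ?expR_gt0 // expRK; congr expR.
by rewrite mulrC; ring.
Qed.

Lemma hconv_Lr (u : F) (w : R) : L2 mu u -> (forall x, 0 <= u x) -> 0 < w -> w < 2^-1 -> Lr w (hconv 1 u).
Proof.
move=> lu u0 w0 w1; have h0 a := ltW (@heat_gt0 R N 1 a).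
have -> : w = 2^-1 + (w + 2^-1) - 1 by field.
apply: (young (x := 2^-1) (y := w + 2^-1)) => //.
- by rewrite invf_lt1 // ltr1n.
- by rewrite addr_gt0.
- by lra.
- by lra.
- by apply: Lr_heat; rewrite // addr_gt0.
exact: L2_Lr.
Qed.

Lemma hconv_vanishes (u : F) : L2 mu u -> (forall x, 0 <= u x) -> vanishes_at_infinity (hconv 1 u).
Proof.
move=> lu u0; have h0 a := ltW (@heat_gt0 R N 1 a).
have E : 1 - 2^-1 = 2^-1 :> R by field.
apply: (convolution_vanishes (y := 2^-1)) => //; rewrite ?E ?invf_lt1 ?ltr1n //.
- exact: Lr_heat.
- exact: L2_Lr.
Qed.

Lemma majorant_exponent (y : R) : (0 < N)%N -> 0 < y -> 1 - 2 / N%:R < y ->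
  exists k : R, [/\ 0 < k, 0 < k - N%:R / 2 + 1 & 2 * k < N%:R * y].
Proof.
move=> N0 y0 hy; have n0 : 0 < N%:R :> R by rewrite ltr0n.
have ny : 0 < N%:R * y by rewrite mulr_gt0.
have n2 : N%:R - 2 < N%:R * y.
  have := hy; rewrite -(ltr_pM2l n0) mulrBr mulr1 mulrCA mulfV ?gt_eqF // mulr1.
  by [].
move: ny n2; move: (N%:R * y) => b; move: (N%:R : R) => n b0 nb.
pose m := Num.max 0 (n - 2); have mb : m < b by rewrite gt_max b0.
have m0 : 0 <= m by rewrite le_max lexx.
have mn : n - 2 <= m by rewrite le_max lexx orbT.
(* Then 2k is the midpoint of m and b: above n - 2 and below N y. *)
by exists ((m + b) / 4); split; lra.
Qed.

Variables (A u f : F).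
Hypotheses (N0 : (0 < N)%N) (wA : weight A) (hu : H1 u) (u0 : forall x, 0 <= u x) (f0 : forall x, 0 <= f x).
Hypothesis eqn : forall phi, H1 phi -> (forall x, 0 <= phi x) ->
  intg mu (fun x => f x * phi x) /\ qi A u phi = \int[mu]_x (f x * phi x).

Lemma flow_majorant (y : R) : mf f -> 0 < y -> y < 1 -> 1 - 2 / N%:R < y -> exists k c : R, [/\ 0 < c, Lr y (@majorant R N k) &
  {ae mu, forall x, intg mu (fun b => majorant k (x - b) * f b)} ->
  {ae mu, forall x, u x <= hconv 1 u x + c * convolution (majorant k) f x}].
Proof.
move=> mf_ y0 y1 hy; have [k [k0 kp kN]] := majorant_exponent N0 y0 hy.
have [C C0 H] := @heat_le_majorant R N k k0.
have {}H s (z : 'rV[R]_N) : 0 < s -> s <= 1 -> z != 0 -> heat s z <= C * s `^ (k - N%:R / 2 + 1 - 1) * majorant k z.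
  by rewrite addrK; exact: H.
exists k, (C / (k - N%:R / 2 + 1)); split; first by rewrite divr_gt0.
  by split; [exact: mf_majorant|exact: pw_majorant k0 y0 (ltW y1) kN].
move=> iK; exact: (flow_upper wA hu u0 mf_ f0 eqn kp C0 (@mf_majorant R N k) (@majorant_ge0 R N k) H N0 iK).
Qed.

(** The majorant lies in L^(1/y) for every y < 1 above 1 - 2/N, so convolution lowers the reciprocal
    exponent by almost 2/N. It is brought to some a below x, and interpolation with L^2 reaches
    x. *)
Lemma gain (z x : R) : Lr z f -> 0 < z -> z < 1 -> z - 2 / N%:R < x -> 0 < x -> x < 2^-1 -> Lr x u.
Proof.
move=> lf z0 z1 zx x0 x2; have lu := H1_L2 hu.
have n0 : 0 < 2 / N%:R :> R by rewrite divr_gt0 // ltr0n.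
pose m := Num.max 0 (z - 2 / N%:R); pose M := Num.min x z.
have mM : m < M by rewrite gt_max !lt_min x0 z0 zx ltrBlDr ltrDl n0.
have m0 : 0 <= m by rewrite le_max lexx.
have mz : z - 2 / N%:R <= m by rewrite le_max lexx orbT.
have Mx : M <= x by rewrite ge_min lexx.
have Mz : M <= z by rewrite ge_min lexx orbT.
pose a := (m + M) / 2; have am : m < a by rewrite /a; lra.
have aM : a < M by rewrite /a; lra.
pose y := 1 + a - z.
have y0 : 0 < y by rewrite /y; lra.
have y1 : y < 1 by rewrite /y; lra.
have hy : 1 - 2 / N%:R < y by rewrite /y; lra.
have zy : 1 < z + y by rewrite /y; lra.
have [k [c [c0 lK H]]] := flow_majorant lf.1 y0 y1 hy.
have K0 := @majorant_ge0 R N k.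
have {}H := H (young_intg z0 z1 y0 y1 zy lK lf K0 f0).
have := young z0 z1 y0 y1 zy lK lf K0 f0.
have -> : z + y - 1 = a by rewrite /y; ring.
have a0 : 0 < a by lra.
move=> lc; have lh : Lr a (hconv 1 u) by apply: hconv_Lr => //; lra.
have la : Lr a u.
  apply: (Lr_le a0 (L2_mf lu) _ (LrD a0 lh (LrZ c a0 lc))).
  by apply: filterS H => b h; rewrite ger0_norm //; apply: le_trans h (ler_norm _).
exact: (Lr_interp a0 (ltW (lt_le_trans aM Mx)) (ltW x2) la (L2_Lr lu)).
Qed.

(** For z below 2/N the conjugate exponent 1 - z is available for the majorant, and the convolution
    is bounded and vanishes at infinity. *)
Lemma decay (z : R) : Lr z f -> 0 < z -> z < 1 -> z < 2 / N%:R -> exists g : F,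
  [/\ mf g, vanishes_at_infinity g, forall x, hconv 1 u x <= g x & {ae mu, forall x, u x <= g x}].
Proof.
move=> lf z0 z1 zN; have lu := H1_L2 hu; pose y := 1 - z.
have y0 : 0 < y by rewrite subr_gt0.
have y1 : y < 1 by rewrite gtrBl.
have hy : 1 - 2 / N%:R < y by rewrite ltrD2l ltrN2.
have [k [c [c0 lK H]]] := flow_majorant lf.1 y0 y1 hy.
have K0 := @majorant_ge0 R N k.
have lf' : Lr (1 - y) f by rewrite /y subKr.
have [s bk] := bd_ex y0 lK.1 lK.2; have yy : 0 < 1 - y by rewrite /y subKr.
have [t bf] := bd_ex yy lf'.1 lf'.2.
have {}H : {ae mu, forall x, u x <= hconv 1 u x + c * convolution (majorant k) f x}.
  by apply: H; apply: aeW => x; exact: (holder_intg y0 y1 bk bf K0 f0).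
exists (fun x => hconv 1 u x + c * convolution (majorant k) f x); split => //.
- apply: measurable_funD; first exact: (mf_hconv _ (L2_mf lu)).
  by apply: measurable_funM => //; exact: mf_convolution lK.1 lf.1.
- apply: vanishesD; first exact: hconv_vanishes.
  by apply: vanishesZ; exact: convolution_vanishes y0 y1 lK lf' K0 f0.
move=> x; rewrite lerDl mulr_ge0 ?(ltW c0) //; apply: Int_ge0 => b; rewrite mulr_ge0 //.
Qed.

End gain_of_regularity.

(** * Integrability of the right-hand sides *)

Section nonlinearity.
Context (R : realType) (N : nat) (alpha : R).
Hypothesis alpha_itv : 0 < alpha < N%:R.
Local Notation mu := (lebesgue_rV R N).
Local Notation F := ('rV[R]_N -> R).
Local Notation k := (@riesz R N alpha).
Implicit Types (u v : F).

Definition source (p q : R) u v : F := fun x => convolution k (pwf q v) x * `|u x| `^ (p - 1).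

Lemma source_ge0 p q u v x : 0 <= source p q u v x.
Proof.
rewrite mulr_ge0 ?powR_ge0 //; apply: Int_ge0 => y.
by rewrite mulr_ge0 ?riesz_ge0 ?pwf_ge0.
Qed.

(** The Riesz kernel just misses the reciprocal exponent 1 - alpha/N. Its inner half is used at this
    value plus d and its outer half at this value minus d, with |v|^q at two matching exponents that
    both give w. *)
Lemma Lr_potential (q x w d : R) v : 0 < q -> 0 < x -> Lr x v -> Lr 2^-1 v -> 0 < w -> 0 < d ->
  d < alpha / N%:R -> alpha / N%:R + d < 1 -> q * x <= w + alpha / N%:R - d ->
  w + alpha / N%:R + d <= q / 2 -> w + alpha / N%:R + d < 1 -> Lr w (convolution k (pwf q v)).
Proof.
move=> q0 x0 lx l2 w0 d0 da ad h1 h2 h3; have /andP[a0 aN] := alpha_itv.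
have n0 : 0 < N%:R :> R by apply: lt_trans aN.
have nd : 0 < N%:R * d by rewrite mulr_gt0.
have naE : N%:R * (alpha / N%:R) = alpha by rewrite mulrCA mulfV ?mulr1 // gt_eqF.
pose z1 := w + alpha / N%:R - d; pose z2 := w + alpha / N%:R + d.
pose y1 := 1 - alpha / N%:R + d; pose y2 := 1 - alpha / N%:R - d.
have lv z : q * x <= z -> z <= q / 2 -> Lr z (pwf q v).
  move=> za zb; have zq : z = q * (z / q) by rewrite mulrCA mulfV ?mulr1 // gt_eqF.
  have xz : x <= z / q by rewrite ler_pdivlMr // mulrC.
  have z2' : z / q <= 2^-1 by rewrite ler_pdivrMr // mulrC.
  by rewrite zq; exact: (Lr_pow q0 (Lr_interp x0 xz z2' lx l2)).
have k1 : Lr y1 (inn 1 k).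
  split; first by apply: mf_inn; exact: mf_riesz.
  by apply: pw_riesz_inn => //; rewrite /y1; [lra|rewrite mulrDr mulrBr mulr1 naE; lra].
have k2 : Lr y2 (out 1 k).
  split; first by apply: mf_out; exact: mf_riesz.
  by apply: pw_riesz_out => //; rewrite /y2; [lra|rewrite !mulrBr mulr1 naE; lra].
have i0 a : 0 <= inn 1 k a by apply: inn_ge0 => b; exact: riesz_ge0.
have o0 a : 0 <= out 1 k a by apply: out_ge0 => b; exact: riesz_ge0.
have f0 a : 0 <= pwf q v a by exact: pwf_ge0.
have az : 0 < alpha / N%:R by rewrite divr_gt0.
have qx : 0 < q * x by rewrite mulr_gt0.
have l1 : Lr z1 (pwf q v) by apply: lv; rewrite /z1; lra.
have l2' : Lr z2 (pwf q v) by apply: lv; rewrite /z2; lra.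
have e1 : z1 + y1 - 1 = w by rewrite /z1 /y1; ring.
have e2 : z2 + y2 - 1 = w by rewrite /z2 /y2; ring.
have A1 : 0 < z1 by rewrite /z1; lra.
have A2 : z1 < 1 by rewrite /z1; lra.
have A3 : 0 < y1 by rewrite /y1; lra.
have A4 : y1 < 1 by rewrite /y1; lra.
have A5 : 1 < z1 + y1 by rewrite -subr_gt0 e1.
have B1 : 0 < z2 by rewrite /z2; lra.
have B2 : z2 < 1 by rewrite /z2; lra.
have B3 : 0 < y2 by rewrite /y2; lra.
have B4 : y2 < 1 by rewrite /y2; lra.
have B5 : 1 < z2 + y2 by rewrite -subr_gt0 e2.
have I1 := young_intg A1 A2 A3 A4 A5 k1 l1 i0 f0.
have I2 := young_intg B1 B2 B3 B4 B5 k2 l2' o0 f0.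
have Y1 := young A1 A2 A3 A4 A5 k1 l1 i0 f0; rewrite e1 in Y1.
have Y2 := young B1 B2 B3 B4 B5 k2 l2' o0 f0; rewrite e2 in Y2.
apply: Lr_le (LrD w0 Y1 Y2) => //; first by apply: mf_convolution; [exact: mf_riesz|exact: l1.1].
apply: filterS2 I1 I2 => a j1 j2; rewrite /convolution -(IntD j1 j2); apply: le_of_eq.
congr (`|_|); apply: eq_Rintegral => b _; rewrite -mulrDl; congr (_ * _).
by rewrite innE outE; case: ifP; rewrite ?addr0 ?add0r.
Qed.

Lemma Lr_source (p q x e : R) u v : 1 < p -> (N%:R + alpha) / N%:R < q -> 0 < x -> x < 2^-1 -> q * x < 1 ->
  Lr x u -> Lr x v -> Lr 2^-1 v -> 0 < e ->
  exists2 z, 0 < z <= Num.max (q * x - alpha / N%:R) 0 + (p - 1) * x + e & Lr z (source p q u v).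
Proof.
move=> p1 qN x0 x2 qx lu lv l2 e0; have /andP[a0 aN] := alpha_itv.
have n0 : 0 < N%:R :> R by apply: lt_trans aN.
pose c := alpha / N%:R; have c0 : 0 < c by rewrite divr_gt0.
have c1 : c < 1 by rewrite ltr_pdivrMr // mul1r.
have qc : 1 + c < q by rewrite mulrDl divff ?gt_eqF // in qN.
have q0 : 0 < q by lra.
pose m := Num.max (q * x) c; pose M := Num.min (q / 2) 1.
have qx2 : q * x < q / 2 by rewrite ltr_pM2l.
have mM : m < M by rewrite gt_max !lt_min qx2 qx c1 andbT /=; lra.
pose d := Num.min (Num.min e ((M - m) / 4)) (Num.min (c / 2) ((1 - c) / 2)).
have d0 : 0 < d by rewrite !lt_min e0 /=; apply/and3P; split; lra.
have d1 : d <= e by rewrite !ge_min lexx.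
have d2 : d <= (M - m) / 4 by rewrite !ge_min lexx orbT.
have d3 : d <= c / 2 by rewrite !ge_min lexx !orbT.
have d4 : d <= (1 - c) / 2 by rewrite !ge_min lexx !orbT.
have m1 : q * x <= m by rewrite le_max lexx.
have M1 : M <= q / 2 by rewrite ge_min lexx.
have M2 : M <= 1 by rewrite ge_min lexx orbT.
(* The ideal exponent q x - alpha/N, kept positive and raised by d, which is spent on the two halves
   of the kernel. *)
pose w := Num.max (q * x - c) 0 + d.
have wm : w + c = m + d.
  rewrite /w /m addrAC; congr (_ + d); rewrite addr_maxl subrK add0r; done.
have x00 : 0 <= Num.max (q * x - c) 0 by rewrite le_max lexx orbT.
have w0 : 0 < w by rewrite /w ltr_wpDl.
have px : 0 < (p - 1) * x by rewrite mulr_gt0 // subr_gt0.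
exists (w + (p - 1) * x).
  by rewrite addr_gt0 //= /w addrAC lerD2l.
have lV : Lr w (convolution k (pwf q v)).
  have g1 : d < c by lra.
  have g2 : c + d < 1 by lra.
  have g3 : q * x <= w + c - d by rewrite wm; lra.
  have g4 : w + c + d <= q / 2 by rewrite wm; lra.
  have g5 : w + c + d < 1 by rewrite wm; lra.
  exact: (Lr_potential q0 x0 lv l2 w0 d0 g1 g2 g3 g4 g5).
have p10 : 0 < p - 1 by rewrite subr_gt0.
exact: (Lr_mul w0 px lV (Lr_pow p10 lu)).
Qed.

End nonlinearity.

Opaque Lr.

Lemma lin_between (R : realFieldType) (a b x y z : R) : x <= y -> y <= z -> a * x < b -> a * z < b -> a * y < b.
Proof.
move=> xy yz hx hz; have [a0|a0] := leP 0 a.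
  by apply: le_lt_trans hz; exact: ler_wpM2l.
by apply: le_lt_trans hx; rewrite ler_nM2l.
Qed.

(** A pair (a, b) stands for the condition a x < b: finitely many strict linear conditions persist
    slightly to the right. *)
Lemma open_right (R : realFieldType) (l : seq (R * R)) (x : R) : all (fun c => c.1 * x < c.2) l ->
  exists2 y, x < y & all (fun c => c.1 * y < c.2) l.
Proof.
elim: l => [_|[a b] l IH /= /andP[ab hl]]; first by exists (x + 1); rewrite ?ltrDl.
have [y1 xy1 hl1] := IH hl.
have a1 : 0 < `|a| + 1 by rewrite ltr_wpDl.
have d0 : 0 < (b - a * x) / (`|a| + 1) by rewrite divr_gt0 // subr_gt0.
have [t t0 ht] : exists2 t, 0 < t < (b - a * x) / (`|a| + 1) & x + t <= y1.
  pose m := Num.min ((b - a * x) / (`|a| + 1)) (y1 - x).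
  have m0 : 0 < m by rewrite lt_min d0 subr_gt0.
  have mh : m / 2 < m by rewrite ltr_pdivrMr // ltr_pMr // ltr1n.
  exists (m / 2); first by rewrite divr_gt0 //=; apply: lt_le_trans mh _; rewrite ge_min lexx.
  by rewrite -lerBrDl; apply: le_trans (ltW mh) _; rewrite ge_min lexx orbT.
have /andP[t0' t1] := t0; exists (x + t); first by rewrite ltrDl.
rewrite mulrDr -ltrBrDl; apply/andP; split.
  apply: (@le_lt_trans _ _ ((`|a| + 1) * t)).
    by rewrite ler_wpM2r ?(ltW t0') //; apply: le_trans (ler_norm a) _; rewrite lerDl.
  by rewrite mulrC -ltr_pdivlMr.
apply/allP => c cl; apply: (@lin_between _ _ _ x (x + t) y1) => //; first by rewrite lerDl ltW.
  by move/allP: hl; apply.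
by move/allP: hl1; apply.
Qed.

(** At x = 1/2 - 1/N (or 0 when N <= 2) and th = 1 all conditions except x0 > 0 and th < 1 hold or
    become equalities of the right kind; the first perturbation moves x up, the second moves th
    below 1. Strict subcriticality is what leaves the room. *)
Lemma contraction_exponents (R : realType) (N : nat) (alpha p q : R) : (0 < N)%N -> 0 < alpha < N%:R ->
  (N%:R + alpha) / N%:R < p -> (N%:R + alpha) / N%:R < q ->
  ((3 <= N)%N -> p * (N%:R - 2) < N%:R + alpha) -> ((3 <= N)%N -> q * (N%:R - 2) < N%:R + alpha) ->
  let a := alpha / N%:R in let b := 2 / N%:R in
  exists x0 th : R, [/\ 0 < x0 < 2^-1 /\ 0 < th < 1, subcrit N x0^-1,
    p * x0 < 1 /\ q * x0 < 1, (p + q - 1) * x0 < 1 + a &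
    [/\ (p + q - 1 - th) * x0 < a + b, (p - 1 - th) * x0 < b & (q - 1 - th) * x0 < b]].
Proof.
move=> N0 /andP[a0 aN] hp hq sp sq a b; have n0 : 0 < N%:R :> R by rewrite ltr0n.
have a_0 : 0 < a by rewrite divr_gt0.
have a_1 : a < 1 by rewrite ltr_pdivrMr // mul1r.
have b_0 : 0 < b by rewrite divr_gt0.
have E : (N%:R + alpha) / N%:R = 1 + a by rewrite mulrDl divff // gt_eqF.
rewrite E in hp hq.
have [x [[x00 x02 [px qx]] [xs3 xs2]]] : exists x : R, [/\ 0 <= x, x < 2^-1 & p * x < (1 + a) / 2 /\ q * x < (1 + a) / 2] /\
    (((3 <= N)%N -> x = 2^-1 - b / 2) /\ ((N < 3)%N -> x = 0)).
  case: (leqP 3 N) => N3; last first.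
    by exists 0; split; [rewrite !mulr0 ?invr_gt0; split => //; split; lra|split].
  exists (2^-1 - b / 2); split; last by split.
  have n3 : 3 <= N%:R :> R by rewrite ler_nat.
  have b1 : b <= 1 by rewrite ler_pdivrMr // mul1r; apply: le_trans n3; rewrite ler_nat.
  have EE (r : R) : r * (2^-1 - b / 2) = r * (N%:R - 2) / (2 * N%:R) by rewrite /b; field; rewrite gt_eqF.
  have n2 : 0 < 2 * N%:R :> R by rewrite mulr_gt0.
  have F : (1 + a) / 2 = (N%:R + alpha) / (2 * N%:R) by rewrite /a; field; rewrite gt_eqF.
  split; [lra|lra|rewrite !EE F !ltr_pM2r ?invr_gt0 //].
  by split; [exact: sp|exact: sq].
have x2 : x = 2^-1 - b / 2 \/ [/\ x = 0, p * x = 0 & q * x = 0].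
  by case: (leqP 3 N) => N3; [left; exact: xs3|right; rewrite (xs2 N3) !mulr0].
pose l := [:: (p, 1); (q, 1); (p + q - 1, 1 + a); (p + q - 2, a + b); (p - 2, b); (q - 2, b); (1, 2^-1)].
have hl : all (fun c => c.1 * x < c.2) l.
  rewrite /= andbT !mulrBl !mulrDl !mul1r.
  move: (p * x) px (q * x) qx x2 => P px Q qx x2; clear - a_0 a_1 b_0 x00 x02 px qx x2; clearbody a b.
  by case: x2 => [x2|[x2 P2 Q2]]; apply/and5P; split; try (apply/and3P; split); lra.
have [y xy] := open_right hl; rewrite /= andbT => /and5P[y1 y2 y3 y4 /and3P[y5 y6 y7]].
have y0 : 0 < y by apply: le_lt_trans xy.
pose l' := [:: (y, a + b - (p + q - 1) * y); (y, b - (p - 1) * y); (y, b - (q - 1) * y); (1, 0)].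
have hl' : all (fun c => c.1 * (-1) < c.2) l'.
  rewrite /= andbT; move: y4 y5 y6; rewrite !mulrBl !mulrDl.
  move: (p * y) (q * y) => P Q y4 y5 y6; clear - y4 y5 y6; clearbody a b.
  by apply/and4P; split; lra.
have [t t1] := open_right hl'; rewrite /= andbT mul1r => /and4P[t2 t3 t4 t5].
exists y, (- t); split.
- by split; [rewrite y0 -[y]mul1r|apply/andP; clear - t1 t5; split; lra].
- split.
    have -> : 2 = (2^-1)^-1 :> R by rewrite invrK.
    by rewrite lef_pV2 ?posrE ?invr_gt0 // -[y]mul1r ltW.
  move=> N3; rewrite mulrC ltr_pdivrMr //; have := xs3 N3 => xE.
  have -> : N%:R - 2 = 2 * N%:R * x by rewrite xE /b; field; rewrite gt_eqF.
  by rewrite ltr_pM2l // mulr_gt0.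
- by split.
- exact: y3.
by split; move: t2 t3 t4; rewrite !mulrBl !mulrDl ?mulNr ?(mulrC y t); move: (p * y) (q * y) (t * y) => P Q T t2 t3 t4;
  clear - t2 t3 t4; clearbody a b; lra.
Qed.

(** * The bootstrap on Lebesgue exponents *)

Section bootstrap.
Context (R : realType) (N : nat) (alpha : R).
Hypotheses (N0 : (0 < N)%N) (alpha_itv : 0 < alpha < N%:R).
Local Notation mu := (lebesgue_rV R N).
Local Notation F := ('rV[R]_N -> R).
Local Notation a := (alpha / N%:R).
Local Notation b := (2 / N%:R : R).
Local Notation src := (source alpha).

Section one_equation.
Variables (A u v : F) (p q c : R).
Hypotheses (wA : weight A) (hu : H1 u) (u0 : forall x, 0 <= u x) (c0 : 0 < c) (hv : H1 v).
Hypotheses (p1 : 1 < p) (hq : (N%:R + alpha) / N%:R < q).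
Hypothesis eqn : forall phi, H1 phi -> (forall x, 0 <= phi x) ->
  intg mu (fun x => c * src p q u v x * phi x) /\ qi A u phi = \int[mu]_x (c * src p q u v x * phi x).

Let f0 x : 0 <= c * src p q u v x.
Proof. by rewrite mulr_ge0 ?(ltW c0) // source_ge0. Qed.

Lemma Lr_source_lt (x M : R) : 0 < x -> x < 2^-1 -> q * x < 1 -> Lr x u -> Lr x v ->
  (q + p - 1) * x < a + M -> (p - 1) * x < M ->
  exists2 z, 0 < z < M & Lr z (fun x => c * src p q u v x).
Proof.
move=> x0 x2 qx lu lv h1 h2; pose m := Num.max (q * x - a) 0 + (p - 1) * x.
have mM : m < M.
  rewrite /m; have [h|h] := leP (q * x - a) 0; first by rewrite add0r.
  by move: h1; rewrite !mulrBl mulrDl; move: (q * x) (p * x) => Q P; lra.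
have e0 : 0 < (M - m) / 2 by rewrite divr_gt0 // subr_gt0.
have [z /andP[z0 z1] lz] := Lr_source alpha_itv p1 hq x0 x2 qx lu lv (L2_Lr (H1_L2 hv)) e0.
exists z; last exact: LrZ c z0 lz.
by rewrite z0 /=; apply: le_lt_trans z1 _; rewrite -/m; lra.
Qed.

(** The reciprocal exponent shrinks by the factor th. The conditions on x are linear, so they stay
    true at every smaller x and the step can be repeated. *)
Lemma Lr_step (x th : R) : 0 < x -> x < 2^-1 -> 0 < th -> th < 1 -> q * x < 1 -> p * x < 1 -> Lr x u -> Lr x v ->
  (p + q - 1) * x < 1 + a -> (p + q - 1 - th) * x < a + b -> (p - 1 - th) * x < b -> Lr (th * x) u.
Proof.
move=> x0 x2 th0 th1 qx px lu lv h1 h2 h3.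
have tx : 0 < th * x by rewrite mulr_gt0.
have tx2 : th * x < 2^-1 by apply: le_lt_trans x2; rewrite ler_piMl // ltW.
pose M := Num.min 1 (b + th * x).
have M1 : M <= 1 by rewrite ge_min lexx.
have M2 : M <= b + th * x by rewrite ge_min lexx orbT.
have e1 : (q + p - 1) * x < a + M.
  rewrite -ltrBlDl lt_min; move: h1 h2; rewrite !mulrBl !mulrDl; move: (p * x) (q * x) (th * x) => P Q T h1 h2.
  by apply/andP; split; lra.
have e2 : (p - 1) * x < M.
  rewrite lt_min; move: h3; rewrite !mulrBl; move: (p * x) px (th * x) => P px T h3.
  by apply/andP; split; lra.
have [z /andP[z0 zM] lz] := Lr_source_lt x0 x2 qx lu lv e1 e2.
apply: (gain N0 wA hu u0 f0 eqn lz z0 (lt_le_trans zM M1) _ tx tx2).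
by rewrite ltrBlDl; exact: lt_le_trans zM M2.
Qed.

Lemma source_decay (x : R) : 0 < x -> x < 2^-1 -> q * x < 1 -> Lr x u -> Lr x v ->
  q * x <= a -> (p - 1) * x < Num.min 1 b -> ~ {ae mu, forall x, u x = 0} ->
  exists w : F, [/\ mf w, forall x, 0 < w x, vanishes_at_infinity w & {ae mu, forall x, u x = w x}].
Proof.
move=> x0 x2 qx lu lv qa pM nz.
have e1 : (q + p - 1) * x < a + Num.min 1 b.
  by rewrite -addrA mulrDl; apply: ler_ltD.
have [z /andP[z0]] := Lr_source_lt x0 x2 qx lu lv e1 pM; rewrite lt_min => /andP[z1 zb] lz.
have l2 := H1_L2 hu.
have [g [mg vg hg ug]] := decay N0 wA hu u0 f0 eqn lz z0 z1 zb.
have [d d0 hd] := flow_lower wA hu u0 f0 eqn.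
have h0 y : 0 < hconv 1 u y by exact: hconv_gt0.
have mh := mf_hconv 1 (L2_mf l2).
have g0 y : 0 < g y by apply: lt_le_trans (hg y).
(* Almost everywhere d h_1 * u <= u <= g, so this equals u; at every other point the maximum keeps
   it positive and the minimum keeps it below a decaying function. *)
exists (fun y => Num.max (d * hconv 1 u y) (Num.min (u y) (g y))); split.
- apply: measurable_maxr; first exact: measurable_funM.
  by apply: measurable_minr => //; exact: L2_mf l2.
- by move=> y; rewrite lt_max mulr_gt0.
- apply: (@vanishes_le _ _ _ (fun y => d * hconv 1 u y + g y)).
    have dh y : 0 <= d * hconv 1 u y by rewrite ltW // mulr_gt0.
    move=> y; rewrite ger0_norm; last by rewrite le_max dh.
    rewrite ger0_norm; last by rewrite addr_ge0 // ltW.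
    rewrite ge_max lerDl (ltW (g0 y)) /=; apply: (@le_trans _ _ (g y)); first by rewrite ge_min lexx orbT.
    by rewrite lerDr.
  by apply: vanishesD => //; apply: vanishesZ; exact: hconv_vanishes.
by apply: filterS2 hd ug => y h1 h2; rewrite (min_l h2) (max_r h1).
Qed.

End one_equation.

Variables (A B u v : F) (p q c d : R).
Hypotheses (wA : weight A) (wB : weight B) (hu : H1 u) (hv : H1 v).
Hypotheses (u0 : forall x, 0 <= u x) (v0 : forall x, 0 <= v x) (c0 : 0 < c) (d0 : 0 < d).
Hypotheses (hp : (N%:R + alpha) / N%:R < p) (hq : (N%:R + alpha) / N%:R < q).
Hypotheses (sp : (3 <= N)%N -> p * (N%:R - 2) < N%:R + alpha) (sq : (3 <= N)%N -> q * (N%:R - 2) < N%:R + alpha).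
Hypothesis eqn_u : forall phi, H1 phi -> (forall x, 0 <= phi x) ->
  intg mu (fun x => c * src p q u v x * phi x) /\ qi A u phi = \int[mu]_x (c * src p q u v x * phi x).
Hypothesis eqn_v : forall phi, H1 phi -> (forall x, 0 <= phi x) ->
  intg mu (fun x => d * src q p v u x * phi x) /\ qi B v phi = \int[mu]_x (d * src q p v u x * phi x).
Hypotheses (nu : ~ {ae mu, forall x, u x = 0}) (nv : ~ {ae mu, forall x, v x = 0}).

(** Both components are improved together, since each right-hand side involves both. After finitely
    many steps the exponent is small enough for [source_decay]. *)
Lemma positive_decaying_representatives : exists u' v' : F,
  [/\ mf u' /\ mf v', forall x, 0 < u' x /\ 0 < v' x,
     vanishes_at_infinity u' /\ vanishes_at_infinity v' &
     {ae mu, forall x, u x = u' x} /\ {ae mu, forall x, v x = v' x}].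
Proof.
have /andP[al0 alN] := alpha_itv; have n0 : 0 < N%:R :> R by rewrite ltr0n.
have a0 : 0 < a by rewrite divr_gt0.
have b0 : 0 < b by rewrite divr_gt0.
have E : (N%:R + alpha) / N%:R = 1 + a by rewrite mulrDl divff // gt_eqF.
have p1 : 1 < p by apply: lt_trans hp; rewrite E ltrDl.
have q1 : 1 < q by apply: lt_trans hq; rewrite E ltrDl.
have [x0 [th [[/andP[x00 x02] /andP[th0 th1]] sc [px qx] pqx [h1 h2 h3]]]] :=
  contraction_exponents N0 alpha_itv hp hq sp sq.
have init (w : F) : H1 w -> Lr x0 w.
  by move=> hw; apply: intg_Lr; [exact: L2_mf (H1_L2 hw)|exact: sobolev_intg].
have pos n : 0 < th ^+ n * x0 by rewrite mulr_gt0 // exprn_gt0.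
have le0 n : th ^+ n * x0 <= x0 by rewrite ler_piMl ?(ltW x00) // exprn_ile1 // ltW.
have shrink (r m : R) n : 0 < m -> r * x0 < m -> r * (th ^+ n * x0) < m.
  by move=> m0 hr; apply: (@lin_between _ _ _ 0 _ x0) => //; [exact: ltW|rewrite mulr0].
have ab0 : 0 < a + b by rewrite addr_gt0.
have a10 : 0 < 1 + a by rewrite addr_gt0.
have small n : th ^+ n * x0 < 2^-1 by apply: le_lt_trans (le0 n) x02.
have qp r : q + p - r = p + q - r by rewrite [q + p]addrC.
have all_n n : Lr (th ^+ n * x0) u /\ Lr (th ^+ n * x0) v.
  elim: n => [|n [lu lv]]; first by rewrite expr0 mul1r; split; exact: init.
  have s1 := shrink _ _ n ltr01 px; have s2 := shrink _ _ n ltr01 qx; have s3 := shrink _ _ n a10 pqx.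
  have s4 := shrink _ _ n ab0 h1; have s5 := shrink _ _ n b0 h2; have s6 := shrink _ _ n b0 h3.
  rewrite exprS -mulrA; split.
    exact: (Lr_step wA hu u0 c0 hv p1 hq eqn_u (pos n) (small n) th0 th1 s2 s1 lu lv s3 s4 s5).
  rewrite -qp in s3; rewrite -qp in s4.
  exact: (Lr_step wB hv v0 d0 hu q1 hp eqn_v (pos n) (small n) th0 th1 s1 s2 lv lu s3 s4 s6).
pose M := Num.min a (Num.min 1 b); have M0 : 0 < M by rewrite !lt_min a0 ltr01 b0.
have pq0 : 0 < p + q by lra.
have e0 : 0 < M / 2 / (p + q) by rewrite !divr_gt0.
have thi : 0 <= th < 1 by rewrite (ltW th0).
have [n hn] := exp_small thi e0; have [lu lv] := all_n n.
have K : (p + q) * (th ^+ n * x0) < M.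
  apply: (@le_lt_trans _ _ (M / 2)); last by rewrite ltr_pdivrMr // ltr_pMr // ltr1n.
  rewrite mulrC -ler_pdivlMr //; apply: le_trans hn; rewrite ler_piMr ?exprn_ge0 ?(ltW th0) //.
  by apply: ltW; apply: lt_trans x02 _; rewrite invf_lt1 // ltr1n.
have X0 := pos n; move: K; rewrite !lt_min => /and3P[K1 K2 K3].
have lep (r : R) : r <= p + q -> r * (th ^+ n * x0) <= (p + q) * (th ^+ n * x0).
  by move=> h; rewrite ler_wpM2r // ltW.
have r1 : q <= p + q by rewrite lerDr; apply: ltW; exact: lt_trans p1.
have r2 : p <= p + q by rewrite lerDl; apply: ltW; exact: lt_trans q1.
have r3 : p - 1 <= p + q by apply: le_trans r2; rewrite gerBl.
have r4 : q - 1 <= p + q by apply: le_trans r1; rewrite gerBl.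
have m1 : (p - 1) * (th ^+ n * x0) < Num.min 1 b.
  by rewrite lt_min (le_lt_trans (lep _ r3) K2) (le_lt_trans (lep _ r3) K3).
have m2 : (q - 1) * (th ^+ n * x0) < Num.min 1 b.
  by rewrite lt_min (le_lt_trans (lep _ r4) K2) (le_lt_trans (lep _ r4) K3).
have k1 := le_lt_trans (lep _ r1) K2; have k2 := le_lt_trans (lep _ r2) K2.
have k3 := ltW (le_lt_trans (lep _ r1) K1); have k4 := ltW (le_lt_trans (lep _ r2) K1).
have [u' [mu' up uv ue]] := source_decay wA hu u0 c0 hv p1 hq eqn_u X0 (small n) k1 lu lv k3 m1 nu.
have [v' [mv' vp vv ve]] := source_decay wB hv v0 d0 hu q1 hp eqn_v X0 (small n) k2 lv lu k4 m2 nv.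
by exists u', v'; split.
Qed.

End bootstrap.

(** * Equations of optimal pairs and change of representative *)

Section optimal_pairs.
Context (R : realType) (N : nat).
Local Notation mu := (lebesgue_rV R N).
Local Notation F := ('rV[R]_N -> R).
Variables (alpha p q x1 x2 : R) (A B : F).
Local Notation k := (@riesz R N alpha).
Hypotheses (N0 : (0 < N)%N) (KS : good_kernel x1 x2 k) (wA : weight A) (wB : weight B).
Hypotheses (p1 : 1 < p) (q1 : 1 < q).
Hypotheses (sp1 : subcrit N (p / x1)) (sp2 : subcrit N (p / x2)).
Hypotheses (sq1 : subcrit N (q / x1)) (sq2 : subcrit N (q / x2)).
Implicit Types (f g u v : F).
Local Notation Dw := (Dw k p q).
Local Notation Qw := (Qw A B).
Local Notation form := (form k).

Lemma convolution_ae f g : mf f -> mf g -> {ae mu, forall x, f x = g x} -> convolution k f = convolution k g.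
Proof.
move=> mf_ mg fg; apply/funext => x.
have mk := mf_reflect x (gk_mf KS).
apply: Int_ae; [exact: measurable_funM|exact: measurable_funM|].
by apply: filterS fg => y ->.
Qed.

Lemma form_ae s s' t t' f f' g g' : adm x1 x2 s f -> adm x1 x2 s' f' -> adm x1 x2 t g -> adm x1 x2 t' g' ->
  {ae mu, forall x, f x = f' x} -> {ae mu, forall x, g x = g' x} -> form f g = form f' g'.
Proof.
move=> af af' ag ag' ff gg.
rewrite (form_convolution KS af ag) (form_convolution KS af' ag').
rewrite (convolution_ae (adm_mf af) (adm_mf af') ff).
have mc := mf_convolution (gk_mf KS) (adm_mf af').
apply: Int_ae; [exact: measurable_funM mc (adm_mf ag)|exact: measurable_funM mc (adm_mf ag')|].
by apply: filterS gg => y ->.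
Qed.

Lemma Dw_ae u u' v v' : H1 u -> H1 u' -> H1 v -> H1 v' ->
  {ae mu, forall x, u x = u' x} -> {ae mu, forall x, v x = v' x} -> Dw u v = Dw u' v'.
Proof.
move=> hu hu' hv hv' uu vv; have [s a1] := admp_ex KS sp1 sp2 hu; have [s' a2] := admp_ex KS sp1 sp2 hu'.
have [t a3] := admq_ex KS sq1 sq2 hv; have [t' a4] := admq_ex KS sq1 sq2 hv'.
rewrite !DwE; apply: (form_ae a1 a2 a3 a4).
  by apply: filterS uu => y; rewrite /pwf => ->.
by apply: filterS vv => y; rewrite /pwf => ->.
Qed.

Lemma Dw_neq0 u v : H1 u -> H1 v -> Dw u v != 0 ->
  ~ {ae mu, forall x, u x = 0} /\ ~ {ae mu, forall x, v x = 0}.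
Proof.
move=> hu hv D0; have h0 := @H1_0 R N.
have [s au] := admp_ex KS sp1 sp2 hu; have [t av] := admq_ex KS sq1 sq2 hv.
have Z (r : R) (f : F) : 1 < r -> pwf r (fun _ : 'rV[R]_N => 0) = fun x => 0 * pwf r f x.
  by move=> r1; apply/funext => x; rewrite /pwf mul0r normr0 powR0 // gt_eqF // (lt_trans ltr01).
split=> e; move: D0.
  rewrite (Dw_ae hu h0 hv hv e); last by apply: aeW.
  by rewrite DwE (Z p u p1) (formZl KS 0 au av) mul0r eqxx.
rewrite (Dw_ae hu hu hv h0 _ e); last by apply: aeW.
by rewrite DwE (Z q v q1) (formZr KS 0 au av) mul0r eqxx.
Qed.

(** Integrability of the product is taken from the double integral: where the inner integral is
    infinite, the convolution has the value 0 and the comparison still holds. *)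
Lemma convolution_intg s t f g : adm x1 x2 s f -> adm x1 x2 t g -> (forall x, 0 <= f x) -> (forall x, 0 <= g x) ->
  intg mu (fun x => convolution k f x * g x).
Proof.
move=> af ag f0 g0; have iF := integrable_fubini_F (form_intg KS af ag).
have mc := mf_convolution (gk_mf KS) (adm_mf af).
apply: le_integrable iF => //; first by apply/measurable_EFinP; exact: measurable_funM mc (adm_mf ag).
move=> x _; rewrite /fubini_F /=.
have k0 z := gk_ge0 KS z.
have mk : mf (fun y : 'rV[R]_N => k (x - y) * f y).
  exact: measurable_funM (mf_reflect x (gk_mf KS)) (adm_mf af).
have -> : (\int[mu]_y (kern k f g (x, y))%:E = nnI mu (fun y => k (x - y) * f y)%R * (g x)%:E)%E.
  have gx : (0 <= (g x)%:E)%E by rewrite lee_fin.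
  rewrite -(Int_nnI_mul mk (fun y => mulr_ge0 (k0 _) (f0 y)) gx).
  by apply: eq_integral => y _; rewrite /kern /= [f y * _]mulrC EFinM.
have n0 : (0 <= nnI mu (fun y => k (x - y) * f y)%R)%E by apply: nnI_ge0 => y; rewrite mulr_ge0.
Transparent nnI.
have -> : convolution k f x = fine (nnI mu (fun y => k (x - y) * f y)%R) by [].
Opaque nnI.
move: (nnI _ _) n0 => e e0; have := g0 x; move: (g x) => b b0.
by case: e e0 => [r| |] //= e0; rewrite mul0r normr0; exact: abse_ge0.
Qed.

Section equations.
Variables (u v : F).
Hypotheses (hu : H1 u) (hv : H1 v) (u0 : forall x, 0 <= u x) (v0 : forall x, 0 <= v x).
Hypotheses (Qo : Qw u v = Qs alpha p q A B) (Do : Dw u v = Qs alpha p q A B / 2).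

Let power_split (r a : R) : 1 < r -> 0 <= a -> a `^ (r - 2) * a = a `^ (r - 1).
Proof.
move=> r1 a0; have [->|an] := eqVneq a 0; first by rewrite mulr0 powR0 // subr_eq0 gt_eqF.
have ap : 0 < a by rewrite lt_neqAle eq_sym an.
by rewrite -{2}[a](powRr1 a0) -powRD ?an ?implybT //; congr powR; ring.
Qed.

Let adm_test (r : R) (w f : F) : 1 < r -> subcrit N (r / x1) -> subcrit N (r / x2) -> H1 w -> (forall x, 0 <= w x) -> H1 f ->
  exists s, adm x1 x2 s (fun x => `|w x| `^ (r - 1) * f x).
Proof.
move=> r1 s1 s2 hw w0 hf; have [K K0 HK] := adm_dif KS r1 s1 s2 hw.
have P : 0 < 1 + S1 f by rewrite ltr_pwDl ?S1_ge0.
have P' : S1 f <= 1 + S1 f by rewrite lerDr.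
have rn : r != 0 by rewrite gt_eqF // (lt_trans ltr01).
have := admZ KS (invr_neq0 rn) (HK f _ hf P P'); set s := _ * _ => h; exists s; move: h.
have -> // : (fun x => r^-1 * (r * phi r (w x) * f x)) = fun x => `|w x| `^ (r - 1) * f x.
by apply/funext => x; rewrite -mulrA mulKf // /phi ger0_norm // power_split.
Qed.

Lemma equation_u f : H1 f -> (forall x, 0 <= f x) ->
  intg mu (fun x => 2 * p / (p + q) * source alpha p q u v x * f x) /\
  qi A u f = \int[mu]_x (2 * p / (p + q) * source alpha p q u v x * f x).
Proof.
move=> hf f0; have [s a1] := adm_test p1 sp1 sp2 hu u0 hf; have [t a2] := admq_ex KS sq1 sq2 hv.
have i := convolution_intg a2 a1 (fun x => pwf_ge0 _ _ _) (fun x => mulr_ge0 (powR_ge0 _ _) (f0 x)).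
have E : (fun x => 2 * p / (p + q) * source alpha p q u v x * f x) =
    fun x => 2 * p / (p + q) * (convolution k (pwf q v) x * (`|u x| `^ (p - 1) * f x)).
  by apply/funext => x; rewrite /source -!mulrA.
rewrite E; split; first exact: intgZ.
have [W _] := optimal_weak_form N0 KS wA wB p1 q1 sp1 sp2 sq1 sq2 hu hv Qo Do.
have := W f hf; rewrite /= (qi_Int wA hu hf) => ->; rewrite IntZ //; congr (_ * _).
by apply: eq_Rintegral => x _; rewrite ger0_norm // -(power_split p1 (u0 x)) !mulrA.
Qed.

Lemma equation_v f : H1 f -> (forall x, 0 <= f x) ->
  intg mu (fun x => 2 * q / (p + q) * source alpha q p v u x * f x) /\
  qi B v f = \int[mu]_x (2 * q / (p + q) * source alpha q p v u x * f x).
Proof.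
move=> hf f0; have [s a1] := adm_test q1 sq1 sq2 hv v0 hf; have [t a2] := admp_ex KS sp1 sp2 hu.
have i := convolution_intg a2 a1 (fun x => pwf_ge0 _ _ _) (fun x => mulr_ge0 (powR_ge0 _ _) (f0 x)).
have E : (fun x => 2 * q / (p + q) * source alpha q p v u x * f x) =
    fun x => 2 * q / (p + q) * (convolution k (pwf p u) x * (`|v x| `^ (q - 1) * f x)).
  by apply/funext => x; rewrite /source -!mulrA.
rewrite E; split; first exact: intgZ.
have [_ W] := optimal_weak_form N0 KS wA wB p1 q1 sp1 sp2 sq1 sq2 hu hv Qo Do.
have := W f hf; rewrite /= (qi_Int wB hv hf) => ->; rewrite IntZ //; congr (_ * _).
by apply: eq_Rintegral => x _; rewrite ger0_norm // -(power_split q1 (v0 x)) !mulrA.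
Qed.

End equations.

(** The maximiser on Qw = 1 is rescaled by the square root of [Qs], which puts it on the Nehari
    set. *)
Lemma optimal_pair_exists T : 2 < p / x1 -> 2 < p / x2 ->
  (forall x, exists2 a : 'rV[R]_N, `|x - a| <= T & per A a /\ per B a) ->
  exists u v : F, [/\ H1 u /\ H1 v, forall x, 0 <= u x, forall x, 0 <= v x,
    Qw u v = Qs alpha p q A B & Dw u v = Qs alpha p q A B / 2].
Proof.
move=> tp1 tp2 Hl.
have [u [v [[hu hv] u0 v0 Q1 D1]]] := maximiser_exists N0 KS wA wB p1 q1 sp1 sp2 sq1 sq2 tp1 tp2 Hl.
have Q0 := Qs_gt0 N0 KS wA wB p1 q1 sp1 sp2 sq1 sq2.
pose t := Num.sqrt (Qs alpha p q A B); have t0 : 0 <= t by exact: sqrtr_ge0.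
have t2 : t ^+ 2 = Qs alpha p q A B by rewrite sqr_sqrtr // ltW.
exists (fun x => t * u x), (fun x => t * v x); split.
- by split; exact: H1Z.
- by move=> x; rewrite mulr_ge0.
- by move=> x; rewrite mulr_ge0.
- by rewrite (QwZ wA wB t hu hv) Q1 mulr1.
rewrite (DwZ KS p1 q1 sp1 sp2 sq1 sq2 hu hv t0) D1 -(Qs_pow N0 KS wA wB p1 q1 sp1 sp2 sq1 sq2) mulrC.
by congr (_ * _); rewrite -t2 -powR_mulrn // -powRrM; congr powR; field.
Qed.

End optimal_pairs.

Lemma crit_exp_lt (R : realType) (N : nat) (alpha p : R) : (p%:E < crit_exp N alpha)%E ->
  (3 <= N)%N -> p * (N%:R - 2) < N%:R + alpha.
Proof.
rewrite /crit_exp => + N3; rewrite N3 lte_fin ltr_pdivlMr // subr_gt0.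
by rewrite ltr_nat.
Qed.

(** At r = (N + alpha)/(2N) all conditions hold strictly, but neither half of the Riesz kernel is in
    the required space. Moving up to x2 gives the outer half, within the room left by the lower
    bounds on p and q; moving down to x1 gives the inner half, within the room left by
    subcriticality. *)
Lemma kernel_exponents (R : realType) (N : nat) (alpha p q : R) : (0 < N)%N -> 0 < alpha < N%:R ->
  (N%:R + alpha) / N%:R < p -> (N%:R + alpha) / N%:R < q ->
  ((3 <= N)%N -> p * (N%:R - 2) < N%:R + alpha) -> ((3 <= N)%N -> q * (N%:R - 2) < N%:R + alpha) ->
  exists x1 x2 : R, [/\ good_kernel x1 x2 (@riesz R N alpha),
    subcrit N (p / x1) /\ subcrit N (p / x2), subcrit N (q / x1) /\ subcrit N (q / x2) &
    2 < p / x1 /\ 2 < p / x2].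
Proof.
move=> N0 ai hp hq sp sq; have /andP[a0 aN] := ai; have n0 : 0 < N%:R :> R by rewrite ltr0n.
pose r : R := (N%:R + alpha) / N%:R / 2.
have rE : N%:R + alpha = 2 * N%:R * r by rewrite /r; field; rewrite gt_eqF.
have {}hp : r < p / 2 by rewrite ltr_pM2r ?invr_gt0.
have {}hq : r < q / 2 by rewrite ltr_pM2r ?invr_gt0.
have n2 : 0 < 2 * N%:R :> R by rewrite mulr_gt0.
have r2 : 2^-1 < r by rewrite -(ltr_pM2l n2) -rE mulrAC divff ?mul1r ?ltrDl.
have r1 : r < 1 by rewrite -(ltr_pM2l n2) -rE mulr1 mulr_natl mulr2n ltrD2l.
have gen (s : R) : r < s / 2 -> ((3 <= N)%N -> s * (N%:R - 2) < N%:R + alpha) -> s * (N%:R - 2) < 2 * N%:R * r.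
  move=> rs h; rewrite -rE; case: (leqP 3 N) => [/h //|N3].
  apply: (@le_lt_trans _ _ 0); last by rewrite addr_gt0.
  by rewrite mulr_ge0_le0 // ?subr_le0 ?ler_nat //; lra.
have gp := gen p hp sp; have gq := gen q hq sq.
pose l2 : seq (R * R) := [:: (1, 1); (1, p / 2); (1, q / 2)].
have [x2 x2r] : exists2 y, r < y & all (fun c => c.1 * y < c.2) l2.
  by apply: open_right; rewrite /= !mul1r andbT r1 hp hq.
rewrite /= !mul1r andbT => /and3P[x21 x2p x2q].
pose l1 : seq (R * R) := [:: (1, - 2^-1); (2 * N%:R, - (p * (N%:R - 2))); (2 * N%:R, - (q * (N%:R - 2)))].
(* A move to the left of r, obtained as a move to the right of -r. *)
have [t tr] : exists2 y, - r < y & all (fun c => c.1 * y < c.2) l1.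
  by apply: open_right; rewrite /= !mul1r andbT !mulrN !ltrN2 r2 gp gq.
rewrite /= mul1r andbT => /and3P[t1 tp tq].
pose x1 := - t; have x12 : 2^-1 < x1 by rewrite ltrNr.
have x1r : x1 < r by rewrite ltrNl.
have x10 : 0 < x1 by apply: lt_trans x12; rewrite invr_gt0.
have x20 : 0 < x2 by apply: lt_trans x2r; apply: lt_trans r2; rewrite invr_gt0.
have half (s x : R) : 0 < x -> x < s / 2 -> 2 < s / x.
  by move=> x0 h; rewrite ltr_pdivlMr // mulrC -ltr_pdivlMr.
have sc (s x : R) : 0 < x -> x < s / 2 -> s * (N%:R - 2) < 2 * N%:R * x -> subcrit N (s / x).
  move=> x0 h1 h2; split; first exact/ltW/half.
  by move=> _; rewrite mulrAC ltr_pdivrMr.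
have up (s : R) : s * (N%:R - 2) < 2 * N%:R * r -> s * (N%:R - 2) < 2 * N%:R * x2.
  by move=> h; apply: lt_trans h _; rewrite ltr_pM2l.
have tp' : p * (N%:R - 2) < 2 * N%:R * x1 by rewrite mulrN ltrNr.
have tq' : q * (N%:R - 2) < 2 * N%:R * x1 by rewrite mulrN ltrNr.
exists x1, x2; split.
- apply: riesz_good => //.
  + by rewrite x12 (lt_trans x1r r1).
  + by rewrite (lt_trans r2 x2r) x21.
  + have : 2 * N%:R * x1 < N%:R + alpha by rewrite rE ltr_pM2l.
    by rewrite mulrBr mulrCA mulrA; lra.
  + have : N%:R + alpha < 2 * N%:R * x2 by rewrite rE ltr_pM2l.
    by rewrite mulrBr mulrCA mulrA; lra.
- by split; apply: sc => //; [exact: lt_trans x1r hp|exact: up].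
- by split; apply: sc => //; [exact: lt_trans x1r hq|exact: up].
by split; apply: half => //; exact: lt_trans x1r hp.
Qed.

Theorem theorem1p2 (R : realType) (N : nat) (alpha p q : R)
    (tau : 'I_N -> R) (A B : 'rV[R]_N -> R) (A0 B0 : R) :
  (1 <= N)%N ->
  0 < alpha < N%:R ->
  (N%:R + alpha) / N%:R < p -> (p%:E < crit_exp N alpha)%E ->
  (N%:R + alpha) / N%:R < q -> (q%:E < crit_exp N alpha)%E ->
  p != q ->
  (forall i, 0 < tau i) ->
  continuous A -> 0 < A0 -> (forall x, A0 <= A x) ->
  (forall i x, A (x + tau i *: delta_mx ord0 i) = A x) ->
  continuous B -> 0 < B0 -> (forall x, B0 <= B x) ->
  (forall i x, B (x + tau i *: delta_mx ord0 i) = B x) ->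
  exists u v : 'rV[R]_N -> R,
    [/\ ground_state alpha p q A B (u, v),
        forall x, 0 < u x
      & forall x, 0 < v x].
Proof.
move=> N0 ai hp cp hq cq _ tau0 cA A00 hA perA cB B00 hB perB.
have sp := crit_exp_lt cp; have sq := crit_exp_lt cq.
have /andP[a0 aN] := ai; have n0 : 0 < N%:R :> R by rewrite ltr0n.
have E : 1 < (N%:R + alpha) / N%:R by rewrite ltr_pdivlMr // mul1r ltrDl.
have p1 := lt_trans E hp; have q1 := lt_trans E hq.
have wA := weight_periodic tau0 cA A00 hA perA; have wB := weight_periodic tau0 cB B00 hB perB.
have [x1 [x2 [KS [sp1 sp2] [sq1 sq2] [tp1 tp2]]]] := kernel_exponents N0 ai hp hq sp sq.
have [T T0 HT] := @lattice R N tau tau0.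
have Hl (x : 'rV[R]_N) : exists2 a : 'rV[R]_N, `|x - a| <= T & per A a /\ per B a.
  by have [a xa Ha] := HT x; exists a => //; split; exact: Ha.
have [u [v [[hu hv] u0 v0 Qo Do]]] := optimal_pair_exists N0 KS wA wB p1 q1 sp1 sp2 sq1 sq2 tp1 tp2 Hl.
have Q0 := Qs_gt0 N0 KS wA wB p1 q1 sp1 sp2 sq1 sq2.
have Dn : Dw (riesz alpha) p q u v != 0 by rewrite Do gt_eqF // divr_gt0.
have [nu nv] := Dw_neq0 KS p1 q1 sp1 sp2 sq1 sq2 hu hv Dn.
have pq : 0 < p + q by rewrite addr_gt0 // (lt_trans ltr01).
have c0 : 0 < 2 * p / (p + q) by rewrite divr_gt0 // mulr_gt0 // (lt_trans ltr01).
have d0 : 0 < 2 * q / (p + q) by rewrite divr_gt0 // mulr_gt0 // (lt_trans ltr01).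
have eu := equation_u N0 KS wA wB p1 q1 sp1 sp2 sq1 sq2 hu hv u0 Qo Do.
have ev := equation_v N0 KS wA wB p1 q1 sp1 sp2 sq1 sq2 hu hv v0 Qo Do.
have [u' [v' [[mu' mv'] pos [vu vv] [uu vv']]]] :=
  positive_decaying_representatives N0 ai wA wB hu hv u0 v0 c0 d0 hp hq sp sq eu ev nu nv.
(* The new representatives have the same Qw and Dw, so optimality, and with it every conclusion, is
   derived again for them. *)
have hu' := H1_ae mu' uu hu; have hv' := H1_ae mv' vv' hv.
have Qo' : Qw A B u' v' = Qs alpha p q A B.
  rewrite -Qo /Qw; apply: eq_add.
    by rewrite (qi_ae wA hu mu' hu uu) qiC (qi_ae wA hu mu' hu' uu).
  by rewrite (qi_ae wB hv mv' hv vv') qiC (qi_ae wB hv mv' hv' vv').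
have Do' : Dw (riesz alpha) p q u' v' = Qs alpha p q A B / 2.
  by rewrite -Do; apply/esym; exact: (Dw_ae KS sp1 sp2 sq1 sq2 hu hu' hv hv' uu vv').
exists u', v'; split; [|by move=> x; have [] := pos x|by move=> x; have [] := pos x].
split; [split| |].
- exact: (optimal_critical N0 KS wA wB p1 q1 sp1 sp2 sq1 sq2 hu' hv' Qo' Do').
- exact: (optimal_weak_form N0 KS wA wB p1 q1 sp1 sp2 sq1 sq2 hu' hv' Qo' Do').
- exact: vu.
- exact: vv.
- exact: (optimal_nontrivial N0 KS wA wB p1 q1 sp1 sp2 sq1 sq2 hu' hv' Qo').
exact: (optimal_ground N0 KS wA wB p1 q1 sp1 sp2 sq1 sq2 hu' hv' Qo' Do').
Qed.
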